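(* Let $G$ be a Carnot group equipped with its Carnot metric $d_G$. If $(G,d_G)$ biLipschitz embeds into $L^1$, then $G$ is abelian.
   Context: $L^1$ denotes the real Banach space $L^1([0,1])$ with Lebesgue measure. A Carnot group of step $s$ is a connected, simply connected Lie group $G$ whose Lie algebra $\mathfrak g$ is stratified: $\mathfrak g=\bigoplus_{i=1}^s V_i$ with $[V_1,V_i]=V_{i+1}$ for $i<s$, $[V_1,V_s]=\{0\}$, $V_s\ne\{0\}$. A scalar product is fixed on $V_1$ and extended by left-invariance to the left-invariant subbundle of $TG$ determined by $V_1$ (the horizontal distribution). The Carnot metric $d_G(x,y)$ is the infimum of the lengths of absolutely continuous curves from $x$ to $y$ that are tangent almost everywhere to the horizontal distribution. A metric space $(X,d)$ biLipschitz embeds into $L^1$ if there are $f:X\to L^1$ and $L\ge1$ with $L^{-1}d(x,y)\le\|f(x)-f(y)\|_{L^1}\le L\,d(x,y)$ for all $x,y\in X$. *)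

(* Defs.v *)
From HB Require Import structures.
From mathcomp Require Import all_boot all_order all_algebra.
From mathcomp Require Import all_classical all_reals all_analysis.
Set Implicit Arguments.
Unset Strict Implicit.
Unset Printing Implicit Defensive.
Import Order.TTheory GRing.Theory Num.Theory.
Import numFieldNormedType.Exports.
Local Open Scope classical_set_scope.
Local Open Scope ring_scope.

(* The set U is meant to be open.  In finite dimension, a function all of whose
   directional derivatives exist and are of class C^k is of class C^(k+1). *)
Fixpoint Ck (R : realType) (E F : normedModType R) (k : nat) (U : set E)
    (f : E -> F) : Prop :=
  {within U, continuous f} /\
  if k is k'.+1 then
    forall v : E, (forall x, U x -> derivable f x v) /\ Ck k' U ('D_v f)
  else True.

Definition smooth_on (R : realType) (E F : normedModType R) (U : set E)
    (f : E -> F) : Prop :=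
  forall k, Ck k U f.

(* Only the values of chart_fun on chart_dom, and of chart_inv on the image of
   chart_dom, are meaningful. *)
Record chart (R : realType) (n : nat) (M : topologicalType) := Chart {
  chart_dom : set M;
  chart_fun :> M -> 'rV[R]_n;
  chart_inv : 'rV[R]_n -> M;
  chart_dom_open : open chart_dom;
  chart_img_open : open (chart_fun @` chart_dom);
  chart_funK : forall x, chart_dom x -> chart_inv (chart_fun x) = x;
  chart_fun_continuous : {within chart_dom, continuous chart_fun};
  chart_inv_continuous :
    {within chart_fun @` chart_dom, continuous chart_inv}
}.

Definition chart_img (R : realType) (n : nat) (M : topologicalType)
    (c : chart R n M) : set 'rV[R]_n :=
  c @` chart_dom c.

HB.mixin Record Topological_isSmoothManifold (R : realType) (n : nat) M
    & Topological M := {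
  atlas : set (chart R n M);
  manifold_hausdorff : hausdorff_space M;
  manifold_second_countable : @second_countable M;
  atlas_cover : forall x : M, exists2 c, atlas c & chart_dom c x;
  atlas_smooth : forall c c', atlas c -> atlas c' ->
    smooth_on (chart_img c `&` (chart_inv c @^-1` chart_dom c'))
      (c' \o chart_inv c)
}.

#[short(type="smoothManifoldType")]
HB.structure Definition SmoothManifold (R : realType) (n : nat) :=
  {M of Topological M & Topological_isSmoothManifold R n M}.

HB.mixin Record SmoothManifold_isLieGroup (R : realType) (n : nat) G
    & SmoothManifold R n G & Group G := {
  lie_mul_continuous : continuous (fun p : G * G => (p.1 * p.2)%g);
  lie_inv_continuous : continuous (fun x : G => (x^-1)%g);
  lie_mul_smooth : forall a b c : chart R n G, atlas a -> atlas b -> atlas c ->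
    smooth_on
      [set p : 'rV[R]_n * 'rV[R]_n | [/\ chart_img a p.1, chart_img b p.2
        & chart_dom c (chart_inv a p.1 * chart_inv b p.2)%g]]
      (fun p => c (chart_inv a p.1 * chart_inv b p.2)%g);
  lie_inv_smooth : forall a b : chart R n G, atlas a -> atlas b ->
    smooth_on
      [set u | chart_img a u /\ chart_dom b ((chart_inv a u)^-1)%g]
      (fun u => b ((chart_inv a u)^-1)%g)
}.

#[short(type="lieGroupType")]
HB.structure Definition LieGroup (R : realType) (n : nat) :=
  {G of SmoothManifold R n G & Group G & SmoothManifold_isLieGroup R n G}.

Definition simply_connected (R : realType) (T : topologicalType) : Prop :=
  forall g : R -> T, {within `[0, 1], continuous g} -> g 0 = g 1 ->
  exists H : R * R -> T,
    [/\ {within `[0, 1] `*` `[0, 1], continuous H},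
        forall t, `[0, 1]%classic t -> H (0, t) = g t,
        forall t, `[0, 1]%classic t -> H (1, t) = g 0 &
        forall s, `[0, 1]%classic s -> H (s, 0) = g 0 /\ H (s, 1) = g 0].

Section tangent.
Context {R : realType} {n : nat} {M : smoothManifoldType R n}.

Definition smooth_fun (f : M -> R) : Prop :=
  forall c : chart R n M, atlas c ->
    smooth_on (chart_img c) (f \o chart_inv c : 'rV[R]_n -> R^o).

(* Tangent vectors at p are the derivations at p of the algebra of smooth
   functions.  They are represented as functionals on all functions, extended
   by 0 so that equality of functionals is equality of derivations. *)
Definition tangent_space (p : M) : set ((M -> R) -> R^o) :=
  [set v | [/\ forall (a : R) (f g : M -> R), smooth_fun f -> smooth_fun g ->
                 v (fun x => a * f x + g x) = a * v f + v g,
               forall f g : M -> R, smooth_fun f -> smooth_fun g ->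
                 v (fun x => f x * g x) = v f * g p + f p * v g &
               forall f : M -> R, ~ smooth_fun f -> v f = 0]].

Definition differentiable_curve_at (g : R -> M) (t : R) : Prop :=
  forall f : M -> R, smooth_fun f -> derivable (f \o g : R -> R^o) t 1.

Definition velocity (g : R -> M) (t : R) : (M -> R) -> R^o :=
  fun f => if `[< smooth_fun f >] then derive1 (f \o g : R -> R^o) t else 0.

End tangent.

Definition abs_continuous (R : realType) (a b : R) (f : R -> R) : Prop :=
  forall e : R, 0 < e -> exists2 d : R, 0 < d &
    forall (m : nat) (u v : 'I_m -> R),
      (forall i, a <= u i /\ u i <= v i /\ v i <= b) ->
      trivIset [set: 'I_m] (fun i => `]u i, v i[%classic) ->
      \sum_i (v i - u i) < d -> \sum_i `|f (v i) - f (u i)| < e.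

(* Curves are parametrized by [0, 1]; their values elsewhere are irrelevant. *)
Definition abs_continuous_curve (R : realType) (n : nat)
    (M : smoothManifoldType R n) (g : R -> M) : Prop :=
  {within `[0, 1], continuous g} /\
  forall (c : chart R n M) (a b : R), atlas c -> 0 <= a -> a <= b -> b <= 1 ->
    (forall t, `[a, b]%classic t -> chart_dom c (g t)) ->
    forall i, abs_continuous a b (fun t => c (g t) ord0 i).

Section lie_algebra.
Context {R : realType} {n : nat} {G : lieGroupType R n}.
Implicit Types v w : (G -> R) -> R^o.

Definition lie_algebra : set ((G -> R) -> R^o) := tangent_space (1%g : G).

(* The differential of the left translation x |-> g * x. *)
Definition dL (g : G) v : (G -> R) -> R^o :=
  fun f => v (fun x => f (g * x)%g).

Definition left_invariant_field v (f : G -> R) : G -> R :=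
  fun g => dL g v f.

Definition lie_bracket v w : (G -> R) -> R^o :=
  fun f => v (left_invariant_field w f) - w (left_invariant_field v f).

Definition subspace_set (V : set ((G -> R) -> R^o)) : Prop :=
  submod_closed (mem V).

Definition lie_bracket_set (V W : set ((G -> R) -> R^o)) :
    set ((G -> R) -> R^o) :=
  smallest subspace_set [set lie_bracket v w | v in V & w in W].

(* Only V 1, ..., V s are relevant. *)
Definition stratification (s : nat) (V : nat -> set ((G -> R) -> R^o)) : Prop :=
  [/\ (0 < s)%N,
      forall i, (1 <= i <= s)%N -> subspace_set (V i) /\ V i `<=` lie_algebra,
      forall x, lie_algebra x -> exists! v : 'I_s -> ((G -> R) -> R^o),
        (forall i : 'I_s, V i.+1 (v i)) /\ x = \sum_i v i &
      [/\ forall i, (1 <= i < s)%N -> lie_bracket_set (V 1%N) (V i) = V i.+1,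
          lie_bracket_set (V 1%N) (V s) = [set 0] &
          V s <> [set 0]]].

Definition scalar_product_on (V : set ((G -> R) -> R^o))
    (ip : ((G -> R) -> R^o) -> ((G -> R) -> R^o) -> R) : Prop :=
  [/\ forall v w, V v -> V w -> ip v w = ip w v,
      forall (a : R) u v w, V u -> V v -> V w ->
        ip (a *: u + v) w = a * ip u w + ip v w &
      forall v, V v -> v <> 0 -> 0 < ip v v].

End lie_algebra.

Record carnotGroup (R : realType) := CarnotGroup {
  carnot_dim : nat;
  carnot_group :> lieGroupType R carnot_dim;
  carnot_step : nat;
  layer : nat -> set ((carnot_group -> R) -> R^o);
  hscal : ((carnot_group -> R) -> R^o) -> ((carnot_group -> R) -> R^o) -> R;
  carnot_connected : connected [set: carnot_group];
  carnot_simply_connected : simply_connected R carnot_group;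
  carnot_stratification : stratification carnot_step layer;
  carnot_hscal : scalar_product_on (layer 1) hscal
}.

Arguments layer {R} c i _.
Arguments hscal {R} c v w : rename.

Section carnot_metric.
Context {R : realType} {G : carnotGroup R}.
Local Notation mu := (@lebesgue_measure R).

Definition horizontal_distribution (x : G) : set ((G -> R) -> R^o) :=
  dL x @` layer G 1.

Definition horizontal_norm (x : G) (v : (G -> R) -> R^o) : R :=
  Num.sqrt (hscal G (dL (x^-1)%g v) (dL (x^-1)%g v)).

Definition horizontal_curve (g : R -> G) : Prop :=
  abs_continuous_curve g /\
  {ae mu, forall t, `]0, 1[%classic t ->
    differentiable_curve_at g t /\
    horizontal_distribution (g t) (velocity g t)}.

Definition curve_length (g : R -> G) : \bar R :=
  \int[mu]_(t in `]0, 1[) (horizontal_norm (g t) (velocity g t))%:E.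

Definition carnot_dist (x y : G) : \bar R :=
  ereal_inf [set curve_length g | g in
    [set g | [/\ horizontal_curve g, g 0 = x & g 1 = y]]].

End carnot_metric.

Definition lebesgue01 (R : realType) :
    {measure set (measurableTypeR R) -> \bar R} :=
  mrestr (@lebesgue_measure R) (measurable_itv `[0, 1]).

Definition L1 (R : realType) : Type := LspaceType1 (lebesgue01 R).

Definition L1dist (R : realType) (f g : L1 R) : \bar R :=
  'N[lebesgue01 R]_1[EFin \o ((f : R -> R) \- (g : R -> R))].

Definition biLipschitz_embeds_L1 (R : realType) (X : Type)
    (d : X -> X -> \bar R) : Prop :=
  exists (f : X -> L1 R) (L : R), 1 <= L /\
    forall x y, ((L^-1)%:E * d x y <= L1dist (f x) (f y))%E /\
                (L1dist (f x) (f y) <= L%:E * d x y)%E.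

(* Main.v *)
(* Let [F] embed [(G, d)] into [L^1], and let [b a = F (. a) - F]. At a scale [delta -> 0], a limit
   of the functionals [h |-> sup_g 1/delta \int h (g, .)] on functions of sequences dominates, by
   an invariant Hahn-Banach theorem, positive invariant linear functionals [J], and
   [psi a = J |b a|] is a length function. As the functionals live on a lattice of functions, [J]
   can be split, along a given direction [v], into two positive invariant parts for which [b] has
   asymptotically a constant sign on the powers of [v] (this replaces cut measures); then the
   stable length is the absolute value of a homomorphism. Splitting along finitely many
   directions [x^a y^Q], and by induction on the nilpotency class, [psi [x^n, y^n] = o(n)].

   On the other hand, let [X] and [Y] be velocities of horizontal curves with
   [Z = [X, Y] <> 0], and let [x], [y] be points of these curves at distance [O(delta)].
   A compactly supported function [u] with vanishing horizontal derivative and [Z u <> 0] at [1]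
   satisfies [|u c - u 1| <= C d(1, c)^2], while
   [u [x^m, y^m] - u 1 ~ m^2 delta^2 Z u]; thus [d(1, [x^m, y^m]) >= k m delta], a contradiction.
   So the horizontal velocities commute. A function without horizontal derivative is constant,
   since [d] is finite; this yields both the nilpotency of [G] used above and, when the
   velocities commute, that [G] is abelian. *)
From HB Require Import structures.
Require Import Defs.
From mathcomp Require Import all_boot all_order all_algebra.
From mathcomp Require Import all_classical all_reals all_analysis.
From mathcomp Require Import measurable_realfun.
From mathcomp Require Import ring lra zify.
Set Implicit Arguments.
Unset Strict Implicit.
Unset Printing Implicit Defensive.
Import Order.TTheory GRing.Theory Num.Theory.
Import numFieldNormedType.Exports HBNNSimple.
Local Open Scope classical_set_scope.
Local Open Scope ring_scope.

(** * Invariant Hahn-Banach theorem *)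

(** Four difficulties shape the development. The dominating functional is a supremum over base
    points, with no invariant mean at hand; invariance is obtained by averaging over finite lists,
    level by level along a central filtration. A splitting of [J] serves one direction, so only
    finitely many directions can be treated: the integers [p] and [Q] are fixed from the lengths of
    [x] and [y] before any splitting, and the bound to be proved is additive in [J]. The speed of a
    horizontal curve is not known to be measurable, so lengths are handled as lower integrals,
    through simple functions and measurable minorants. Finally, no integral curve is constructed for
    a given vector of the first layer: the argument uses only those vectors that are velocities of
    horizontal curves at times where the length grows at most linearly. Such vectors suffice to
    recognize constant functions, because any two points are joined by a curve of finite length;
    this finiteness is read off from the embedding, since distances in [L1] are finite. *)

Definition linear_space (R : realType) (V : lmodType R) (L : set V) : Prop :=
  L 0 /\ forall (t : R) x y, L x -> L y -> L (t *: x + y).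

Definition linear_on (R : realType) (V : lmodType R) (L : set V)
    (phi : V -> R) : Prop :=
  forall (t : R) x y, L x -> L y -> phi (t *: x + y) = t * phi x + phi y.

(** Everything is relative to a subspace [L], because the functionals in use are suprema and infima
    that are finite only there. *)
Definition sublinear_on (R : realType) (V : lmodType R) (L : set V)
    (p : V -> R) : Prop :=
  (forall x y, L x -> L y -> p (x + y) <= p x + p y) /\
  forall (t : R) x, 0 <= t -> L x -> p (t *: x) = t * p x.

Section hahn_banach.
Context (R : realType) (V : lmodType R) (L : set V) (p : V -> R).
Hypothesis L_lin : linear_space L.
Hypothesis p_sub : sublinear_on L p.

Let L0 : L 0. Proof. exact: L_lin.1. Qed.
Let LZ t x : L x -> L (t *: x).
Proof. by move=> Lx; rewrite -[_ *: _]addr0; apply: L_lin.2. Qed.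
Let LD x y : L x -> L y -> L (x + y).
Proof. by move=> Lx Ly; rewrite -[x]scale1r; apply: L_lin.2. Qed.
Let LN x : L x -> L (- x).
Proof. by rewrite -scaleN1r; apply: LZ. Qed.

Let p0 : p 0 = 0.
Proof. by rewrite -(scale0r 0) p_sub.2 // mul0r. Qed.

(* Domination by [p] makes a linear graph functional. *)
Let dominated (A : set (V * R)) : Prop :=
  (forall t u v, A u -> A v -> A (t *: u.1 + v.1, t * u.2 + v.2)) /\
  (forall u, A u -> L u.1 /\ u.2 <= p u.1).

Let dominated_fun A x a b : dominated A -> A (x, a) -> A (x, b) -> a = b.
Proof.
move=> [Alin Adom] Axa Axb.
have H c d : A (x, c) -> A (x, d) -> d - c <= 0.
  move=> Ac Ad; have /= := Alin (-1) _ _ Ac Ad.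
  by move=> /Adom /= [_]; rewrite scaleN1r addNr p0 mulN1r addrC.
by apply/eqP; rewrite eq_le -subr_le0 (H _ _ Axb Axa) -subr_le0 (H _ _ Axa Axb).
Qed.

Let extend A x : dominated A -> A !=set0 -> L x ->
  exists a, dominated [set w | exists2 u, A u &
                         exists t, w = (u.1 + t *: x, u.2 + t * a)].
Proof.
move=> [Alin Adom] [u0 Au0] Lx.
(* The possible values at [x] form an interval, nonempty by this inequality; its lower end is taken.
   A multiple [t] of [x] is reduced to [x] or [- x] by rescaling with the inverse of [|t|]. *)
have key u v : A u -> A v -> u.2 - p (u.1 - x) <= p (v.1 + x) - v.2.
  move=> Au Av; rewrite lerBlDr addrAC lerBrDr.
  have [Lu _] := Adom _ Au; have [Lv _] := Adom _ Av.
  have /Adom[/= _] := Alin 1 _ _ Au Av.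
  rewrite scale1r mul1r => /le_trans; apply.
  have -> : u.1 + v.1 = (v.1 + x) + (u.1 - x) by rewrite addrACA subrr addr0 addrC.
  by apply: p_sub.1; [exact: LD | apply: LD => //; exact: LN].
pose S := [set r | exists2 u, A u & r = u.2 - p (u.1 - x)].
have S0 : S !=set0 by exists (u0.2 - p (u0.1 - x)), u0.
have Sub : has_ubound S.
  by exists (p (u0.1 + x) - u0.2) => _ [u Au ->]; exact: key.
pose a := sup S.
have aL u : A u -> u.2 - p (u.1 - x) <= a.
  by move=> Au; apply: sup_upper_bound => //; exists u.
have aU v : A v -> a <= p (v.1 + x) - v.2.
  by move=> Av; apply: ge_sup => // _ [u Au ->]; exact: key.
exists a; split.
- move=> t _ _ [u Au [r ->]] [v Av [s ->]] /=.
  exists (t *: u.1 + v.1, t * u.2 + v.2); first exact: Alin.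
  exists (t * r + s) => /=; congr pair; last by ring.
  by rewrite scalerDr scalerDl scalerA addrACA.
- move=> _ [u Au [t ->]] /=; have [Lu pu] := Adom _ Au.
  split; first by apply: LD => //; exact: LZ.
  have A00 : A (0, 0).
    by have := Alin (-1) _ _ Au Au; rewrite scaleN1r addNr mulN1r addNr.
  have AZ r : A (r *: u.1, r * u.2).
    by have := Alin r _ _ Au A00; rewrite /= !addr0.
  have pZ r y : 0 < r -> L y -> p (r *: y) = r * p y.
    by move=> r0 Ly; rewrite p_sub.2 // ltW.
  have [t0|t0|->] := ltgtP t 0.
  + have t0' : 0 < - t by rewrite oppr_gt0.
    have := aL _ (AZ (- t)^-1) => /=.
    have -> : (- t)^-1 *: u.1 - x = (- t)^-1 *: (u.1 + t *: x).
      rewrite scalerDr scalerA invrN mulNr mulVf ?lt_eqF //.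
      by rewrite scaleN1r.
    rewrite pZ ?invr_gt0 //; last by apply: LD => //; exact: LZ.
     rewrite -mulrBr mulrC ler_pdivrMr // mulrN lerBlDr => h.
    by rewrite -lerBrDr (le_trans h) // addrC [a * t]mulrC.
  + have := aU _ (AZ t^-1) => /=.
    have -> : t^-1 *: u.1 + x = t^-1 *: (u.1 + t *: x).
      by rewrite scalerDr scalerA mulVf ?gt_eqF // scale1r.
    rewrite pZ ?invr_gt0 //; last by apply: LD => //; exact: LZ.
    rewrite -mulrBr mulrC ler_pdivlMr // lerBrDr => h.
    by rewrite addrC mulrC.
  + by rewrite scale0r mul0r !addr0.
Qed.

Theorem hahn_banach x0 (c : R) : L x0 -> (forall t : R, t * c <= p (t *: x0)) ->
  exists phi : V -> R, [/\ linear_on L phi, forall x, L x -> phi x <= p x &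
                         phi x0 = c].
Proof.
move=> Lx0 hc.
pose base : set (V * R) := [set u | exists t, u = (t *: x0, t * c)].
have base_dom : dominated base.
  split=> [t _ _ [r ->] [s ->] /=|_ [t ->] /=]; last by split=> //; exact: LZ.
  by exists (t * r + s); rewrite scalerDl scalerA mulrDl mulrA.
pose P A := A = set0 \/ (base `<=` A /\ dominated A).
have [|A [PA Amax]] := @Zorn_bigcup (V * R) P.
  move=> F FP Ftot.
  have [[A0 [FA0 A0n]]|noA] := pselect (exists A, F A /\ A <> set0); last first.
    left; rewrite -subset0 => u [A FA Au]; apply: noA; exists A; split => //.
    by move=> A0; rewrite A0 in Au.
  right; split.
    move=> u bu; exists A0 => //.
    by have [//|[+ _]] := FP _ FA0; apply.
  have Fdom A u : F A -> A u -> dominated A.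
    by move=> /FP[->//|[]].
  split=> [t u v [A FA Au] [B FB Bv]|u [A FA Au]]; last first.
    by have [_] := Fdom _ _ FA Au; apply.
  have [AB|BA] := Ftot _ _ FA FB.
    by exists B => //; apply: (Fdom _ _ FB Bv).1 => //; exact: AB.
  by exists A => //; apply: (Fdom _ _ FA Au).1 => //; exact: BA.
have bx0 : base (x0, c) by exists 1; rewrite scale1r mul1r.
case: PA => [A0|[bA Adom]].
  exfalso; apply: (Amax base); last by right; split.
  by rewrite A0; split=> // /(_ _ bx0).
have Atot x : L x -> exists a, A (x, a).
  move=> Lx; have A0 : A !=set0 by exists (x0, c); exact: bA.
  have [a Bdom] := extend Adom A0 Lx.
  set B := (X in dominated X) in Bdom.
  have AB : A `<=` B.
    by move=> u Au; exists u => //; exists 0; rewrite scale0r mul0r !addr0; case: u Au.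
  have [BA|nBA] := pselect (B `<=` A).
    have A00 : A (0, 0) by apply: bA; exists 0; rewrite scale0r mul0r.
    exists a; apply: BA; exists (0, 0) => //.
    by exists 1; rewrite scale1r mul1r !add0r.
  exfalso; apply: (Amax B) => //; right; split => //.
  by move=> u /bA /AB.
pose phi x := if pselect (L x) is left Lx then sval (cid (Atot x Lx)) else 0.
have phiA x : L x -> A (x, phi x).
  move=> Lx; rewrite /phi; case: pselect => // Lx'.
  by case: cid.
exists phi; split.
- move=> t x y Lx Ly; apply: (dominated_fun Adom (phiA _ _)).
    by apply: LD => //; exact: LZ.
  exact: (Adom.1 t (x, _) (y, _) (phiA _ Lx) (phiA _ Ly)).
- by move=> x Lx; have [_] := Adom.2 _ (phiA _ Lx).
- exact: (dominated_fun Adom (phiA _ Lx0) (bA _ bx0)).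
Qed.

End hahn_banach.

Definition subgroup_set (Gam : groupType) (H : set Gam) : Prop :=
  [/\ H 1%g, forall a b, H a -> H b -> H (a * b)%g & forall a, H a -> H a^-1%g].

(** Nilpotency enters only through a level [s] of such a filtration at which everything considered
    vanishes, exactly or up to null functions. *)
Definition central_filtration (Gam : groupType) (H : set Gam)
    (U : nat -> set Gam) : Prop :=
  [/\ U 0%N = H, forall j, subgroup_set (U j),
      forall j, U j.+1 `<=` U j &
      forall j h u, H h -> U j u -> U j.+1 [~ h, u]%g].

Lemma linear_spaceZ (R : realType) (V : lmodType R) (L : set V) :
  linear_space L -> forall (t : R) x, L x -> L (t *: x).
Proof. by move=> H t x Lx; rewrite -[_ *: _]addr0; apply: H.2 => //; exact: H.1. Qed.

Lemma linear_spaceD (R : realType) (V : lmodType R) (L : set V) :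
  linear_space L -> forall x y, L x -> L y -> L (x + y).
Proof. by move=> H x y Lx Ly; rewrite -[x]scale1r; apply: H.2. Qed.

Lemma linear_spaceN (R : realType) (V : lmodType R) (L : set V) :
  linear_space L -> forall x, L x -> L (- x).
Proof. by move=> H x Lx; rewrite -scaleN1r; apply: linear_spaceZ. Qed.

Lemma linear_spaceB (R : realType) (V : lmodType R) (L : set V) :
  linear_space L -> forall x y, L x -> L y -> L (x - y).
Proof.
by move=> H x y Lx Ly; apply: linear_spaceD => //; exact: linear_spaceN.
Qed.

Lemma linear_space_sum (R : realType) (V : lmodType R) (L : set V) (T : eqType)
  (l : seq T) (F : T -> V) : linear_space L ->
  (forall h, h \in l -> L (F h)) -> L (\sum_(h <- l) F h).
Proof.
move=> H; elim: l => [|h l IH] LF; first by rewrite big_nil; exact: H.1.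
rewrite big_cons; apply: linear_spaceD => //; first by apply: LF; rewrite mem_head.
by apply: IH => k kl; apply: LF; rewrite inE kl orbT.
Qed.

Section translation.
Context (R : realType) (Gam : groupType) (Y : Type) (act : Y -> Gam -> Y).
Hypothesis actM : forall y a b, act (act y a) b = act y (a * b)%g.
Hypothesis act1 : forall y, act y 1%g = y.

Definition tr (a : Gam) (F : Y -> R^o) : Y -> R^o := fun y => F (act y a).

Lemma trM a b F : tr a (tr b F) = tr (a * b)%g F.
Proof. by apply/funext => y; rewrite /tr actM. Qed.

Lemma tr1 F : tr 1%g F = F.
Proof. by apply/funext => y; rewrite /tr act1. Qed.

Lemma trZD a (t : R) F G : tr a (t *: F + G) = t *: tr a F + tr a G.
Proof. by []. Qed.

Lemma trD a F G : tr a (F + G) = tr a F + tr a G.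
Proof. by []. Qed.

Lemma trN a F : tr a (- F) = - tr a F.
Proof. by []. Qed.

Lemma trB a F G : tr a (F - G) = tr a F - tr a G.
Proof. by []. Qed.

Lemma trZ a (t : R) F : tr a (t *: F) = t *: tr a F.
Proof. by []. Qed.

Lemma tr_sum (T : Type) a (l : seq T) (F : T -> Y -> R^o) :
  tr a (\sum_(h <- l) F h) = \sum_(h <- l) tr a (F h).
Proof.
elim: l => [|h l IH]; first by rewrite !big_nil.
by rewrite !big_cons trD IH.
Qed.

(** Lists keep multiplicities, so that a composite of two averages is the average over the list of
    products ([avg_avg]). *)
Definition avg (l : seq Gam) (F : Y -> R^o) : Y -> R^o :=
  (size l)%:R^-1 *: \sum_(h <- l) tr h F.

Lemma avg1 F : avg [:: 1%g] F = F.
Proof. by rewrite /avg big_seq1 tr1 invr1 scale1r. Qed.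

Lemma avgZD l (t : R) F G : avg l (t *: F + G) = t *: avg l F + avg l G.
Proof.
rewrite /avg (eq_bigr (fun h => t *: tr h F + tr h G)) => [|h _]; last exact: trZD.
by rewrite big_split /= -scaler_sumr scalerDr !scalerA mulrC.
Qed.

Lemma avgD l F G : avg l (F + G) = avg l F + avg l G.
Proof. by rewrite -{1}[F]scale1r avgZD scale1r. Qed.

Lemma avgZ l (t : R) F : avg l (t *: F) = t *: avg l F.
Proof.
have := avgZD l t F 0; rewrite addr0 => ->.
by rewrite /avg [X in _ + _ *: X]big1 ?scaler0 ?addr0.
Qed.

Lemma avgN l F : avg l (- F) = - avg l F.
Proof. by rewrite -scaleN1r avgZ scaleN1r. Qed.

Lemma avg_avg l1 l2 F :
  avg l1 (avg l2 F) = avg [seq (h1 * h2)%g | h1 <- l1, h2 <- l2] F.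
Proof.
rewrite /avg size_allpairs natrM invfM -scalerA; congr (_ *: _).
rewrite big_allpairs_dep /= [RHS]scaler_sumr.
apply: eq_bigr => h _.
rewrite trZ tr_sum; congr (_ *: _); apply: eq_bigr => k _; exact: trM.
Qed.

End translation.

Section sublinear.
Context (R : realType) (V : lmodType R) (L : set V) (p : V -> R).
Hypothesis L_lin : linear_space L.
Hypothesis p_sub : sublinear_on L p.

Lemma sublinear0 : p 0 = 0.
Proof. by rewrite -(scale0r 0) p_sub.2 ?mul0r //; exact: L_lin.1. Qed.

Lemma sublinear_sum (T : eqType) (l : seq T) (F : T -> V) :
  (forall h, h \in l -> L (F h)) -> p (\sum_(h <- l) F h) <= \sum_(h <- l) p (F h).
Proof.
elim: l => [|h l IH] LF; first by rewrite !big_nil sublinear0.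
have Ll k : k \in l -> L (F k) by move=> kl; apply: LF; rewrite inE kl orbT.
have Lh : L (F h) by apply: LF; rewrite mem_head.
rewrite !big_cons (le_trans (p_sub.1 _ _ Lh (linear_space_sum L_lin Ll))) //.
by rewrite lerD2l IH.
Qed.

Lemma sublinear_opp x : L x -> - p (- x) <= p x.
Proof.
move=> Lx; rewrite -subr_ge0 opprK -sublinear0 -(subrr x).
by apply: p_sub.1 => //; exact: linear_spaceN.
Qed.

Lemma sublinear_mean (T : eqType) (l : seq T) (F : T -> V) (c : R) : l != [::] ->
  (forall h, h \in l -> L (F h) /\ p (F h) <= c) ->
  p ((size l)%:R^-1 *: \sum_(h <- l) F h) <= c.
Proof.
move=> l0 LF; have s0 : 0 < (size l)%:R :> R by rewrite ltr0n lt0n size_eq0.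
have LF' h : h \in l -> L (F h) by move=> /LF[].
rewrite p_sub.2 ?invr_ge0 ?ler0n //; last exact: linear_space_sum.
rewrite mulrC ler_pdivrMr // (le_trans (sublinear_sum LF')) //.
rewrite big_seq (le_trans (ler_sum _ (G := fun=> c) _)) => [//|h /LF[]//|].
by rewrite -big_seq big_const_seq count_predT iter_addr_0 mulr_natr.
Qed.

End sublinear.

Section invariant_hahn_banach.
Context (R : realType) (Gam : groupType) (Y : Type) (act : Y -> Gam -> Y).
Hypothesis actM : forall y a b, act (act y a) b = act y (a * b)%g.
Hypothesis act1 : forall y, act y 1%g = y.
Let V : lmodType R := Y -> R^o.
Context (L : set V) (N : set Gam) (U : nat -> set Gam) (s : nat).
Hypothesis L_lin : linear_space L.
Hypothesis NU : central_filtration N U.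
Hypothesis trL : forall a F, N a -> L F -> L (tr act a F).
Local Notation tr := (@tr R Gam Y act).
Local Notation avg := (@avg R Gam Y act).

Let UN j a : U j a -> N a.
Proof. by case: NU => <- _ Udecr _; elim: j => // j IH /Udecr/IH. Qed.

Let N_sub : subgroup_set N.
Proof. by case: NU => <- /(_ 0%N). Qed.

Let avgL l F : (forall h, h \in l -> N h) -> L F -> L (avg l F).
Proof.
move=> lN LF; apply: linear_spaceZ => //; apply: linear_space_sum => // h hl.
by apply: trL => //; exact: lN.
Qed.

Let conjU j a h : N a -> U j h -> U j (h ^ a)%g.
Proof.
case: NU => _ Usub Udecr Ucomm Na Uh.
have -> : (h ^ a = h * [~ h, a])%g by rewrite commgEl mulVKg.
have [_ M I] := Usub j; apply: M => //; rewrite -invgR; apply: I.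
exact/Udecr/Ucomm.
Qed.

Section step.
Context (q : V -> R) (F0 : V) (c : R).
Hypothesis LF0 : L F0.

(** State of a descending induction on [j]. The last clause keeps the value [c] at [F0] admissible
    for all averages, and not only for [F0]; in this form it survives an infimum over averages. *)
Let inv_at (j : nat) (p : V -> R) : Prop :=
  [/\ sublinear_on L p,
      forall F, L F -> p F <= q F,
      forall a F, N a -> L F -> p (tr a F) <= p F,
      forall z F, U j z -> L F -> p (tr z F - F) <= 0 &
      forall l, l != [::] -> (forall h, h \in l -> N h) ->
        c <= p (avg l F0) /\ - c <= p (avg l (- F0))].

Let avg_le (p : V -> R) l F : sublinear_on L p ->
  (forall a F, N a -> L F -> p (tr a F) <= p F) ->
  l != [::] -> (forall h, h \in l -> N h) -> L F -> p (avg l F) <= p F.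
Proof.
move=> ps pt l0 lN LF; apply: (sublinear_mean L_lin ps) => // h hl.
by split; [apply: trL => //; exact: lN | apply: pt => //; exact: lN].
Qed.

(* Averages over [U j] commute up to commutators, which lie in [U j.+1] and are
   already annihilated by [p]; hence the infimum over averages is sublinear. *)
Let inv_step j p : inv_at j.+1 p -> exists p', inv_at j p'.
Proof.
move=> [ps pq pt pn pc]; have [U0 Usub Udecr Ucomm] := NU.
pose A F := [set r | exists l : seq Gam,
  [/\ l != [::], (forall h, h \in l -> U j h) & r = p (avg l F)]].
have A1 F : A F (p F).
  exists [:: 1%g]; split => //; last by rewrite avg1.
  by move=> h; rewrite inE => /eqP ->; case: (Usub j).
have Alb F : L F -> lbound (A F) (- p (- F)).
  move=> LF _ [l [l0 lU ->]].
  have lN h : h \in l -> N h by move=> /lU/UN.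
  apply: (@le_trans _ _ (- p (- avg l F))); last first.
    by apply: (sublinear_opp L_lin ps); exact: avgL.
  by rewrite lerN2 -avgN; apply: avg_le => //; exact: linear_spaceN.
have Ainf F : L F -> has_inf (A F).
  by move=> LF; split; [exists (p F) | exists (- p (- F)); exact: Alb].
pose p' F := inf (A F).
have p'_le F l : L F -> l != [::] -> (forall h, h \in l -> U j h) ->
    p' F <= p (avg l F).
  by move=> LF l0 lU; apply: ge_inf; [exact: (Ainf _ LF).2 | exists l].
have p'_ge F r : (forall l, l != [::] -> (forall h, h \in l -> U j h) ->
    r <= p (avg l F)) -> r <= p' F.
  by move=> H; apply: lb_le_inf; [exists (p F) | move=> _ [l [l0 lU ->]]; exact: H].
have p'p F : L F -> p' F <= p F.
  by move=> LF; apply: ge_inf => //; exact: (Ainf _ LF).2.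
have p'eps F e : L F -> 0 < e -> exists l, [/\ l != [::],
    forall h, h \in l -> U j h & p (avg l F) < p' F + e].
  move=> LF e0; have [_ [l [l0 lU ->]] le] := inf_adherent e0 (Ainf _ LF).
  by exists l.
have lN (l : seq Gam) : (forall h, h \in l -> U j h) -> forall h, h \in l -> N h.
  by move=> lU h /lU/UN.
have comm l1 l2 F : l1 != [::] -> l2 != [::] -> (forall h, h \in l1 -> U j h) ->
    (forall h, h \in l2 -> U j h) -> L F -> p (avg l1 (avg l2 F)) <= p (avg l1 F).
  move=> l10 l20 l1U l2U LF.
  apply: (@le_trans _ _ (p (avg l2 (avg l1 F)))); last first.
    by apply: avg_le => //; [exact: lN | apply: avgL => //; exact: lN].
  have -> : avg l1 (avg l2 F) = avg l2 (avg l1 F) +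
     (size [seq (h1, h2) | h1 <- l1, h2 <- l2])%:R^-1 *:
     \sum_(h <- [seq (h1, h2) | h1 <- l1, h2 <- l2])
       (tr (h.1 * h.2)%g F - tr (h.2 * h.1)%g F).
    rewrite !avg_avg // /avg !size_allpairs !big_allpairs_dep /=.
    rewrite [X in _ = _ *: X + _]exchange_big [in RHS]mulnC /= -scalerDr.
    congr (_ *: _).
    rewrite -big_split /=; apply: eq_bigr => a _.
    by rewrite -big_split /=; apply: eq_bigr => b _; rewrite addrC subrK.
  set X := avg l2 _; set D := _ *: _.
  have LX : L X by apply: avgL; [exact: lN|apply: avgL => //; exact: lN].
  have LD : forall h, h \in [seq (h1, h2) | h1 <- l1, h2 <- l2] ->
     L (tr (h.1 * h.2)%g F - tr (h.2 * h.1)%g F).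
    move=> _ /allpairsP[[a b] /= [al bl ->]] /=.
    have [_ NM _] := N_sub.
    by apply: linear_spaceB => //; apply: trL => //; apply: NM; apply: (@UN j);
      [exact: l1U|exact: l2U|exact: l2U|exact: l1U].
  rewrite (le_trans (ps.1 _ _ LX _)) //.
    by apply: linear_spaceZ => //; exact: linear_space_sum.
  rewrite gerDl; apply: (sublinear_mean L_lin ps).
    by rewrite -size_eq0 size_allpairs muln_eq0 !size_eq0 negb_or l10.
  move=> h hl; split; first exact: LD.
  move: hl => /allpairsP[[a b] /= [al bl ->]] /=.
  have -> : (a * b = [~ a^-1, b^-1] * (b * a))%g by rewrite -commgCV.
  rewrite -trM //; apply: pn.
    by apply: Ucomm; [have [_ _ I] := N_sub; apply/I/UN/(l1U _ al)|
                     have [_ _ I] := Usub j; apply/I/l2U].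
  apply: trL => //; have [_ NM _] := N_sub; apply: NM; apply: (@UN j).
    exact: l2U.
  exact: l1U.
exists p'; split.
- split=> [F G LF LG|t F t0 LF].
  + apply/ler_addgt0Pr => e e0; have e20 : 0 < e / 2 by rewrite divr_gt0.
    have [l1 [l10 l1U H1]] := p'eps F _ LF e20.
    have [l2 [l20 l2U H2]] := p'eps G _ LG e20.
    have LFG : L (F + G) by exact: linear_spaceD.
    have l12 : (forall h, h \in [seq (h1 * h2)%g | h1 <- l1, h2 <- l2] -> U j h).
      move=> _ /allpairsP[[a b] /= [al bl ->]].
      by have [_ M _] := Usub j; apply: M; [exact: l1U|exact: l2U].
    apply: (le_trans (p'_le _ _ LFG _ l12)).
      by rewrite -size_eq0 size_allpairs muln_eq0 !size_eq0 negb_or l10.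
    rewrite -avg_avg // !avgD.
    apply: (le_trans (ps.1 _ _ _ _)).
      by apply: avgL; [exact: lN|apply: avgL => //; exact: lN].
      by apply: avgL; [exact: lN|apply: avgL => //; exact: lN].
    have := comm _ _ _ l10 l20 l1U l2U LF.
    have LG2 : L (avg l2 G) by apply: avgL => //; exact: lN.
    have := avg_le ps pt l10 (lN _ l1U) LG2.
    by move: H1 H2; lra.
  + have [->|t_neq0] := eqVneq t 0.
      rewrite mul0r scale0r; apply/le_anti/andP; split.
        by rewrite (le_trans (p'p _ _)) ?(sublinear0 L_lin ps) //; exact: L_lin.1.
      apply: p'_ge => l _ _; rewrite -{1}(sublinear0 L_lin ps).
      by rewrite -[in X in _ <= X](scale0r 0) avgZ scale0r.
    have t_gt0 : 0 < t by rewrite lt_def t_neq0.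
    have LtF : L (t *: F) by exact: linear_spaceZ.
    apply/le_anti/andP; split.
      rewrite -ler_pdivrMl //; apply: p'_ge => l l0 lU.
      rewrite ler_pdivrMl // -ps.2 //; last by apply: avgL => //; exact: lN.
      by rewrite -avgZ; exact: p'_le.
    apply: p'_ge => l l0 lU; rewrite avgZ ps.2 //.
      by rewrite ler_pM2l //; exact: p'_le.
    by apply: avgL => //; exact: lN.
- by move=> F LF; rewrite (le_trans (p'p _ LF)) // pq.
- move=> a F Na LF; apply: p'_ge => l l0 lU.
  have [_ _ NI] := N_sub.
  have Nai : N (a^-1)%g by exact: NI.
  (* The conjugated list still lies in [U j], and averaging [tr a F] over it is the translate by [a]
     of the average of [F] over [l]. *)
  pose l' := [seq (h ^ a^-1)%g | h <- l].
  have l'U : forall h, h \in l' -> U j h.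
    by move=> _ /mapP[h hl ->]; apply: conjU => //; exact: lU.
  have l'0 : l' != [::] by rewrite -size_eq0 size_map size_eq0.
  apply: (le_trans (p'_le _ _ (trL Na LF) l'0 l'U)).
  have -> : avg l' (tr a F) = tr a (avg l F).
    rewrite /avg size_map trZ tr_sum big_map; congr (_ *: _).
    by apply: eq_bigr => h _; rewrite !trM // -conjgCV.
  by apply: pt => //; apply: avgL => //; exact: lN.
- move=> z F Uz LF; have Nz := UN Uz.
  have LzF : L (tr z F - F) by apply: linear_spaceB => //; exact: trL.
  have zX n : U j (z ^+ n)%g.
    by have [U1 M _] := Usub j; elim: n => [|n IH]; rewrite ?expg0 // expgS; exact: M.
  (* The average of [tr z F - F] over 1, z, ..., z^n telescopes, so [p'] of it is at most a constant
     divided by [n.+1]. *)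
  have main n : p' (tr z F - F) * n.+1%:R <= p F + p (- F).
    pose l := [seq (z ^+ i)%g | i <- iota 0 n.+1].
    have lU h : h \in l -> U j h by move=> /mapP[i _ ->].
    have l0 : l != [::] by [].
    have n0 : 0 < n.+1%:R :> R by [].
    rewrite -ler_pdivlMr //.
    apply: (le_trans (p'_le _ _ LzF l0 lU)).
    have -> : avg l (tr z F - F) = n.+1%:R^-1 *: (tr (z ^+ n.+1)%g F - F).
      rewrite /avg size_map size_iota big_map; congr (_ *: _).
      rewrite (_ : iota 0 n.+1 = index_iota 0 n.+1) //.
      rewrite (eq_bigr (fun i => tr (z ^+ i.+1)%g F - tr (z ^+ i)%g F)).
        by rewrite (telescope_sumr (fun i => tr (z ^+ i)%g F)) // expg0 tr1.
      by move=> i _; rewrite trB trM // -expgSr.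
    have LznF : L (tr (z ^+ n.+1)%g F) by apply: trL => //; exact: (UN (zX _)).
    rewrite ps.2 ?invr_ge0 //; last first.
      by apply: linear_spaceB.
    rewrite mulrC ler_pM2r ?invr_gt0 //.
    rewrite (le_trans (ps.1 _ _ _ _)) //; first exact: linear_spaceN.
    by rewrite lerD2r; apply: pt => //; exact: (UN (zX _)).
  rewrite leNgt; apply/negP => H0.
  have := archi_boundP (x := (p F + p (- F)) / p' (tr z F - F)).
  set m := Num.bound _ => /(_ _) Hm.
  have H1 : 0 <= (p F + p (- F)) / p' (tr z F - F).
    rewrite divr_ge0 ?(ltW H0) // -(sublinear0 L_lin ps) -(subrr F).
    by apply: ps.1 => //; exact: linear_spaceN.
  have := main m; rewrite leNgt => /negP; apply.
  have := Hm H1; rewrite ltr_pdivrMr // => /lt_trans; apply.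
  by rewrite mulrC ltr_pM2l // ltr_nat.
- move=> l l0 lN'.
  have prod (l' : seq Gam) : l' != [::] -> (forall h, h \in l' -> U j h) ->
    [seq (h1 * h2)%g | h1 <- l', h2 <- l] != [::] /\
    (forall h, h \in [seq (h1 * h2)%g | h1 <- l', h2 <- l] -> N h).
    move=> l'0 l'U; split.
      by rewrite -size_eq0 size_allpairs muln_eq0 !size_eq0 negb_or l'0.
    move=> _ /allpairsP[[a b] /= [al bl ->]].
    by have [_ M _] := N_sub; apply: M; [exact/(@UN j)/l'U|exact: lN'].
  by split; apply: p'_ge => l' l'0 l'U; rewrite avg_avg //;
    have [H1 H2] := prod _ l'0 l'U; have [] := pc _ H1 H2.
Qed.

(** The descent starts from [q] at level [s] and ends at level 0, where the functional is
    nonpositive on every [tr z F - F]; applying this to [z] and to its inverse, any linear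
    functional below it is invariant. The condition on averages is forced, since an invariant [phi]
    takes the value [c] on every average of [F0]. *)
Theorem invariant_hahn_banach : sublinear_on L q ->
  (forall a F, N a -> L F -> q (tr a F) <= q F) ->
  (forall l, l != [::] -> (forall h, h \in l -> N h) ->
    c <= q (avg l F0) /\ - c <= q (avg l (- F0))) ->
  (forall z F, U s z -> L F -> q (tr z F - F) <= 0) ->
  exists phi : V -> R,
    [/\ linear_on L phi, forall F, L F -> phi F <= q F,
        forall a F, N a -> L F -> phi (tr a F) = phi F & phi F0 = c].
Proof.
move=> qs qt qc qn; have [U0 Usub Udecr Ucomm] := NU.
have H j : (j <= s)%N -> exists p, inv_at (s - j) p.
  elim: j => [_|j IH js].
    by rewrite subn0; exists q.
  have [p] := IH (ltnW js).
  by rewrite (_ : (s - j = (s - j.+1).+1)%N); [exact: inv_step | lia].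
have := H s (leqnn s); rewrite subnn => -[p [ps pq pt pn pc]].
have pF0 : c <= p F0 /\ - c <= p (- F0).
  have := pc [:: 1%g] isT; rewrite !avg1 //; apply => h.
  by rewrite inE => /eqP ->; case: N_sub.
have [t|phi [phi_lin phi_le phi0]] := @hahn_banach _ _ L p L_lin ps F0 c LF0.
  have [t0|t0] := leP 0 t; first by rewrite ps.2 // ler_wpM2l //; exact: pF0.1.
  have t0' : 0 <= - t by rewrite oppr_ge0 ltW.
  rewrite -(mulrNN t) -[X in X *: F0]opprK scaleNr -scalerN ps.2 //; last first.
    exact: linear_spaceN.
  by rewrite ler_wpM2l //; exact: pF0.2.
exists phi; split => // [F LF|a F Na LF].
  by rewrite (le_trans (phi_le _ LF)) // pq.
have phiB G1 G2 : L G1 -> L G2 -> phi (G1 - G2) = phi G1 - phi G2.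
  by move=> L1 L2; rewrite addrC -scaleN1r phi_lin // mulN1r addrC.
have one a' G : N a' -> L G -> phi (tr a' G) - phi G <= 0.
  move=> Na' LG; have LaG := trL Na' LG.
  rewrite -phiB // (le_trans (phi_le _ _)) ?pn // ?U0 //.
  exact: linear_spaceB.
have [_ _ NI] := N_sub.
apply/eqP; rewrite eq_le -subr_le0 one //= -subr_le0.
have := one _ _ (NI _ Na) (trL Na LF).
by rewrite trM // mulVg tr1.
Qed.

End step.

End invariant_hahn_banach.

(** * Commutators along a central filtration *)

Section iterated_commutator.
Context (Gam : groupType) (H : set Gam) (U : nat -> set Gam).
Hypothesis HU : central_filtration H U.
Local Open Scope group_scope.

(** Commutators nested to the right. A list of size m+1 with entries in [H] gives an element of
    [U m], hence the predecessor in [icomm_level]. *)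
Fixpoint icomm (t : seq Gam) : Gam :=
  match t with
  | [::] => 1
  | [:: u] => u
  | u :: t' => [~ u, icomm t']
  end.

Arguments icomm t : simpl never.

Definition eqmod k (a b : Gam) : Prop := U k (a^-1 * b).

Lemma filtration_sub k a : U k a -> H a.
Proof. by case: HU => <- _ Udecr _; elim: k => // k IH /Udecr/IH. Qed.

Let U1 k : U k 1. Proof. by case: HU => _ /(_ k)[]. Qed.
Let UM k a b : U k a -> U k b -> U k (a * b).
Proof. by case: HU => _ /(_ k)[_ + _] _ _; apply. Qed.
Let UV k a : U k a -> U k a^-1. Proof. by case: HU => _ /(_ k)[_ _ +] _ _; apply. Qed.
Let H_U0 a : H a <-> U 0%N a. Proof. by case: HU => ->. Qed.
Let HM a b : H a -> H b -> H (a * b). Proof. by rewrite !H_U0; exact: UM. Qed.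
Let HV a : H a -> H a^-1. Proof. by rewrite !H_U0; exact: UV. Qed.
Let HX a n : H a -> H (a ^+ n).
Proof. by move=> Ha; elim: n => [|n IH]; [exact/H_U0/U1|rewrite expgS; exact: HM]. Qed.

Lemma filtration_commg k h u : H h -> U k u -> U k.+1 [~ h, u].
Proof. by case: HU => _ _ _; apply. Qed.

Lemma filtration_commgV k h u : H h -> U k u -> U k.+1 [~ u, h].
Proof. by move=> Hh Uu; rewrite -invgR; apply: UV; exact: filtration_commg. Qed.

Lemma filtration_conj k h u : H h -> U k u -> U k (u ^ h).
Proof.
move=> Hh Uu; have -> : u ^ h = u * [~ u, h] by rewrite commgEl mulVKg.
by apply: UM => //; case: HU => _ _ Udecr _; exact/Udecr/filtration_commgV.
Qed.

Lemma eqmod_refl k a : eqmod k a a. Proof. by rewrite /eqmod mulVg. Qed.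

Lemma eqmod_sym k a b : eqmod k a b -> eqmod k b a.
Proof. by rewrite /eqmod => /UV; rewrite invgM invgK. Qed.

Lemma eqmod_trans k b a c : eqmod k a b -> eqmod k b c -> eqmod k a c.
Proof. by move=> ab /(UM ab); rewrite /eqmod -mulgA mulVKg. Qed.

Lemma eqmodM k a a' b b' : H b -> eqmod k a a' -> eqmod k b b' ->
  eqmod k (a * b) (a' * b').
Proof.
move=> Hb aa' bb'; rewrite /eqmod invgM.
have -> : b^-1 * a^-1 * (a' * b') = (a^-1 * a') ^ b * (b^-1 * b').
  by rewrite conjgE !mulgA mulgK.
by apply: UM => //; exact: filtration_conj.
Qed.

Lemma eqmodX k a b n : H a -> eqmod k a b -> eqmod k (a ^+ n) (b ^+ n).
Proof.
move=> Ha ab; elim: n => [|n IH]; first exact: eqmod_refl.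
by rewrite !expgS; apply: eqmodM => //; exact: HX.
Qed.

Lemma eqmodC k a b : U k a -> H b -> eqmod k.+1 (a * b) (b * a).
Proof.
by move=> Ua Hb; apply: eqmod_sym; rewrite /eqmod [X in _ * X]commgC mulKg; exact: filtration_commgV.
Qed.

(** The quotient of [U k] by [U k.+1] is central in that of [H], hence abelian. *)
Lemma eqmodXM k a b n : U k a -> U k b -> eqmod k.+1 ((a * b) ^+ n) (a ^+ n * b ^+ n).
Proof.
move=> Ua Ub; have Ha := filtration_sub Ua; have Hb := filtration_sub Ub.
elim: n => [|n IH]; first by rewrite !expg0 mulg1; exact: eqmod_refl.
rewrite !expgS; apply: (@eqmod_trans _ (a * b * (a ^+ n * b ^+ n))).
  apply: eqmodM => //; first exact/HX/HM.
  exact: eqmod_refl.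
rewrite -!mulgA; apply: eqmodM; [by apply: HM => //; apply: HM; exact: HX|
  exact: eqmod_refl|].
rewrite !mulgA; apply: eqmodM; [exact: HX| |exact: eqmod_refl].
by apply: eqmodC => //; exact: HX.
Qed.

Lemma eqmod_shift k a u : H a -> U k u -> eqmod k (a * u) a.
Proof. by move=> Ha Uu; apply: eqmod_sym; rewrite /eqmod mulKg. Qed.

Lemma commg_mulr (u q q' : Gam) : [~ u, q * q'] = [~ u, q'] * [~ u, q] ^ q'.
Proof. by rewrite !commgEl !conjgE !invgM !mulgA !mulgK. Qed.

Lemma commg_mull (u u' q : Gam) : [~ u * u', q] = [~ u, q] ^ u' * [~ u', q].
Proof. by rewrite !commgEl !conjgE !invgM !mulgA !mulgK. Qed.

Lemma eqmod_commg_mulr j u q q' : H u -> U j q -> H q' ->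
  eqmod j.+2 [~ u, q * q'] ([~ u, q] * [~ u, q']).
Proof.
move=> Hu Uq Hq'; rewrite commg_mulr.
have Uc := filtration_commg Hu Uq.
have Hc : H [~ u, q] by exact: filtration_sub Uc.
have Hc' : H [~ u, q'].
  by apply: (@filtration_sub 1); apply: filtration_commg => //; exact/H_U0.
have Hcq : H ([~ u, q] ^ q') by apply/(@filtration_sub j.+1)/filtration_conj.
apply: (@eqmod_trans _ ([~ u, q'] * [~ u, q])).
  apply: eqmodM => //; first exact: eqmod_refl.
  have -> : [~ u, q] ^ q' = [~ u, q] * [~ [~ u, q], q'].
    by rewrite [in RHS]commgEl mulVKg.
  by apply: eqmod_shift => //; exact: filtration_commgV.
by apply/eqmod_sym/eqmodC.
Qed.

Lemma eqmod_commg_mull j u u' q : H u -> H u' -> U j q ->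
  eqmod j.+2 [~ u * u', q] ([~ u, q] * [~ u', q]).
Proof.
move=> Hu Hu' Uq; rewrite commg_mull.
have Uc := filtration_commg Hu Uq.
have Hc : H [~ u, q] by exact: filtration_sub Uc.
have Hc' : H [~ u', q] by apply: filtration_sub (filtration_commg Hu' Uq).
apply: eqmodM => //; last exact: eqmod_refl.
have -> : [~ u, q] ^ u' = [~ u, q] * [~ [~ u, q], u'].
  by rewrite [in RHS]commgEl mulVKg.
by apply: eqmod_shift => //; exact: filtration_commgV.
Qed.

Lemma eqmod_commg_congr j u q q' : H u -> U j q -> eqmod j.+1 q q' ->
  eqmod j.+2 [~ u, q] [~ u, q'].
Proof.
move=> Hu Uq qq'; have Hd := filtration_sub qq'.
have -> : q' = q * (q^-1 * q') by rewrite mulVKg.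
apply: eqmod_sym; apply: (eqmod_trans (eqmod_commg_mulr Hu Uq Hd)).
apply: eqmod_shift; last exact: filtration_commg.
exact: filtration_sub (filtration_commg Hu Uq).
Qed.

Lemma icomm_cons u t : t != [::] -> icomm (u :: t) = [~ u, icomm t].
Proof. by case: t. Qed.

Lemma icomm_level t : t != [::] -> (forall u, u \in t -> H u) ->
  U (size t).-1 (icomm t).
Proof.
elim: t => // u [|v t] IH _ Ht; first by apply/H_U0/Ht; rewrite mem_head.
rewrite icomm_cons //; apply: filtration_commg; first by apply: Ht; rewrite mem_head.
by apply: IH => // w wt; apply: Ht; rewrite inE wt orbT.
Qed.

Lemma icomm_H t : (forall u, u \in t -> H u) -> H (icomm t).
Proof.
case: t => [|u t] Ht; first exact/H_U0/U1.
by apply: filtration_sub; exact: icomm_level.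
Qed.

Section multilinearity.
Context (l1 l2 : seq Gam).
Hypothesis l1H : forall u, u \in l1 -> H u.
Hypothesis l2H : forall u, u \in l2 -> H u.

Let hole_H l a : (forall u, u \in l -> H u) -> H a ->
  forall u, u \in l ++ a :: l2 -> H u.
Proof.
by move=> lH Ha u; rewrite mem_cat inE => /or3P[/lH//|/eqP->//|/l2H].
Qed.

(** Additivity in one entry, at any position, modulo the level just below that of the commutator
    itself: the commutator lies at level [size - 1], the error at level [size]. Each outer letter
    lowers both by one. *)
Lemma eqmod_icomm_mul a b : H a -> H b ->
  eqmod (size (l1 ++ a :: l2)) (icomm (l1 ++ (a * b) :: l2))
    (icomm (l1 ++ a :: l2) * icomm (l1 ++ b :: l2)).
Proof.
move=> Ha Hb; elim: l1 l1H => [_|u l IH] /=.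
  case E : l2 => [|v l2']; first by exact: eqmod_refl.
  rewrite -E !icomm_cons ?E // -E.
  have := @eqmod_commg_mull (size l2').+1.-1 a b (icomm l2) Ha Hb.
  by rewrite E /=; apply; apply: (@icomm_level (v :: l2')) => // u; rewrite -E; exact: l2H.
move=> ulH; have Hu : H u by apply: ulH; rewrite mem_head.
have lH v : v \in l -> H v by move=> vl; apply: ulH; rewrite inE vl orbT.
have n0 c : l ++ c :: l2 != [::] by case: (l).
rewrite !icomm_cons //.
have szE c : (size (l ++ c :: l2)) = (size (l ++ c :: l2)).-1.+1 by rewrite size_cat /= addnS.
have sz c d : size (l ++ c :: l2) = size (l ++ d :: l2) by rewrite !size_cat.
have UA := icomm_level (n0 a) (hole_H lH Ha).
have UB := icomm_level (n0 b) (hole_H lH Hb).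
have UAB := icomm_level (n0 (a * b)) (hole_H lH (HM Ha Hb)).
rewrite (sz b a) in UB; rewrite (sz (a * b) a) in UAB.
have := IH lH; rewrite szE => E.
apply: (eqmod_trans (eqmod_commg_congr Hu UAB E)).
by apply: eqmod_commg_mulr => //; exact: filtration_sub UB.
Qed.

Lemma eqmod_icommX a n : H a ->
  eqmod (size (l1 ++ a :: l2)) (icomm (l1 ++ (a ^+ n) :: l2))
    (icomm (l1 ++ a :: l2) ^+ n).
Proof.
move=> Ha; have H1 : H 1 by exact/H_U0/U1.
elim: n => [|n IH].
  rewrite !expg0; have := eqmod_icomm_mul H1 H1; rewrite mulg1 => E.
  rewrite (_ : size (l1 ++ a :: l2) = size (l1 ++ 1 :: l2)); last by rewrite !size_cat.
  by apply: eqmod_sym; rewrite /eqmod invg1 mul1g; move: E; rewrite /eqmod mulKg.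
rewrite !expgS; apply: eqmod_trans (eqmod_icomm_mul Ha (HX n Ha)) _.
apply: eqmodM => //; last exact: eqmod_refl.
by apply: icomm_H; apply: hole_H => //; exact: HX.
Qed.

(** A power of a product inside an entry is not the product of the powers; the exponent is moved out
    of the commutator, distributed at its deep level, and moved back in. *)
Lemma eqmod_icommXM a b n : H a -> H b ->
  eqmod (size (l1 ++ a :: l2)) (icomm (l1 ++ ((a * b) ^+ n) :: l2))
    (icomm (l1 ++ a ^+ n :: l2) * icomm (l1 ++ b ^+ n :: l2)).
Proof.
move=> Ha Hb; have n0 c : l1 ++ c :: l2 != [::] by case: (l1).
have sz c d : size (l1 ++ c :: l2) = size (l1 ++ d :: l2) by rewrite !size_cat.
have szE c : (size (l1 ++ c :: l2)) = (size (l1 ++ c :: l2)).-1.+1.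
  by rewrite size_cat /= addnS.
have Hc c : H c -> H (icomm (l1 ++ c :: l2)).
  by move=> Hc; apply: icomm_H; exact: hole_H.
have UA := icomm_level (n0 a) (hole_H l1H Ha).
have UB := icomm_level (n0 b) (hole_H l1H Hb).
rewrite (sz b a) in UB.
have Eab := eqmod_icommX n (HM Ha Hb); rewrite (sz _ a) in Eab.
apply: (eqmod_trans Eab).
apply: (@eqmod_trans _ ((icomm (l1 ++ a :: l2) * icomm (l1 ++ b :: l2)) ^+ n)).
  by apply: eqmodX; [exact/Hc/HM|exact: eqmod_icomm_mul].
rewrite szE; apply: (eqmod_trans (eqmodXM n UA UB)); rewrite -szE.
apply: eqmodM; [exact/HX/Hc| |].
  exact/eqmod_sym/eqmod_icommX.
by rewrite (sz a b); exact/eqmod_sym/eqmod_icommX.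
Qed.

End multilinearity.

Lemma icomm_commute t : (1 < size t)%N ->
  (forall u v, u \in t -> v \in t -> commute u v) -> icomm t = 1.
Proof.
elim: t => // u [|v [|w t]] IH // _ Hc.
  by rewrite icomm_cons //=; apply/eqP/commgP/Hc; rewrite !inE eqxx ?orbT.
rewrite icomm_cons // IH ?commg1 // => a b at_ bt.
by apply: Hc; rewrite inE ?at_ ?bt orbT.
Qed.

End iterated_commutator.

(** * Length functions on nilpotent groups *)

(** A monoid closure, used for sets closed under inverses, where it is the generated subgroup; the
    inductive form gives induction on words. *)
Inductive gen (Gam : groupType) (S : set Gam) : Gam -> Prop :=
| gen1 : gen S 1%g
| gen_in a : S a -> gen S a
| genM a b : gen S a -> gen S b -> gen S (a * b)%g.

Lemma genV (Gam : groupType) (S : set Gam) : (forall a, S a -> S a^-1%g) ->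
  forall a, gen S a -> gen S a^-1%g.
Proof.
move=> SV a; elim=> [|b /SV Sb|b c _ IHb _ IHc].
- by rewrite invg1; exact: gen1.
- exact: gen_in.
- by rewrite invgM; exact: genM.
Qed.

Lemma gen_sub (Gam : groupType) (S H : set Gam) : subgroup_set H -> S `<=` H ->
  gen S `<=` H.
Proof. by move=> [H1 HM _] SH a; elim=> [//|b /SH //|b c _ ? _ ?]; exact: HM. Qed.

Lemma gen_subgroup (Gam : groupType) (S : set Gam) :
  (forall a, S a -> S a^-1%g) -> subgroup_set (gen S).
Proof. by move=> SV; split; [exact: gen1|exact: genM|exact: genV]. Qed.

Lemma subgroup_commg (Gam : groupType) (H : set Gam) : subgroup_set H ->
  forall a b, H a -> H b -> H [~ a, b]%g.
Proof.
move=> [_ mulH I] a b Ha Hb; rewrite commgEl conjgE.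
by apply/mulH; [exact: I|apply/mulH; [exact: I|exact: mulH]].
Qed.

Lemma subgroup_expg (Gam : groupType) (H : set Gam) : subgroup_set H ->
  forall a n, H a -> H (a ^+ n)%g.
Proof.
by move=> [H1 mulH _] a n Ha; elim: n => // n IH; rewrite expgS; exact: mulH.
Qed.

Lemma mean_const (R : realType) (V : lmodType R) (T : eqType) (l : seq T) (x : V) :
  l != [::] -> (size l)%:R^-1 *: \sum_(h <- l) x = x.
Proof.
move=> l0; rewrite big_const_seq count_predT iter_addr_0 -(scaler_nat _ x) scalerK //.
by rewrite pnatr_eq0 size_eq0.
Qed.

(** * Cocycles with values in a lattice of functions, and their lengths *)

Section cocycle.
Context (R : realType) (Gam : groupType) (Y : Type) (act : Y -> Gam -> Y).
Hypothesis actM : forall y a b, act (act y a) b = act y (a * b)%g.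
Hypothesis act1 : forall y, act y 1%g = y.
Let V : lmodType R := Y -> R^o.
Local Notation tr := (@tr R Gam Y act).
Local Notation avg := (@avg R Gam Y act).
Context (L : set V) (H : set Gam) (U : nat -> set Gam) (s : nat).
Hypothesis L_lin : linear_space L.
Hypothesis HU : central_filtration H U.
Hypothesis trL : forall a F, H a -> L F -> L (tr a F).

Definition absf (F : Y -> R^o) : Y -> R^o := fun y => `|F y|.

Hypothesis absL : forall F, L F -> L (absf F).
Context (f : V).

(** Only the increments of [f] are asked to lie in [L], not [f] itself; so [cob] is a cocycle with
    values in [L] that need not be a coboundary there. *)
Definition cob (a : Gam) : Y -> R^o := tr a f - f.

Hypothesis cobL : forall a, H a -> L (cob a).

Let H_sub : subgroup_set H.
Proof. by case: HU => <- /(_ 0%N). Qed.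

Let H1 : H 1%g. Proof. by case: H_sub. Qed.
Let HM a b : H a -> H b -> H (a * b)%g. Proof. by case: H_sub => _ + _; apply. Qed.
Let HV a : H a -> H a^-1%g. Proof. by case: H_sub => _ _; apply. Qed.
Let HX a n : H a -> H (a ^+ n)%g. Proof. exact: subgroup_expg. Qed.

Let U_H j a : U j a -> H a.
Proof. by case: HU => <- _ Udecr _; elim: j => // j IH /Udecr/IH. Qed.

Lemma cob1 : cob 1%g = 0.
Proof. by rewrite /cob tr1 // subrr. Qed.

Lemma cobM a c : cob (a * c)%g = cob a + tr a (cob c).
Proof. by rewrite /cob trB trM // [RHS]addrC addrA subrK. Qed.

Definition posinv (J : (Y -> R^o) -> R) : Prop :=
  [/\ linear_on L J, forall F, L F -> (forall y, 0 <= F y) -> 0 <= J F &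
      forall a F, H a -> L F -> J (tr a F) = J F].

Section linear_functional.
Context (phi : (Y -> R^o) -> R).
Hypothesis phi_lin : linear_on L phi.

Lemma linear_onD F G : L F -> L G -> phi (F + G) = phi F + phi G.
Proof. by move=> LF LG; rewrite -[F]scale1r phi_lin // mul1r scale1r. Qed.

Lemma linear_on0 : phi 0 = 0.
Proof.
have L0 := L_lin.1; have := linear_onD L0 L0.
by rewrite addr0 => h; apply: (@addrI _ (phi 0)); rewrite -h addr0.
Qed.

Lemma linear_onZ t F : L F -> phi (t *: F) = t * phi F.
Proof.
by move=> LF; rewrite -[t *: F]addr0 phi_lin //; [rewrite linear_on0 addr0|exact: L_lin.1].
Qed.

Lemma linear_onB F G : L F -> L G -> phi (F - G) = phi F - phi G.
Proof. by move=> LF LG; rewrite addrC -scaleN1r phi_lin // mulN1r addrC. Qed.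

Lemma linear_onN F : L F -> phi (- F) = - phi F.
Proof. by move=> LF; rewrite -scaleN1r linear_onZ // mulN1r. Qed.

Lemma linear_on_sum (T : eqType) (l : seq T) (F : T -> Y -> R^o) :
  (forall h, h \in l -> L (F h)) -> phi (\sum_(h <- l) F h) = \sum_(h <- l) phi (F h).
Proof.
elim: l => [|h l IH] LF; first by rewrite !big_nil linear_on0.
have Ll k : k \in l -> L (F k) by move=> kl; apply: LF; rewrite inE kl orbT.
by rewrite !big_cons linear_onD ?IH //; [apply: LF; rewrite mem_head|exact: linear_space_sum].
Qed.

Lemma cobM_invariant (N : set Gam) a c : (forall a F, N a -> L F -> phi (tr a F) = phi F) ->
  N a -> H a -> H c -> phi (cob (a * c)%g) = phi (cob a) + phi (cob c).
Proof.
move=> phi_inv Na Ha Hc; have Lc := cobL Hc; have La := cobL Ha.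
by rewrite cobM linear_onD ?phi_inv //; exact: trL.
Qed.

Lemma cobX_invariant (N : set Gam) a n :
  (forall a F, N a -> L F -> phi (tr a F) = phi F) ->
  N a -> H a -> phi (cob (a ^+ n)%g) = n%:R * phi (cob a).
Proof.
move=> phi_inv Na Ha; elim: n => [|n IH]; first by rewrite expg0 cob1 linear_on0 mul0r.
rewrite expgS (cobM_invariant phi_inv) //; last exact: HX.
by rewrite IH [in RHS]mulrSr mulrDl mul1r addrC.
Qed.

End linear_functional.

Section positive_functional.
Context (J : (Y -> R^o) -> R).
Hypothesis J_pos : posinv J.

Let J_lin : linear_on L J. Proof. by case: J_pos. Qed.

Lemma posinv_le F G : L F -> L G -> (forall y, F y <= G y) -> J F <= J G.
Proof.
move=> LF LG FG; rewrite -subr_ge0 -linear_onB //.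
by have [_ + _] := J_pos; apply; [exact: linear_spaceB|move=> y; rewrite subr_ge0].
Qed.

Definition nrm F := J (absf F).

Lemma nrm_ge0 F : L F -> 0 <= nrm F.
Proof. by move=> LF; have [_ + _] := J_pos; apply; [exact: absL|move=> y; exact: normr_ge0]. Qed.

Lemma le_nrm F : L F -> J F <= nrm F.
Proof. by move=> LF; apply: posinv_le => //; [exact: absL|move=> y; exact: ler_norm]. Qed.

Lemma nrmN F : nrm (- F) = nrm F.
Proof. by congr J; apply/funext => y; rewrite /absf /= normrN. Qed.

Lemma abs_le_nrm F : L F -> `|J F| <= nrm F.
Proof.
move=> LF; rewrite ler_norml le_nrm // andbT lerNl -linear_onN // -nrmN.
by apply: le_nrm; exact: linear_spaceN.
Qed.

Lemma nrm_sublinear : sublinear_on L nrm.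
Proof.
split=> [F G LF LG|t F t0 LF].
  rewrite /nrm -(linear_onD J_lin (absL LF) (absL LG)).
  apply: posinv_le; [by apply: absL; exact: linear_spaceD|apply: linear_spaceD => //; exact: absL|].
  by move=> y; exact: ler_normD.
rewrite /nrm -(linear_onZ J_lin); last exact: absL.
by congr J; apply/funext => y; rewrite /absf /= normrZ ger0_norm.
Qed.

Lemma nrm_tr a F : H a -> L F -> nrm (tr a F) = nrm F.
Proof. by move=> Ha LF; have [_ _ /(_ a (absf F) Ha (absL LF))] := J_pos. Qed.

Definition psi a := nrm (cob a).

(** The substitute for nilpotency of class [s]: the level [U s] may be nontrivial, but it has length
    0 and moves the functions of [L] by null functions only. This weak form is the one that passes
    to limits. *)
Definition null_at_top : Prop :=
  (forall z, U s z -> psi z = 0) /\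
  forall z F, U s z -> L F -> nrm (tr z F - F) = 0.

Lemma psi_ge0 a : H a -> 0 <= psi a.
Proof. by move=> Ha; exact/nrm_ge0/cobL. Qed.

Lemma psi1 : psi 1%g = 0.
Proof.
rewrite /psi cob1; exact: (sublinear0 L_lin nrm_sublinear).
Qed.

Lemma psiM a c : H a -> H c -> psi (a * c)%g <= psi a + psi c.
Proof.
move=> Ha Hc; rewrite /psi cobM -(nrm_tr Ha (cobL Hc)).
by apply: nrm_sublinear.1; [exact: cobL|by apply: trL => //; exact: cobL].
Qed.

Lemma psiV a : H a -> psi a^-1%g = psi a.
Proof.
move=> Ha; have Hai := HV Ha.
have : cob a + tr a (cob a^-1%g) = 0 by rewrite -cobM mulgV cob1.
move/eqP; rewrite addrC addr_eq0 => /eqP E.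
by rewrite /psi -(nrm_tr Ha (cobL Hai)) E nrmN.
Qed.

Lemma psiX a n : H a -> psi (a ^+ n)%g <= n%:R * psi a.
Proof.
move=> Ha; elim: n => [|n IH]; first by rewrite expg0 psi1 mul0r.
rewrite expgS (le_trans (psiM Ha (HX _ Ha))) //.
by rewrite mulrSr mulrDl mul1r addrC lerD2r.
Qed.

(** Stable length: by subadditivity the infimum is also the limit of [psi (v ^+ n) / n], which
    [stable_le] and [stable_bound] express. *)
Definition stable v := inf [set r | exists n, r = psi (v ^+ n.+1)%g / n.+1%:R].

Let stable_inf v : H v -> has_inf [set r | exists n, r = psi (v ^+ n.+1)%g / n.+1%:R].
Proof.
move=> Hv; split; first by exists (psi (v ^+ 1)%g / 1), 0%N.
exists 0 => _ [n ->]; rewrite divr_ge0 // psi_ge0 //; exact: HX.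
Qed.

Lemma stable_le v n : H v -> stable v * n%:R <= psi (v ^+ n)%g.
Proof.
move=> Hv; case: n => [|n]; first by rewrite mulr0 expg0 psi1.
by rewrite -ler_pdivlMr //; apply: ge_inf; [exact: (stable_inf Hv).2|exists n].
Qed.

Lemma stable_ge0 v : H v -> 0 <= stable v.
Proof.
move=> Hv; apply: lb_le_inf; first exact: (stable_inf Hv).1.
move=> _ [n ->]; rewrite divr_ge0 // psi_ge0 //; exact: HX.
Qed.

Lemma stable_adherent v e : H v -> 0 < e ->
  exists2 n, (0 < n)%N & psi (v ^+ n)%g <= (stable v + e) * n%:R.
Proof.
move=> Hv e0; have [_ [n ->] lt] := inf_adherent e0 (stable_inf Hv).
by exists n.+1 => //; rewrite -ler_pdivrMr // ltW.
Qed.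

Lemma stable_bound v e : H v -> 0 < e -> exists2 B : R, 0 <= B &
  forall n, psi (v ^+ n)%g <= (stable v + e) * n%:R + B.
Proof.
move=> Hv e0; have [m m0 Hm] := stable_adherent Hv e0.
exists (m%:R * psi v); first by rewrite mulr_ge0 // psi_ge0.
move=> n; rewrite {1}(divn_eq n m) expgnDr mulnC expgnA.
apply: (le_trans (psiM (HX _ (HX _ Hv)) (HX _ Hv))); apply: lerD; last first.
  apply: (le_trans (psiX _ Hv)); rewrite ler_wpM2r ?psi_ge0 // ler_nat ltnW //.
  by rewrite ltn_mod.
apply: (le_trans (psiX _ (HX _ Hv))).
apply: (@le_trans _ _ ((n %/ m)%:R * ((stable v + e) * m%:R))).
  by rewrite ler_wpM2l.
have Ae : 0 <= stable v + e by rewrite addr_ge0 ?stable_ge0 ?(ltW e0).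
rewrite mulrCA -natrM; apply: ler_wpM2l => //.
by rewrite ler_nat {2}(divn_eq n m) leq_addr.
Qed.

Definition dominated_invariant (N : set Gam) (phi : (Y -> R^o) -> R) : Prop :=
  [/\ linear_on L phi, forall F, L F -> phi F <= nrm F &
      forall a F, N a -> L F -> phi (tr a F) = phi F].

Lemma dominated_abs phi F : linear_on L phi ->
  (forall F, L F -> phi F <= nrm F) -> L F -> `|phi F| <= nrm F.
Proof.
move=> phi_lin phi_le LF; rewrite ler_norml phi_le // andbT lerNl.
by rewrite -linear_onN // -nrmN; apply: phi_le; exact: linear_spaceN.
Qed.

(** On powers of [q] the functional [phi] composed with [cob] is additive, so the value at [q] is
    that at [q ^+ n] divided by [n]. *)
Lemma invariant_le_stable N phi q : dominated_invariant N phi -> N q -> H q ->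
  `|phi (cob q)| <= stable q.
Proof.
move=> [phi_lin phi_le phi_inv] Nq Hq.
apply: lb_le_inf; first exact: (stable_inf Hq).1.
move=> _ [n ->]; rewrite ler_pdivlMr // mulrC.
rewrite -[X in X * _]ger0_norm // -normrM -(cobX_invariant phi_lin n.+1 phi_inv) //.
by apply: dominated_abs => //; apply: cobL; exact: HX.
Qed.

Hypothesis J_null : null_at_top.

(** Invariant Hahn-Banach for [N] with the traces of the [U k]. The bound on averages is asked for
    [cob v] only, because for its opposite the required lower bound is [- stable v], which is
    nonpositive. *)
Lemma dominated_invariant_exists (N : set Gam) v : subgroup_set N -> N `<=` H ->
  H v ->
  (forall l, l != [::] -> (forall h, h \in l -> N h) ->
     stable v <= nrm (avg l (cob v))) ->
  exists2 phi, dominated_invariant N phi & phi (cob v) = stable v.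
Proof.
move=> Nsub NH Hv Hl; have [U0 Usub Udecr Ucomm] := HU.
have NU : central_filtration N (fun k => N `&` U k).
  split=> [|j|j u [Nu /Udecr]|j h u Nh [Nu Uu]].
  - by rewrite U0; apply/seteqP; split=> [a []//|a Na]; split => //; exact: NH.
  - have [U1 UM UV] := Usub j; have [N1 NM NV] := Nsub.
    by split=> [//|a b [? ?] [? ?]|a [? ?]]; split; auto.
  - by [].
  - by split; [exact: subgroup_commg|apply: Ucomm => //; exact: NH].
have trN a F : N a -> L F -> L (tr a F) by move=> /NH; exact: trL.
have [a F /NH Ha LF|l l0 lN|z F [_ Uz] LF|phi [? ? ? ?]] := invariant_hahn_banach actM act1
  (s := s) L_lin NU trN (q := nrm) (c := stable v) (cobL Hv) nrm_sublinear.
- by rewrite nrm_tr.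
- split; first exact: Hl.
  rewrite avgN nrmN (@le_trans _ _ 0) ?oppr_le0 ?stable_ge0 //.
  apply: nrm_ge0; apply: linear_spaceZ => //; apply: linear_space_sum => // h hl.
  by apply: trN; [exact: lN|exact: cobL].
- by rewrite J_null.2.
- by exists phi.
Qed.

(** For [h] commuting with [v], translating [cob (v ^+ n)] by [h] changes it by
    [cob h - tr (v ^+ n) (cob h)], whose size does not depend on [n]. The average of [cob (v ^+ n)]
    is a sum of [n] translates of the average of [cob v], so dividing by [n] gives the
    inequality. *)
Lemma stable_le_avg_commute v l : H v -> l != [::] ->
  (forall h, h \in l -> H h /\ commute h v) -> stable v <= nrm (avg l (cob v)).
Proof.
move=> Hv l0 Hl; rewrite leNgt; apply/negP => lt.
set F := avg l (cob v) in lt.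
have LF : L F.
  apply: linear_spaceZ => //; apply: linear_space_sum => // h /Hl[Hh _].
  by apply: trL => //; exact: cobL.
have [subadd homog] := nrm_sublinear.
pose M := \sum_(h <- l) (psi h + psi h).
have M0 : 0 <= M by rewrite /M big_seq; apply: sumr_ge0 => h /Hl[Hh _]; rewrite addr_ge0 ?psi_ge0.
have key n : stable v * n%:R <= nrm F * n%:R + M.
  have E : avg l (cob (v ^+ n)%g) = \sum_(0 <= i < n) tr (v ^+ i)%g F.
    elim: n => [|n IH].
      rewrite big_geq // expg0 cob1 /avg big1 ?scaler0 //.
    rewrite big_nat_recr //= -IH expgSr cobM avgD; congr (_ + _).
    rewrite /F /avg trZ tr_sum; congr (_ *: _); apply: eq_big_seq => h /Hl[_ hv].
    by rewrite !trM // (commuteX _ hv).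
  have D : nrm (cob (v ^+ n)%g - avg l (cob (v ^+ n)%g)) <= M.
    rewrite -[X in X - _](mean_const _ l0) /avg -scalerBr -sumrB.
    apply: (sublinear_mean L_lin nrm_sublinear) => // h hl.
    have [Hh hv] := Hl _ hl; have Hvn : H (v ^+ n)%g by exact: HX.
    have Lh := cobL Hh; have Lth : L (tr (v ^+ n)%g (cob h)) by exact: trL.
    have -> : cob (v ^+ n)%g - tr h (cob (v ^+ n)%g) = cob h - tr (v ^+ n)%g (cob h).
      apply/eqP; rewrite subr_eq addrAC eq_sym subr_eq -!cobM.
      by rewrite (commuteX _ hv).
    split; first exact: linear_spaceB.
    apply: (le_trans (subadd _ _ Lh (linear_spaceN L_lin Lth))).
    rewrite nrmN nrm_tr // /M (big_rem h) //= lerDl.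
    by rewrite big_seq; apply: sumr_ge0 => k /mem_rem/Hl[Hk _]; rewrite addr_ge0 ?psi_ge0.
  apply: (le_trans (stable_le _ Hv)).
  have LE : L (avg l (cob (v ^+ n)%g)).
    apply: linear_spaceZ => //; apply: linear_space_sum => // h /Hl[Hh _].
    by apply: trL => //; apply: cobL; exact: HX.
  have Lvn : L (cob (v ^+ n)%g) by apply: cobL; exact: HX.
  rewrite /psi -[X in nrm X](subrK (avg l (cob (v ^+ n)%g))) addrC.
  apply: (le_trans (subadd _ _ LE (linear_spaceB L_lin Lvn LE))).
  apply: lerD => //; rewrite E.
  have LF' i : L (tr (v ^+ i)%g F) by apply: trL => //; exact: HX.
  apply: (le_trans (sublinear_sum L_lin nrm_sublinear _)) => // .
  rewrite (eq_bigr (fun=> nrm F)) => [|i _]; last by rewrite nrm_tr //; exact: HX.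
  by rewrite sumr_const_nat subn0 mulr_natr.
have d0 : 0 < stable v - nrm F by rewrite subr_gt0.
have := archi_boundP (x := M / (stable v - nrm F)).
rewrite divr_ge0 ?(ltW d0) // => /(_ isT).
set m := Num.bound _; rewrite ltr_pdivrMr // => Hm.
by have := key m; move: Hm; lra.
Qed.

(** The subgroup generated by [v] and [U i]: all of [H] for i = 0, and the powers of [v] up to null
    effects for i = [s]. *)
Let adjoin v i := gen [set a | [\/ a = v, a = v^-1%g | U i a]].

Let adjoin_sub v i : H v -> adjoin v i `<=` H.
Proof. by move=> Hv; apply: gen_sub => // a [->|->|/U_H//]; auto. Qed.

Let adjoin_subgroup v i : subgroup_set (adjoin v i).
Proof.
apply: gen_subgroup => a [->|->|Ua]; [exact: Or32|by rewrite invgK; exact: Or31|].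
by apply: Or33; have [_ /(_ i)[_ _ UV] _ _] := HU; exact: UV.
Qed.

Let adjoin_conj v i u a : H v -> U i u -> adjoin v i.+1 a ->
  adjoin v i.+1 (a ^ u)%g.
Proof.
move=> Hv Uu; have [_ Usub Udecr Ucomm] := HU.
have gv : adjoin v i.+1 v by apply: gen_in; exact: Or31.
have [_ NM NV] := adjoin_subgroup v i.+1.
have conj_comm b : H b -> adjoin v i.+1 b -> adjoin v i.+1 (b ^ u)%g.
  move=> Hb Nb; have -> : (b ^ u = b * [~ b, u])%g by rewrite commgEl mulVKg.
  by apply: NM => //; apply: gen_in; apply: Or33; exact: Ucomm.
elim=> [|b Sb|b c _ IHb _ IHc].
- by rewrite conj1g; exact: gen1.
- have Nb : adjoin v i.+1 b by exact: gen_in.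
  by apply: conj_comm => //; exact: adjoin_sub Nb.
- by rewrite conjMg; exact: NM.
Qed.

(** The functionals invariant under [adjoin v i.+1] with value [stable v] at [cob v] are permuted by
    the translations in [adjoin v i]. Hence [phi] has this value on every average of [cob v] over
    that group, which is the lower bound needed for averaging once more. *)
Let extend_step v i : H v -> (forall h, H h -> stable [~ h, v^-1]%g = 0) ->
  (exists2 phi, dominated_invariant (adjoin v i.+1) phi & phi (cob v) = stable v) ->
  exists2 phi, dominated_invariant (adjoin v i) phi & phi (cob v) = stable v.
Proof.
move=> Hv Hcomm [phi phi_dom phiv]; have [_ Usub Udecr Ucomm] := HU.
have N_H := @adjoin_sub v i Hv.
apply: dominated_invariant_exists => //.
pose good phi' := dominated_invariant (adjoin v i.+1) phi' /\ phi' (cob v) = stable v.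
have Lv := cobL Hv.
have good_tr h : adjoin v i h -> forall phi', good phi' -> good (fun F => phi' (tr h F)).
  elim=> [phi' gp|a Sa phi' [[plin ple pinv] pv]|a c _ IHa _ IHc phi' gp].
  - by have -> : (fun F => phi' (tr 1%g F)) = phi' by apply/funext => F; rewrite tr1.
  - have Ha : H a by case: Sa => [->|->|/U_H //]; auto.
    have conjE b : adjoin v i.+1 b -> adjoin v i.+1 (b ^ a^-1)%g.
      case: Sa => [->|->|Ua] Nb; last first.
      - by apply: adjoin_conj => //; have [_ _ UV] := Usub i; exact: UV.
      - have [_ NM NV] := adjoin_subgroup v i.+1; rewrite conjgE.
        by apply: (NM) => //; [|apply: (NM) => //]; rewrite ?invgK; do ?apply: (NV);
          apply: gen_in; exact: Or31.
      - have [_ NM NV] := adjoin_subgroup v i.+1; rewrite conjgE.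
        by apply: (NM) => //; [|apply: (NM) => //]; rewrite ?invgK; do ?apply: (NV);
          apply: gen_in; exact: Or31.
    split; [split|].
    + by move=> t F G LF LG; rewrite trZD plin //; exact: trL.
    + by move=> F LF; rewrite (le_trans (ple _ (trL Ha LF))) // nrm_tr.
    + move=> b F Nb LF; have Hb := adjoin_sub Hv Nb.
      rewrite trM // conjgCV -trM //; apply: pinv; first exact: conjE.
      exact: trL.
    + case: Sa => [av|av|Ua].
      * by rewrite pinv //; apply: gen_in; rewrite av; exact: Or31.
      * by rewrite pinv //; apply: gen_in; rewrite av; exact: Or32.
      (* Write a v = [a^-1, v^-1] v a. The functional is additive on these factors, and the
         commutator contributes 0 since its stable length vanishes; so translation by [a] does not
         change the value at [cob v]. *)
      have E : tr a (cob v) = cob (a * v)%g - cob a by rewrite cobM addrC addKr.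
      set q := [~ a^-1, v^-1]%g.
      have Uq : U i.+1 q.
        rewrite /q -invgR; have [_ _ UV] := Usub i.+1; apply: (UV).
        by apply: Ucomm; [exact: HV|have [_ _ UV'] := Usub i; exact: UV'].
      have Nq : adjoin v i.+1 q by apply: gen_in; exact: Or33.
      have Nv : adjoin v i.+1 v by apply: gen_in; exact: Or31.
      have Hq : H q by exact: adjoin_sub Nq.
      rewrite E linear_onB //; [|by apply: cobL; exact: HM|exact: cobL].
      rewrite commgCV -/q (cobM_invariant plin pinv) //; last exact: HM.
      rewrite (cobM_invariant plin pinv) // addrA addrK pv.
      have := invariant_le_stable (And3 plin ple pinv) Nq Hq.
      by rewrite Hcomm ?normr_le0 => [/eqP->|]; [rewrite add0r|exact: HV].
  - have -> : (fun F => phi' (tr (a * c)%g F)) = (fun F => (fun F => phi' (tr a F)) (tr c F)).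
      by apply/funext => F; rewrite trM.
    exact: (IHc _ (IHa _ gp)).
move=> l l0 lN; have gphi : good phi by [].
have LA : L (avg l (cob v)).
  apply: linear_spaceZ => //; apply: linear_space_sum => // h /lN/N_H Hh.
  exact: trL.
have [plin ple pinv] := phi_dom.
apply: le_trans (ple _ LA).
rewrite /avg linear_onZ // ?linear_on_sum //; last 1 first.
- by apply: linear_space_sum => // h /lN/N_H Hh; exact: trL.
- rewrite (eq_big_seq (fun=> stable v)) => [|h /lN /good_tr/(_ _ gphi)[_ //]].
  by rewrite [leRHS](mean_const (stable v : R^o) l0).
- by move=> h /lN/N_H Hh; exact: trL.
Qed.

Let extend_all v : H v -> (forall h, H h -> stable [~ h, v^-1]%g = 0) ->
  exists2 phi, dominated_invariant H phi & phi (cob v) = stable v.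
Proof.
move=> Hv Hcomm; have [U0 Usub Udecr Ucomm] := HU.
suff [phi [plin ple pinv] pv] : exists2 phi,
    dominated_invariant (adjoin v 0) phi & phi (cob v) = stable v.
  exists phi => //; split => // a F Ha; apply: pinv.
  by apply: gen_in; apply: Or33; rewrite U0.
(* At level [s] it is enough to average over powers of [v], which commute with [v]; invariance under
   [U s] comes from [null_at_top]. *)
have base : exists2 phi, dominated_invariant (adjoin v s) phi & phi (cob v) = stable v.
  pose S := [set a | a = v \/ a = v^-1%g].
  have SV a : S a -> S a^-1%g by move=> [->|->]; [right|left; rewrite invgK].
  have SH : gen S `<=` H by apply: gen_sub => // a [->|->] //; exact: HV.
  have [|||l l0 lN|phi [plin ple pinv] pv] := @dominated_invariant_exists (gen S) v.
  - exact: gen_subgroup.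
  - exact: SH.
  - exact: Hv.
  - apply: stable_le_avg_commute => // h /lN Nh; split; first exact: SH.
    elim: Nh => [|a [->|->]|a c _ IHa _ IHc].
    + exact/commute_sym/commute1.
    + exact: commute_refl.
    + exact/commute_sym/commuteV/commute_refl.
    + by apply: commute_sym; apply: commuteM; exact: commute_sym.
  exists phi => //; split => // a F Na; elim: Na F => [F LF|b Sb F LF|b c Nb IHb Nc IHc F LF].
  - by rewrite tr1.
  - case: Sb => [->|->|Ub]; [by apply: pinv => //; apply: gen_in; left|
      by apply: pinv => //; apply: gen_in; right|].
    have LbF : L (tr b F) by apply: trL => //; exact: U_H Ub.
    apply/eqP; rewrite -subr_eq0 -linear_onB // -normr_le0.
    rewrite (le_trans (dominated_abs _ _ _)) ?J_null.2 //.
    exact: linear_spaceB.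
  - have LcF : L (tr c F) by apply: trL => //; exact: adjoin_sub Nc.
    by rewrite -trM // IHb // IHc.
have step j : (j <= s)%N -> exists2 phi,
    dominated_invariant (adjoin v (s - j)) phi & phi (cob v) = stable v.
  elim: j => [|j IH js]; first by rewrite subn0.
  apply: extend_step => //.
  by rewrite (_ : (s - j.+1).+1 = (s - j)%N); [exact/IH/ltnW|lia].
by have := step s (leqnn s); rewrite subnn.
Qed.

(* The stable length of a commutator vanishes: by induction along the central
   series it is computed by an invariant functional, which restricts to a
   homomorphism on cocycle values. *)
Let extend_level j v : (j <= s)%N -> U (s - j)%N v ->
  exists2 phi, dominated_invariant H phi & phi (cob v) = stable v.
Proof.
have [U0 Usub Udecr Ucomm] := HU.
elim: j v => [|j IH] v js Uv; have Hv := U_H Uv.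
  move: Uv; rewrite subn0 => Uv; apply: extend_all => // h Hh.
  have Uq : U s [~ h, v^-1]%g.
    by apply/Udecr/Ucomm => //; have [_ _ UV] := Usub s; exact: UV.
  apply/eqP; rewrite eq_le stable_ge0 ?andbT; last exact: U_H Uq.
  by have := stable_le 1 (U_H Uq); rewrite mulr1 expg1 J_null.1.
apply: extend_all => // h Hh.
set q := [~ h, v^-1]%g.
have Uq : U (s - j)%N q.
  rewrite (_ : (s - j)%N = (s - j.+1).+1); last lia.
  by apply: Ucomm => //; have [_ _ UV] := Usub (s - j.+1)%N; exact: UV.
have [phi [plin ple pinv] <-] := IH q (ltnW js) Uq.
have Hq := U_H Uq; have Hvi := HV Hv.
have := cobM_invariant plin pinv Hh Hh Hvi.
rewrite commgC -/q (cobM_invariant plin pinv (HM Hvi Hh)) //; last exact: HM.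
rewrite (cobM_invariant plin pinv Hvi) // [X in X + _]addrC -[RHS]addr0.
by move/addrI.
Qed.

Lemma stable_attained v : H v ->
  exists2 phi, dominated_invariant H phi & phi (cob v) = stable v.
Proof.
move=> Hv; apply: (@extend_level s v) => //; rewrite subnn.
by have [-> _ _ _] := HU.
Qed.

End positive_functional.
(** On some power of [v] the functions [|cob|] and [sg *: cob] have nearly the same mass. One power
    for each [e] suffices, since the stable length is an infimum over powers. *)
Definition coherent (J : (Y -> R^o) -> R) v : Prop :=
  exists2 sg : R, sg = 1 \/ sg = -1 & forall e : R, 0 < e -> exists2 n, (0 < n)%N &
    J (absf (cob (v ^+ n)%g) - sg *: cob (v ^+ n)%g) <= e * n%:R.

Lemma coherent_stable J v : posinv J -> H v -> coherent J v -> stable J v <= `|J (cob v)|.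
Proof.
move=> J_pos Hv [sg sg1 Hc]; have [J_lin _ J_inv] := J_pos.
apply/ler_addgt0Pr => e e0; have [n n0 Hn] := Hc _ e0.
have n0R : 0 < n%:R :> R by rewrite ltr0n.
rewrite -(ler_pM2r n0R) (le_trans (stable_le J_pos n Hv)) //.
have Lc : L (cob (v ^+ n)%g) by apply: cobL; exact: HX.
move: Hn; rewrite (linear_onB J_lin) ?(linear_onZ J_lin) //; last 2 first.
- exact: absL.
- exact: linear_spaceZ.
rewrite lerBlDr /psi /nrm => /le_trans; apply.
rewrite mulrDl addrC lerD2r (cobX_invariant J_lin n J_inv) // mulrCA mulrC ler_pM2r //.
by case: sg1 => ->; rewrite ?mul1r ?ler_norm // mulN1r -normrN ler_norm.
Qed.

Lemma sign_part_ge0 (sg : R) (F : Y -> R^o) : sg = 1 \/ sg = -1 ->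
  forall y, 0 <= (absf F - sg *: F) y.
Proof.
move=> sg1 y; rewrite /absf !fctE subr_ge0.
by case: sg1 => ->; rewrite ?scale1r ?ler_norm // scaleN1r -normrN ler_norm.
Qed.

Lemma coherent_le J J' v : (forall F, L F -> (forall y, 0 <= F y) -> J' F <= J F) ->
  H v -> coherent J v -> coherent J' v.
Proof.
move=> JJ' Hv [sg sg1 Hc]; exists sg => // e e0; have [n n0 Hn] := Hc _ e0.
exists n => //; apply: le_trans Hn; apply: JJ'; last exact: sign_part_ge0.
have Lc : L (cob (v ^+ n)%g) by apply: cobL; exact: HX.
by apply: linear_spaceB => //; [exact: absL|exact: linear_spaceZ].
Qed.

Lemma null_at_top_le J J' : posinv J' ->
  (forall F, L F -> (forall y, 0 <= F y) -> J' F <= J F) ->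
  null_at_top J -> null_at_top J'.
Proof.
move=> J'_pos JJ' [N1 N2]; have le0 F : L F -> nrm J F = 0 -> nrm J' F = 0.
  move=> LF F0; apply/le_anti/andP; split; last exact: nrm_ge0.
  by rewrite -F0; apply: JJ' => [|y]; [exact: absL|exact: normr_ge0].
split=> [z Uz|z F Uz LF]; apply: le0.
- by apply: cobL; exact: U_H Uz.
- exact: N1.
- by apply: linear_spaceB => //; apply: trL => //; exact: U_H Uz.
- exact: N2.
Qed.

(* If [phi <= J] attains the stable length of [v], then [J - phi] is small on the
   positive part of the cocycle along [v], and [J + phi] on the negative part. *)
Lemma split_coherent J v : posinv J -> null_at_top J -> H v ->
  exists J1 J2, [/\ posinv J1, posinv J2, coherent J1 v, coherent J2 v &
    forall F, L F -> J F = J1 F + J2 F].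
Proof.
move=> J_pos J_null Hv; have [J_lin J_ge0 J_inv] := J_pos.
have [phi [phi_lin phi_le phi_inv] phiv] := stable_attained J_pos J_null Hv.
pose K (sg : R) F := (J F + sg * phi F) / 2.
have K_pos (sg : R) : sg = 1 \/ sg = -1 -> posinv (K sg).
  move=> sg1; split.
  - by move=> t F G LF LG; rewrite /K J_lin // phi_lin //; field.
  - move=> F LF F0; rewrite /K divr_ge0 //.
    have := dominated_abs phi_lin phi_le LF.
    have -> : nrm J F = J F by rewrite /nrm; congr J; apply/funext => y; exact: ger0_norm.
    by rewrite ler_norml => /andP[]; case: sg1 => ->; rewrite ?mul1r ?mulN1r; lra.
  - by move=> a F Ha LF; rewrite /K J_inv // phi_inv.
have K_coh (sg : R) : sg = 1 \/ sg = -1 -> coherent (K sg) v.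
  move=> sg1; exists sg => // e e0; have [n n0 Hn] := stable_adherent J_pos Hv e0.
  exists n => //; set b := cob (v ^+ n)%g; have Lb : L b by apply: cobL; exact: HX.
  have Lab := absL Lb.
  have phib := cobX_invariant phi_lin n phi_inv Hv Hv; rewrite -/b phiv in phib.
  move: Hn; rewrite /psi /nrm -/b; clearbody b => Hn.
  have Lp : L (sg *: absf b + b) by apply: linear_spaceD => //; exact: linear_spaceZ.
  have LZ G : L G -> L (sg *: G) by move=> LG; exact: linear_spaceZ.
  have := phi_le _ Lp.
  have -> : nrm J (sg *: absf b + b) = J (absf b + sg *: b).
    rewrite /nrm; congr J; apply/funext => y; rewrite /absf !fctE.
    have := ler_norm (b y : R); have := ler_norm (- (b y : R)); rewrite normrN => h1 h2.
    case: sg1 => ->; rewrite ?scale1r ?scaleN1r; first by rewrite ger0_norm //; lra.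
    by rewrite ler0_norm ?opprD ?opprK //; lra.
  rewrite phi_lin // (linear_onD J_lin) ?(linear_onZ J_lin) //; last exact: LZ.
  rewrite /K !(linear_onB J_lin, linear_onB phi_lin) ?(linear_onZ J_lin) ?(linear_onZ phi_lin) //;
    do ?[exact: LZ | exact: absL].
  rewrite phib; by case: sg1 => ->; lra.
have l1 : 1 = 1 :> R \/ 1 = -1 :> R by left.
have l2 : -1 = 1 :> R \/ -1 = -1 :> R by right.
exists (K 1), (K (-1)); split; [exact: K_pos|exact: K_pos|exact: K_coh|exact: K_coh|].
by move=> F LF; rewrite /K; field.
Qed.

(** A property that is additive in [J] may be checked for functionals coherent along all of [vs].
    Splitting along a further direction keeps the coherence already obtained, because both parts are
    positive and below [J] ([coherent_le]). *)
Lemma coherent_ind (vs : seq Gam) (P : ((Y -> R^o) -> R) -> Prop) :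
  (forall v, v \in vs -> H v) ->
  (forall J J1 J2, posinv J1 -> posinv J2 -> (forall F, L F -> J F = J1 F + J2 F) ->
     P J1 -> P J2 -> P J) ->
  (forall J, posinv J -> null_at_top J -> (forall v, v \in vs -> coherent J v) -> P J) ->
  forall J, posinv J -> null_at_top J -> P J.
Proof.
move=> vsH PD; elim: vs vsH => [|v vs IH] vsH Pcoh J J_pos J_null; first exact: Pcoh.
apply: IH => //; first by move=> w wvs; apply: vsH; rewrite inE wvs orbT.
move=> {J_pos J_null} {}J J_pos J_null Jcoh; have Hv : H v by apply: vsH; rewrite mem_head.
have [J1 [J2 [J1_pos J2_pos c1 c2 E]]] := split_coherent J_pos J_null Hv.
have le1 F : L F -> (forall y, 0 <= F y) -> J1 F <= J F.
  by move=> LF F0; rewrite E // lerDl; have [_ + _] := J2_pos; apply.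
have le2 F : L F -> (forall y, 0 <= F y) -> J2 F <= J F.
  by move=> LF F0; rewrite E // lerDr; have [_ + _] := J1_pos; apply.
apply: (PD _ _ _ J1_pos J2_pos E); apply: Pcoh => //; try exact: null_at_top_le J_null.
- move=> w; rewrite inE => /predU1P[->//|wvs].
  by apply: coherent_le le1 _ (Jcoh _ wvs); apply: vsH; rewrite inE wvs orbT.
- move=> w; rewrite inE => /predU1P[->//|wvs].
  by apply: coherent_le le2 _ (Jcoh _ wvs); apply: vsH; rewrite inE wvs orbT.
Qed.

(** * Sublinear length of iterated commutators of the maximal weight *)

Section vanishing.
Context (J : (Y -> R^o) -> R).
Hypothesis J_pos : posinv J.
Hypothesis J_null : null_at_top J.
Let Js := psi_ge0 J_pos.

Lemma psi_eqmod a b : H a -> eqmod U s a b -> psi J b <= psi J a.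
Proof.
move=> Ha ab; have -> : b = (a * (a^-1 * b))%g by rewrite mulVKg.
by rewrite (le_trans (psiM J_pos Ha (U_H ab))) // (J_null.1 _ ab) addr0.
Qed.

(** The length of [u, q] is at most twice that of [u] plus twice that of [q], whence a factor 4 for
    each letter. *)
Lemma psi_icomm t D : 0 <= D -> (forall u, u \in t -> H u /\ psi J u <= D) ->
  psi J (icomm t) <= 4 ^+ size t * D.
Proof.
move=> D0; elim: t => [|u t IH] Ht; first by rewrite psi1 // mul1r.
have [Hu uD] := Ht u (mem_head _ _).
have Ht' v : v \in t -> H v /\ psi J v <= D by move=> vt; apply: Ht; rewrite inE vt orbT.
have tH : H (icomm t) by apply: (icomm_H HU) => v /Ht'[].
case: t IH {Ht} Ht' tH => [|w t] IH Ht tH; first by rewrite /icomm /= expr1; lra.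
rewrite icomm_cons // commgEl conjgE; set q := icomm _ in IH tH *.
apply: (le_trans (psiM J_pos (HV Hu) (HM (HV tH) (HM Hu tH)))).
apply: (le_trans (lerD (lexx _) (psiM J_pos (HV tH) (HM Hu tH)))).
apply: (le_trans (lerD (lexx _) (lerD (lexx _) (psiM J_pos Hu tH)))).
rewrite !psiV // [size _]/= exprS -mulrA; have := IH Ht; rewrite [size _]/=.
have : D <= 4 ^+ (size t).+1 * D by rewrite ler_peMl // exprn_ege1 // ler1n.
lra.
Qed.

(** Every letter that is a power of a product is replaced by two letters of [A], which at most
    doubles the bound. The list [l1] holds the letters already treated. The errors lie in [U s],
    since the commutators have [s] letters. *)
Lemma psi_icomm_expand (A W : set Gam) (M : R) l1 l2 : A `<=` H ->
  (forall w, W w -> A w \/ exists a b n,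
     [/\ w = ((a * b) ^+ n)%g, H a, H b, A (a ^+ n)%g & A (b ^+ n)%g]) ->
  (forall t, size t = s -> (forall u, u \in t -> A u) -> psi J (icomm t) <= M) ->
  size (l1 ++ l2) = s -> (forall u, u \in l1 -> A u) -> (forall u, u \in l2 -> W u) ->
  psi J (icomm (l1 ++ l2)) <= 2 ^+ size l2 * M.
Proof.
move=> AH Wsplit HA; have WH w : W w -> H w.
  by move=> /Wsplit[/AH//|[a [b [n [-> Ha Hb _ _]]]]]; apply: HX; exact: HM.
elim: l2 l1 => [|w l2 IH] l1 szl l1A l2W.
  by rewrite cats0 mul1r; apply: HA => //; rewrite -szl cats0.
have l2W' u : u \in l2 -> W u by move=> ul; apply: l2W; rewrite inE ul orbT.
have step a : A a -> psi J (icomm (l1 ++ a :: l2)) <= 2 ^+ size l2 * M.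
  move=> Aa; rewrite -cat_rcons; apply: IH => //.
    by rewrite cat_rcons -szl !size_cat.
  by move=> u; rewrite mem_rcons inE => /predU1P[->|/l1A].
have l1H u : u \in l1 -> H u by move=> /l1A/AH.
have l2H u : u \in l2 -> H u by move=> /l2W'/WH.
have hole a : A a -> H (icomm (l1 ++ a :: l2)).
  move=> /AH Aa; apply: (icomm_H HU) => u.
  by rewrite mem_cat inE => /or3P[/l1H|/eqP->|/l2H].
rewrite [size _]/= exprS -mulrA mulr_natl mulr2n.
have M0 : 0 <= 2 ^+ size l2 * M.
  have [Aw|[a [b [n [_ _ _ Aa _]]]]] := Wsplit w (l2W _ (mem_head _ _)).
    exact: le_trans (Js (hole _ Aw)) (step _ Aw).
  exact: le_trans (Js (hole _ Aa)) (step _ Aa).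
have [Aw|[a [b [n [-> Ha Hb Aa Ab]]]]] := Wsplit w (l2W _ (mem_head _ _)).
  by rewrite (le_trans (step _ Aw)) // lerDl.
have := eqmod_icommXM HU l1H l2H n Ha Hb.
have -> : size (l1 ++ a :: l2) = s by rewrite -szl !size_cat.
move=> /(eqmod_sym HU)/psi_eqmod E.
apply: (le_trans (E (HM (hole _ Aa) (hole _ Ab)))).
by rewrite (le_trans (psiM J_pos (hole _ Aa) (hole _ Ab))) // lerD // step.
Qed.

(** Each letter [g ^+ p] is replaced by [g] at the price of a factor [p] in the exponent outside the
    commutator. An occurrence of [sg] is kept in the list, to receive that exponent later. *)
Lemma icomm_collect (C : set Gam) (sg : Gam) p l1 l2 : C `<=` H -> H sg ->
  size (l1 ++ l2) = s -> (forall u, u \in l1 -> u = sg \/ C u) ->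
  (forall u, u \in l2 -> u = sg \/ exists2 g, C g & u = (g ^+ p)%g) ->
  sg \in l1 ++ l2 ->
  exists k t, [/\ (k <= size l2)%N, size t = s, forall u, u \in t -> u = sg \/ C u,
    sg \in t & eqmod U s (icomm (l1 ++ l2)) (icomm t ^+ (p ^ k))%g].
Proof.
move=> CH Hsg; elim: l2 l1 => [|w l2 IH] l1 szl l1C l2C.
  rewrite cats0 => sgl; exists 0%N, l1; split=> //; first by rewrite -szl cats0.
  by rewrite expn0 expg1; exact: (eqmod_refl HU).
have l2C' u : u \in l2 -> u = sg \/ exists2 g, C g & u = (g ^+ p)%g.
  by move=> ul; apply: l2C; rewrite inE ul orbT.
have rc u c : (c = sg \/ C c) -> u \in rcons l1 c -> u = sg \/ C u.
  by move=> Cc; rewrite mem_rcons inE => /predU1P[->|/l1C].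
have szl' c : size (rcons l1 c ++ l2) = s by rewrite cat_rcons -szl !size_cat.
have [wsg|wsg] := eqVneq w sg.
  rewrite -cat_rcons => sgl.
  have [|k [t [kl szt tC sgt E]]] := IH (rcons l1 w) (szl' _) _ l2C' sgl.
    by move=> u; apply: rc; left.
  by exists k, t; split => //; rewrite ltnW.
move=> sgl; have [/eqP|[g Cg wg]] := l2C w (mem_head _ _); first by rewrite (negPf wsg).
have sgl' : sg \in rcons l1 g ++ l2.
  move: sgl; rewrite cat_rcons !mem_cat !inE eq_sym (negPf wsg) /=.
  by move=> /orP[->//|->]; rewrite !orbT.
have [|k [t [kl szt tC sgt E]]] := IH (rcons l1 g) (szl' _) _ l2C' sgl'.
  by move=> u; apply: rc; right.
exists k.+1, t; split => //.
have l1H u : u \in l1 -> H u by move=> /l1C[->//|/CH].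
have l2H u : u \in l2 -> H u by move=> /l2C'[->//|[h /CH Hh ->]]; exact: HX.
have := eqmod_icommX HU l1H l2H p (CH _ Cg); rewrite -wg.
have -> : size (l1 ++ g :: l2) = s by rewrite -szl !size_cat.
rewrite cat_rcons in E.
move=> /(eqmod_trans HU); apply; rewrite expnSr expgnA.
apply: (eqmodX HU) => //; apply: (icomm_H HU) => u.
by rewrite mem_cat inE => /or3P[/l1H|/eqP->|/l2H] //; exact: CH.
Qed.

(** This is the gain over [psi_icomm]: the letters [g ^+ p] may be long, but the bound involves only
    the lengths of the [g] and of moderate powers of [sg]. Without [sg] all letters commute and the
    commutator is trivial; otherwise all exponents are gathered on one occurrence of [sg]. *)
Lemma psi_icomm_collect (C : set Gam) (sg : Gam) p t D : (1 < s)%N -> (0 < p)%N ->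
  C `<=` H -> (forall g h, C g -> C h -> commute g h) -> H sg -> 0 <= D ->
  (forall g, C g -> psi J g <= D) ->
  (forall n, (0 < n <= p ^ s)%N -> psi J (sg ^+ n)%g <= D) ->
  size t = s -> (forall u, u \in t -> u = sg \/ exists2 g, C g & u = (g ^+ p)%g) ->
  psi J (icomm t) <= 4 ^+ s * D.
Proof.
move=> s1 p0 CH Ccomm Hsg D0 CD sgD szt tC.
have R0 : 0 <= 4 ^+ s * D by rewrite mulr_ge0 // exprn_ge0.
have tH u : u \in t -> H u by move=> /tC[->//|[h /CH Hh ->]]; exact: HX.
case: (boolP (sg \in t)) => sgt; last first.
  rewrite icomm_commute ?szt ?psi1 // => u v ut vt.
  have [E|[g Cg ->]] := tC _ ut; first by rewrite -E ut in sgt.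
  have [E|[h Ch ->]] := tC _ vt; first by rewrite -E vt in sgt.
  by apply: commuteX2; exact: Ccomm.
have [//|k [t' [kl szt' t'C sgt' E]]] := @icomm_collect C sg p [::] t CH Hsg szt _ tC sgt.
have t'H u : u \in t' -> H u by move=> /t'C[->//|/CH].
have Ht' : H (icomm t' ^+ (p ^ k))%g by apply: HX; exact: (icomm_H HU).
apply: (le_trans (psi_eqmod Ht' (eqmod_sym HU E))).
move: szt' t'C t'H Ht'; case/splitPr: sgt' => l1 l2 szt' t'C t'H Ht'.
have l1H u : u \in l1 -> H u by move=> ul; apply: t'H; rewrite mem_cat ul.
have l2H u : u \in l2 -> H u by move=> ul; apply: t'H; rewrite mem_cat inE ul !orbT.
have := eqmod_icommX HU l1H l2H (p ^ k) Hsg; rewrite szt' => /psi_eqmod E'.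
have {}E' := E' (icomm_H HU _).
have lH u : u \in l1 ++ (sg ^+ (p ^ k))%g :: l2 -> H u /\ psi J u <= D.
  have n0 : (0 < p ^ k <= p ^ s)%N.
    by rewrite expn_gt0 p0 /= leq_pexp2l // -szt.
  rewrite mem_cat inE => /or3P[ul|/eqP->|ul].
  - split; first exact: l1H.
    have [->|/CD//] : u = sg \/ C u by apply: t'C; rewrite mem_cat ul.
    by have := sgD 1%N; rewrite expg1; apply; rewrite expn_gt0 p0.
  - by split; [exact: HX|exact: sgD].
  - split; first exact: l2H.
    have [->|/CD//] : u = sg \/ C u by apply: t'C; rewrite mem_cat inE ul !orbT.
    by have := sgD 1%N; rewrite expg1; apply; rewrite expn_gt0 p0.
apply: le_trans (E' _) _; first by move=> u /lH[].
have := psi_icomm D0 lH.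
by rewrite (_ : size _ = s) // -szt' !size_cat.
Qed.

End vanishing.
Definition word x y (l : seq bool) N : Gam :=
  icomm [seq ((if b then x else y) ^+ N)%g | b <- l].

Lemma word_swap x y l N : word y x (map negb l) N = word x y l N.
Proof.
by rewrite /word -map_comp; congr (icomm _); apply: eq_map => -[].
Qed.

Lemma invariantV J a : posinv J -> H a -> J (cob a^-1%g) = - J (cob a).
Proof.
move=> [J_lin _ J_inv] Ha; apply/eqP; rewrite -addr_eq0.
by rewrite -(cobM_invariant J_lin J_inv) ?mulVg ?cob1 ?(linear_on0 J_lin) //; exact: HV.
Qed.

(** Rounding: [J] composed with [cob] is a homomorphism to the reals, and [c] is the integer part of
    the ratio of the absolute values at [y ^+ Q] and at [x]. The remainder is below the value at
    [x], whatever [Q] is. If the value at [x] is 0, so is that at [y], and c = 0 works. *)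
Lemma small_direction J x y Q : posinv J -> H x -> H y ->
  `|J (cob y)| <= `|J (cob x)| -> exists c a, [/\ (c <= Q)%N,
    a = (x ^+ c)%g \/ a = (x ^+ c)^-1%g & `|J (cob (a^-1 * y ^+ Q)%g)| <= `|J (cob x)|].
Proof.
move=> J_pos Hx Hy; have [J_lin _ J_inv] := J_pos.
have E a : H a -> J (cob (a^-1 * y ^+ Q)%g) = Q%:R * J (cob y) - J (cob a).
  move=> Ha; have Hai := HV Ha; have HyQ := HX Q Hy.
  rewrite (cobM_invariant J_lin J_inv) // invariantV // addrC.
  by rewrite (cobX_invariant J_lin Q J_inv).
have E1 c : J (cob (x ^+ c)%g) = c%:R * J (cob x) by rewrite (cobX_invariant J_lin c J_inv).
have Hxc c := HX c Hx; have Hxci c := HV (Hxc c).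
move=> ba; have [a0|a0] := eqVneq (J (cob x)) 0.
  exists 0%N, (x ^+ 0)%g; split; [by []|by left|].
  by move: ba; rewrite E // E1 a0 mulr0 subr0 normr0 normr_le0 => /eqP ->; rewrite mulr0 normr0.
set al := J (cob x) in E1 ba a0 *; set be := J (cob y) in E ba *.
have a_gt0 : 0 < `|al| by rewrite normr_gt0.
have r0 : 0 <= Q%:R * `|be| / `|al| by rewrite divr_ge0 // mulr_ge0.
pose c := Num.truncn (Q%:R * `|be| / `|al|).
have := truncn_itv r0; rewrite -/c ler_pdivlMr // ltr_pdivrMr // => /andP[c1 c2].
have cQ : (c <= Q)%N.
  rewrite -(ler_nat R) -(ler_pM2r a_gt0) (le_trans c1) //.
  by rewrite ler_wpM2l.
move: c2; rewrite -natr1 mulrDl mul1r => c2; exists c.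
have [al0|al0] := leP 0 al; have [be0|be0] := leP 0 be;
  rewrite ?(ger0_norm al0) ?(ltr0_norm al0) ?(ger0_norm be0) ?(ltr0_norm be0) in c1 c2 *.
- by exists (x ^+ c)%g; split=> //; [left|rewrite E // E1 ler_norml; lra].
- exists (x ^+ c)^-1%g; split=> //; first by right.
  by rewrite E // invariantV // E1 ler_norml; lra.
- exists (x ^+ c)^-1%g; split=> //; first by right.
  by rewrite E // invariantV // E1 ler_norml; lra.
- by exists (x ^+ c)%g; split=> //; [left|rewrite E // E1 ler_norml; lra].
Qed.

(** Factorials are used as exponents because they are eventually divisible by any given integer. *)
Lemma fact_large (m0 : nat) (B e : R) : 0 < e -> exists i0, forall i, (i0 <= i)%N ->
  (m0 <= i)%N /\ B <= e * i`!%:R.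
Proof.
move=> e0; exists (maxn m0 (Num.bound (B / e))) => i; rewrite geq_max => /andP[-> ib].
split=> //; have [B0|B0] := leP B 0; first by rewrite (le_trans B0) // mulr_ge0 // ltW.
rewrite mulrC -ler_pdivrMr //.
apply: (le_trans (ltW (archi_boundP _))); first by rewrite divr_ge0 ?ltW.
by rewrite ler_nat (leq_trans ib) // fact_geq.
Qed.

(** With b = a^-1 y^Q one has y^Q = a b, where [a] is a power of [x] or its inverse. Coherence gives
    stable b <= |J (cob b)| <= |J (cob x)| <= psi x, although [b] contains a [Q]-th power. For N =
    n' Q p and n = n' p, x^N is a [p]-th power and y^N = (a b)^n splits into a^n, again a [p]-th
    power commuting with it, and the short element b^n. The factor 8^s is 2^s from the expansion
    times 4^s from the commutators. *)
Lemma psi_word_coherent J x y p Q e : (1 < s)%N -> (0 < p)%N -> (0 < Q)%N ->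
  posinv J -> null_at_top J -> H x -> H y -> `|J (cob y)| <= `|J (cob x)| ->
  (forall c a, (c <= Q)%N -> a = (x ^+ c)%g \/ a = (x ^+ c)^-1%g ->
     coherent J (a^-1 * y ^+ Q)%g) ->
  0 < e -> exists i0, forall i, (i0 <= i)%N -> forall l, size l = s ->
    psi J (word x y l i`!) <= 8 ^+ s *
      ((psi J x * (p%:R^-1 + p%:R ^+ s / Q%:R) + e) * i`!%:R).
Proof.
move=> s1 p0 Q0 J_pos J_null Hx Hy yx Hcoh e0.
have [c [a [cQ ac small]]] := small_direction Q J_pos Hx Hy yx.
have {}Hcoh := Hcoh c a cQ ac.
have Ha : H a by case: ac => ->; [exact: HX|exact/HV/HX].
have psia : psi J a <= c%:R * psi J x.
  by case: ac => ->; rewrite ?psiV //; [exact: psiX|exact: psiX|exact: HX].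
set b := (a^-1 * y ^+ Q)%g in Hcoh small.
have Hb : H b by apply: HM; [exact: HV|exact: HX].
have yQ : (y ^+ Q = a * b)%g by rewrite mulVKg.
have pR : 0 < p%:R :> R by rewrite ltr0n.
have QR : 0 < Q%:R :> R by rewrite ltr0n.
have ps0 : 0 < p%:R ^+ s :> R by rewrite exprn_gt0.
pose e1 := e / (2 * p%:R ^+ s).
have e10 : 0 < e1 by rewrite divr_gt0 // mulr_gt0.
have [B B0 HB] := stable_bound J_pos Hb e10.
have bx : stable J b <= psi J x.
  apply: (le_trans (coherent_stable J_pos Hb Hcoh)); apply: (le_trans small).
  by apply: abs_le_nrm => //; exact: cobL.
have e20 : 0 < e / 2 by rewrite divr_gt0.
have [i0 Hi0] := fact_large (Q * p) B e20.
exists i0 => i /Hi0[iQp BN] l szl.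
have /dvdnP[n' Nn'] : (Q * p %| i`!)%N by rewrite dvdn_fact // muln_gt0 Q0 p0.
pose n := (n' * p)%N.
have Nn : i`! = (Q * n)%N by rewrite Nn' /n; lia.
have N1 : i`! = (n' * Q * p)%N by rewrite Nn'; lia.
pose g1 := (x ^+ (n' * Q))%g; pose g2 := (a ^+ n')%g; pose sg := (b ^+ n)%g.
pose C g := g = g1 \/ g = g2.
pose A u := u = sg \/ exists2 g, C g & u = (g ^+ p)%g.
pose W w := A w \/ w = ((a * b) ^+ n)%g.
have CH : C `<=` H by move=> g [->|->]; exact: HX.
have AH : A `<=` H by move=> u [->|[g /CH Hg ->]]; exact: HX.
have cxa : commute x a.
  by case: ac => ->; [exact/commuteX/commute_refl|exact/commuteV/commuteX/commute_refl].
have Ccomm g h : C g -> C h -> commute g h.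
  have cax := commute_sym cxa.
  by move=> [->|->] [->|->]; apply: commuteX2; rewrite ?commute_refl.
have psx0 := psi_ge0 J_pos Hx.
have st0 := stable_ge0 J_pos Hb.
(* The first term bounds the lengths of [g1] and [g2]; the other two bound the powers [sg ^+ k] with
   k at most p^s, by [stable_bound] applied to [b ^+ (n * k)]. *)
pose D := (n' * Q)%:R * psi J x + (psi J x + e1) * (n%:R * p%:R ^+ s) + B.
have t10 : 0 <= (n' * Q)%:R * psi J x by rewrite mulr_ge0.
have t20 : 0 <= (psi J x + e1) * (n%:R * p%:R ^+ s).
  by rewrite !mulr_ge0 ?addr_ge0 ?(ltW e10) ?(ltW ps0).
have D0 : 0 <= D by rewrite /D !addr_ge0.
have D1 : (n' * Q)%:R * psi J x <= D by rewrite /D -addrA lerDl addr_ge0.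
have CD g : C g -> psi J g <= D.
  move=> [->|->]; apply: le_trans D1; first exact: psiX.
  apply: (le_trans (psiX J_pos _ Ha)); rewrite natrM -mulrA; apply: ler_wpM2l => //.
  by apply: (le_trans psia); apply: ler_wpM2r => //; rewrite ler_nat.
have sgD k : (0 < k <= p ^ s)%N -> psi J (sg ^+ k)%g <= D.
  move=> /andP[_ kp]; rewrite /sg -expgnA; apply: (le_trans (HB _)).
  rewrite /D lerD2r -[leLHS]add0r; apply: lerD => //.
  apply: ler_pM => //; [by rewrite addr_ge0 // ltW|by rewrite lerD2r|].
  by rewrite natrM ler_wpM2l // -natrX ler_nat.
have HM' t : size t = s -> (forall u, u \in t -> A u) -> psi J (icomm t) <= 4 ^+ s * D.
  move=> szt tA; apply: (psi_icomm_collect J_pos J_null s1 p0 CH Ccomm) sgD szt tA => //.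
  exact: HX.
have Wsplit w : W w -> A w \/ exists a b n,
    [/\ w = ((a * b) ^+ n)%g, H a, H b, A (a ^+ n)%g & A (b ^+ n)%g].
  move=> [Aw|->]; [by left|right; exists a, b, n; split=> //; last by left].
  by right; exists g2; [right|rewrite /g2 -expgnA].
have lW u : u \in [seq ((if b then x else y) ^+ i`!)%g | b <- l] -> W u.
  move=> /mapP[[] _ ->]; last by right; rewrite -yQ -expgnA -Nn.
  by left; right; exists g1; [left|rewrite /g1 -expgnA -N1].
have := @psi_icomm_expand J J_pos J_null A W _ [::] _ AH Wsplit HM' _ _ lW.
rewrite /= size_map szl => /(_ erefl) H8.
apply: (le_trans (H8 _)) => //.
have -> : (8 : R) = 2 * 4 by rewrite -natrM.
rewrite exprMn -!mulrA; do 2 (apply: ler_wpM2l; first by rewrite exprn_ge0).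
have NR : i`!%:R = Q%:R * n%:R :> R by rewrite Nn natrM.
have e1p : e1 * p%:R ^+ s = e / 2 by rewrite /e1; field; rewrite gt_eqF.
have n'Q : (n' * Q)%:R = i`!%:R / p%:R :> R.
  by rewrite N1 !natrM mulfK // gt_eqF.
rewrite /D n'Q.
have p_neq0 : p%:R != 0 :> R by rewrite gt_eqF.
have Q_neq0 : Q%:R != 0 :> R by rewrite gt_eqF.
have -> : (psi J x + e1) * (n%:R * p%:R ^+ s) =
   psi J x * (p%:R ^+ s / Q%:R) * i`!%:R + (e / 2) * n%:R.
  by rewrite -e1p NR; field.
have nN : e / 2 * n%:R <= e / 2 * i`!%:R.
  by rewrite ler_pM2l // ler_nat Nn leq_pmull.
have -> : (psi J x * (p%:R^-1 + p%:R ^+ s / Q%:R) + e) * i`!%:R =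
  i`!%:R / p%:R * psi J x + psi J x * (p%:R ^+ s / Q%:R) * i`!%:R + e * i`!%:R.
  by field; rewrite Q_neq0.
by lra.
Qed.
(** First [p] makes 1/p small, then [Q] makes p^s/Q small, both relative to [psi J x + psi J y]. The
    property [P] is stated with this sum, which is additive in [J], so the bounds for the coherent
    pieces add up without loss in the number of pieces. *)
Lemma psi_word_small J x y (e : R) : (1 < s)%N -> posinv J -> null_at_top J -> H x -> H y ->
  0 < e -> exists i0, forall i, (i0 <= i)%N -> forall l, size l = s ->
    psi J (word x y l i`!) <= e * i`!%:R.
Proof.
move=> s1 J_pos J_null Hx Hy e0; pose K : R := 8 ^+ s.
have K0 : 0 < K by rewrite exprn_gt0.
have psi0 J' : posinv J' -> 0 <= psi J' x + psi J' y.
  by move=> J'_pos; rewrite addr_ge0 // psi_ge0.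
have C0 := psi0 _ J_pos; set C := psi J x + psi J y in C0.
have small (A : R) : 0 <= A -> exists2 p, (0 < p)%N & A / p%:R <= e / 3.
  move=> A0; exists (Num.bound (A / (e / 3))).+1 => //.
  rewrite ler_pdivrMr // mulrC -ler_pdivrMr ?divr_gt0 //.
  have A1 : 0 <= A / (e / 3) by rewrite divr_ge0 // divr_ge0 // ltW.
  by apply: (le_trans (ltW (archi_boundP A1))); rewrite ler_nat.
have [p p0 Hp] := small (K * C) (mulr_ge0 (ltW K0) C0).
have [|Q Q0 HQ] := small (K * C * p%:R ^+ s).
  by rewrite mulr_ge0 ?exprn_ge0 // mulr_ge0 // ltW.
(* All directions that [small_direction] may return. Which one occurs depends on the piece of [J],
   so the splitting is made along all of them, and with both orders of [x] and [y]. *)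
pose dirs (u v : Gam) : seq Gam := [seq (a^-1 * v ^+ Q)%g | a <- [seq (u ^+ c)%g | c <- iota 0 Q.+1] ++
   [seq (u ^+ c)^-1%g | c <- iota 0 Q.+1]].
have dirs_in u v c a : (c <= Q)%N -> a = (u ^+ c)%g \/ a = (u ^+ c)^-1%g ->
    (a^-1 * v ^+ Q)%g \in dirs u v.
  move=> cQ ac; apply/mapP; exists a => //; rewrite mem_cat; apply/orP.
  by case: ac => ->; [left|right]; apply/mapP; exists c => //; rewrite mem_iota.
have dirsH u v : H u -> H v -> forall w, w \in dirs u v -> H w.
  move=> Hu Hv w /mapP[a]; rewrite mem_cat => /orP aP ->.
  by apply: HM; [apply: HV; case: aP => /mapP[c _ ->]; [exact: HX|exact/HV/HX]|exact: HX].
pose rate : R := p%:R^-1 + p%:R ^+ s / Q%:R.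
have rate0 : 0 <= rate by rewrite addr_ge0 ?divr_ge0 ?invr_ge0 ?exprn_ge0.
pose P J' := forall e' : R, 0 < e' -> exists i0, forall i, (i0 <= i)%N -> forall l, size l = s ->
    psi J' (word x y l i`!) <= (K * (psi J' x + psi J' y) * rate + e') * i`!%:R.
have wordH l i : H (word x y l i).
  by apply: (icomm_H HU) => _ /mapP[[] _ ->]; exact: HX.
suff : P J.
  have e30 : 0 < e / 3 by rewrite divr_gt0.
  move=> /(_ _ e30)[i0 Hi0]; exists i0 => i /Hi0 Hi l /Hi /le_trans; apply.
  rewrite ler_wpM2r // /rate mulrDr mulrA.
  by move: Hp HQ; rewrite -/C; lra.
apply: (coherent_ind (vs := dirs x y ++ dirs y x)) J_pos J_null => //.
- by move=> v; rewrite mem_cat => /orP[]; exact: dirsH.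
- move=> J' J1 J2 J1_pos J2_pos E P1 P2 e' e'0.
  have e20 : 0 < e' / 2 by rewrite divr_gt0.
  have [[i1 H1'] [i2 H2']] := (P1 _ e20, P2 _ e20).
  exists (maxn i1 i2) => i; rewrite geq_max => /andP[/H1' h1 /H2' h2] l szl.
  have psiE a : H a -> psi J' a = psi J1 a + psi J2 a.
    by move=> Ha; rewrite /psi /nrm E //; apply: absL; exact: cobL.
  rewrite !psiE //; have := h1 l szl; have := h2 l szl.
  set X := _%:R; move=> h h'.
  by apply: (le_trans (lerD h' h)); rewrite le_eqVlt; apply/orP; left; apply/eqP; field.
- move=> J' J'_pos J'_null Jcoh e' e'0.
  have e80 : 0 < e' / K by rewrite divr_gt0.
  have px0 := psi_ge0 J'_pos Hx; have py0 := psi_ge0 J'_pos Hy.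
  have fin z i l : H z -> psi J' z <= psi J' x + psi J' y ->
      psi J' (word x y l i`!) <= K * ((psi J' z * rate + e' / K) * i`!%:R) ->
      psi J' (word x y l i`!) <= (K * (psi J' x + psi J' y) * rate + e') * i`!%:R.
    move=> Hz zC /le_trans; apply; rewrite mulrA ler_wpM2r // mulrDr.
    rewrite [K * (e' / K)]mulrC mulfVK ?gt_eqF // lerD2r mulrA ler_wpM2r //.
    by rewrite ler_wpM2l // ltW.
  have [yx|/ltW xy] := leP `|J' (cob y)| `|J' (cob x)|.
    have [|i0 Hi0] := @psi_word_coherent J' x y p Q _ s1 p0 Q0 J'_pos J'_null Hx Hy yx _ e80.
      by move=> c a cQ ac; apply: Jcoh; rewrite mem_cat (dirs_in x y c a).
    exists i0 => i /Hi0 Hi l /Hi; apply: fin => //; by rewrite lerDl.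
  have [|i0 Hi0] := @psi_word_coherent J' y x p Q _ s1 p0 Q0 J'_pos J'_null Hy Hx xy _ e80.
    by move=> c a cQ ac; apply: Jcoh; rewrite mem_cat (dirs_in y x c a) ?orbT.
  exists i0 => i /Hi0 Hi l szl; have := Hi (map negb l).
  by rewrite size_map word_swap => /(_ szl); apply: fin => //; rewrite lerDr.
Qed.

Section word_commutators.

(** The last entry may be deep in the filtration: levels add up. This is how commutators of
    commutators are compared with words. *)
Lemma icomm_rcons_level l j q : (forall u, u \in l -> H u) -> U j q ->
  U (size l + j) (icomm (rcons l q)).
Proof.
move=> lH Uq; elim: l lH => [|u l IH] ulH; first exact: Uq.
rewrite rcons_cons icomm_cons; last by case: (l).
have [_ _ _ Ucomm] := HU; apply: Ucomm; first by apply: ulH; rewrite mem_head.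
by apply: IH => v vl; apply: ulH; rewrite inE vl orbT.
Qed.

Lemma eqmod_icomm_rcons_mul l j q q' : (forall u, u \in l -> H u) -> U j q -> U j q' ->
  eqmod U (size l + j).+1 (icomm (rcons l (q * q')%g))
    (icomm (rcons l q) * icomm (rcons l q'))%g.
Proof.
move=> lH Uq Uq'; have [_ Usub Udecr Ucomm] := HU.
have Uqq' : U j (q * q')%g by have [_ + _] := Usub j; apply.
elim: l lH => [|u l IH] ulH; first exact: (eqmod_refl HU).
have lH v : v \in l -> H v by move=> vl; apply: ulH; rewrite inE vl orbT.
have Hu : H u by apply: ulH; rewrite mem_head.
have n0 c : rcons l c != [::] by case: (l).
rewrite !rcons_cons !icomm_cons //=.
apply: (eqmod_trans HU (eqmod_commg_congr HU Hu (icomm_rcons_level lH Uqq') (IH lH))).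
apply: (eqmod_commg_mulr HU Hu (icomm_rcons_level lH Uq)).
exact/U_H/(icomm_rcons_level lH Uq').
Qed.

Lemma eqmod_icomm_rcons_congr l j q q' : (forall u, u \in l -> H u) -> U j q ->
  eqmod U j.+1 q q' ->
  eqmod U (size l + j).+1 (icomm (rcons l q)) (icomm (rcons l q')).
Proof.
move=> lH Uq qq'; elim: l lH => [|u l IH] ulH //.
have lH v : v \in l -> H v by move=> vl; apply: ulH; rewrite inE vl orbT.
have n0 c : rcons l c != [::] by case: (l).
rewrite !rcons_cons !icomm_cons //=.
apply: (eqmod_commg_congr HU _ (icomm_rcons_level lH Uq) (IH lH)).
by apply: ulH; rewrite mem_head.
Qed.

End word_commutators.
End cocycle.

(** * Groups of sequences and limits at a growing scale *)

Definition seqg (Gam : groupType) : Type := nat -> Gam.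

Section sequence_group.
Context (Gam : groupType).
Local Open Scope group_scope.

HB.instance Definition _ := Choice.on (seqg Gam).

Let seq1 : seqg Gam := fun=> 1.
Let seqV (a : seqg Gam) : seqg Gam := fun n => (a n)^-1.
Let seqM (a b : seqg Gam) : seqg Gam := fun n => a n * b n.

Let seqMA : associative seqM.
Proof. by move=> a b c; apply/funext => n; exact: mulgA. Qed.
Let seq1M : left_id seq1 seqM.
Proof. by move=> a; apply/funext => n; exact: mul1g. Qed.
Let seqM1 : right_id seq1 seqM.
Proof. by move=> a; apply/funext => n; exact: mulg1. Qed.
Let seqVM : left_inverse seq1 seqV seqM.
Proof. by move=> a; apply/funext => n; exact: mulVg. Qed.
Let seqMV : right_inverse seq1 seqV seqM.
Proof. by move=> a; apply/funext => n; exact: mulgV. Qed.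

HB.instance Definition _ := isGroup.Build (seqg Gam) seqMA seq1M seqM1 seqVM seqMV.

Lemma seqg_expE (a : seqg Gam) k n : (a ^+ k) n = a n ^+ k.
Proof. by elim: k => // k IH; rewrite !expgS -IH. Qed.

End sequence_group.

Section lower_central_series.
Context (Gam : groupType) (H : set Gam) (Hsub : subgroup_set H).

(** Inverses of commutators are among the generators because [gen] closes under products only. *)
Fixpoint lcs j : set Gam :=
  if j is j'.+1 then gen [set a | exists h q, [/\ H h, lcs j' q &
    a = [~ h, q]%g \/ a = [~ h, q]^-1%g]]
  else H.

Lemma lcs_subgroup j : subgroup_set (lcs j).
Proof.
case: j => [//|j]; apply: gen_subgroup => a [h [q [Hh Hq [->|->]]]].
  by exists h, q; split => //; right.
by exists h, q; split => //; left; rewrite invgK.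
Qed.

Lemma lcs_central_filtration : central_filtration H lcs.
Proof.
split=> //; [exact: lcs_subgroup| |].
- elim=> [|j IH].
    apply: gen_sub => // a [h [q [Hh Hq]]] /=; have [_ _ HV] := Hsub.
    by move=> [->|->]; rewrite ?invgR; exact: subgroup_commg.
  apply: gen_sub; first exact: lcs_subgroup.
  by move=> a [h [q [Hh /IH Hq aE]]]; apply: gen_in; exists h, q.
- by move=> j h u Hh Hu; apply: gen_in; exists h, u; split=> //; left.
Qed.

End lower_central_series.

(** One record for all the data, because the induction on the class replaces the group, the function
    space and the functional simultaneously. *)
Record frame (R : realType) (Gam : groupType) (Y : Type) (act : Y -> Gam -> Y)
    (L : set (Y -> R^o)) (H : set Gam) (U : nat -> set Gam) (s : nat) (f : Y -> R^o)
    (J : (Y -> R^o) -> R) : Prop := Frame {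
  frame_actM : forall y a b, act (act y a) b = act y (a * b)%g;
  frame_act1 : forall y, act y 1%g = y;
  frame_lin : linear_space (V := Y -> R^o) L;
  frame_filt : central_filtration H U;
  frame_tr : forall a F, H a -> L F -> L (tr act a F);
  frame_abs : forall F, L F -> L (absf F);
  frame_cob : forall a, H a -> L (cob act f a);
  frame_pos : posinv act L H J;
  frame_null : null_at_top act L U s f J }.

(* A limit functional on sequences of functions, which dominates the eventual lower
   bounds of [p] at scale [N]. *)
Section limit_frame.
Context (R : realType) (Gam : groupType) (Y : Type) (act : Y -> Gam -> Y).
Hypothesis actM : forall y a b, act (act y a) b = act y (a * b)%g.
Hypothesis act1 : forall y, act y 1%g = y.
Context (L : set (Y -> R^o)) (H : set Gam) (f : Y -> R^o) (p : (Y -> R^o) -> R).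
Hypothesis L_lin : linear_space (V := Y -> R^o) L.
Hypothesis H_sub : subgroup_set H.
Hypothesis trL : forall a F, H a -> L F -> L (tr act a F).
Hypothesis absL : forall F, L F -> L (absf F).
Hypothesis cobL : forall a, H a -> L (cob act f a).
Hypothesis p_sub : sublinear_on (V := Y -> R^o) L p.
Hypothesis p_mono : forall F G, L F -> L G -> (forall y, F y <= G y) -> p F <= p G.
Hypothesis p_tr : forall a F, H a -> L F -> p (tr act a F) <= p F.
Context (N : nat -> R) (x y : seqg Gam) (s : nat).
Hypothesis N_gt0 : forall n, 0 < N n.
Hypothesis Hx : forall n, H (x n).
Hypothesis Hy : forall n, H (y n).

Let pa F := p (absf F).
Let pi a := pa (cob act f a).

Context (C : R).
Hypothesis xC : forall n, pi (x n) <= C * N n.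
Hypothesis yC : forall n, pi (y n) <= C * N n.

Let H1 : H 1%g. Proof. by case: H_sub. Qed.
Let HM a b : H a -> H b -> H (a * b)%g. Proof. by case: H_sub => _ + _; apply. Qed.
Let HV a : H a -> H a^-1%g. Proof. by case: H_sub => _ _; apply. Qed.

Definition seq_act (ny : nat * Y) (a : seqg Gam) : nat * Y := (ny.1, act ny.2 (a ny.1)).
Definition seq_fun (g : Y -> R^o) : nat * Y -> R^o := fun ny => g ny.2.
(** Only sequences whose increments are of order [N] have their coboundary in the space below; those
    generated by [x] and [y] do. *)
Definition pair_gen : set (seqg Gam) :=
  gen [set a | [\/ a = x, a = x^-1%g, a = y | a = y^-1%g]].
Let H' := pair_gen.
Let U' := lcs H'.

Hypothesis lcs_null : forall z : seqg Gam, U' s z -> forall e, 0 < e ->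
  \forall n \near \oo, pi (z n) <= e * N n.

Let slice n (F : nat * Y -> R^o) : Y -> R^o := fun w => F (n, w).

Lemma pair_gen_subgroup : subgroup_set pair_gen.
Proof.
by apply: gen_subgroup => a [->|->|->|->]; rewrite /= ?invgK;
  [exact: Or42|exact: Or41|exact: Or44|exact: Or43].
Qed.

Let HU' : central_filtration H' U'.
Proof. exact/lcs_central_filtration/pair_gen_subgroup. Qed.

Let H'_H a : H' a -> forall n, H (a n).
Proof.
elim=> [//|b [->|->|->|->] n //|b c _ IHb _ IHc n]; [exact: HV|exact: HV|exact: HM].
Qed.

Let U'_H' j a : U' j a -> H' a. Proof. exact: (filtration_sub HU'). Qed.

Let p0 : p 0 = 0. Proof. exact: (sublinear0 L_lin p_sub). Qed.

Let LB F G : L F -> L G -> L (F - G). Proof. exact: linear_spaceB. Qed.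
Let LD F G : L F -> L G -> L (F + G). Proof. exact: linear_spaceD. Qed.

Let p_le_pa F : L F -> p F <= pa F.
Proof. by move=> LF; apply: p_mono => //; [exact: absL|move=> w; exact: ler_norm]. Qed.

Let pa_ge0 F : L F -> 0 <= pa F.
Proof.
move=> LF; rewrite -p0; apply: p_mono; [exact: L_lin.1|exact: absL|].
by move=> w; exact: normr_ge0.
Qed.

Let paN F : pa (- F) = pa F.
Proof. by congr p; apply/funext => w; exact: normrN. Qed.

Let paD F G : L F -> L G -> pa (F + G) <= pa F + pa G.
Proof.
move=> LF LG; apply: le_trans (p_sub.1 _ _ (absL LF) (absL LG)).
by apply: p_mono; [exact/absL/LD|apply: LD; exact: absL|move=> w; exact: ler_normD].
Qed.

Let paZ (t : R) F : L F -> pa (t *: F) = `|t| * pa F.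
Proof.
move=> LF; rewrite -p_sub.2 //; last exact: absL.
by congr p; apply/funext => w; exact: normrZ.
Qed.

Let pa_tr a F : H a -> L F -> pa (tr act a F) <= pa F.
Proof. by move=> Ha LF; apply: p_tr => //; exact: absL. Qed.

Let pi1 : pi 1%g = 0.
Proof.
by rewrite /pi cob1 // /pa (_ : absf 0 = 0) //; apply/funext => w; exact: normr0.
Qed.

Let piM a b : H a -> H b -> pi (a * b)%g <= pi a + pi b.
Proof.
move=> Ha Hb; rewrite /pi cobM //; apply: (le_trans (paD _ _)); first exact: cobL.
  by apply: trL => //; exact: cobL.
by rewrite lerD2l; apply: pa_tr => //; exact: cobL.
Qed.

Let piV a : H a -> pi a^-1%g <= pi a.
Proof.
move=> Ha; have : cob act f a^-1%g + tr act a^-1%g (cob act f a) = 0.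
  by rewrite -cobM // mulVg cob1.
move/eqP; rewrite addr_eq0 => /eqP E; rewrite /pi E paN.
by apply: pa_tr; [exact: HV|exact: cobL].
Qed.

(** Sequences of functions of order [N] on which the elements of level [s] act by o([N]). The last
    clause becomes the second half of [null_at_top] in the limit. *)
Definition seq_space : set (nat * Y -> R^o) := [set F | [/\ forall n, L (slice n F),
  exists2 D, 0 <= D & forall n, pa (slice n F) <= D * N n &
  forall z e, U' s z -> 0 < e -> \forall n \near \oo,
    pa (tr act (z n) (slice n F) - slice n F) <= e * N n]].
Let L' := seq_space.

Let L'_lin : linear_space (V := nat * Y -> R^o) L'.
Proof.
have E0 e : 0 < e -> forall n, 0 <= e * N n by move=> e0 n; rewrite mulr_ge0 // ltW.
split.
  have L0 : L 0 by exact: L_lin.1.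
  have pa0 : pa 0 = 0 by rewrite /pa (_ : absf 0 = 0) //; apply/funext => w; exact: normr0.
  split=> [n|//|z e _ e0]; [exact: L0|by exists 0 => // n; rewrite mul0r (_ : slice n 0 = 0) // pa0|].
  apply: nearW => n; rewrite (_ : _ - _ = 0) ?pa0 ?E0 //.
  by apply/funext => w; exact: subrr.
move=> t F G [LF [D D0 FD] Fz] [LG [D' D'0 GD] Gz].
have E n : slice n (t *: F + G) = t *: slice n F + slice n G by [].
have LtF n : L (t *: slice n F) by exact: linear_spaceZ.
split=> [n|//|z e Uz e0].
- by rewrite E; apply: LD.
- exists (`|t| * D + D') => [|n]; first by rewrite addr_ge0 // mulr_ge0.
  rewrite E (le_trans (paD _ _)) // mulrDl lerD // paZ // -mulrA.
  by rewrite ler_wpM2l.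
- have e1 : 0 < e / 2 / (`|t| + 1) by rewrite !divr_gt0 // ltr_pwDr.
  have e2 : 0 < e / 2 by rewrite divr_gt0.
  near=> n.
  have Hz : H (z n) by apply: H'_H; exact: U'_H' Uz.
  have -> : tr act (z n) (slice n (t *: F + G)) - slice n (t *: F + G) =
     t *: (tr act (z n) (slice n F) - slice n F) + (tr act (z n) (slice n G) - slice n G).
    by rewrite E trZD scalerBr opprD addrACA.
  have Lz F' : L F' -> L (tr act (z n) F' - F') by move=> LF'; apply: LB => //; exact: trL.
  apply: (le_trans (paD (linear_spaceZ L_lin _ (Lz _ (LF n))) (Lz _ (LG n)))).
  rewrite paZ; last exact: Lz.
  have h1 : pa (tr act (z n) (slice n F) - slice n F) <= e / 2 / (`|t| + 1) * N n.
    by near: n; exact: Fz.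
  have h2 : pa (tr act (z n) (slice n G) - slice n G) <= e / 2 * N n.
    by near: n; exact: Gz.
  have t1 : 0 < `|t| + 1 by rewrite ltr_pwDr.
  have h3 : `|t| * pa (tr act (z n) (slice n F) - slice n F) <= e / 2 * N n.
    apply: (@le_trans _ _ ((`|t| + 1) * pa (tr act (z n) (slice n F) - slice n F))).
      by rewrite ler_wpM2r ?lerDl // pa_ge0 //; exact: Lz.
    by rewrite mulrC -ler_pdivlMr // mulrAC.
  by have := lerD h3 h2; rewrite -mulrDl -splitr.
Unshelve. all: by end_near. Qed.

Let trL' a F : H' a -> L' F -> L' (tr seq_act a F).
Proof.
move=> Ha [LF [D D0 FD] Fz]; have HaH := H'_H Ha.
have E n : slice n (tr seq_act a F) = tr act (a n) (slice n F) by [].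
split=> [n|//|z e Uz e0]; first by rewrite E; exact: trL.
  by exists D => // n; rewrite E (le_trans (pa_tr _ _)).
have Uza : U' s (z ^ a)%g by exact: (filtration_conj HU').
have := Fz _ _ Uza e0; apply: filterS => n; apply: le_trans.
have Hza : H ((z ^ a)%g n) by apply: H'_H; exact: U'_H' Uza.
have -> : tr act (z n) (slice n (tr seq_act a F)) - slice n (tr seq_act a F) =
   tr act (a n) (tr act ((z ^ a)%g n) (slice n F) - slice n F).
  by rewrite E trB !trM // (_ : a n * _ = z n * a n)%g //; exact: (esym (conjgC _ _)).
by apply: pa_tr => //; apply: LB => //; exact: trL.
Qed.

Let absL' F : L' F -> L' (absf F).
Proof.
move=> [LF [D D0 FD] Fz].
have E n : slice n (absf F) = absf (slice n F) by [].
have aa G : pa (absf G) = pa G by congr p; apply/funext => w; exact: normr_id.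
split=> [n|//|z e Uz e0]; first by rewrite E; exact: absL.
  by exists D => // n; rewrite E aa.
have := Fz _ _ Uz e0; apply: filterS => n; apply: le_trans.
have Hz : H (z n) by apply: H'_H; exact: U'_H' Uz.
rewrite E; apply: p_mono.
- by apply/absL/LB; [apply: trL => //; exact: absL|exact: absL].
- by apply/absL/LB => //; exact: trL.
- by move=> w; rewrite /absf /tr !fctE; exact: ler_dist_dist.
Qed.

Let pi_bounded a : H' a -> exists2 D, 0 <= D & forall n, pi (a n) <= D * N n.
Proof.
have C0 : 0 <= C.
  by have := le_trans (pa_ge0 (cobL (Hx 0))) (xC 0%N); rewrite pmulr_lge0.
elim=> [|b bS|b c Hb [D D0 bD] Hc [D' D'0 cD]].
- by exists 0 => // n; rewrite mul0r pi1.
- exists C => // n; case: bS => [->|->|->|->] //.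
    by rewrite (le_trans (piV (Hx n))).
  by rewrite (le_trans (piV (Hy n))).
- exists (D + D') => [|n]; first exact: addr_ge0.
  by rewrite (le_trans (piM (H'_H Hb n) (H'_H Hc n))) // mulrDl lerD.
Qed.

Let f' := seq_fun f.

Let cobL' a : H' a -> L' (cob seq_act f' a).
Proof.
move=> Ha; have HaH := H'_H Ha.
have E n : slice n (cob seq_act f' a) = cob act f (a n) by [].
split=> [n|//|z e Uz e0]; [by rewrite E; exact: cobL| |].
  by have [D D0 h] := pi_bounded Ha; exists D.
have e2 : 0 < e / 2 by rewrite divr_gt0.
have Uza : U' s (z ^ a)%g by exact: (filtration_conj HU').
near=> n.
have Hz : H (z n) by apply: H'_H; exact: U'_H' Uz.
have Hza : H ((z ^ a)%g n) by apply: H'_H; exact: U'_H' Uza.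
have -> : tr act (z n) (slice n (cob seq_act f' a)) - slice n (cob seq_act f' a) =
    tr act (a n) (cob act f ((z ^ a)%g n)) - cob act f (z n).
  have E1 := cobM actM f (z n) (a n).
  have E2 := cobM actM f (a n) ((z ^ a)%g n).
  have E3 : (z n * a n = a n * (z ^ a)%g n)%g by exact: conjgC.
  apply/eqP; rewrite E subr_eq addrAC [X in _ == X - _]addrC -E2 -E3 E1.
  by rewrite addrC addKr.
have Lt : L (tr act (a n) (cob act f ((z ^ a)%g n))) by apply: trL => //; exact: cobL.
apply: (le_trans (paD Lt (linear_spaceN L_lin (cobL Hz)))).
rewrite paN.
have h1 : pi ((z ^ a)%g n) <= e / 2 * N n by near: n; exact: (lcs_null Uza e2).
have h2 : pi (z n) <= e / 2 * N n by near: n; exact: (lcs_null Uz e2).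
have h3 := le_trans (pa_tr (HaH n) (cobL Hza)) h1.
by have := lerD h3 h2; rewrite -mulrDl -splitr.
Unshelve. all: by end_near. Qed.

(** The infimum [q] of this set is the upper limit of [p (slice n F) / N n], a sublinear functional
    of the sequence. *)
Let evset (F : nat * Y -> R^o) := [set r | \forall n \near \oo, p (slice n F) <= r * N n].
Let q F := inf (evset F).

Let ev_inf F : L' F -> has_inf (evset F).
Proof.
move=> [LF [D D0 FD] _]; split.
  by exists D; apply: nearW => n; rewrite (le_trans (p_le_pa _)).
exists (- D) => r /= rF; near \oo => n.
have h : p (slice n F) <= r * N n by near: n.
rewrite -(ler_pM2r (N_gt0 n)); apply: le_trans h; rewrite mulNr lerNl.
apply: le_trans (FD n); rewrite -paN; apply: (@le_trans _ _ (p (- slice n F))).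
  by rewrite lerNl; exact: (sublinear_opp L_lin p_sub).
by apply: p_le_pa; exact: linear_spaceN.
Unshelve. all: by end_near. Qed.

Let q_le F r : L' F -> (\forall n \near \oo, p (slice n F) <= r * N n) -> q F <= r.
Proof. by move=> LF rF; apply: ge_inf => //; exact: (ev_inf LF).2. Qed.

Let q_ev F r : L' F -> q F < r -> \forall n \near \oo, p (slice n F) <= r * N n.
Proof.
move=> LF qr; have e0 : 0 < r - q F by rewrite subr_gt0.
have [r' r'F] := inf_adherent e0 (ev_inf LF).
rewrite addrC subrK => r'r; move: r'F; apply: filterS => n /le_trans; apply.
by rewrite ler_pM2r // ltW.
Qed.

Let q_sub : sublinear_on (V := nat * Y -> R^o) L' q.
Proof.
have qZ t F : 0 < t -> L' F -> q (t *: F) <= t * q F.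
  move=> t0 LF; have LtF : L' (t *: F) by exact: (linear_spaceZ L'_lin).
  apply/ler_addgt0Pr => e e0; apply: q_le => //.
  have et0 : 0 < e / t by rewrite divr_gt0.
  have := @q_ev F (q F + e / t) LF; rewrite ltrDl => /(_ et0).
  apply: filterS => n h; rewrite (_ : slice n (t *: F) = t *: slice n F) //.
  rewrite p_sub.2 ?(ltW t0) //; last by case: LF.
  have -> : t * q F + e = t * (q F + e / t) by rewrite mulrDr mulrCA mulfV ?mulr1 // gt_eqF.
  by rewrite -mulrA ler_pM2l.
split=> [F G LF LG|t F t0 LF].
  have LFG : L' (F + G) by exact: (linear_spaceD L'_lin).
  apply/ler_addgt0Pr => e e0; have e2 : 0 < e / 2 by rewrite divr_gt0.
  apply: q_le => //; near=> n.
  rewrite (_ : slice n (F + G) = slice n F + slice n G) //.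
  have [LFn _ _] := LF; have [LGn _ _] := LG.
  apply: (le_trans (p_sub.1 _ _ (LFn n) (LGn n))).
  have h1 : p (slice n F) <= (q F + e / 2) * N n by near: n; apply: q_ev => //; rewrite ltrDl.
  have h2 : p (slice n G) <= (q G + e / 2) * N n by near: n; apply: q_ev => //; rewrite ltrDl.
  by have := lerD h1 h2; rewrite -mulrDl addrACA -splitr.
have [->|tn0] := eqVneq t 0.
  rewrite scale0r mul0r; apply/le_anti/andP; split.
    apply: q_le; first exact: L'_lin.1.
    by apply: nearW => n; rewrite mul0r (_ : slice n 0 = 0) // p0.
  apply: lb_le_inf; first exact: (ev_inf L'_lin.1).1.
  move=> r /= r0; near \oo => n.
  have : p (slice n 0) <= r * N n by near: n.
  by rewrite (_ : slice n 0 = 0) // p0 pmulr_lge0.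
have {}t0 : 0 < t by rewrite lt_def tn0.
apply/le_anti; rewrite qZ //= -ler_pdivlMl //.
have := qZ t^-1 (t *: F); rewrite scalerA mulVf // scale1r; apply; first by rewrite invr_gt0.
exact: (linear_spaceZ L'_lin).
Unshelve. all: by end_near. Qed.

Let q_le_ev F : L' F -> (forall e, 0 < e -> \forall n \near \oo, p (slice n F) <= e * N n) ->
  q F <= 0.
Proof.
by move=> LF ev; apply/ler_addgt0Pr => e e0; rewrite add0r; apply: q_le => //; exact: ev.
Qed.

(** No value is prescribed (c = 0 at F0 = 0): any invariant functional below [q] is positive, as [p]
    is monotone, and kills what is o([N]). Since [p] is only sublinear, a lower bound for the limit
    length must come from an upper bound of [p] at the opposite of the absolute increment; when [p]
    is a supremum over base points, this is a lower bound uniform in the base point. *)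
Theorem limit_frame : exists2 J,
  frame seq_act seq_space pair_gen (lcs pair_gen) s (seq_fun f) J &
  forall a r, pair_gen a ->
    (\forall n \near \oo, p (- absf (cob act f (a n))) <= - r * N n) ->
    r <= psi seq_act (seq_fun f) J a.
Proof.
have actM' ny a b : seq_act (seq_act ny a) b = seq_act ny (a * b)%g.
  by rewrite /seq_act /= actM.
have act1' ny : seq_act ny 1%g = ny by case: ny => n w; rewrite /seq_act /= act1.
have [|a F Ha LF|l l0 lN|z F Uz LF|J [J_lin Jq J_inv _]] :=
    @invariant_hahn_banach R (seqg Gam) (nat * Y) seq_act actM' act1' L' H' U' s
      L'_lin HU' trL' q 0 0 _ q_sub.
- exact: L'_lin.1.
- apply/ler_addgt0Pr => e e0; apply: q_le; first exact: trL'.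
  have [LFn _ _] := LF.
  have := @q_ev F (q F + e) LF; rewrite ltrDl => /(_ e0); apply: filterS => n.
  exact: (le_trans (p_tr (H'_H Ha n) (LFn n))).
- have E : avg seq_act l (0 : nat * Y -> R^o) = 0.
    by have := avgZ seq_act l (0 : R) (0 : nat * Y -> R^o); rewrite !scale0r.
  by rewrite !oppr0 !E (sublinear0 L'_lin q_sub).
- have LzF : L' (tr seq_act z F - F).
    by apply: (linear_spaceB L'_lin) => //; apply: trL' => //; exact: U'_H' Uz.
  apply: q_le_ev => // e e0; have [_ _ Fz] := LF.
  have := Fz _ _ Uz e0; apply: filterS => n; apply: le_trans; apply: p_le_pa.
  by have [+ _ _] := LzF => /(_ n).
have J_ge0 F : L' F -> (forall w, 0 <= F w) -> 0 <= J F.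
  move=> LF F0; rewrite -oppr_le0 -(linear_onN L'_lin J_lin) //.
  have LNF : L' (- F) by exact: (linear_spaceN L'_lin).
  apply: (le_trans (Jq _ LNF)); apply: q_le => //; apply: nearW => n.
  rewrite mul0r -p0; apply: p_mono; [by have [+ _ _] := LNF => /(_ n)|exact: L_lin.1|].
  by move=> w; rewrite /slice !fctE oppr_le0.
exists J.
  split=> //; split=> [z Uz|z F Uz LF].
  - have Hz := U'_H' Uz; have La := absL' (cobL' Hz).
    apply/le_anti/andP; split; last by apply: J_ge0 => // w; exact: normr_ge0.
    by apply: (le_trans (Jq _ La)); apply: q_le_ev => // e e0; exact: (lcs_null Uz e0).
  - have Hz := U'_H' Uz.
    have La : L' (absf (tr seq_act z F - F)).
      by apply/absL'/(linear_spaceB L'_lin) => //; exact: trL'.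
    apply/le_anti/andP; split; last by apply: J_ge0 => // w; exact: normr_ge0.
    apply: (le_trans (Jq _ La)); apply: q_le_ev => // e e0.
    by have [_ _ Fz] := LF; exact: (Fz z e Uz e0).
move=> a r Ha ra; have La := absL' (cobL' Ha).
have LNa : L' (- absf (cob seq_act f' a)) by exact: (linear_spaceN L'_lin).
rewrite -lerN2 -(linear_onN L'_lin J_lin) //.
by apply: (le_trans (Jq _ LNa)); exact: q_le.
Qed.

End limit_frame.

Lemma icomm_rcons_commg (Gam : groupType) (l : seq Gam) u q :
  icomm (rcons l [~ u, q]%g) = icomm (rcons (rcons l u) q).
Proof.
elim: l => // v l IH; rewrite !rcons_cons icomm_cons; last by case: (l).
by rewrite icomm_cons ?IH //; case: (l).
Qed.

Lemma icomm_rcons1 (Gam : groupType) (l : seq Gam) : icomm (rcons l 1%g) = 1%g.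
Proof.
elim: l => // v l IH; rewrite rcons_cons icomm_cons; last by case: (l).
by rewrite IH commg1.
Qed.

Section lcs_null.
Context (R : realType) (Gam : groupType) (Y : Type) (act : Y -> Gam -> Y)
  (L : set (Y -> R^o)) (H : set Gam) (U : nat -> set Gam) (s : nat) (f : Y -> R^o)
  (J : (Y -> R^o) -> R) (x y : Gam).
Hypothesis fr : frame act L H U s f J.
Hypothesis s1 : (1 < s)%N.
Hypothesis Hx : H x.
Hypothesis Hy : H y.

Let HU := frame_filt fr.
Let psi0 z : H z -> 0 <= psi act f J z.
Proof. by case: fr => *; eapply psi_ge0; eassumption. Qed.
Let psiM z w : H z -> H w -> psi act f J (z * w)%g <= psi act f J z + psi act f J w.
Proof. by case: fr => *; eapply psiM; eassumption. Qed.
Let psiV z : H z -> psi act f J z^-1%g = psi act f J z.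
Proof. by case: fr => *; eapply psiV; eassumption. Qed.
Let psi1 : psi act f J 1%g = 0.
Proof. by case: fr => *; eapply psi1; eassumption. Qed.
Let psi_eqmod z w : H z -> eqmod U s z w -> psi act f J w <= psi act f J z.
Proof. by case: fr => *; eapply psi_eqmod; eassumption. Qed.

Definition fact_seq (a : Gam) : seqg Gam := fun i => (a ^+ i`!)%g.

Let small (z : seqg Gam) : Prop := forall e : R, 0 < e ->
  \forall i \near \oo, psi act f J (z i) <= e * i`!%:R.

Let letter i (b : bool) : Gam := ((if b then x else y) ^+ i`!)%g.

Let letterH i l u : u \in [seq letter i b | b <- l] -> H u.
Proof.
have [HH _ _ _] := HU; have Hsub : subgroup_set H by rewrite -HH; case: HU => _ /(_ 0%N).
by move=> /mapP[[] _ ->]; exact: subgroup_expg.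
Qed.

(** Sequences at level [j] whose commutators with enough letters to reach level s-1 have length
    o(i!). Changing [q] inside level [j.+1] changes these commutators by elements of [U s], which
    have length 0; so the condition depends on classes only. *)
Let T j (q : seqg Gam) : Prop := (forall i, U j (q i)) /\
  forall l : seq bool, (size l + j).+1 = s ->
    small (fun i => icomm (rcons [seq letter i b | b <- l] (q i))).

Let U_H j a : U j a -> H a. Proof. exact: (filtration_sub HU). Qed.
Let Usub j : subgroup_set (U j). Proof. by case: HU. Qed.

Let UH_icomm j i (l : seq bool) q : U j q -> H (icomm (rcons [seq letter i b | b <- l] q)).
Proof. by move=> Uq; apply/U_H/(icomm_rcons_level HU (@letterH i l) Uq). Qed.

Let small_le z w : (forall i, psi act f J (z i) <= psi act f J (w i)) -> small w -> small z.
Proof. by move=> zw Hw e /Hw; apply: filterS => i; apply: le_trans. Qed.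

Let small_mul z w : (forall i, H (z i)) -> (forall i, H (w i)) ->
  small z -> small w -> small (fun i => z i * w i)%g.
Proof.
move=> Hz Hw zs ws e e0; have e2 : 0 < e / 2 by rewrite divr_gt0.
near=> i; have h1 : psi act f J (z i) <= e / 2 * i`!%:R by near: i; exact: zs.
have h2 : psi act f J (w i) <= e / 2 * i`!%:R by near: i; exact: ws.
by apply: (le_trans (psiM (Hz i) (Hw i))); have := lerD h1 h2; rewrite -mulrDl -splitr.
Unshelve. all: by end_near. Qed.

Let T_congr j q q' : T j q -> (forall i, eqmod U j.+1 (q i) (q' i)) -> T j q'.
Proof.
move=> [Uq qs] qq'; have [_ _ Udecr _] := HU.
have Uq' i : U j (q' i).
  by have [_ M _] := Usub j; rewrite -(mulVKg (q i) (q' i)); apply: M => //; exact/Udecr/qq'.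
split=> // l szl; apply: small_le (qs l szl) => i.
apply: psi_eqmod; first exact: UH_icomm.
by rewrite -szl -(size_map (letter i) l); exact: (eqmod_icomm_rcons_congr HU (@letterH i l)).
Qed.

Let T_mul j q q' : T j q -> T j q' -> T j (q * q')%g.
Proof.
move=> [Uq qs] [Uq' qs']; split=> [i|l szl].
  by have [_ M _] := Usub j; exact: M.
apply: small_le (small_mul _ _ (qs l szl) (qs' l szl)) => i; try exact: UH_icomm.
apply: psi_eqmod.
  by have [HH _ _ _] := HU; have := Usub 0; rewrite HH => -[_ + _]; apply; exact: UH_icomm.
apply: (eqmod_sym HU); rewrite -szl -(size_map (letter i) l).
exact: (eqmod_icomm_rcons_mul HU (@letterH i l)).
Qed.

Let T1 j : T j 1%g.
Proof.
split=> [i|l _ e e0]; first by have [] := Usub j.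
by apply: nearW => i; rewrite icomm_rcons1 psi1 mulr_ge0 // ltW.
Qed.

Let T_inv j q : T j q -> T j q^-1%g.
Proof.
move=> [Uq qs]; have UV i : U j (q i)^-1%g by have [_ _] := Usub j; apply.
split=> // l szl; apply: small_le (qs l szl) => i.
set t := [seq _ | _ <- _].
have HA := UH_icomm i l (UV i); have HB := UH_icomm i l (Uq i).
rewrite -(psiV HB); apply: psi_eqmod; first by apply/(U_H (j := 0)); have [_ _ V] := Usub 0;
  apply: V; have [-> _ _ _] := HU.
have := eqmod_icomm_rcons_mul HU (@letterH i l) (Uq i) (UV i).
rewrite size_map szl mulgV icomm_rcons1 /eqmod invg1 mul1g => E.
by rewrite invgK.
Qed.

(** Commuting with a letter moves that letter from the prefix into [q]. Inverses and products of
    letters follow by bilinearity modulo the next level. *)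
Let T_commg j q (h : seqg Gam) : T j q -> pair_gen (fact_seq x) (fact_seq y) h ->
  (j.+1 < s)%N -> T j.+1 [~ h, q]%g.
Proof.
move=> Tq + js; have [Uq qs] := Tq; have [HH _ _ Ucomm] := HU.
have Hsub : subgroup_set H by rewrite -HH.
have lH i b : H (letter i b) by case: b; exact: subgroup_expg.
have letT b : T j.+1 [~ (fun i => letter i b) : seqg Gam, q]%g.
  split=> [i|l szl]; first exact: Ucomm.
  have := qs (rcons l b); rewrite size_rcons addSnnS => /(_ szl).
  apply: small_le => i; rewrite map_rcons -icomm_rcons_commg.
  exact: lexx.
have letV b : T j.+1 [~ ((fun i => letter i b) : seqg Gam)^-1, q]%g.
  apply: T_congr (T_inv (letT b)) _ => i.
  have [_ _ HV] := Hsub.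
  have := eqmod_commg_mull HU (lH i b) (HV _ (lH i b)) (Uq i).
  by rewrite mulgV comm1g /eqmod invg1 mul1g /= invgK.
have HpH a : pair_gen (fact_seq x) (fact_seq y) a -> forall i, H (a i).
  have [H1 HM HV] := Hsub.
  elim=> [//|b [->|->|->|->] i|b c _ IHb _ IHc i]; rewrite /fact_seq //.
  - exact: (lH i true).
  - exact/HV/(lH i true).
  - exact: (lH i false).
  - exact/HV/(lH i false).
  - exact: HM.
elim=> [|b [->|->|->|->]|a b Ha Ta Hb Tb].
- by rewrite comm1g.
- exact: (letT true).
- exact: (letV true).
- exact: (letT false).
- exact: (letV false).
apply: T_congr (T_mul Ta Tb) _ => i; apply: (eqmod_sym HU).
by apply: (eqmod_commg_mull HU) => //; exact: HpH.
Qed.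

(** The index [s.-1] is the point: at scale i! the generated group of sequences behaves as if its
    class were one less. Words in [x] and [y] control the lower central series because [T] passes
    from level to level. *)
Lemma pair_lcs_null (z : seqg Gam) : lcs (pair_gen (fact_seq x) (fact_seq y)) s.-1 z ->
  forall e : R, 0 < e -> \forall i \near \oo, psi act f J (z i) <= e * i`!%:R.
Proof.
have HH : U 0%N = H by case: HU.
have T0 b : T 0 (fun i => letter i b).
  split=> [i|l szl e e0].
    by rewrite HH; apply: (@letterH i [:: b]); rewrite mem_head.
  have [i0 Hi0] : exists i0, forall i, (i0 <= i)%N -> forall l, size l = s ->
      psi act f J (word x y l i`!) <= e * i`!%:R.
    by case: fr => *; eapply psi_word_small; eassumption.
  near=> i; have := Hi0 i; have ii : (i0 <= i)%N by near: i; exact: nbhs_infty_ge.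
  move=> /(_ ii (rcons l b)); rewrite size_rcons -szl addn0 => /(_ erefl).
  by rewrite /word map_rcons.
have lcsT j w : (j < s)%N -> lcs (pair_gen (fact_seq x) (fact_seq y)) j w -> T j w.
  elim: j w => [|j IH] w js.
    elim=> [|a [->|->|->|->]|a b _ Ta _ Tb]; [exact: T1|exact: (T0 true)|
      exact/T_inv/(T0 true)|exact: (T0 false)|exact/T_inv/(T0 false)|exact: T_mul].
  elim=> [|a [h [q [Hh Hq [->|->]]]]|a b _ Ta _ Tb]; [exact: T1| | |exact: T_mul].
    by apply: T_commg => //; apply: IH => //; exact: ltnW.
  by apply: T_inv; apply: T_commg => //; apply: IH => //; exact: ltnW.
move=> /lcsT[|_ /(_ [::])]; first by rewrite prednK // ltnW.
by rewrite add0n prednK ?(ltnW s1) //; apply.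
Unshelve. all: by end_near. Qed.

End lcs_null.

(** Induction on the class. In class 0 or 1 the commutator itself is null. Otherwise pass to the
    limit along exponents i!: the class drops, while the lower bound is inherited, because the n-th
    powers of the sequences x^(i!) and y^(i!) are x^(n i!) and y^(n i!), to which the hypothesis
    applies again. *)
Theorem commutators_sublinear s (R : realType) (Gam : groupType) (Y : Type)
    (act : Y -> Gam -> Y) (L : set (Y -> R^o)) (H : set Gam) (U : nat -> set Gam)
    (f : Y -> R^o) (J : (Y -> R^o) -> R) (x y : Gam) (k : R) :
  frame act L H U s f J -> H x -> H y -> 0 < k ->
  ~ forall n, k * n%:R <= psi act f J [~ (x ^+ n), (y ^+ n)]%g.
Proof.
case: s => [|s].
  move=> fr Hx Hy k0 /(_ 1%N); rewrite !expg1 mulr1 leNgt.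
  have HU := frame_filt fr; have [HH _ Udecr Ucomm] := HU.
  rewrite (frame_null fr).1 ?k0 //; apply/Udecr/Ucomm => //; by rewrite HH.
elim: s Gam Y act L H U f J x y => [|s IH] Gam Y act L H U f J x y fr Hx Hy k0 Hk.
  move: Hk => /(_ 1%N); rewrite !expg1 mulr1 leNgt.
  have HU := frame_filt fr; have [HH _ Udecr Ucomm] := HU.
  rewrite (frame_null fr).1 ?k0 //; apply: Ucomm => //; by rewrite HH.
have [actM act1 L_lin HU trL absL cobL J_pos J_null] := fr.
have Hsub : subgroup_set H by case: (HU) => <- /(_ 0%N).
have [J_lin J_ge0 J_inv] := J_pos.
have J_sub : sublinear_on (V := Y -> R^o) L J.
  split=> [F G LF LG|t F t0 LF]; first by rewrite (linear_onD J_lin).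
  by rewrite (linear_onZ L_lin J_lin).
have J_mono F G : L F -> L G -> (forall y, F y <= G y) -> J F <= J G.
  exact: (posinv_le L_lin J_pos).
have J_tr a F : H a -> L F -> J (tr act a F) <= J F by move=> Ha LF; rewrite J_inv.
have HX a n : H a -> H (a ^+ n)%g by exact: subgroup_expg.
pose C := psi act f J x + psi act f J y.
have bnd a : H a -> psi act f J a <= C -> forall n : nat,
    J (absf (cob act f (fact_seq a n))) <= C * n`!%:R.
  move=> Ha aC n; apply: (le_trans (psiX actM act1 L_lin HU trL absL cobL J_pos n`! Ha)).
  by rewrite mulrC ler_wpM2r.
have psi0 a : H a -> 0 <= psi act f J a by exact: (psi_ge0 absL cobL J_pos).
have [||n|n|n|J' fr' low] := @limit_frame R Gam Y act actM act1 L H f J L_lin Hsub trL absL cobL J_sub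
  J_mono J_tr (fun n => n`!%:R) (fact_seq x) (fact_seq y) s.+1 _ _ _ C _ _
  (pair_lcs_null fr isT Hx Hy).
- by move=> n; rewrite ltr0n fact_gt0.
- by move=> n; exact: HX.
- exact: HX.
- by apply: bnd; rewrite ?lerDl ?psi0.
- by apply: bnd; rewrite ?lerDr ?psi0.
have Gx : pair_gen (fact_seq x) (fact_seq y) (fact_seq x) by apply: gen_in; exact: Or41.
have Gy : pair_gen (fact_seq x) (fact_seq y) (fact_seq y) by apply: gen_in; exact: Or43.
have Gsub := pair_gen_subgroup (fact_seq x) (fact_seq y).
apply: (IH _ _ _ _ _ _ _ _ _ _ fr' Gx Gy k0) => n; apply: low.
  by apply: subgroup_commg => //; exact: subgroup_expg.
apply: nearW => i.
have Hc : H [~ (x ^+ (n * i`!)), (y ^+ (n * i`!))]%g by apply: subgroup_commg => //; exact: HX.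
have -> : ([~ (fact_seq x ^+ n), (fact_seq y ^+ n)] i = [~ (x ^+ (n * i`!)), (y ^+ (n * i`!))])%g.
  rewrite [LHS](_ : _ = [~ ((fact_seq x ^+ n) i), ((fact_seq y ^+ n) i)]%g) //.
  by rewrite !seqg_expE /fact_seq -!expgnA mulnC.
rewrite (linear_onN L_lin J_lin); last by apply: absL; exact: cobL.
by rewrite mulNr lerN2 -mulrA -natrM; exact: Hk.
Qed.

(** * Orbits of integrable functions *)

Lemma lcs_pointwise (Gam : groupType) (H : set (seqg Gam)) (K : set Gam) (U : nat -> set Gam) :
  central_filtration K U -> (forall a, H a -> forall n, K (a n)) ->
  forall j z, lcs H j z -> forall n, U j (z n).
Proof.
move=> [UK Usub _ Ucomm] HK; elim=> [|j IH] z; first by rewrite UK; exact: HK.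
have [U1 UM UV] := Usub j.+1.
elim=> [//|a [h [q [Hh Hq [->|->]]]] n|a b _ IHa _ IHb n].
- by apply: Ucomm; [exact: HK|exact: IH].
- by apply: UV; apply: Ucomm; [exact: HK|exact: IH].
- exact: UM.
Qed.

Section orbit.
Context (R : realType) d (T : measurableType d) (mu : {measure set T -> \bar R}).
Context (G : groupType) (U : nat -> set G) (s : nat) (F : G -> T -> R) (D : G -> R) (lam : R).
Hypothesis HU : central_filtration setT U.
Hypothesis Us : U s `<=` [set 1%g].
Hypothesis F_int : forall g, mu.-integrable setT (EFin \o F g).
Hypothesis lam0 : 0 < lam.
Hypothesis FD : forall g c, lam * D c <= \int[mu]_w `|F (g * c)%g w - F g w| <= D c.

Let act (gw : G * T) (a : G) : G * T := ((gw.1 * a)%g, gw.2).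
Let intg (F : G * T -> R^o) g : R := \int[mu]_w F (g, w).
Let integ (F : G * T -> R^o) : Prop := forall g, mu.-integrable setT (EFin \o (fun w => F (g, w))).

(** The group carries no measure: [g] is a base point, and the integrals over [T] have to be bounded
    uniformly in it. The map [F] itself need not satisfy this; its increments do. *)
Let bounded_orbit : set (G * T -> R^o) :=
  [set F | integ F /\ exists C, forall g, intg (absf F) g <= C].
Let L := bounded_orbit.

Let integ_abs E : integ E -> integ (absf E).
Proof. by move=> iE g; exact: integrable_norm. Qed.

Let integZD t E E' : integ E -> integ E' -> integ (t *: E + E').
Proof.
move=> iE iE' g.
have -> : EFin \o (fun w => (t *: E + E') (g, w)) =
   (fun w => t%:E * (EFin \o (fun w => E (g, w))) w + (EFin \o (fun w => E' (g, w))) w)%E.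
  by apply/funext => w.
by apply: integrableD => //; exact: integrableZl.
Qed.

Let intgZD t E E' : integ E -> integ E' -> forall g, intg (t *: E + E') g = t * intg E g + intg E' g.
Proof.
move=> iE iE' g; rewrite /intg.
have i1 : mu.-integrable setT (EFin \o (fun w => t * E (g, w))).
  have -> : EFin \o (fun w => t * E (g, w)) = (fun w => t%:E * (EFin \o (fun w => E (g, w))) w)%E.
    by apply/funext => w.
  exact: integrableZl.
by rewrite -RintegralZl // -RintegralD.
Qed.

Let intg_le E E' g : integ E -> integ E' -> (forall y, E y <= E' y) -> intg E g <= intg E' g.
Proof. by move=> iE iE' EE'; apply: le_Rintegral => // w _; exact: EE'. Qed.

Let intgD E E' : integ E -> integ E' -> forall g, intg (E + E') g = intg E g + intg E' g.
Proof. by move=> iE iE' g; have := intgZD 1 iE iE' g; rewrite scale1r mul1r. Qed.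

Let integ0 : integ 0.
Proof. by move=> g; exact: integrable0. Qed.

Let intg0 g : intg 0 g = 0.
Proof. by rewrite /intg Rintegral_cst // mul0r. Qed.

Let intgZ t E : integ E -> forall g, intg (t *: E) g = t * intg E g.
Proof. by move=> iE g; have := intgZD t iE integ0 g; rewrite addr0 intg0 addr0. Qed.

Let L_lin : linear_space (V := G * T -> R^o) L.
Proof.
split.
  split; first exact: integ0.
  exists 0 => g; rewrite (_ : absf 0 = 0) ?intg0 //.
  by apply/funext => w; exact: normr0.
move=> t E E' [iE [C EC]] [iE' [C' EC']]; split; first exact: integZD.
exists (`|t| * C + C') => g.
apply: (@le_trans _ _ (intg (`|t| *: absf E + absf E') g)).
  apply: intg_le; [exact/integ_abs/integZD|by apply: integZD; exact: integ_abs|].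
  by move=> y; rewrite /absf !fctE (le_trans (ler_normD _ _)) // normrZ.
rewrite intgZD; [|exact: integ_abs|exact: integ_abs].
by rewrite lerD // ler_wpM2l.
Qed.

Let intg_sup E : L E -> has_sup (range (intg E)).
Proof.
move=> [iE [C EC]]; split; first by exists (intg E 1%g), 1%g.
exists C => _ [g _ <-]; apply: le_trans (EC g); apply: intg_le => //.
  exact: integ_abs.
by move=> y; exact: ler_norm.
Qed.

Let p (E : G * T -> R^o) : R := sup (range (intg E)).

Let le_p E g : L E -> intg E g <= p E.
Proof. by move=> LE; apply: ub_le_sup; [exact: (intg_sup LE).2|exists g]. Qed.

Let p_le E r : (forall g, intg E g <= r) -> p E <= r.
Proof.
move=> Er; apply: ge_sup; first by exists (intg E 1%g), 1%g.
by move=> _ [g _ <-].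
Qed.

Let p_sub : sublinear_on (V := G * T -> R^o) L p.
Proof.
split=> [E E' LE LE'|t E t0 LE].
  apply: p_le => g; rewrite intgD; [|exact: LE.1|exact: LE'.1].
  by rewrite lerD // le_p.
have [->|tn0] := eqVneq t 0.
  rewrite scale0r mul0r; apply/le_anti/andP; split.
    by apply: p_le => g; rewrite intg0.
  by rewrite -(intg0 1%g); apply: le_p; exact: L_lin.1.
have {}t0 : 0 < t by rewrite lt_def tn0.
apply/le_anti/andP; split.
  by apply: p_le => g; rewrite intgZ; [rewrite ler_pM2l // le_p|exact: LE.1].
rewrite -ler_pdivlMl //; apply: p_le => g; rewrite ler_pdivlMl // -intgZ; last exact: LE.1.
by apply: le_p; exact: (linear_spaceZ L_lin).
Qed.

Let f : G * T -> R^o := fun gw => F gw.1 gw.2.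

Let cobL a : setT a -> L (cob act f a).
Proof.
move=> _; split=> [g|].
  have -> : EFin \o (fun w => cob act f a (g, w)) =
    ((EFin \o F (g * a)%g) \- (EFin \o F g))%E by [].
  exact: integrableB.
by exists (D a) => g; have /andP[] := FD g a.
Qed.

(** Limit frame at scale [N], followed by [commutators_sublinear] with constant [lam * k]. For each
    [m] the lower bound is asked for large [n] only, which is all that a limit functional
    retains. *)
Lemma no_integrable_orbit (x y : nat -> G) (N : nat -> R) (C k : R) :
  (forall n, 0 < N n) -> (forall n, D (x n) <= C * N n) -> (forall n, D (y n) <= C * N n) ->
  0 < k ->
  ~ forall m : nat, \forall n \near \oo, k * m%:R * N n <= D [~ (x n ^+ m), (y n ^+ m)]%g.
Proof.
move=> N0 xC yC k0 low.
have actM z a b : act (act z a) b = act z (a * b)%g by rewrite /act /= mulgA.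
have act1 z : act z 1%g = z by case: z => g w; rewrite /act /= mulg1.
have trL a E : setT a -> L E -> L (tr act a E).
  by move=> _ [iE [M EM]]; split=> [g|]; [exact: (iE (g * a)%g)|exists M => g; exact: (EM (g * a)%g)].
have absL E : L E -> L (absf E).
  move=> [iE [M EM]]; split; [exact: integ_abs|exists M => g].
  by rewrite (_ : absf (absf E) = absf E) //; apply/funext => w; exact: normr_id.
have p_mono E E' : L E -> L E' -> (forall y, E y <= E' y) -> p E <= p E'.
  move=> LE LE' EE'; apply: p_le => g; apply: le_trans (le_p g LE').
  by apply: intg_le => //; [exact: LE.1|exact: LE'.1].
have p_tr a E : setT a -> L E -> p (tr act a E) <= p E.
  by move=> _ LE; apply: p_le => g; exact: (le_p (g * a)%g LE).
have Tsub : subgroup_set [set: G] by [].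
have D_p a : p (absf (cob act f a)) <= D a.
  by apply: p_le => g; have /andP[] := FD g a.
have xN n : p (absf (cob act f (x n))) <= C * N n by exact: le_trans (D_p _) _.
have yN n : p (absf (cob act f (y n))) <= C * N n by exact: le_trans (D_p _) _.
have null (z : seqg G) : lcs (pair_gen x y) s z -> forall e, 0 < e ->
    \forall n \near \oo, p (absf (cob act f (z n))) <= e * N n.
  move=> Hz e e0; apply: nearW => n.
  have /Us -> : U s (z n) by apply: (lcs_pointwise HU _ Hz).
  rewrite cob1 // (_ : absf 0 = 0); last by apply/funext => w; exact: normr0.
  by rewrite (sublinear0 L_lin p_sub) mulr_ge0 // ltW.
have [J fr lowJ] := limit_frame actM act1 L_lin Tsub trL absL cobL p_sub p_mono p_tr N0
  (fun=> I) (fun=> I) xN yN null.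
have Gx : pair_gen x y x by apply: gen_in; exact: Or41.
have Gy : pair_gen x y y by apply: gen_in; exact: Or43.
have Gsub := pair_gen_subgroup x y.
have kl : 0 < lam * k by rewrite mulr_gt0.
apply: (commutators_sublinear fr Gx Gy kl) => m; apply: lowJ.
  by apply: subgroup_commg => //; exact: subgroup_expg.
have := low m; apply: filterS => n Hn.
have -> : ([~ ((x : seqg G) ^+ m), ((y : seqg G) ^+ m)] n = [~ (x n ^+ m), (y n ^+ m)])%g.
  rewrite [LHS](_ : _ = [~ (((x : seqg G) ^+ m) n), (((y : seqg G) ^+ m) n)]%g) //.
  by rewrite !seqg_expE.
apply: p_le => g; rewrite -scaleN1r intgZ; last by apply: integ_abs; exact: (cobL I).1.
rewrite mulN1r !mulNr lerN2 -!mulrA.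
have /andP[+ _] := FD g [~ (x n ^+ m), (y n ^+ m)]%g; apply: le_trans.
by rewrite ler_pM2l // mulrA.
Qed.

End orbit.

(** * Functions of class C^k *)

Section directional.
Context {R : realType} {E F : normedModType R}.
Implicit Types (f : E -> F) (a v : E).

Lemma is_deriveP f a v df : is_derive a v f df <->
  forall e : R, 0 < e -> exists2 d : R, 0 < d & forall h : R, h != 0 -> `|h| < d ->
    `|h^-1 *: (f (h *: v + a) - f a) - df| <= e.
Proof.
pose q (h : R) := h^-1 *: ((f \o shift a) (h *: v) - f a).
have key : (q @ 0^' --> df) <-> forall e : R, 0 < e -> exists2 d : R, 0 < d &
    forall h : R, h != 0 -> `|h| < d -> `|h^-1 *: (f (h *: v + a) - f a) - df| <= e.
  split=> [/cvgrPdist_le H e /H | H]; last apply/cvgrPdist_le => e /H.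
    rewrite near_withinE => /nbhs_ballP[d /= d0 Hd]; exists d => // h h0 hd.
    by rewrite distrC; apply: Hd => //; rewrite -ball_normE /= sub0r normrN.
  move=> [d d0 Hd]; rewrite near_withinE; apply/nbhs_ballP; exists d => //= h.
  by rewrite -ball_normE /= sub0r normrN => hd h0; rewrite distrC; exact: Hd.
rewrite -key; split=> [[fd <-]|qdf]; first exact: fd.
split; first by apply/cvg_ex; exists df.
exact: cvg_lim qdf.
Qed.

Lemma is_derive_local f g a v df : (\forall x \near a, f x = g x) ->
  is_derive a v f df -> is_derive a v g df.
Proof. exact: near_eq_is_derive. Qed.

End directional.

(** Restriction of a derivative to an affine image; [A] is the linear part of [b]. Lines, slices of
    products and translations of the parameter are instances. *)
Lemma is_derive_affine (R : realType) (E E' F : normedModType R) (b : E -> E') (A : E -> E')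
    (f : E' -> F) x v df : (forall h : R, b (h *: v + x) = h *: A v + b x) ->
  is_derive (b x) (A v) f df <-> is_derive x v (f \o b) df.
Proof.
by move=> bE; rewrite !is_deriveP; split=> H e /H[d d0 Hd]; exists d => // h h0 /(Hd h h0) /=;
  rewrite bE.
Qed.

Section line.
Context {R : realType} {E : normedModType R}.

Lemma is_derive_line (f : E -> R^o) x v (s : R) df :
  is_derive (s *: v + x) v f df <-> is_derive s 1 (fun s : R => f (s *: v + x)) df.
Proof.
have := @is_derive_affine R R^o E R^o (fun s : R => s *: v + x) (fun s => s *: v) f s 1 df.
by rewrite /= scale1r; apply=> h; rewrite -[h *: 1]/(h * 1) mulr1 scalerDl addrA.
Qed.

Lemma mvt_symmetric (f df : R -> R) (c : R) :
  (forall s : R, `|s| <= `|c| -> is_derive s 1 f (df s)) ->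
  exists2 s, `|s| <= `|c| & f c - f 0 = df s * c.
Proof.
move=> fd.
have cont a b : (forall s, a <= s <= b -> `|s| <= `|c|) -> {within `[a, b], continuous f}.
  move=> ab; apply: derivable_within_continuous => s; rewrite in_itv /= => /ab/fd.
  by move=> h; exact: ex_derive.
have der a b : (forall s, a <= s <= b -> `|s| <= `|c|) ->
    forall s : R, s \in `]a, b[%R -> is_derive s 1 f (df s).
  by move=> ab s; rewrite in_itv /= => /andP[/ltW as_ /ltW sb]; apply/fd/ab; rewrite as_.
have [c0|c0] := leP 0 c.
  have H s : 0 <= s <= c -> `|s| <= `|c| by move=> /andP[s0 sc]; rewrite !ger0_norm.
  have [s] := MVT_segment c0 (der _ _ H) (cont _ _ H).
  by rewrite in_itv /= subr0 => /H sc ->; exists s.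
have H s : c <= s <= 0 -> `|s| <= `|c|.
  by move=> /andP[cs s0]; rewrite !ler0_norm ?lerN2 // ltW.
have [s] := MVT_segment (ltW c0) (der _ _ H) (cont _ _ H).
rewrite in_itv /= sub0r => /H sc E0; exists s => //.
by rewrite -opprB E0 mulrN opprK.
Qed.

End line.

(* A finite-dimensional space is described by a basis [b] and bounded coordinate forms
   [p]; this covers row vectors, the scalars and their products. *)
Definition coordinates (R : realType) (E : normedModType R) (N : nat) (b : 'I_N -> E)
    (p : 'I_N -> E -> R) : Prop :=
  [/\ forall i (t : R) x y, p i (t *: x + y) = t * p i x + p i y,
      forall x, x = \sum_i p i x *: b i &
      exists2 M : R, 0 <= M & forall i x, `|p i x| <= M * `|x|].

Section coordinates.
Context {R : realType} {E : normedModType R} {N : nat} {b : 'I_N -> E} {p : 'I_N -> E -> R}.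
Hypothesis C : coordinates b p.

Lemma coordB i x y : p i (x - y) = p i x - p i y.
Proof.
have [L _ _] := C; have E0 : p i 0 = 0.
  by have := L i 1 0 0; rewrite scale1r addr0 mul1r => h; apply: (@addrI _ (p i 0)); rewrite -h addr0.
by rewrite addrC -scaleN1r L mulN1r addrC.
Qed.

Lemma coordZ i t x : p i (t *: x) = t * p i x.
Proof.
have [L _ _] := C; have := L i t x 0; rewrite !addr0 => ->.
by have := coordB i 0 0; rewrite !subrr => ->; rewrite addr0.
Qed.

Lemma coord_continuous i : continuous (p i).
Proof.
have [_ _ [M M0 HM]] := C; move=> x; apply/cvgrPdist_le => e e0.
have M1 : 0 < M + 1 by rewrite ltr_pwDr.
near=> y; rewrite -coordB (le_trans (HM _ _)) //.
rewrite (@le_trans _ _ ((M + 1) * `|x - y|)) ?ler_wpM2r ?lerDl //.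
rewrite mulrC -ler_pdivlMr //; apply: ltW.
near: y; apply: cvgr_dist_lt; [|exact: divr_gt0]; exact: cvg_id.
Unshelve. all: by end_near. Qed.

(** Strict differentiability: both points vary near [x0]. It yields the chain rule and also the
    local Lipschitz bounds needed for absolutely continuous curves. *)
Definition strict_diff (h : E -> R) (x0 : E) (D : 'I_N -> R) : Prop :=
  forall e : R, 0 < e -> exists2 d : R, 0 < d & forall x y, `|x - x0| < d -> `|y - x0| < d ->
    `|h y - h x - \sum_i p i (y - x) * D i| <= e * `|y - x|.

Lemma C1_strict_diff (h : E -> R) (dh : 'I_N -> E -> R) (U : set E) x0 : open U -> U x0 ->
  (forall i x, U x -> is_derive x (b i) (h : E -> R^o) (dh i x)) ->
  (forall i, {for x0, continuous (dh i)}) ->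
  strict_diff h x0 (fun i => dh i x0).
Proof.
move=> Uo Ux0 hd hc; have [L S [M M0 HM]] := C => e e0.
pose K := \sum_i `|b i|.
have K0 : 0 <= K by apply: sumr_ge0.
pose e' := e / (N%:R * M + 1).
have NM : 0 < N%:R * M + 1 by rewrite ltr_pwDr // mulr_ge0.
have e'0 : 0 < e' by rewrite divr_gt0.
have [r r0 Hr] : exists2 r : R, 0 < r & forall z, `|z - x0| < r -> U z /\
    forall i, `|dh i z - dh i x0| <= e'.
  have : \forall z \near x0, U z /\ forall i, `|dh i z - dh i x0| <= e'.
    apply: filterI; first exact: open_nbhs_nbhs.
    apply: filter_forall => i; have /cvgrPdist_le := hc i => /(_ _ e'0).
    by apply: filterS => z; rewrite distrC.
  move=> /nbhs_ballP[r /= r0 Hr]; exists r => // z zx; apply: Hr.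
  by rewrite -ball_normE /= distrC.
(* Coordinates are moved one at a time, with a mean value in each direction; the base point is
   arbitrary because it moves in the induction. *)
have tel (c : 'I_N -> R) (l : seq 'I_N) x : `|x - x0| + \sum_(j <- l) `|c j| * `|b j| < r ->
    `|h (\sum_(j <- l) c j *: b j + x) - h x - \sum_(j <- l) c j * dh j x0| <=
    e' * \sum_(j <- l) `|c j|.
  elim: l x => [|j l IH] x; first by rewrite !big_nil add0r subrr subr0 normr0 mulr0.
  rewrite !big_cons => xr; set w := \sum_(i <- l) _ *: _.
  have cj0 : 0 <= `|c j| * `|b j| by rewrite mulr_ge0.
  have l0 : 0 <= \sum_(j <- l) `|c j| * `|b j|.
    by apply: sumr_ge0 => i _; rewrite mulr_ge0.
  have inball (s : R) : `|s| <= `|c j| -> `|s *: b j + x - x0| < r.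
    move=> sc; apply: le_lt_trans xr; rewrite -addrA addrC (le_trans (ler_normD _ _)) //.
    by rewrite lerD2l normrZ -[leLHS]addr0 lerD // ler_wpM2r.
  have [s sc Es] := @mvt_symmetric R (fun s => h (s *: b j + x)) (fun s => dh j (s *: b j + x)) (c j)
    (fun s sc => (is_derive_line _ _ _ _ _).1 (hd j _ (Hr _ (inball s sc)).1)).
  rewrite /= scale0r add0r in Es.
  have /IH : `|c j *: b j + x - x0| + \sum_(j <- l) `|c j| * `|b j| < r.
    apply: le_lt_trans xr; rewrite addrA lerD2r -addrA addrC.
    by rewrite (le_trans (ler_normD _ _)) // lerD2l normrZ.
  rewrite -/w addrA [w + _]addrC => H1.
  have -> : h (c j *: b j + w + x) - h x - (c j * dh j x0 + \sum_(i <- l) c i * dh i x0) =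
    (h (c j *: b j + w + x) - h (c j *: b j + x) - \sum_(i <- l) c i * dh i x0) +
    c j * (dh j (s *: b j + x) - dh j x0).
    by rewrite mulrBr [c j * dh _ (_ + _)]mulrC -Es; ring.
  rewrite (le_trans (ler_normD _ _)) // [leRHS]mulrDr [leLHS]addrC lerD //.
  by rewrite normrM mulrC ler_wpM2r //; exact: (Hr _ (inball s sc)).2.
have MK : 0 < 1 + 2 * (M * K) by rewrite ltr_pwDl // !mulr_ge0.
(* Points at distance less than [d] from [x0] are less than 2d apart, so the coordinate path between
   them stays within d + 2 d M K = r of [x0]. *)
pose d := r / (1 + 2 * (M * K)).
have d0 : 0 < d by rewrite divr_gt0.
exists d => // x y xd yd.
have yx : `|y - x| < 2 * d.
  by rewrite -(subrKA x0) (le_lt_trans (ler_normD _ _)) // [`|x0 - x|]distrC mulr2n mulrDl mul1r ltrD.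
have pM j : `|p j (y - x)| <= M * `|y - x| by exact: HM.
have Hr' : `|x - x0| + \sum_j `|p j (y - x)| * `|b j| < r.
  apply: (@le_lt_trans _ _ (`|x - x0| + \sum_j (M * `|y - x|) * `|b j|)).
    by rewrite lerD2l; apply: ler_sum => j _; rewrite ler_wpM2r.
  rewrite -mulr_sumr -/K; have : d * (1 + 2 * (M * K)) = r by rewrite mulfVK // gt_eqF.
  have : M * `|y - x| * K <= M * K * (2 * d).
    by rewrite mulrAC ler_wpM2l ?mulr_ge0 // ltW.
  lra.
have := tel (fun j => p j (y - x)) (index_enum _) x Hr'.
rewrite -(S (y - x)) subrK => /le_trans; apply.
apply: (@le_trans _ _ (e' * (N%:R * M * `|y - x|))).
  rewrite ler_wpM2l ?(ltW e'0) // (le_trans (ler_sum _ (fun j _ => pM j))) //.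
  by rewrite sumr_const card_ord -[leLHS]mulr_natl mulrA.
rewrite mulrA ler_wpM2r // /e' mulrAC ler_pdivrMr // ler_wpM2l ?(ltW e0) //.
by rewrite lerDl.
Qed.

(** Of the inner map only the coordinatewise derivative at [x] in the direction [v] is known; this
    suffices because the outer map is differentiable in the full sense. *)
Lemma strict_diff_chain (E0 : normedModType R) (F : E0 -> E) (dF : 'I_N -> R) (x v : E0)
    (h : E -> R) (D : 'I_N -> R) :
  (forall i, is_derive x v (p i \o F : E0 -> R^o) (dF i)) ->
  strict_diff h (F x) D ->
  is_derive x v (h \o F : E0 -> R^o) (\sum_i dF i * D i).
Proof.
move=> Fd hd; have [L S [M M0 HM]] := C; apply/is_deriveP => e e0.
pose K := \sum_i (`|dF i| + 1) * `|b i|.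
have K0 : 0 <= K by apply: sumr_ge0 => i _; rewrite mulr_ge0 // addr_ge0.
have K1 : 0 < K + 1 by rewrite ltr_pwDr.
have e1 : 0 < e / 2 / (K + 1) by rewrite !divr_gt0.
have [d d0 Hd] := hd _ e1.
pose Q := \sum_i `|D i|.
have Q0 : 0 <= Q by apply: sumr_ge0.
have Q1 : 0 < Q + 1 by rewrite ltr_pwDr.
pose e2 := Num.min 1 (e / 2 / (Q + 1)).
have e20 : 0 < e2 by rewrite lt_min ltr01 !divr_gt0.
have [r r0 Hr] : exists2 r : R, 0 < r & forall t : R, t != 0 -> `|t| < r -> forall i,
    `|t^-1 * (p i (F (t *: v + x)) - p i (F x)) - dF i| <= e2.
  have : forall i, \forall t \near 0^', `|t^-1 * (p i (F (t *: v + x)) - p i (F x)) - dF i| <= e2.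
    move=> i; have /is_deriveP/(_ _ e20)[r r0 Hr] := Fd i.
    rewrite near_withinE; apply/nbhs_ballP; exists r => //= t.
    by rewrite -ball_normE /= sub0r normrN => tr t0; exact: Hr.
  move=> /filter_forall; rewrite near_withinE => /nbhs_ballP[r /= r0 Hr]; exists r => // t t0 tr.
  by apply: Hr => //; rewrite -ball_normE /= sub0r normrN.
exists (Num.min r (d / (K + 1))); first by rewrite lt_min r0 divr_gt0.
move=> t t0; rewrite lt_min => /andP[/(Hr t t0) Ht td].
set y := F (t *: v + x) in Ht *.
have tn : 0 < `|t| by rewrite normr_gt0.
have pc i : `|p i (y - F x)| <= `|t| * (`|dF i| + 1).
  rewrite coordB -ler_pdivrMl // -normfV -normrM.
  rewrite -[_ * _](subrK (dF i)) addrC (le_trans (ler_normD _ _)) // lerD2l.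
  by rewrite (le_trans (Ht i)) // ge_min lexx.
have yF : `|y - F x| <= `|t| * K.
  rewrite [y - F x]S (le_trans (ler_norm_sum _ _ _)) // mulr_sumr; apply: ler_sum => i _.
  by rewrite normrZ mulrA ler_wpM2r.
have yd : `|y - F x| < d.
  apply: (le_lt_trans yF); apply: (@le_lt_trans _ _ (`|t| * (K + 1))).
    by rewrite ler_wpM2l ?lerDl.
  by rewrite -ltr_pdivlMr.
have := Hd (F x) y _ yd; rewrite subrr normr0 => /(_ d0) H1.
rewrite /= -/y; set X := h y - h (F x) in H1 *.
have -> : t^-1 *: X - \sum_i dF i * D i = t^-1 * (X - \sum_i p i (y - F x) * D i) +
   \sum_i (t^-1 * (p i y - p i (F x)) - dF i) * D i.
  rewrite mulrBr mulr_sumr -addrA; congr (_ + _); rewrite -sumrN -sumrN -big_split /=.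
  by apply: eq_bigr => i _; rewrite coordB; ring.
rewrite (le_trans (ler_normD _ _)) // [leRHS]splitr lerD //.
  rewrite normrM normfV ler_pdivrMl // (le_trans H1) //.
  apply: (@le_trans _ _ (e / 2 / (K + 1) * (`|t| * (K + 1)))).
    rewrite ler_wpM2l ?(ltW e1) // (le_trans yF) // ler_wpM2l // lerDl //.
  by rewrite mulrCA mulfVK ?gt_eqF.
rewrite (le_trans (ler_norm_sum _ _ _)) //.
apply: (@le_trans _ _ (\sum_i e / 2 / (Q + 1) * `|D i|)).
  apply: ler_sum => i _; rewrite normrM ler_wpM2r // (le_trans (Ht i)) //.
  by rewrite ge_min lexx orbT.
rewrite -mulr_sumr -/Q mulrAC ler_pdivrMr // ler_wpM2l ?divr_ge0 ?(ltW e0) //.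
by rewrite lerDl.
Qed.

Lemma strict_diff_lipschitz (h : E -> R) x0 D : strict_diff h x0 D ->
  exists2 K : R, 0 <= K & exists2 d : R, 0 < d & forall x y, `|x - x0| < d -> `|y - x0| < d ->
    `|h y - h x| <= K * \sum_i `|p i (y - x)|.
Proof.
move=> hd; have [L S [M M0 HM]] := C; have [d d0 Hd] := hd _ ltr01.
pose K := \sum_i (`|b i| + `|D i|).
have K0 : 0 <= K by apply: sumr_ge0 => i _; rewrite addr_ge0.
exists K => //; exists d => // x y xd yd.
have le_K i : `|b i| + `|D i| <= K.
  by rewrite /K (bigD1 i) //= lerDl; apply: sumr_ge0 => j _; rewrite addr_ge0.
rewrite -[h y - h x](subrK (\sum_i p i (y - x) * D i)) (le_trans (ler_normD _ _)) //.
apply: (@le_trans _ _ (\sum_i `|p i (y - x)| * `|b i| + \sum_i `|p i (y - x)| * `|D i|)).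
  apply: lerD.
    rewrite (le_trans (Hd _ _ xd yd)) // mul1r {1}[y - x]S (le_trans (ler_norm_sum _ _ _)) //.
    by apply: ler_sum => i _; rewrite normrZ.
  by rewrite (le_trans (ler_norm_sum _ _ _)) //; apply: ler_sum => i _; rewrite normrM.
rewrite -big_split mulr_sumr; apply: ler_sum => i _ /=.
by rewrite -mulrDr mulrC ler_wpM2r.
Qed.

End coordinates.

Lemma near_open (T : topologicalType) (U : set T) (P : T -> Prop) x : open U -> U x ->
  (forall y, U y -> P y) -> \forall y \near x, P y.
Proof. by move=> Uo Ux UP; apply: filterS (open_nbhs_nbhs (conj Uo Ux)). Qed.

Lemma within_openP (T S : topologicalType) (U : set T) (f : T -> S) : open U ->
  {within U, continuous f} <-> forall x, U x -> {for x, continuous f}.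
Proof.
move=> Uo; rewrite continuous_open_subspace //; split=> H x; first by move=> Ux; apply: H; rewrite inE.
by rewrite inE; exact: H.
Qed.

Section Ck.
Context {R : realType} {E F : normedModType R}.
Implicit Types (f g : E -> F) (U V : set E).

Lemma Ck_for k U f : open U -> Ck k U f -> forall x, U x -> {for x, continuous f}.
Proof. by move=> Uo; case: k => [|k] [/(within_openP _ Uo) + _]. Qed.

Lemma Ck_derive k U f : Ck k.+1 U f -> forall x v, U x -> is_derive x v f ('D_v f x).
Proof. by move=> [_ H] x v Ux; apply: derivableP; exact: (H v).1. Qed.

Lemma Ck_D k U f v : Ck k.+1 U f -> Ck k U ('D_v f).
Proof. by move=> [_ H]; exact: (H v).2. Qed.

Lemma Ck_ext k U f g : open U -> (forall x, U x -> f x = g x) -> Ck k U f -> Ck k U g.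
Proof.
move=> Uo; have cont j f' g' : (forall x, U x -> f' x = g' x) -> Ck j U f' ->
    {within U, continuous g'}.
  move=> fg Cf; apply/(within_openP _ Uo) => x Ux.
  have fx := Ck_for Uo Cf Ux; rewrite /prop_for /continuous_at -(fg _ Ux).
  by apply: cvg_trans fx; apply: near_eq_cvg; exact: near_open fg.
elim: k f g => [|k IH] f g fg Cf; first by split=> //; exact: cont Cf.
split; first exact: cont Cf.
move=> v; split=> [x Ux|].
  have := is_derive_local (near_open Uo Ux fg) (Ck_derive Cf v Ux).
  by move=> h; exact: ex_derive.
by apply: IH (Ck_D v Cf) => x Ux; apply: near_eq_derive; exact: near_open fg.
Qed.

Lemma CkS k U f : open U -> (forall x, U x -> {for x, continuous f}) ->
  (forall v, exists2 df, forall x, U x -> is_derive x v f (df x) & Ck k U df) ->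
  Ck k.+1 U f.
Proof.
move=> Uo fc fd; split; first exact/within_openP.
move=> v; have [df Hd Hk] := fd v; split=> [x /Hd h|]; first exact: ex_derive.
by apply: Ck_ext Hk => // x /Hd h; rewrite derive_val.
Qed.

Lemma Ck_sub k U V f : open V -> V `<=` U -> Ck k U f -> Ck k V f.
Proof.
move=> Vo VU; elim: k f => [|k IH] f Cf.
  by split=> //; case: Cf => + _; exact: continuous_subspaceW.
have [fc _] := Cf; split; first exact: continuous_subspaceW fc.
by move=> v; split=> [x /VU Ux|]; [exact: (Cf.2 v).1|apply: IH; exact: Ck_D].
Qed.

Lemma Ck_local k U f : open U ->
  (forall x, U x -> exists2 V, open V /\ V x & Ck k V f) -> Ck k U f.
Proof.
move=> Uo; elim: k f => [|k IH] f H.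
  split=> //; apply/(within_openP _ Uo) => x /H[V [Vo Vx] Cf].
  exact: Ck_for Cf _ Vx.
split; first by apply/(within_openP _ Uo) => x /H[V [Vo Vx] Cf]; exact: Ck_for Cf _ Vx.
move=> v; split=> [x /H[V [Vo Vx] Cf]|]; first exact: (Cf.2 v).1.
by apply: IH => x /H[V ? Cf]; exists V => //; exact: Ck_D.
Qed.

Lemma Ck_S k U f : Ck k.+1 U f -> Ck k U f.
Proof.
elim: k f => [|k IH] f Cf; first by split=> //; exact: Cf.1.
by split; [exact: Cf.1|move=> v; split; [exact: (Cf.2 v).1|apply: IH; exact: Ck_D]].
Qed.

Lemma Ck_cst k U (c : F) : open U -> Ck k U (fun=> c).
Proof.
move=> Uo; elim: k c => [|k IH] c.
  by split=> //; apply/(within_openP _ Uo) => x _; exact: cvg_cst.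
apply: CkS => // [x _|v]; first exact: cvg_cst.
by exists (fun=> 0); [move=> x _; exact: is_derive_cst|exact: IH].
Qed.

Lemma Ck_add k U f g : open U -> Ck k U f -> Ck k U g -> Ck k U (f + g).
Proof.
move=> Uo; elim: k f g => [|k IH] f g Cf Cg.
  split=> //; apply/(within_openP _ Uo) => x Ux.
  by apply: continuousD; [exact: (Ck_for Uo Cf)|exact: (Ck_for Uo Cg)].
apply: CkS => // [x Ux|v].
  by apply: continuousD; [exact: (Ck_for Uo Cf)|exact: (Ck_for Uo Cg)].
exists ('D_v f + 'D_v g); last by apply: IH; exact: Ck_D.
move=> x Ux; have df := Ck_derive Cf v Ux; have dg := Ck_derive Cg v Ux.
exact: is_deriveD.
Qed.

End Ck.

Lemma Ck_comp_affine (R : realType) (E E' F : normedModType R) k (U : set E) (f : E -> F)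
    (b A : E' -> E) :
  open U -> continuous b -> (forall (h : R) v x, b (h *: v + x) = h *: A v + b x) ->
  Ck k U f -> Ck k (b @^-1` U) (f \o b).
Proof.
move=> Uo bc bE; have Uo' : open (b @^-1` U) by apply: open_comp => // x _; exact: bc.
have cont (g : E -> F) : (forall x, U x -> {for x, continuous g}) ->
    forall x, (b @^-1` U) x -> {for x, continuous (g \o b)}.
  by move=> gc x Ux; apply: continuous_comp; [exact: bc|exact: gc].
elim: k f => [|k IH] f Cf.
  by split=> //; apply/(within_openP _ Uo'); apply: cont; exact: Ck_for Cf.
apply: CkS => // [|v]; first by apply: cont; exact: Ck_for Cf.
exists ('D_(A v) f \o b) => [x Ux|]; last by apply: IH; exact: Ck_D.
exact: ((@is_derive_affine R E' E F b A f x v _ (fun h => bE h v x)).1 (Ck_derive Cf _ Ux)).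
Qed.

Section Ck_scalar.
Context {R : realType} {E : normedModType R}.
Implicit Types (f g : E -> R^o) (U : set E).

Lemma Ck_mul k U f g : open U -> Ck k U f -> Ck k U g -> Ck k U (f * g : E -> R^o).
Proof.
move=> Uo; elim: k f g => [|k IH] f g Cf Cg.
  split=> //; apply/(within_openP _ Uo) => x Ux.
  by apply: continuousM; [exact: (Ck_for Uo Cf)|exact: (Ck_for Uo Cg)].
apply: CkS => // [x Ux|v].
  by apply: continuousM; [exact: (Ck_for Uo Cf)|exact: (Ck_for Uo Cg)].
exists (fun x => f x * 'D_v g x + g x * 'D_v f x).
  move=> x Ux; have df := Ck_derive Cf v Ux; have dg := Ck_derive Cg v Ux.
  exact: (is_deriveM df dg).
by apply: Ck_add => //; apply: IH; do ?[exact: Ck_D | exact: Ck_S].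
Qed.

Lemma Ck_affine k U (f : E -> R^o) (A : E -> R) : open U -> continuous f ->
  (forall (h : R) v x, f (h *: v + x) = h * A v + f x) -> Ck k U f.
Proof.
move=> Uo fc fA; case: k => [|k]; first by split=> //; apply/within_openP => // x _; exact: fc.
apply: CkS => // [x _|v]; first exact: fc.
exists (fun=> A v); last exact: Ck_cst.
move=> x _; apply/is_deriveP => e e0; exists 1 => // h h0 _.
by rewrite fA addrK -[_ *: _]/(_ * _) mulKf // subrr normr0 ltW.
Qed.

Lemma Ck_sum k U N (f : 'I_N -> E -> R^o) : open U -> (forall i, Ck k U (f i)) ->
  Ck k U (\sum_i f i).
Proof.
move=> Uo fC; apply: (big_ind (fun f => Ck k U f)) => //; first exact: Ck_cst.
by move=> g h; exact: Ck_add.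
Qed.

Lemma double_mvt U f x v w (s t : R) : open U -> Ck 2 U f ->
  (forall s' t', `|s'| <= `|s| -> `|t'| <= `|t| -> U (s' *: v + (t' *: w + x))) ->
  exists s' t', [/\ `|s'| <= `|s|, `|t'| <= `|t| &
    f (s *: v + (t *: w + x)) - f (s *: v + x) - (f (t *: w + x) - f x) =
    s * t * 'D_w ('D_v f) (s' *: v + (t' *: w + x))].
Proof.
move=> Uo Cf H; have n0 (r : R) : `|0 : R| <= `|r| by rewrite normr0.
have H0 s' : `|s'| <= `|s| -> U (s' *: v + x).
  by move=> hs; have := H s' 0 hs (n0 _); rewrite scale0r add0r.
have [|s' hs' E1] := @mvt_symmetric R (fun s => f (s *: v + (t *: w + x)) - f (s *: v + x))
    (fun s => 'D_v f (s *: v + (t *: w + x)) - 'D_v f (s *: v + x)) s.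
  move=> s' hs'.
  have d1 := (is_derive_line f (t *: w + x) v s' _).1 (Ck_derive Cf v (H s' t hs' (lexx _))).
  have d2 := (is_derive_line f x v s' _).1 (Ck_derive Cf v (H0 s' hs')).
  exact: (is_deriveB d1 d2).
have [|t' ht' E2] := @mvt_symmetric R (fun t => 'D_v f (s' *: v + (t *: w + x)))
    (fun t => 'D_w ('D_v f) (s' *: v + (t *: w + x))) t.
  move=> t' ht'; have U' : U (t' *: w + (s' *: v + x)) by rewrite addrCA; exact: H.
  have := (is_derive_line ('D_v f) (s' *: v + x) w t' _).1 (Ck_derive (Ck_D v Cf) w U').
  rewrite [t' *: w + _]addrCA.
  by under eq_fun do rewrite addrCA.
exists s', t'; split=> //; move: E1; rewrite /= !scale0r !add0r => ->.
by move: E2; rewrite /= !scale0r !add0r => ->; rewrite -mulrA mulrC [t * s]mulrC.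
Qed.

(** One second difference is evaluated by [double_mvt] in both orders, which equates the two mixed
    derivatives at two points near [x]. *)
Lemma schwarz U f x v w : open U -> Ck 2 U f -> U x ->
  'D_w ('D_v f) x = 'D_v ('D_w f) x.
Proof.
move=> Uo Cf Ux; apply/eqP; rewrite -subr_eq0 -normr_le0; apply/ler_addgt0Pr => e e0.
rewrite add0r; have e2 : 0 < e / 2 by rewrite divr_gt0.
have c1 : {for x, continuous ('D_w ('D_v f))} by apply: (Ck_for Uo (Ck_D w (Ck_D v Cf))).
have c2 : {for x, continuous ('D_v ('D_w f))} by apply: (Ck_for Uo (Ck_D v (Ck_D w Cf))).
have : \forall y \near x, [/\ U y, `|'D_w ('D_v f) x - 'D_w ('D_v f) y| <= e / 2 &
    `|'D_v ('D_w f) x - 'D_v ('D_w f) y| <= e / 2].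
  have /cvgrPdist_le/(_ _ e2) n1 := c1.
  have /cvgrPdist_le/(_ _ e2) n2 := c2.
  by apply: filterS3 (open_nbhs_nbhs (conj Uo Ux)) n1 n2 => y Uy h1 h2; exact: (And3 Uy h1 h2).
move=> /nbhs_ballP[r /= r0 Hr].
pose K := `|v| + `|w| + 1; have K0 : 0 < K by rewrite ltr_pwDr // addr_ge0.
pose s := r / 2 / K; have s0 : 0 < s by rewrite !divr_gt0.
have ball_in a b : `|a| <= `|s| -> `|b| <= `|s| -> ball x r (a *: v + (b *: w + x)).
  rewrite (gtr0_norm s0) => ha hb; rewrite -ball_normE /= distrC addrA addrK.
  apply: (@le_lt_trans _ _ (s * K)); last by rewrite mulfVK ?gt_eqF // ltr_pdivrMr // ltr_pMr // ltr1n.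
  rewrite (le_trans (ler_normD _ _)) // !normrZ /K !mulrDr mulr1 -[leLHS]addr0.
  by rewrite !lerD ?(ltW s0) // ler_wpM2r.
have [a [b [ha hb Ea]]] := @double_mvt U f x v w s s Uo Cf
  (fun a b ha hb => let: And3 h _ _ := Hr _ (ball_in a b ha hb) in h).
have [|a' [b' [ha' hb' Eb]]] := @double_mvt U f x w v s s Uo Cf.
  by move=> a' b' h1 h2; have [+ _ _] := Hr _ (ball_in b' a' h2 h1); rewrite addrCA.
have [_ h1 _] := Hr _ (ball_in a b ha hb).
have [_ _ h2] := Hr _ (ball_in b' a' hb' ha').
have Eab : 'D_w ('D_v f) (a *: v + (b *: w + x)) = 'D_v ('D_w f) (b' *: v + (a' *: w + x)).
  have ss : s * s != 0 by rewrite mulf_neq0 // gt_eqF.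
  rewrite [a' *: w + _]addrCA [s *: w + _]addrCA in Eb.
  apply: (mulfI ss); apply: (etrans (esym Ea)); apply: etrans Eb.
  by rewrite !opprB addrACA [RHS]addrACA; congr (_ + _); rewrite addrC.
rewrite Eab in h1; move: h1 h2.
move: ('D_w ('D_v f) x) ('D_v ('D_w f) x) ('D_v ('D_w f) (b' *: v + (a' *: w + x))) => A A' B h1 h2.
rewrite -(subrKA B) [leRHS]splitr (le_trans (ler_normD _ _)) //.
by apply: lerD => //; rewrite distrC.
Qed.

End Ck_scalar.

Section Ck_chain.
Context {R : realType} {E E0 : normedModType R} {N : nat} {b : 'I_N -> E} {p : 'I_N -> E -> R}.
Hypothesis C : coordinates b p.

Lemma Ck_strict_diff (h : E -> R^o) U x : open U -> Ck 1 U h -> U x ->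
  strict_diff (p := p) h x (fun i => 'D_(b i) h x).
Proof.
move=> Uo Ch Ux; apply: (C1_strict_diff C (dh := fun i => 'D_(b i) h) Uo Ux).
  by move=> i y Uy; exact: (Ck_derive Ch).
by move=> i; apply: (Ck_for Uo (Ck_D (b i) Ch)).
Qed.

Lemma coord_comp_continuous (F : E0 -> E) x :
  (forall i, {for x, continuous (p i \o F)}) -> {for x, continuous F}.
Proof.
have [L S [M M0 HM]] := C; move=> Fc; apply/cvgrPdist_le => e e0.
pose K := \sum_i `|b i| + 1; have K0 : 0 < K by rewrite ltr_pwDr // sumr_ge0.
have eK : 0 < e / K by rewrite divr_gt0.
have : \forall y \near x, forall i, `|p i (F x) - p i (F y)| <= e / K.
  by apply: filter_forall => i; have /cvgrPdist_le := Fc i; exact.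
apply: filterS => y Hy; rewrite [F x - F y]S (le_trans (ler_norm_sum _ _ _)) //.
apply: (@le_trans _ _ (\sum_i e / K * `|b i|)).
  by apply: ler_sum => i _; rewrite normrZ (coordB C) ler_wpM2r.
rewrite -mulr_sumr mulrAC ler_pdivrMr // ler_wpM2l ?(ltW e0) //.
by rewrite lerDl.
Qed.

(** A derivative of the composite is a sum of products of derivatives of the coordinates with
    composites of partial derivatives of [h], so the induction is on [k] with [h] general. *)
Theorem Ck_chain k (U : set E0) (W : set E) (F : E0 -> E) (h : E -> R^o) :
  open U -> open W -> F @` U `<=` W -> (forall i, Ck k U (p i \o F : E0 -> R^o)) ->
  Ck k W h -> Ck k U (h \o F).
Proof.
move=> Uo Wo FW; have inW x : U x -> W (F x) by move=> Ux; apply: FW; exists x.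
elim: k h => [|k IH] h FC Ch.
  split=> //; apply/(within_openP _ Uo) => x Ux.
  apply: continuous_comp; last exact: (Ck_for Wo Ch (inW _ Ux)).
  by apply: coord_comp_continuous => i; exact: (Ck_for Uo (FC i)).
apply: CkS => // [x Ux|v].
  apply: continuous_comp; last exact: (Ck_for Wo Ch (inW _ Ux)).
  by apply: coord_comp_continuous => i; exact: (Ck_for Uo (FC i)).
exists (\sum_i ('D_v (p i \o F : E0 -> R^o) * ('D_(b i) h \o F : E0 -> R^o) : E0 -> R^o)); last first.
  apply: Ck_sum => // i; apply: Ck_mul => //; first exact: Ck_D.
  by apply: IH => [j|]; [exact: Ck_S|exact: Ck_D].
move=> x Ux; rewrite fct_sumE; apply: (strict_diff_chain C (D := fun i => 'D_(b i) h (F x))).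
  by move=> i; exact: Ck_derive (FC i) _ _ Ux.
apply: (@Ck_strict_diff h W) => //; last exact: inW.
by elim: (k) Ch => // j IHj /Ck_S/IHj.
Qed.

End Ck_chain.

Lemma mx_coord_le (R : realType) n (x : 'rV[R]_n) i : `|x ord0 i| <= `|x|.
Proof.
rewrite [leRHS](_ : _ = mx_norm x) // mx_normrE.
by rewrite (bigD1 (ord0, i)) //= le_max lexx.
Qed.

Lemma mx_norm_le (R : realType) n (x : 'rV[R]_n) (M : R) : 0 <= M ->
  (forall i, `|x ord0 i| <= M) -> `|x| <= M.
Proof.
move=> M0 H; rewrite [leLHS](_ : _ = mx_norm x) // mx_normrE.
apply: (big_ind (fun y => y <= M)) => // [a b aM bM|[i j] _ /=]; first by rewrite ge_max aM.
by rewrite ord1.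
Qed.

Lemma rV_coordinates (R : realType) n :
  coordinates (fun i : 'I_n => delta_mx ord0 i : 'rV[R]_n) (fun i x => x ord0 i).
Proof.
split; [by move=> i t x y; rewrite !mxE|by move=> x; exact: row_sum_delta|].
by exists 1 => // i x; rewrite mul1r; exact: mx_coord_le.
Qed.

Lemma scalar_coordinates (R : realType) :
  coordinates (fun _ : 'I_1 => 1 : R^o) (fun _ (x : R^o) => x : R).
Proof.
split=> [//|x|]; first by rewrite big_ord1 -[_ *: _]/(_ * _) mulr1.
by exists 1 => // i x; rewrite mul1r.
Qed.

Section prod_coordinates.
Context {R : realType} {E F : normedModType R} {N M : nat}.
Context {b : 'I_N -> E} {p : 'I_N -> E -> R} {b' : 'I_M -> F} {p' : 'I_M -> F -> R}.

Definition prod_basis (i : 'I_(N + M)) : E * F :=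
  match fintype.split i with inl j => (b j, 0) | inr j => (0, b' j) end.
Definition prod_coord (i : 'I_(N + M)) (x : E * F) : R :=
  match fintype.split i with inl j => p j x.1 | inr j => p' j x.2 end.

Lemma prod_coordinates : coordinates b p -> coordinates b' p' ->
  coordinates prod_basis prod_coord.
Proof.
move=> [L S [K K0 HK]] [L' S' [K' K'0 HK']]; split.
- by move=> i t x y; rewrite /prod_coord; case: fintype.split => j; [exact: L|exact: L'].
- move=> x; rewrite big_split_ord /=.
  under eq_bigr do rewrite /prod_coord /prod_basis (unsplitK (inl _ : 'I_N + 'I_M)%type).
  under [X in _ + X]eq_bigr do rewrite /prod_coord /prod_basis (unsplitK (inr _ : 'I_N + 'I_M)%type).
  have fst_sum k (f : 'I_k -> E * F) : (\sum_i f i).1 = \sum_i (f i).1.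
    by apply: (big_morph fst).
  have snd_sum k (f : 'I_k -> E * F) : (\sum_i f i).2 = \sum_i (f i).2.
    by apply: (big_morph snd).
  rewrite [LHS]surjective_pairing; congr pair => /=.
    rewrite !fst_sum [X in _ + X]big1 ?addr0; first exact: S.
    by move=> i _; rewrite /= scaler0.
  rewrite !snd_sum [X in X + _]big1 ?add0r; first exact: S'.
  by move=> i _; rewrite /= scaler0.
- exists (K + K') => [|i x]; first exact: addr_ge0.
  have n1 : `|x.1| <= `|x| by rewrite prod_normE le_max lexx.
  have n2 : `|x.2| <= `|x| by rewrite prod_normE le_max lexx orbT.
  rewrite /prod_coord; case: fintype.split => j; rewrite mulrDl.
    rewrite (le_trans (HK _ _)) // -[leLHS]addr0 lerD //; first exact: ler_wpM2l.
    by rewrite mulr_ge0.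
  rewrite (le_trans (HK' _ _)) // -[leLHS]add0r lerD //; last exact: ler_wpM2l.
  by rewrite mulr_ge0.
Qed.

End prod_coordinates.

Lemma is_derive_scale (R : realType) (f : R -> R) (x v df : R) :
  is_derive x 1 f df -> is_derive x v f (v * df).
Proof.
move=> fd; have dx : differentiable f x by apply/derivable1_diffP.
apply: DeriveDef; first exact: diff_derivable.
rewrite deriveE // -[v in LHS]mulr1 -[v * 1]/(v *: 1) linearZ -deriveE //.
by rewrite derive_val.
Qed.

Lemma Ck_real (R : realType) k (f df : R -> R) : (forall x : R, is_derive x 1 f (df x)) ->
  Ck k setT (df : R^o -> R^o) -> Ck k.+1 setT (f : R^o -> R^o).
Proof.
move=> fd Cdf; apply: CkS; [exact: openT| |].
  by move=> x _; apply: differentiable_continuous; apply/derivable1_diffP; exact: ex_derive.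
move=> v; exists (cst v * df : R^o -> R^o); first by move=> x _; exact: is_derive_scale.
by apply: Ck_mul; [exact: openT|apply: Ck_cst; exact: openT|].
Qed.

Lemma Ck_inv (R : realType) (E : normedModType R) k (U : set E) (f : E -> R^o) : open U ->
  (forall x, U x -> f x != 0) -> Ck k U f -> Ck k U (fun x => (f x)^-1 : R^o).
Proof.
move=> Uo f0; elim: k => [|k IH] Cf.
  split=> //; apply/(within_openP _ Uo) => x Ux.
  by apply: cvgV; [exact: f0|exact: (Ck_for Uo Cf)].
apply: CkS => // [x Ux|v].
  by apply: cvgV; [exact: f0|exact: (Ck_for Uo Cf)].
have Ci := IH (Ck_S Cf).
exists (fun x => - (((f x)^-1 * (f x)^-1) * 'D_v f x)).
  move=> x Ux; have [df _] := Ck_derive Cf v Ux.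
  have fx0 : f x != 0 by exact: f0.
  apply: DeriveDef; first exact: derivableV.
  by rewrite deriveV // -[_ *: _]/(_ * _) mulNr; congr (- (_ * _)); rewrite expr2 invfM.
rewrite (_ : (fun x => _) = cst (-1) * ((fun x => (f x)^-1) * (fun x => (f x)^-1) * 'D_v f)).
  by do ?[apply: Ck_mul => //]; [exact: Ck_cst|exact: Ck_D].
by apply/funext => x; rewrite !fctE mulN1r.
Qed.

(** * Flat functions and bump functions *)

Section flat.
Context {R : realType}.

(** The polynomial factor makes the family closed under differentiation, with [flat_next] giving the
    new polynomial; smoothness is then a plain induction. *)
Definition flat (P : {poly R}) (x : R) : R :=
  if 0 < x then P.[x^-1] * expR (- x^-1) else 0.

(** From e^y >= y^(m+1)/(m+1)! at y = 1/x. Applied to ['X * P], whose flat function is the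
    difference quotient at 0, it shows that the derivative there is 0. *)
Lemma flat_bound (P : {poly R}) : exists2 C : R, 0 <= C &
  forall x, `|x| <= 1 -> `|flat P x| <= C * `|x|.
Proof.
pose m := size P; pose S := \sum_(i < m) `|P`_i|.
have S0 : 0 <= S by apply: sumr_ge0.
exists (S * m.+1`!%:R) => [|x x1]; first by rewrite mulr_ge0.
rewrite /flat; case: ifPn => [x0|_]; last by rewrite normr0 mulr_ge0 // mulr_ge0.
rewrite gtr0_norm // in x1; have y1 : 1 <= x^-1 by rewrite invf_ge1.
set y := x^-1 in y1 *; have y0 : 0 < y by rewrite invr_gt0.
have Py : `|P.[y]| <= S * y ^+ m.
  rewrite horner_coef (le_trans (ler_norm_sum _ _ _)) // mulr_suml; apply: ler_sum => i _.
  rewrite normrM ler_wpM2l // normrX gtr0_norm // ler_weXn2l //; exact: ltnW.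
have Ey : y ^+ m.+1 / m.+1`!%:R <= expR y.
  by rewrite (le_trans _ (expR_ge1Dxn m (ltW y0))) // lerDr.
have e0 : 0 < expR y by exact: expR_gt0.
rewrite normrM expRN [`|_^-1|]gtr0_norm ?invr_gt0 // ler_pdivrMr // (le_trans Py) //.
rewrite (gtr0_norm x0) -!mulrA ler_wpM2l //.
apply: (@le_trans _ _ (m.+1`!%:R * (x * (y ^+ m.+1 / m.+1`!%:R)))); last first.
  by rewrite ler_wpM2l // ler_wpM2l // ltW.
have f0 : m.+1`!%:R != 0 :> R by rewrite pnatr_eq0 -lt0n fact_gt0.
have xy : x * y = 1 by rewrite mulfV // gt_eqF.
have -> : m.+1`!%:R * (x * (y ^+ m.+1 / m.+1`!%:R)) = y ^+ m * (x * y) * (m.+1`!%:R / m.+1`!%:R).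
  by rewrite exprS; ring.
by rewrite xy mulfV // !mulr1.
Qed.

Definition flat_next (P : {poly R}) : {poly R} := 'X ^+ 2 * (P - P^`()).

Lemma flat_derive (P : {poly R}) (x : R) : is_derive x 1 (flat P) (flat (flat_next P) x).
Proof.
have [x0|x0|x0] := ltgtP 0 x.
- have x_neq0 : x != 0 by rewrite gt_eqF.
  have dV : is_derive x 1 (fun x : R => x^-1) (- (x^-1 ^+ 2)).
    apply: DeriveDef; first exact: derivableV.
    by rewrite deriveV // derive_id -[_ *: _]/(_ * _) mulr1 exprVn.
  have dP : is_derive x 1 (horner P \o (fun x : R => x^-1)) ((P^`()).[x^-1] * - (x^-1 ^+ 2)).
    exact: is_derive1_comp.
  have dN : is_derive x 1 (fun x : R => - x^-1) (- - (x^-1 ^+ 2)) by exact: is_deriveN.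
  have dE : is_derive x 1 (expR \o (fun x : R => - x^-1)) (expR (- x^-1) * - - (x^-1 ^+ 2)).
    exact: is_derive1_comp.
  have := is_deriveM dP dE.
  rewrite -[_ *: _ + _ *: _]/(P.[x^-1] * (expR (- x^-1) * - - (x^-1 ^+ 2)) +
    expR (- x^-1) * ((P^`()).[x^-1] * - (x^-1 ^+ 2))).
  have -> : P.[x^-1] * (expR (- x^-1) * - - (x^-1 ^+ 2)) +
    expR (- x^-1) * ((P^`()).[x^-1] * - (x^-1 ^+ 2)) = flat (flat_next P) x.
    by rewrite /flat x0 /flat_next hornerM hornerXn hornerD hornerN; ring.
  apply: is_derive_local.
  have Uo : open [set y : R | 0 < y] by exact: open_gt.
  have UP (y : R) : [set y : R | 0 < y] y -> P.[y^-1] * expR (- y^-1) = flat P y.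
    by move=> /= y0; rewrite /flat y0.
  exact: near_open Uo x0 UP.
- apply: (@is_derive_local _ _ _ (cst 0)).
    have Uo : open [set y : R | y < 0] by exact: open_lt.
    have UP (y : R) : [set y : R | y < 0] y -> cst 0 y = flat P y.
      by move=> /= y0; rewrite /flat ltNge (ltW y0).
    exact: near_open Uo x0 UP.
  by rewrite /flat ltNge (ltW x0) /=; exact: is_derive_cst.
- rewrite -x0; have [C C0 HC] := flat_bound ('X * P).
  apply/is_deriveP => e e0; exists (Num.min 1 (e / (C + 1))).
    by rewrite lt_min ltr01 divr_gt0 // ltr_pwDr.
  have C1 : 0 < C + 1 by rewrite ltr_pwDr.
  move=> h h0; rewrite lt_min => /andP[/ltW h1 he].
  rewrite /= addr0 -[h *: 1]/(h * 1) mulr1 [flat P 0]/flat [flat _ 0]/flat ltxx !subr0.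
  have -> : h^-1 *: flat P h = flat ('X * P) h.
    rewrite /flat; case: ifP => _; last by rewrite scaler0.
    by rewrite hornerM hornerX -mulrA.
  rewrite (le_trans (HC h h1)) // (@le_trans _ _ ((C + 1) * `|h|)) //.
    by rewrite ler_wpM2r // lerDl.
  by rewrite mulrC -ler_pdivlMr // ltW.
Qed.

Lemma Ck_flat k P : Ck k setT (flat P : R^o -> R^o).
Proof.
elim: k P => [|k IH] P; last exact: Ck_real (flat_derive P) (IH _).
split=> //; apply/(within_openP _ openT) => x _.
by apply: differentiable_continuous; apply/derivable1_diffP; have [] := flat_derive P x.
Qed.

End flat.

Section bump.
Context {R : realType}.

Definition plateau (t : R) : R := flat 1 (2 - t) / (flat 1 (2 - t) + flat 1 (t - 1)).

Lemma flat1_ge0 (x : R) : 0 <= flat 1 x.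
Proof. by rewrite /flat; case: ifP => // _; rewrite hornerC mul1r expR_ge0. Qed.

Lemma flat1_gt0 (x : R) : 0 < x -> 0 < flat 1 x.
Proof. by rewrite /flat => ->; rewrite hornerC mul1r expR_gt0. Qed.

Lemma flat1_eq0 (x : R) : x <= 0 -> flat 1 x = 0.
Proof. by rewrite /flat ltNge => ->. Qed.

Lemma plateau_eq1 (t : R) : t <= 1 -> plateau t = 1.
Proof.
move=> t1; have t0 : t - 1 <= 0 by rewrite subr_le0.
rewrite /plateau (flat1_eq0 t0) addr0 mulfV // gt_eqF //.
by apply: flat1_gt0; lra.
Qed.

Lemma plateau_eq0 (t : R) : 2 <= t -> plateau t = 0.
Proof. by move=> t2; rewrite /plateau flat1_eq0 ?mul0r // subr_le0. Qed.

Lemma Ck_plateau k : Ck k setT (plateau : R^o -> R^o).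
Proof.
have C1 : Ck k setT (fun t : R^o => flat 1 (2 - t) : R^o).
  rewrite -[setT](preimage_setT (fun t : R^o => 2 - t : R^o)).
  apply: (@Ck_comp_affine _ R^o R^o R^o k setT (flat 1 : R^o -> R^o) (fun t => 2 - t) (fun t => - t)).
  - exact: openT.
  - by move=> x; apply: cvgB; [exact: cvg_cst|exact: cvg_id].
  - by move=> h v x; rewrite -![_ *: _]/(_ * _); ring.
  - exact: Ck_flat.
have C2 : Ck k setT (fun t : R^o => flat 1 (t - 1) : R^o).
  rewrite -[setT](preimage_setT (fun t : R^o => t - 1 : R^o)).
  apply: (@Ck_comp_affine _ R^o R^o R^o k setT (flat 1 : R^o -> R^o) (fun t => t - 1) (fun t => t)).
  - exact: openT.
  - by move=> x; apply: cvgB; [exact: cvg_id|exact: cvg_cst].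
  - by move=> h v x; rewrite -![_ *: _]/(_ * _); ring.
  - exact: Ck_flat.
apply: (Ck_mul openT C1); apply: (Ck_inv openT); last exact: (Ck_add openT C1 C2).
move=> t _; rewrite gt_eqF //; have [t2|t2] := ltP t 2.
  by rewrite ltr_pwDl ?flat1_ge0 // flat1_gt0 // subr_gt0.
by rewrite ltr_pwDr ?flat1_ge0 // flat1_gt0 // subr_gt0 (lt_le_trans _ t2) // ltr1n.
Qed.

(** A product over the squared coordinates avoids the norm, which is not smooth. The plateau
    function falls from 1 at 1 to 0 at 2, and (3/2)^2 exceeds 2, whence the radius of the
    support. *)
Lemma bump_exists n (p : 'rV[R]_n) (r : R) : 0 < r -> exists eta : 'rV[R]_n -> R,
  [/\ forall k, Ck k setT (eta : 'rV[R]_n -> R^o),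
      forall x, `|x - p| <= r -> eta x = 1 &
      forall x, eta x != 0 -> `|x - p| <= 3 / 2 * r].
Proof.
move=> r0; pose q (i : 'I_n) (x : 'rV[R]_n) : R^o := ((x ord0 i - p ord0 i) / r) ^+ 2.
exists (fun x => \prod_i plateau (q i x)); split.
- move=> k; rewrite (_ : (fun x => _) = \prod_i ((plateau : R^o -> R^o) \o q i)); last first.
    by apply/funext => x; rewrite fct_prodE.
  apply: (big_ind (fun f : 'rV[R]_n -> R^o => Ck k setT f)); first exact: (Ck_cst k _ openT).
    by move=> f g; apply: Ck_mul; exact: openT.
  move=> i _; apply: (Ck_chain (scalar_coordinates R) openT openT) => // [j|]; last exact: Ck_plateau.
  have Ca : Ck k setT (fun x : 'rV[R]_n => (x ord0 i - p ord0 i) / r : R^o).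
    apply: (@Ck_affine R 'rV[R]_n k setT (fun x => (x ord0 i - p ord0 i) / r : R^o)
      (fun x => x ord0 i / r)); first exact: openT.
      move=> x; have cx : {for x, continuous (fun x : 'rV[R]_n => x ord0 i)}.
        exact: (coord_continuous (rV_coordinates R n)).
      apply: (@continuousM _ _ (fun x : 'rV[R]_n => x ord0 i - p ord0 i) (cst r^-1)); last exact: cst_continuous.
      by apply: (@continuousB _ _ _ (fun x : 'rV[R]_n => x ord0 i : R^o) (cst (p ord0 i))) => //; exact: cst_continuous.
    by move=> h v x; rewrite !mxE; ring.
  have := Ck_mul openT Ca Ca; apply: Ck_ext; first exact: openT.
  by move=> x _; rewrite /= /q expr2.
- move=> x xp; apply: big1 => i _; apply: plateau_eq1.
  rewrite /q -real_normK ?num_real // normrM normfV (gtr0_norm r0).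
  rewrite exprn_ile1 ?divr_ge0 ?(ltW r0) // ler_pdivrMr // mul1r (le_trans _ xp) //.
  by have := mx_coord_le (x - p) i; rewrite !mxE.
- move=> x /prodf_neq0 H; apply: mx_norm_le => [|i]; first by rewrite mulr_ge0 ?divr_ge0 ?(ltW r0).
  have := H i isT; apply: contraNT; rewrite -ltNge !mxE => xi; apply/eqP/plateau_eq0.
  rewrite /q -real_normK ?num_real // normrM normfV (gtr0_norm r0).
  have : 3 / 2 <= `|x ord0 i - p ord0 i| / r by rewrite ler_pdivlMr // ltW.
  by move=> h; rewrite expr2; nra.
Qed.

End bump.

(** * Integrals along segments, for Hadamard's lemma *)

Section segment_integral.
Context {R : realType} {E : normedModType R}.
Local Notation mu := (@lebesgue_measure R).
Let I01 : set R := `[0, 1]%classic.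

Let compact01 : compact I01. Proof. exact: segment_compact. Qed.
Let meas01 : measurable (I01 : set (measurableTypeR R)). Proof. exact: measurable_itv. Qed.

(** Tube lemma: compactness of the segment makes the neighbourhood uniform in [t]. *)
Lemma segment_uniform (U : set E) (g : E -> R) (x p : E) (e : R) : open U ->
  (forall z, U z -> {for z, continuous g}) -> (forall t, I01 t -> U (t *: (x - p) + p)) ->
  0 < e -> exists2 d : R, 0 < d & forall t y, I01 t -> `|y| < d ->
    U (t *: (x - p) + p + y) /\ `|g (t *: (x - p) + p + y) - g (t *: (x - p) + p)| <= e.
Proof.
move=> Uo gc xU e0; have e2 : 0 < e / 2 by rewrite divr_gt0.
pose c t := t *: (x - p) + p.
have cc : continuous (fun ty : R * E => c ty.1 + ty.2).
  move=> ty; apply: cvgD; last exact: cvg_snd.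
  by apply: cvgD; [apply: cvgZl; exact: cvg_fst|exact: cvg_cst].
have /compact_near_coveringP nc := compact01.
have := nc E (nbhs (0 : E)) (fun y t => U (c t + y) /\ `|g (c t + y) - g (c t)| <= e) (nbhs_filter (0 : E)).
have : forall t, I01 t -> \forall t' \near t & y \near (0 : E),
    U (c t' + y) /\ `|g (c t' + y) - g (c t')| <= e.
  move=> t It; have Uc : U (c t) by exact: xU.
  have Hz : \forall z \near c t, U z /\ `|g (c t) - g z| <= e / 2.
    apply: filterI; first exact: open_nbhs_nbhs.
    by have /cvgrPdist_le := gc _ Uc; exact.
  have E0 : c t + 0 = c t by rewrite addr0.
  have H1 : \forall ty \near (t, (0 : E)), U (c ty.1 + ty.2) /\ `|g (c t) - g (c ty.1 + ty.2)| <= e / 2.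
    by have := cc (t, 0); rewrite /continuous_at /= E0 => /(_ _ Hz).
  have H2 : \forall ty \near (t, (0 : E)), U (c ty.1 + 0) /\ `|g (c t) - g (c ty.1 + 0)| <= e / 2.
    have : continuous (fun ty : R * E => c ty.1 + 0).
      move=> ty; apply: cvgD; last exact: cvg_cst.
      by apply: cvgD; [apply: cvgZl; exact: cvg_fst|exact: cvg_cst].
    by move=> /(_ (t, 0)); rewrite /continuous_at /= E0 => /(_ _ Hz).
  apply: filterS2 H1 H2 => -[t' y] /= [U1 h1] [_]; rewrite addr0 => h2; split=> //.
  rewrite -(subrKA (g (c t))) [leRHS]splitr (le_trans (ler_normD _ _)) // lerD //.
  by rewrite distrC.
move=> H /(_ H) /nbhs_ballP[d /= d0 Hd]; exists d => // t y It yd.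
by apply: (Hd y); rewrite // -ball_normE /= sub0r normrN.
Qed.

(** With a weight [w] the derivative is again of this form, with weight t w(t) and the derivative of
    [g]; so regularity follows by induction. *)
Definition segment_integral (p : E) (w : R -> R) (g : E -> R) (x : E) : R :=
  \int[mu]_(t in I01) (w t * g (t *: (x - p) + p)).

Context (U : set E) (p : E).
Hypothesis Uo : open U.
Hypothesis Ustar : forall x t, U x -> I01 t -> U (t *: (x - p) + p).

Let seg_cont (g : E -> R) x : (forall z, U z -> {for z, continuous g}) -> U x ->
  forall t, I01 t -> {for t, continuous (fun t : R => g (t *: (x - p) + p))}.
Proof.
move=> gc Ux t It; apply: (@continuous_comp _ _ _ (fun t : R => t *: (x - p) + p) g).
  by apply: cvgD; [apply: cvgZl; exact: cvg_id|exact: cvg_cst].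
exact/gc/Ustar.
Qed.

Let int_cont (F : R -> R) : (forall t, I01 t -> {for t, continuous F}) ->
  mu.-integrable I01 (EFin \o F).
Proof.
move=> Fc; apply: continuous_compact_integrable; first exact: compact01.
by apply: continuous_in_subspaceT => t; rewrite inE; exact: Fc.
Qed.

Let wg_int (w : R -> R) (g : E -> R) x : continuous w -> (forall z, U z -> {for z, continuous g}) -> U x ->
  mu.-integrable I01 (EFin \o (fun t => w t * g (t *: (x - p) + p))).
Proof.
move=> wc gc Ux; apply: int_cont => t It; apply: continuousM; first exact: wc.
exact: seg_cont.
Qed.

Let int_sub (F G : R -> R) : mu.-integrable I01 (EFin \o F) -> mu.-integrable I01 (EFin \o G) ->
  mu.-integrable I01 (EFin \o (fun t => F t - G t)).
Proof.
move=> iF iG; have -> : EFin \o (fun t => F t - G t) = ((EFin \o F) \- (EFin \o G))%E by [].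
exact: integrableB.
Qed.

Let int_scale (a : R) (F : R -> R) : mu.-integrable I01 (EFin \o F) ->
  mu.-integrable I01 (EFin \o (fun t => a * F t)).
Proof.
move=> iF; have -> : EFin \o (fun t => a * F t) = (fun t => a%:E * (EFin \o F) t)%E by [].
exact: integrableZl.
Qed.

Let mu01 : fine (mu I01) = 1.
Proof. by rewrite /I01 lebesgue_measure_itv /= lte_fin ltr01 -EFinB subr0. Qed.

Let int_small (F : R -> R) e : mu.-integrable I01 (EFin \o F) ->
  (forall t, I01 t -> `|F t| <= e) -> `|\int[mu]_(t in I01) F t| <= e.
Proof.
move=> iF Fe; apply: (le_trans (le_normr_Rintegral _ iF)) => //.
rewrite -[leRHS]mulr1 -mu01 -Rintegral_cst //; apply: le_Rintegral => //.
  exact: (integrable_norm iF).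
by apply: int_cont => t _; exact: cst_continuous.
Qed.

Let wbound (w : R -> R) : continuous w -> exists2 W : R, 0 < W & forall t, I01 t -> `|w t| <= W.
Proof.
move=> wc; have /compact_bounded[M [_ HM]] : compact (w @` I01).
  by apply: continuous_compact => //; exact: continuous_subspaceT.
exists (`|M| + 1) => [|t It]; first by rewrite ltr_pwDr.
apply: HM; last by exists t.
by rewrite (le_lt_trans (ler_norm _)) // ltrDl.
Qed.

Lemma Ck_segment_integral k (w : R -> R) (g : E -> R^o) : continuous w -> Ck k U g ->
  Ck k U (segment_integral p w g : E -> R^o).
Proof.
have cont (w' : R -> R) (g' : E -> R) : continuous w' -> (forall z, U z -> {for z, continuous g'}) ->
    forall x, U x -> {for x, continuous (segment_integral p w' g')}.
  move=> wc gc x Ux; apply/cvgrPdist_le => e e0; have [W W0 HW] := wbound wc.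
  have eW : 0 < e / W by rewrite divr_gt0.
  have [d d0 Hd] := segment_uniform Uo gc (fun t => Ustar Ux) eW.
  have : \forall y \near x, U y /\ `|x - y| < d.
    apply: filterI; first exact: open_nbhs_nbhs.
    by apply/nbhs_ballP; exists d => // y; rewrite -ball_normE.
  apply: filterS => y [Uy xy].
  rewrite /segment_integral -RintegralB //; [|exact: wg_int|exact: wg_int].
  apply: int_small => [|t It].
    by apply: int_sub; exact: wg_int.
  have [t0 t1] : 0 <= t /\ t <= 1 by move: It; rewrite /I01 /= in_itv /= => /andP.
  have ty : `|t *: (y - x)| < d.
    by rewrite normrZ ger0_norm // distrC (le_lt_trans _ xy) // ler_piMl.
  have [_] := Hd t _ It ty; rewrite (_ : t *: (x - p) + p + t *: (y - x) = t *: (y - p) + p).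
    move=> h; rewrite -mulrBr normrM distrC -(mulfVK (lt0r_neq0 W0) e) mulrC.
    by apply: ler_pM => //; exact: HW.
  by rewrite addrAC -scalerDr [x - p + _]addrC subrKA.
move=> + Cg; elim: k w g Cg => [|k IH] w g Cg wc.
  by split=> //; apply/(within_openP _ Uo); apply: cont => // z; exact: (Ck_for Uo Cg).
apply: CkS => // [|v]; first by apply: cont => // z; exact: (Ck_for Uo Cg).
have wc' : continuous (fun t : R => t * w t) by move=> t; apply: continuousM; [exact: cvg_id|exact: wc].
exists (segment_integral p (fun t => t * w t) ('D_v g)); last by apply: IH => //; exact: Ck_D.
have gc z : U z -> {for z, continuous g} by exact: (Ck_for Uo Cg).
have dgc z : U z -> {for z, continuous ('D_v g)} by exact: (Ck_for Uo (Ck_D v Cg)).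
move=> x Ux; apply/is_deriveP => e e0; have [W W0 HW] := wbound wc.
have eW : 0 < e / W by rewrite divr_gt0.
have [d d0 Hd] := segment_uniform Uo dgc (fun t => Ustar Ux) eW.
have [r r0 Hr] : exists2 r : R, 0 < r & forall y, `|x - y| < r -> U y.
  have /nbhs_ballP[r /= r0 Hr] := open_nbhs_nbhs (conj Uo Ux).
  by exists r => // y xy; apply: Hr; rewrite -ball_normE.
pose K := `|v| + 1; have K0 : 0 < K by rewrite ltr_pwDr.
exists (Num.min d r / K); first by rewrite divr_gt0 // lt_min d0.
move=> h h0; rewrite ltr_pdivlMr // lt_min => /andP[hd hr].
have hv : `|h *: v| <= `|h| * K by rewrite normrZ ler_wpM2l // lerDl.
have Uy : U (h *: v + x) by apply: Hr; rewrite opprD addrCA subrr addr0 normrN (le_lt_trans hv).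
rewrite /segment_integral -RintegralB //; [|exact: wg_int|exact: wg_int].
set G := fun t => _ - _.
have iG : mu.-integrable I01 (EFin \o G).
  by apply: int_sub; exact: wg_int.
have iG' := int_scale h^-1 iG; have iD := wg_int wc' dgc Ux.
rewrite -[h^-1 *: _]/(h^-1 * _) -(RintegralZl h^-1 meas01 iG) -(RintegralB meas01 iG' iD).
apply: int_small => [|t It]; first exact: int_sub.
have [t0 t1] : 0 <= t /\ t <= 1 by move: It; rewrite /I01 /= in_itv /= => /andP.
have th s : `|s| <= `|t * h| -> `|s *: v| < d.
  move=> sth; rewrite (le_lt_trans _ hd) // (le_trans _ hv) // !normrZ ler_wpM2r //.
  by rewrite (le_trans sth) // normrM ger0_norm // ler_piMl.
pose z := t *: (x - p) + p.
have zE s : s *: v + z = z + s *: v by rewrite addrC.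
have [|s sth Es] := @mvt_symmetric R (fun s => g (s *: v + z)) (fun s => 'D_v g (s *: v + z)) (t * h).
  move=> s sth; apply: (is_derive_line g z v s _).1; apply: (Ck_derive Cg); rewrite zE.
  exact: (Hd t _ It (th s sth)).1.
rewrite /= scale0r add0r in Es.
have -> : h^-1 * G t - t * w t * 'D_v g z = w t * (t * ('D_v g (s *: v + z) - 'D_v g z)).
  rewrite /G -mulrBr (_ : t *: (h *: v + x - p) + p = (t * h) *: v + z); last first.
    by rewrite -addrA scalerDr scalerA addrA.
  rewrite -/z Es; move: ('D_v g (s *: v + z)) ('D_v g z) (w t) => A B w1.
  have -> : h^-1 * (w1 * (A * (t * h))) = w1 * (t * A) * (h^-1 * h) by ring.
  by rewrite mulVf //; ring.
have [_] := Hd t _ It (th s sth); rewrite -/z -zE => hD.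
rewrite normrM normrM (ger0_norm t0) -(mulfVK (lt0r_neq0 W0) e) mulrC.
apply: ler_pM => //; [by rewrite mulr_ge0|by rewrite (le_trans _ hD) // ler_piMl|exact: HW].
Qed.

End segment_integral.

(** * Smooth functions and derivations *)

Lemma open_preimage_within (T S : topologicalType) (A : set T) (O : set S) (f : T -> S) :
  open A -> (forall x, A x -> {for x, continuous f}) -> open O -> open (A `&` f @^-1` O).
Proof.
move=> Ao fc Oo; rewrite openE => x [Ax Ofx]; rewrite /interior.
by apply: filterI; [exact: open_nbhs_nbhs|apply: (fc _ Ax); exact: open_nbhs_nbhs].
Qed.

Lemma integrable_scale (R : realType) (D : set R) (a : R) (F : R -> R) :
  measurable (D : set (measurableTypeR R)) ->
  (@lebesgue_measure R).-integrable D (EFin \o F) ->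
  (@lebesgue_measure R).-integrable D (EFin \o (fun t => a * F t)).
Proof.
move=> mD iF; have -> : EFin \o (fun t => a * F t) = (fun t => a%:E * (EFin \o F) t)%E by [].
exact: integrableZl.
Qed.

Lemma Ck_coord (R : realType) (E E' : normedModType R) N (b : 'I_N -> E') (p : 'I_N -> E' -> R)
    k (U : set E) (f : E -> E') i : coordinates b p -> open U -> Ck k U f ->
  Ck k U (p i \o f : E -> R^o).
Proof.
move=> C Uo; have pc := coord_continuous C (i := i).
have cont (g : E -> E') : (forall x, U x -> {for x, continuous g}) ->
    forall x, U x -> {for x, continuous (p i \o g : E -> R^o)}.
  by move=> gc x Ux; apply: continuous_comp; [exact: gc|exact: pc].
elim: k f => [|k IH] f Cf.
  by split=> //; apply/(within_openP _ Uo); apply: cont; exact: (Ck_for Uo Cf).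
apply: CkS => // [|v]; first by apply: cont; exact: (Ck_for Uo Cf).
exists (p i \o 'D_v f) => [x Ux|]; last by apply: IH; exact: Ck_D.
have [_ _ [M M0 HM]] := C.
apply/is_deriveP => e e0; have M1 : 0 < M + 1 by rewrite ltr_pwDr.
have eM : 0 < e / (M + 1) by rewrite divr_gt0.
have /is_deriveP/(_ _ eM)[d d0 Hd] := Ck_derive Cf v Ux.
exists d => // h h0 hd; rewrite -[_ *: _]/(_ * _) /= -(coordB C) -(coordZ C) -(coordB C).
rewrite (le_trans (HM _ _)) //; move: (Hd h h0 hd); rewrite ler_pdivlMr // mulrC.
by apply: le_trans; rewrite ler_wpM2r // lerDl.
Qed.

Section manifold.
Context {R : realType} {n : nat} {M : smoothManifoldType R n}.
Implicit Types (c : chart R n M) (f : M -> R).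
Local Notation rV := 'rV[R]_n.

Let Crv := rV_coordinates R n.

Lemma chart_imgP c x : chart_dom c x -> chart_img c (c x).
Proof. by move=> cx; exists x. Qed.

Lemma chart_inv_dom c q : chart_img c q -> chart_dom c (chart_inv c q).
Proof. by move=> [x cx <-]; rewrite chart_funK. Qed.

Lemma chart_invK c q : chart_img c q -> c (chart_inv c q) = q.
Proof. by move=> [x cx <-]; rewrite chart_funK. Qed.

Lemma chart_img_openW c : open (chart_img c).
Proof. exact: chart_img_open. Qed.

Arguments chart_img_openW : clear implicits.

Lemma chart_inv_for c q : chart_img c q -> {for q, continuous (chart_inv c)}.
Proof.
have := chart_inv_continuous (c := c).
by move/(within_openP (chart_inv c) (chart_img_openW c)); apply.
Qed.

Lemma chart_fun_for c x : chart_dom c x -> {for x, continuous c}.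
Proof.
have := chart_fun_continuous (c := c).
by move/(within_openP c (chart_dom_open c)); apply.
Qed.

Lemma smooth_fun_continuous f : smooth_fun f -> continuous f.
Proof.
move=> fs x; have [c ac cx] := atlas_cover x.
have C0 := fs c ac 0%N.
have := Ck_for (chart_img_openW c) C0 (chart_imgP cx).
move=> fc; have fcc : {for x, continuous ((f \o chart_inv c) \o c)}.
  by apply: continuous_comp; [exact: chart_fun_for|exact: fc].
move: fcc; rewrite /prop_for /continuous_at /= chart_funK // => fcc.
apply: cvg_trans fcc; apply: near_eq_cvg.
by apply: (near_open (chart_dom_open c) cx) => y cy /=; rewrite chart_funK.
Qed.

Lemma smooth_fun_cst (a : R) : smooth_fun (fun _ : M => a).
Proof. by move=> c ac k; exact: (Ck_cst _ (a : R^o) (chart_img_openW c)). Qed.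

Lemma smooth_funD f g : smooth_fun f -> smooth_fun g -> smooth_fun (fun x => f x + g x).
Proof. by move=> fs gs c ac k; exact: (Ck_add (chart_img_openW c) (fs c ac k) (gs c ac k)). Qed.

Lemma smooth_funM f g : smooth_fun f -> smooth_fun g -> smooth_fun (fun x => f x * g x).
Proof. by move=> fs gs c ac k; exact: (Ck_mul (chart_img_openW c) (fs c ac k) (gs c ac k)). Qed.

Lemma smooth_funZD (a : R) f g : smooth_fun f -> smooth_fun g ->
  smooth_fun (fun x => a * f x + g x).
Proof. by move=> fs gs; apply: smooth_funD => //; apply: smooth_funM => //; exact: smooth_fun_cst. Qed.

Lemma smooth_funB f g : smooth_fun f -> smooth_fun g -> smooth_fun (fun x => f x - g x).
Proof.
move=> fs gs; have := smooth_funZD (-1) gs fs.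
by congr smooth_fun; apply/funext => x; rewrite mulN1r addrC.
Qed.

Lemma smooth_local f c k (U : set rV) : atlas c -> smooth_fun f -> open U -> U `<=` chart_img c ->
  Ck k U (f \o chart_inv c : rV -> R^o).
Proof. by move=> ac fs Uo Uc; apply: Ck_sub (fs c ac k). Qed.

(* Multiplying by a bump function supported in a ball inside the chart [c] turns a
   function smooth near that ball into a global smooth function. *)
Lemma bump_extension c (h : rV -> R) (U : set rV) p (r : R) : atlas c -> open U ->
  U `<=` chart_img c -> smooth_on U (h : rV -> R^o) -> 0 < r ->
  (forall x, `|x - p| <= 2 * r -> U x) ->
  exists F : M -> R, [/\ smooth_fun F,
    forall x, chart_dom c x -> `|c x - p| <= r -> F x = h (c x) &
    forall x, F x != 0 -> chart_dom c x /\ `|c x - p| <= 3 / 2 * r].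
Proof.
move=> ac Uo Uc hs r0 rU; have [eta [es e1 e0]] := bump_exists p r0.
pose F x : R := if `[< chart_dom c x >] then eta (c x) * h (c x) else 0.
have Fdom x : chart_dom c x -> F x = eta (c x) * h (c x).
  by move=> cx; rewrite /F; case: asboolP.
have F0 x : F x != 0 -> chart_dom c x /\ `|c x - p| <= 3 / 2 * r.
  rewrite /F; case: asboolP => [cx|_]; last by rewrite eqxx.
  by rewrite mulf_eq0 negb_or => /andP[/e0 ? _].
exists F; split=> //; last by move=> x cx xr; rewrite Fdom // e1 // mul1r.
pose B := [set x : rV | `|x - p| <= 3 / 2 * r].
have B2 x : B x -> U x by move=> Bx; apply: rU; apply: (le_trans Bx); rewrite ler_pM2r //; lra.
(* Compact, hence closed in the Hausdorff space [M], and containing the support of [F]. Each point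
   lies either in the chart over [U], where [F] is smooth, or in the open complement of [K], where
   [F] is 0. *)
pose K := chart_inv c @` B.
have Kclosed : closed K.
  apply: compact_closed; first exact: manifold_hausdorff.
  apply: continuous_compact.
    apply: continuous_in_subspaceT => x; rewrite inE => /B2/Uc; exact: chart_inv_for.
  apply: bounded_closed_compact.
    exists (`|p| + 3 / 2 * r); split; first exact: num_real.
    move=> m pm x Bx; rewrite /= in pm *; rewrite /B /= in Bx.
    have := ler_normD (x - p) p; rewrite subrK => xp; lra.
  have -> : B = closed_ball p (3 / 2 * r).
    rewrite closed_ballE ?mulr_gt0 ?divr_gt0 //.
    by apply/seteqP; split=> x; rewrite /B /closed_ball_ /= distrC.
  exact: closed_ball_closed.
move=> c' ac' k; apply: Ck_local; first exact: chart_img_openW.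
move=> q c'q; set x := chart_inv c' q.
have [[cx Ux]|nx] := pselect (chart_dom c x /\ U (c x)).
  pose D := chart_dom c `&` c @^-1` U.
  have Do : open D by apply: open_preimage_within => //; [exact: chart_dom_open|exact: chart_fun_for].
  pose V := chart_img c' `&` chart_inv c' @^-1` D.
  have Vo : open V.
    by apply: open_preimage_within => //; [exact: chart_img_openW|exact: chart_inv_for].
  exists V; first by split.
  have Vdom y : V y -> chart_dom c (chart_inv c' y) by move=> [_ []].
  apply: (@Ck_ext _ _ _ k V ((fun y => eta y * h y : R^o) \o (c \o chart_inv c'))) => //.
    by move=> y /Vdom cy /=; rewrite Fdom.
  apply: (Ck_chain Crv Vo Uo).
  - by move=> _ [y [_ [_ Uy]] <-].
  - move=> i; apply: (Ck_coord i Crv Vo).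
    apply: Ck_sub (atlas_smooth c' c ac' ac k) => // y [y1 [y2 _]]; by split.
  - have Ce : Ck k U (eta : rV -> R^o) by apply: Ck_sub (es k).
    exact: (Ck_mul Uo Ce (hs k)).
pose V := chart_img c' `&` chart_inv c' @^-1` (~` K).
have Vo : open V.
  apply: open_preimage_within; [exact: chart_img_openW|exact: chart_inv_for|].
  exact: closed_openC.
exists V.
  split=> //; split=> //= -[y By E].
  have c_y := Uc _ (B2 _ By); apply: nx; rewrite /x -E; split; first exact: chart_inv_dom.
  by rewrite chart_invK //; exact: B2.
apply: (@Ck_ext _ _ _ k V (cst 0)) => //; last exact: Ck_cst.
move=> y [c'y Ky] /=; apply/esym/eqP; apply/negP => /negP /F0[cy yp]; apply: Ky.
by exists (c (chart_inv c' y)) => //; rewrite chart_funK.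
Qed.

Lemma ball_in_open (U : set rV) p : open U -> U p -> exists2 r : R, 0 < r &
  forall x, `|x - p| <= 2 * r -> U x.
Proof.
move=> Uo Up; have /nbhs_ballP[r /= r0 Hr] := open_nbhs_nbhs (conj Uo Up).
exists (r / 4); first by rewrite divr_gt0.
by move=> x xp; apply: Hr; rewrite -ball_normE /= distrC (le_lt_trans xp) //; lra.
Qed.

Lemma near_chart c g (r : R) : chart_dom c g -> 0 < r ->
  \forall x \near g, chart_dom c x /\ `|c x - c g| <= r.
Proof.
move=> cg r0; apply: filterI.
  by apply: open_nbhs_nbhs; split=> //; exact: chart_dom_open.
have /cvgrPdist_le/(_ _ r0) := chart_fun_for cg.
by apply: filterS => x; rewrite distrC.
Qed.

Lemma smooth_extension c (h : rV -> R) (U : set rV) g : atlas c -> chart_dom c g -> open U ->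
  U `<=` chart_img c -> smooth_on U (h : rV -> R^o) -> U (c g) ->
  exists2 F : M -> R, smooth_fun F & \forall x \near g, F x = h (c x).
Proof.
move=> ac cg Uo Uc hs Ug; have [r r0 Hr] := ball_in_open Uo Ug.
have [F [Fs Fr _]] := bump_extension ac Uo Uc hs r0 Hr.
by exists F => //; apply: filterS (near_chart cg r0) => x [cx xr]; exact: Fr.
Qed.

Lemma bump_near g (O : set M) : open O -> O g -> exists rho : M -> R,
  [/\ smooth_fun rho, \forall x \near g, rho x = 1 & forall x, rho x != 0 -> O x].
Proof.
move=> Oo Og; have [c ac cg] := atlas_cover g.
pose U := chart_img c `&` chart_inv c @^-1` O.
have Uo : open U.
  by apply: open_preimage_within => //; [exact: chart_img_openW|exact: chart_inv_for].
have Ug : U (c g) by split; [exact: chart_imgP|rewrite /= chart_funK].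
have [r r0 Hr] := ball_in_open Uo Ug.
have Uc : U `<=` chart_img c by move=> x [].
have hs : smooth_on U (cst 1 : rV -> R^o) by move=> k; exact: Ck_cst.
have [F [Fs Fr F0]] := bump_extension ac Uo Uc hs r0 Hr.
exists F; split=> //; first by apply: filterS (near_chart cg r0) => x [cx xr]; rewrite Fr.
move=> x /F0[cx xr]; have /Hr[_ /=] : `|c x - c g| <= 2 * r.
  by apply: (le_trans xr); rewrite ler_pM2r //; lra.
by rewrite chart_funK.
Qed.

Section tangent_vector.
Context (g : M) (v : (M -> R) -> R^o).
Hypothesis vg : tangent_space g v.

Let vD : forall (a : R) f f', smooth_fun f -> smooth_fun f' ->
  v (fun x => a * f x + f' x) = a * v f + v f'.
Proof. by case: vg. Qed.
Let vM : forall f f', smooth_fun f -> smooth_fun f' ->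
  v (fun x => f x * f' x) = v f * f' g + f g * v f'.
Proof. by case: vg. Qed.

Lemma tangent_cst (a : R) : v (fun=> a) = 0.
Proof.
have s1 := smooth_fun_cst 1; have s0 := smooth_fun_cst 0.
have v1 : v (fun=> 1) = 0.
  have := vM s1 s1; rewrite (_ : (fun x => 1 * 1) = (fun=> 1)); last first.
    by apply/funext => x; rewrite mulr1.
  by rewrite mulr1 mul1r => E; apply: (@addrI _ (v (fun=> 1))); rewrite -E addr0.
have v0 : v (fun=> 0) = 0.
  have := vD 1 s0 s0; rewrite (_ : (fun x => 1 * 0 + 0) = (fun=> 0)); last first.
    by apply/funext => x; rewrite mulr0 addr0.
  by rewrite mul1r => E; apply: (@addrI _ (v (fun=> 0))); rewrite -E addr0.
have := vD a s1 s0; rewrite v1 v0 mulr0 [X in _ = X]addr0 => <-.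
by congr v; apply/funext => x; rewrite mulr1 addr0.
Qed.

Lemma tangentD f f' : smooth_fun f -> smooth_fun f' -> v (fun x => f x + f' x) = v f + v f'.
Proof.
move=> fs f's; have := vD 1 fs f's; rewrite mul1r => <-.
by congr v; apply/funext => x; rewrite mul1r.
Qed.

Lemma tangentZ (a : R) f : smooth_fun f -> v (fun x => a * f x) = a * v f.
Proof.
move=> fs; have := vD a fs (smooth_fun_cst 0); rewrite tangent_cst addr0 => <-.
by congr v; apply/funext => x; rewrite addr0.
Qed.

Lemma tangentB f f' : smooth_fun f -> smooth_fun f' -> v (fun x => f x - f' x) = v f - v f'.
Proof.
move=> fs f's; have := vD (-1) f's fs; rewrite mulN1r addrC => <-.
by congr v; apply/funext => x; rewrite mulN1r addrC.
Qed.

Lemma smooth_fun_sum N (f : 'I_N -> M -> R) : (forall i, smooth_fun (f i)) ->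
  smooth_fun (fun x => \sum_i f i x).
Proof.
move=> fs; rewrite (_ : (fun x => _) = \sum_i f i); last by apply/funext => x; rewrite fct_sumE.
apply: (big_ind (fun f => smooth_fun f)) => //; first exact: smooth_fun_cst.
by move=> a b; exact: smooth_funD.
Qed.

Lemma tangent_sum N (f : 'I_N -> M -> R) : (forall i, smooth_fun (f i)) ->
  v (fun x => \sum_i f i x) = \sum_i v (f i).
Proof.
elim: N f => [|N IH] f fs.
  rewrite big_ord0; under eq_fun do rewrite big_ord0; exact: tangent_cst.
rewrite big_ord_recl -IH //; under eq_fun do rewrite big_ord_recl.
by rewrite tangentD //; exact: smooth_fun_sum.
Qed.

(** A derivation is local: multiply the difference by a bump function equal to 1 near [g] and
    vanishing where the difference does not; the Leibniz rule then gives 0. *)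
Lemma tangent_near f f' : smooth_fun f -> smooth_fun f' -> (\forall x \near g, f x = f' x) ->
  v f = v f'.
Proof.
move=> fs f's ff'; apply/eqP; rewrite -subr_eq0 -tangentB //; apply/eqP.
have [W [Wo Wg HW]] : exists W : set M, [/\ open W, W g & forall x, W x -> f x = f' x].
  have : nbhs g [set x | f x = f' x] by exact: ff'.
  by rewrite nbhsE => -[W [Wo Wg] HW]; exists W.
have [rho [rs r1 r0]] := bump_near Wo Wg.
have s := smooth_funB fs f's; have := vM rs s.
rewrite (_ : (fun x => rho x * (f x - f' x)) = (fun=> 0)); last first.
  apply/funext => x; have [->|/r0/HW ->] := eqVneq (rho x) 0; first by rewrite mul0r.
  by rewrite subrr mulr0.
by rewrite tangent_cst (nbhs_singleton r1) HW // subrr mulr0 add0r mul1r.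
Qed.

(* Hadamard's lemma: near [g] one has [f = f g + \sum_i (c_i - c_i g) * f_i]
   with smooth [f_i], so that a derivation only sees the partial derivatives. *)
Lemma hadamard c (xi : 'I_n -> M -> R) f : atlas c -> chart_dom c g ->
  (forall i, smooth_fun (xi i)) -> (forall i, \forall x \near g, xi i x = c x ord0 i) ->
  smooth_fun f ->
  v f = \sum_i v (xi i) * 'D_(delta_mx ord0 i) (f \o chart_inv c : rV -> R^o) (c g).
Proof.
move=> ac cg xis xic fs; set p := c g; pose h : rV -> R^o := f \o chart_inv c.
have [r r0 Hr] := ball_in_open (chart_img_openW c) (chart_imgP cg).
pose U := [set x : rV | `|x - p| < 2 * r].
have Uo : open U.
  have -> : U = ball p (2 * r) by apply/seteqP; split=> x; rewrite -ball_normE /U /= distrC.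
  by apply: ball_open; rewrite mulr_gt0.
have Uc : U `<=` chart_img c by move=> x /ltW; exact: Hr.
have Up : U p by rewrite /U /= subrr normr0 mulr_gt0.
have Ustar x (t : R) : U x -> `[0, 1]%classic t -> U (t *: (x - p) + p).
  rewrite /U /= in_itv /= => Ux /andP[t0 t1]; rewrite addrK normrZ ger0_norm //.
  by apply: le_lt_trans Ux; rewrite ler_piMl.
have hs k : Ck k U h by exact: smooth_local.
pose w i := 'D_(delta_mx ord0 i) h.
have ws i k : Ck k U (w i) by exact: (Ck_D _ (hs k.+1)).
pose gi i := segment_integral p (cst 1) (w i).
have gis i : smooth_on U (gi i : rV -> R^o).
  move=> k; apply: (Ck_segment_integral Uo Ustar); last exact: ws.
  by move=> t; exact: cst_continuous.
have hE x : U x -> h x = h p + \sum_i (x - p) ord0 i * gi i x.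
  move=> Ux; apply/eqP; rewrite addrC -subr_eq; apply/eqP.
  pose dF (t : R) := \sum_i (x - p) ord0 i * w i (t *: (x - p) + p).
  have dh (t : R) : `[0, 1]%classic t -> is_derive t 1 (fun t : R => h (t *: (x - p) + p)) (dF t).
    move=> It; apply: (strict_diff_chain Crv (D := fun i => w i (t *: (x - p) + p))
        (F := fun t : R^o => t *: (x - p) + p)).
      move=> i; apply/is_deriveP => e e0; exists 1 => // s s0 _ /=.
      rewrite -[s *: 1]/(s * 1) mulr1 !mxE -[_ *: _]/(_ * _).
      rewrite (_ : s^-1 * _ - _ = 0) ?normr0 ?ltW //.
      by rewrite mulrDl; field.
    by apply: (Ck_strict_diff Crv Uo (hs 1%N)); exact: Ustar.
  have wcont i (t : R) : `[0, 1]%classic t -> {for t, continuous (fun t : R => w i (t *: (x - p) + p))}.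
    move=> It; apply: (@continuous_comp _ _ _ (fun t : R => t *: (x - p) + p) (w i)).
      by apply: cvgD; [apply: cvgZl; exact: cvg_id|exact: cvg_cst].
    by apply: (Ck_for Uo (ws i 0%N)); exact: Ustar.
  have dFc (t : R) : `[0, 1]%classic t -> {for t, continuous dF}.
    move=> It; rewrite /dF (_ : (fun t => _) = \sum_i (fun t => (x - p) ord0 i * w i (t *: (x - p) + p))).
      apply: (big_ind (fun f : R -> R => {for t, continuous f})); first exact: cst_continuous.
        by move=> a b ca cb; exact: continuousD.
      by move=> i _; apply: continuousM; [exact: cst_continuous|exact: wcont].
    by apply/funext => s; rewrite fct_sumE.
  have F2 : (\int[@lebesgue_measure R]_(t in `[0%R, 1%R]) (dF t)%:E = (h x)%:E - (h p)%:E)%E.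
    rewrite (@continuous_FTC2 _ dF (fun t : R => h (t *: (x - p) + p)) 0 1) //.
    - by rewrite scale1r subrK scale0r add0r.
    - by apply: continuous_in_subspaceT => t; rewrite inE; exact: dFc.
    - have hc (t : R) : `[0, 1]%classic t -> {for t, continuous (fun t : R => h (t *: (x - p) + p))}.
        move=> It; apply: differentiable_continuous; apply/derivable1_diffP.
        by have [] := dh t It.
      split=> [t|//|].
      + rewrite in_itv /= => /andP[t0 t1]; have It : `[0, 1]%classic t by rewrite /= in_itv /= !ltW.
        by have [] := dh t It.
      + have I0 : `[0, 1]%classic (0 : R) by rewrite /= in_itv /= lexx ler01.
        by apply: (cvg_trans _ (hc 0 I0)); apply: cvg_app; exact: cvg_within.
      + have I1 : `[0, 1]%classic (1 : R) by rewrite /= in_itv /= lexx ler01.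
        by apply: (cvg_trans _ (hc 1 I1)); apply: cvg_app; exact: cvg_within.
    - move=> t; rewrite in_itv /= => /andP[t0 t1]; rewrite derive1E.
      have It : `[0, 1]%classic t by rewrite /= in_itv /= !ltW.
      by have [_ ->] := dh t It.
  have Fx : h x - h p = \int[@lebesgue_measure R]_(t in `[0, 1]) dF t by rewrite /Rintegral F2.
  rewrite Fx /dF.
  have wint i : (@lebesgue_measure R).-integrable `[0, 1]
      (EFin \o (fun t => w i (t *: (x - p) + p))).
    apply: continuous_compact_integrable; first exact: segment_compact.
    by apply: continuous_in_subspaceT => t; rewrite inE; exact: wcont.
  have sumint (s : seq 'I_n) : (@lebesgue_measure R).-integrable `[0, 1]
      (EFin \o (fun t => \sum_(i <- s) (x - p) ord0 i * w i (t *: (x - p) + p))) /\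
      \int[@lebesgue_measure R]_(t in `[0, 1]) (\sum_(i <- s) (x - p) ord0 i * w i (t *: (x - p) + p)) =
      \sum_(i <- s) (x - p) ord0 i * gi i x.
    elim: s => [|i s [IH1 IH2]].
      split; last by under eq_Rintegral do rewrite big_nil; rewrite Rintegral_cst // mul0r big_nil.
      apply: (@eq_integrable _ _ _ _ _ _ (cst 0%E)) => //; last exact: integrable0.
      by move=> t _; rewrite /= big_nil.
    have i1 : (@lebesgue_measure R).-integrable `[0, 1]
        (EFin \o (fun t => (x - p) ord0 i * w i (t *: (x - p) + p))).
      exact: (@integrable_scale R _ _ (fun t : R => w i (t *: (x - p) + p)) (measurable_itv _) (wint i)).
    split.
      have mI : measurable (`[0, 1]%classic : set (measurableTypeR R)) by exact: measurable_itv.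
      have := integrableD mI i1 IH1; apply: eq_integrable => //.
      by move=> t _; rewrite /= big_cons.
    under eq_Rintegral do rewrite big_cons.
    rewrite big_cons RintegralD // IH2 RintegralZl //.
    congr (_ * _ + _); rewrite /gi /segment_integral.
    by apply: eq_Rintegral => t _; rewrite mul1r.
  by have [_ ->] := sumint (index_enum _).
have [|F HF] := @choice _ _ (fun i (Fi : M -> R) => smooth_fun Fi /\ \forall x \near g, Fi x = gi i (c x)).
  by move=> i; have [Fi ? ?] := smooth_extension ac cg Uo Uc (gis i) Up; exists Fi.
have gip i : gi i p = w i p.
  have -> : gi i p = \int[@lebesgue_measure R]_(t in `[0, 1]) (w i p).
    by apply: eq_Rintegral => t _; rewrite subrr scaler0 add0r mul1r.
  have m1 : fine (@lebesgue_measure R (`[0, 1]%classic : set R)) = 1.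
    by rewrite lebesgue_measure_itv /= lte_fin ltr01 -EFinB subr0.
  rewrite Rintegral_cst // -[RHS]mulr1; congr (_ * _); exact: m1.
pose f1 x := f g + \sum_i (xi i x - p ord0 i) * F i x.
have dxi i : smooth_fun (fun x => xi i x - p ord0 i).
  by apply: smooth_funB => //; exact: smooth_fun_cst.
have term i : smooth_fun (fun x => (xi i x - p ord0 i) * F i x).
  by apply: smooth_funM => //; case: (HF i).
have f1s : smooth_fun f1.
  by apply: smooth_funD; [exact: smooth_fun_cst|exact: smooth_fun_sum].
have ff1 : \forall x \near g, f x = f1 x.
  have nU : \forall x \near g, chart_dom c x /\ U (c x).
    apply: filterS (near_chart cg r0) => x [cx xr]; split => //.
    by rewrite /U /= (le_lt_trans xr) // ltr_pMl // ltr1n.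
  have n1 : \forall x \near g, forall i, xi i x = c x ord0 i by exact: filter_forall.
  have n2 : \forall x \near g, forall i, F i x = gi i (c x).
    by apply: filter_forall => i; case: (HF i).
  apply: filterS3 nU n1 n2 => x [cx Ux] E1 E2.
  have := hE _ Ux; rewrite /h /= chart_funK // /p chart_funK // => ->.
  by rewrite /f1; congr (_ + _); apply: eq_bigr => i _; rewrite E1 E2 !mxE.
rewrite (tangent_near fs f1s ff1) /f1 tangentD; [|exact: smooth_fun_cst|exact: smooth_fun_sum].
rewrite tangent_cst add0r tangent_sum //; apply: eq_bigr => i _.
have [Fs /nbhs_singleton Fg] := HF i.
rewrite vM // (nbhs_singleton (xic i)) -/p subrr mul0r addr0 Fg -/p gip.
by congr (_ * _); rewrite tangentB //; [rewrite tangent_cst subr0|exact: smooth_fun_cst].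
Qed.

End tangent_vector.
End manifold.

Arguments chart_img_openW : clear implicits.

Section smooth_map.
Context {R : realType} {n : nat} {M : smoothManifoldType R n}.
Local Notation rV := 'rV[R]_n.
Let Crv := rV_coordinates R n.

(** Smoothness of maps from open sets of normed spaces, tested by pulling back smooth functions. It
    is used in place of a manifold structure on products. *)
Definition smooth_map (E : normedModType R) (U : set E) (a : E -> M) : Prop :=
  [/\ open U, forall x, U x -> {for x, continuous a} &
      forall f : M -> R, smooth_fun f -> smooth_on U (f \o a : E -> R^o)].

Lemma smooth_map_sub (E : normedModType R) (U V : set E) (a : E -> M) : open V -> V `<=` U ->
  smooth_map U a -> smooth_map V a.
Proof.
move=> Vo VU [Uo ac afs]; split=> // [x /VU|f fs k]; first exact: ac.
exact: Ck_sub (afs f fs k).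
Qed.

Lemma smooth_map_chart (c : chart R n M) : atlas c -> smooth_map (chart_img c) (chart_inv c).
Proof.
by move=> ac; split=> [|q|f fs]; [exact: chart_img_openW|exact: chart_inv_for|exact: fs].
Qed.

Lemma smooth_map_cst (E : normedModType R) (U : set E) (g : M) : open U ->
  smooth_map U (fun=> g).
Proof. by move=> Uo; split=> // [x _|f fs k]; [exact: cst_continuous|exact: Ck_cst]. Qed.

Lemma smooth_map_affine (E E' : normedModType R) (U : set E) (a : E -> M) (b A : E' -> E) :
  continuous b -> (forall (h : R) v x, b (h *: v + x) = h *: A v + b x) ->
  smooth_map U a -> smooth_map (b @^-1` U) (a \o b).
Proof.
move=> bc bE [Uo ac afs]; split=> [|x Ux|f fs k].
- by apply: open_comp => // x _; exact: bc.
- by apply: continuous_comp; [exact: bc|exact: ac].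
- by have := Ck_comp_affine Uo bc bE (afs f fs k).
Qed.

Lemma smooth_map_dom_open (E : normedModType R) (U : set E) (a : E -> M) (W : set M) :
  smooth_map U a -> open W -> open (U `&` a @^-1` W).
Proof. by move=> [Uo ac _] Wo; exact: open_preimage_within. Qed.

Lemma smooth_map_coord (E : normedModType R) (U : set E) (a : E -> M) (c : chart R n M) i k :
  atlas c -> smooth_map U a ->
  Ck k (U `&` a @^-1` chart_dom c) (fun x => c (a x) ord0 i : R^o).
Proof.
move=> acl sa; have [Uo ac afs] := sa.
apply: Ck_local; first exact: (smooth_map_dom_open sa (chart_dom_open c)).
move=> x [Ux cx].
have Cc j : Ck j (chart_img c) (fun q : rV => q ord0 i : R^o).
  apply: (@Ck_affine R rV j (chart_img c) (fun q => q ord0 i : R^o) (fun q => q ord0 i)).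
  - exact: chart_img_openW.
  - exact: (coord_continuous Crv).
  - by move=> h v y; rewrite !mxE.
have [F Fs HF] := smooth_extension acl cx (chart_img_openW _ _ _ c) (@subset_refl _ _) Cc (chart_imgP cx).
have : nbhs (a x) [set y | F y = c y ord0 i] by exact: HF.
rewrite nbhsE => -[W [Wo Wx] HW].
exists (U `&` a @^-1` W).
  by split; [exact: (smooth_map_dom_open sa Wo)|split].
apply: (@Ck_ext _ _ _ k _ (F \o a)).
- exact: (smooth_map_dom_open sa Wo).
- by move=> y [_ Wy] /=; exact: HW.
- apply: Ck_sub (afs F Fs k); first exact: (smooth_map_dom_open sa Wo).
  by move=> y [].
Qed.

End smooth_map.

(** * Smoothness of the group operations *)

Section lie_group.
Context {R : realType} {n : nat} {G : lieGroupType R n}.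
Local Notation rV := 'rV[R]_n.
Let Crv := rV_coordinates R n.
Local Open Scope group_scope.

Lemma smooth_map_mul (E : normedModType R) (U : set E) (a b : E -> G) :
  smooth_map U a -> smooth_map U b -> smooth_map U (fun x => a x * b x).
Proof.
move=> sa sb; have [Uo ac afs] := sa; have [_ bc bfs] := sb.
have abc x : U x -> {for x, continuous (fun x => a x * b x)}.
  move=> Ux; apply: (@continuous_comp _ _ _ (fun x => (a x, b x)) (fun p : G * G => p.1 * p.2)).
    by apply: cvg_pair; [exact: ac|exact: bc].
  exact: lie_mul_continuous.
split=> // f fs k; apply: Ck_local => // x Ux.
have [ca aca da] := atlas_cover (a x).
have [cb acb db] := atlas_cover (b x).
have [cc acc dc] := atlas_cover (a x * b x).
pose W := [set p : rV * rV | [/\ chart_img ca p.1, chart_img cb p.2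
        & chart_dom cc (chart_inv ca p.1 * chart_inv cb p.2)]].
pose m (p : rV * rV) := cc (chart_inv ca p.1 * chart_inv cb p.2).
have Wo : open W.
  pose W0 := [set p : rV * rV | chart_img ca p.1 /\ chart_img cb p.2].
  have W0o : open W0.
    apply: (@openI _ (fst @^-1` chart_img ca) (snd @^-1` chart_img cb)).
      by apply: open_comp => [p _|]; [exact: cvg_fst|exact: chart_img_openW].
    by apply: open_comp => [p _|]; [exact: cvg_snd|exact: chart_img_openW].
  have -> : W = W0 `&` (fun p => chart_inv ca p.1 * chart_inv cb p.2) @^-1` chart_dom cc.
    by apply/seteqP; split=> p; [move=> [? ? ?]|move=> [[? ?] ?]].
  apply: open_preimage_within => //; last exact: chart_dom_open.
  move=> p [p1 p2]; apply: (@continuous_comp _ _ _ (fun p : rV * rV => (chart_inv ca p.1, chart_inv cb p.2))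
    (fun p : G * G => p.1 * p.2)); last exact: lie_mul_continuous.
  apply: cvg_pair.
    by apply: (@continuous_comp _ _ _ fst (chart_inv ca)); [exact: cvg_fst|exact: chart_inv_for].
  by apply: (@continuous_comp _ _ _ snd (chart_inv cb)); [exact: cvg_snd|exact: chart_inv_for].
have Chm : Ck k W ((f \o chart_inv cc : rV -> R^o) \o m).
  apply: (Ck_chain Crv Wo (chart_img_openW _ _ _ cc)).
  - by move=> _ [p [_ _ dp] <-]; exact: chart_imgP.
  - by move=> i; apply: (Ck_coord i Crv Wo); exact: lie_mul_smooth.
  - exact: fs.
pose V := U `&` a @^-1` chart_dom ca `&` (U `&` b @^-1` chart_dom cb) `&`
  (U `&` (fun x => a x * b x) @^-1` chart_dom cc).
have Vo : open V.
  apply: openI; first by apply: openI; [exact: (smooth_map_dom_open sa (chart_dom_open ca))|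
    exact: (smooth_map_dom_open sb (chart_dom_open cb))].
  by apply: open_preimage_within => //; exact: chart_dom_open.
have VP y : V y -> [/\ U y, chart_dom ca (a y), chart_dom cb (b y) & chart_dom cc (a y * b y)].
  by move=> [[[? ?] [_ ?]] [_ ?]].
exists V; first by split.
pose F (y : E) : rV * rV := (ca (a y), cb (b y)).
apply: (@Ck_ext _ _ _ k V (((f \o chart_inv cc : rV -> R^o) \o m) \o F)) => //.
  by move=> y /VP[_ ay bY aby] /=; rewrite /m /F /= !chart_funK.
apply: (Ck_chain (prod_coordinates Crv Crv) Vo Wo) => //.
- by move=> _ [y /VP[_ ay bY aby] <-]; split; rewrite /F /= ?chart_funK //; exact: chart_imgP.
- move=> i; rewrite /prod_coord /F; case E1 : (fintype.split i) => [j|j].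
    apply: (@Ck_ext _ _ _ k V (fun y => ca (a y) ord0 j)) => //; do ?[by move=> y _; rewrite /= E1].
    apply: Ck_sub (smooth_map_coord j k aca sa) => // y /VP[? ? _ _]; by split.
  apply: (@Ck_ext _ _ _ k V (fun y => cb (b y) ord0 j)) => //; do ?[by move=> y _; rewrite /= E1].
  apply: Ck_sub (smooth_map_coord j k acb sb) => // y /VP[? _ ? _]; by split.
Qed.

Lemma smooth_map_inv (E : normedModType R) (U : set E) (a : E -> G) :
  smooth_map U a -> smooth_map U (fun x => (a x)^-1).
Proof.
move=> sa; have [Uo ac afs] := sa.
have aic x : U x -> {for x, continuous (fun x => (a x)^-1)}.
  by move=> Ux; apply: (@continuous_comp _ _ _ a (fun g : G => g^-1)); [exact: ac|exact: lie_inv_continuous].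
split=> // f fs k; apply: Ck_local => // x Ux.
have [ca aca da] := atlas_cover (a x).
have [cb acb db] := atlas_cover (a x)^-1.
pose W := [set p : rV | chart_img ca p /\ chart_dom cb (chart_inv ca p)^-1].
pose m (p : rV) := cb (chart_inv ca p)^-1.
have Wo : open W.
  apply: (@open_preimage_within _ _ (chart_img ca) (chart_dom cb) (fun p => (chart_inv ca p)^-1));
    [exact: chart_img_openW| |exact: chart_dom_open].
  move=> p cp; apply: (@continuous_comp _ _ _ (chart_inv ca) (fun g : G => g^-1)).
    exact: chart_inv_for.
  exact: lie_inv_continuous.
have Chm : Ck k W ((f \o chart_inv cb : rV -> R^o) \o m).
  apply: (Ck_chain Crv Wo (chart_img_openW _ _ _ cb)).
  - by move=> _ [p [_ dp] <-]; exact: chart_imgP.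
  - by move=> i; apply: (Ck_coord i Crv Wo); exact: lie_inv_smooth.
  - exact: fs.
pose V := U `&` a @^-1` chart_dom ca `&` (U `&` (fun x => (a x)^-1) @^-1` chart_dom cb).
have Vo : open V.
  apply: openI; first exact: (smooth_map_dom_open sa (chart_dom_open ca)).
  by apply: open_preimage_within => //; exact: chart_dom_open.
exists V; first by split.
apply: (@Ck_ext _ _ _ k V (((f \o chart_inv cb : rV -> R^o) \o m) \o (ca \o a))) => //.
  by move=> y [[_ ay] [_ by_]] /=; rewrite /m /= !chart_funK.
apply: (Ck_chain Crv Vo Wo) => //.
- by move=> _ [y [[_ ay] [_ by_]] <-]; split; rewrite /= ?chart_funK //; exact: chart_imgP.
- move=> i; apply: Ck_sub (smooth_map_coord i k aca sa) => // y [[? ?] _]; by split.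
Qed.

Lemma smooth_fun_map (f : G -> R) (T : G -> G) :
  (forall (E : normedModType R) (U : set E) (a : E -> G), smooth_map U a -> smooth_map U (T \o a)) ->
  smooth_fun f -> smooth_fun (f \o T).
Proof.
move=> HT fs c ac k; have [_ _] := HT _ _ _ (smooth_map_chart ac); exact.
Qed.

Lemma smooth_fun_lmul (f : G -> R) g : smooth_fun f -> smooth_fun (fun x => f (g * x)).
Proof.
apply: (@smooth_fun_map f (fun x => g * x)) => E U a sa.
by apply: smooth_map_mul => //; apply: smooth_map_cst; case: sa.
Qed.

Lemma smooth_fun_conj (f : G -> R) g : smooth_fun f -> smooth_fun (fun x => f (g * x * g^-1)).
Proof.
apply: (@smooth_fun_map f (fun x => g * x * g^-1)) => E U a sa; have [Uo _ _] := sa.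
by do 2?[apply: smooth_map_mul => //]; exact: smooth_map_cst.
Qed.

Lemma smooth_fun_rmul (f : G -> R) g : smooth_fun f -> smooth_fun (fun x => f (x * g)).
Proof.
apply: (@smooth_fun_map f (fun x => x * g)) => E U a sa.
by apply: smooth_map_mul => //; apply: smooth_map_cst; case: sa.
Qed.

End lie_group.

Lemma continuous_fst (S T : topologicalType) : continuous (fst : S * T -> S).
Proof. by move=> p; exact: cvg_fst. Qed.

Lemma continuous_snd (S T : topologicalType) : continuous (snd : S * T -> T).
Proof. by move=> p; exact: cvg_snd. Qed.

(** * Tangent vectors at the identity and functions of several group variables *)

Section lie_vectors.
Context {R : realType} {n : nat} {G : lieGroupType R n}.
Local Notation rV := 'rV[R]_n.
Let Crv := rV_coordinates R n.
Let C1 := scalar_coordinates R.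
Let C2 := prod_coordinates C1 C1.
Implicit Types (v w : (G -> R) -> R^o) (f : G -> R).

Lemma is_derive_partial1 (E E' : normedModType R) (F : E * E' -> R^o) (x : E) (y : E') (v : E) df :
  is_derive (x, y) (v, 0) F df <-> is_derive x v (fun s => F (s, y)) df.
Proof.
apply: (@is_derive_affine R E (E * E')%type R^o (fun s => (s, y)) (fun s => (s, 0)) F x v df) => h.
by rewrite -[h *: (v, 0)]/(h *: v, h *: 0) scaler0 -[_ + (x, y)]/(h *: v + x, 0 + y) add0r.
Qed.

Lemma is_derive_partial2 (E E' : normedModType R) (F : E * E' -> R^o) (x : E) (y : E') (v : E') df :
  is_derive (x, y) (0, v) F df <-> is_derive y v (fun s => F (x, s)) df.
Proof.
apply: (@is_derive_affine R E' (E * E')%type R^o (fun s => (x, s)) (fun s => (0, s)) F y v df) => h.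
by rewrite -[h *: (0, v)]/(h *: 0, h *: v) scaler0 -[_ + (x, y)]/(0 + x, h *: v + y) add0r.
Qed.

(** Joint smoothness, tested along all pairs of smooth maps with a common source. *)
Definition smooth2 (Phi : G -> G -> R) : Prop :=
  forall (E : normedModType R) (U : set E) (a b : E -> G), smooth_map U a -> smooth_map U b ->
    smooth_on U (fun e => Phi (a e) (b e) : R^o).

Definition smooth3 (Phi : G -> G -> G -> R) : Prop :=
  forall (E : normedModType R) (U : set E) (a b c : E -> G), smooth_map U a -> smooth_map U b ->
    smooth_map U c -> smooth_on U (fun e => Phi (a e) (b e) (c e) : R^o).

Lemma smooth2_fun1 Phi y : smooth2 Phi -> smooth_fun (fun x => Phi x y).
Proof.
move=> sP c ac k; apply: (sP _ _ _ (fun=> y)); first exact: smooth_map_chart.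
by apply: smooth_map_cst; exact: chart_img_openW.
Qed.

Lemma smooth2_fun2 Phi x : smooth2 Phi -> smooth_fun (Phi x).
Proof.
move=> sP c ac k; apply: (sP _ _ (fun=> x)); last exact: smooth_map_chart.
by apply: smooth_map_cst; exact: chart_img_openW.
Qed.

Lemma smooth3_fun3 Phi x y : smooth3 Phi -> smooth_fun (Phi x y).
Proof.
move=> sP c ac k; apply: (sP _ _ (fun=> x) (fun=> y)); last exact: smooth_map_chart.
  by apply: smooth_map_cst; exact: chart_img_openW.
by apply: smooth_map_cst; exact: chart_img_openW.
Qed.

Definition velocity_curve w (U : set R^o) (s : R^o -> G) : Prop :=
  [/\ smooth_map U s, U 0, s 0 = 1%g &
      forall f, smooth_fun f -> is_derive (0 : R^o) (1 : R^o) (f \o s : R^o -> R^o) (w f)].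

Lemma local_coordinates (c : chart R n G) : atlas c -> chart_dom c 1%g ->
  exists xi : 'I_n -> G -> R, forall i, smooth_fun (xi i) /\
    \forall x \near (1%g : G), xi i x = c x ord0 i.
Proof.
move=> ac c1; have [|xi H] := @choice _ _ (fun i (F : G -> R) => smooth_fun F /\
    \forall x \near (1%g : G), F x = c x ord0 i); last by exists xi.
move=> i; have Cc j : Ck j (chart_img c) (fun q : rV => q ord0 i : R^o).
  apply: (@Ck_affine R rV j (chart_img c) (fun q => q ord0 i : R^o) (fun q => q ord0 i)).
  - exact: chart_img_openW.
  - exact: (coord_continuous Crv).
  - by move=> h v' y; rewrite !mxE.
by have [F Fs HF] := smooth_extension ac c1 (chart_img_openW _ _ _ c) (@subset_refl _ _) Cc (chart_imgP c1);
  exists F.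
Qed.

(** A straight line in a chart at the identity. It realizes [w] at time 0 only, and is in general
    not a one-parameter subgroup. *)
Lemma lie_curve w : lie_algebra w -> exists U s, velocity_curve w U s.
Proof.
move=> lw; have [c ac c1] := atlas_cover (1%g : G).
have [xi Hxi] := local_coordinates ac c1.
pose wv : rV := \row_i w (xi i).
pose b (t : R^o) : rV := t *: wv + c 1%g.
have bE (h : R) (v x : R^o) : b (h *: v + x) = h *: (v *: wv) + b x.
  by rewrite /b scalerDl scalerA addrA.
have bc : continuous b by move=> t; apply: cvgD; [apply: cvgZl; exact: cvg_id|exact: cvg_cst].
have b0 : b 0 = c 1%g by rewrite /b scale0r add0r.
exists (b @^-1` chart_img c), (chart_inv c \o b); split.
- exact: (smooth_map_affine bc bE (smooth_map_chart ac)).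
- by rewrite /= b0; exact: chart_imgP.
- by rewrite /= b0 chart_funK.
move=> f fs; rewrite (hadamard lw ac c1 (fun i => (Hxi i).1) (fun i => (Hxi i).2) fs).
apply: (strict_diff_chain Crv (F := b) (h := f \o chart_inv c)
  (D := fun i => 'D_(delta_mx ord0 i) (f \o chart_inv c : rV -> R^o) (c 1%g))).
  move=> i; apply/is_deriveP => e e0; exists 1 => // s s0 _.
  rewrite /= bE scale1r -[_ *: (_ - _)]/(_ * _) !mxE addrK mulKf // subrr normr0; exact: ltW.
rewrite b0; apply: (Ck_strict_diff Crv (chart_img_openW _ _ _ c) (fs c ac 1%N)).
exact: chart_imgP.
Qed.

Section one_vector.
Context (w : (G -> R) -> R^o) (lw : lie_algebra w).

Let open_prod (E E' : normedModType R) (U : set E) (V : set E') : open U -> open V ->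
  open [set p : E * E' | U p.1 /\ V p.2].
Proof.
move=> Uo Vo; apply: (@openI _ (fst @^-1` U) (snd @^-1` V)).
  by apply: open_comp => // p _; exact: cvg_fst.
by apply: open_comp => // p _; exact: cvg_snd.
Qed.

Let smooth_fst (E E' : normedModType R) (U : set E) (V : set E') (a : E -> G) : open V ->
  smooth_map U a -> smooth_map [set p : E * E' | U p.1 /\ V p.2] (fun p => a p.1).
Proof.
move=> Vo sa; have [Uo _ _] := sa.
have := @smooth_map_affine R n G E (E * E')%type U a fst fst (@continuous_fst _ _) (fun _ _ _ => erefl) sa.
by move=> sH; apply: (smooth_map_sub _ _ sH); [exact: open_prod|move=> p []].
Qed.

Let smooth_snd (E E' : normedModType R) (U : set E) (V : set E') (a : E' -> G) : open U ->
  smooth_map V a -> smooth_map [set p : E * E' | U p.1 /\ V p.2] (fun p => a p.2).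
Proof.
move=> Uo sa; have [Vo _ _] := sa.
have := @smooth_map_affine R n G E' (E * E')%type V a snd snd (@continuous_snd _ _) (fun _ _ _ => erefl) sa.
by move=> sH; apply: (smooth_map_sub _ _ sH); [exact: open_prod|move=> p []].
Qed.

(** Applying [w] in one variable is a partial derivative along the curve of [lie_curve], so
    smoothness in the remaining variables is preserved. *)
Lemma smooth3_tangent Phi : smooth3 Phi -> smooth2 (fun x y => w (Phi x y)).
Proof.
move=> sP E U a b sa sb k; have [V [s [ss V0 s1 sw]]] := lie_curve lw.
have [Uo _ _] := sa; have [Vo _ _] := ss.
pose W := [set p : E * R^o | U p.1 /\ V p.2].
have Wo : open W by exact: open_prod.
pose Psi (p : E * R^o) : R^o := Phi (a p.1) (b p.1) (s p.2).
have CP j : Ck j W Psi.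
  apply: (sP _ W (fun p => a p.1) (fun p => b p.1) (fun p => s p.2));
    [exact: (smooth_fst Vo sa)|exact: (smooth_fst Vo sb)|exact: (smooth_snd Uo ss)].
pose i0 (e : E) : E * R^o := (e, 0).
have i0c : continuous i0.
  move=> e; have c1 : {for e, continuous (id : E -> E)} by exact: cvg_id.
  have c2 : {for e, continuous (cst 0 : E -> R^o)} by exact: cst_continuous.
  exact: (cvg_pair c1 c2).
have i0E (h : R) (v x : E) : i0 (h *: v + x) = h *: (v, 0) + i0 x.
  by rewrite -[h *: (v, 0)]/(h *: v, h *: 0) scaler0 -[RHS]/(h *: v + x, 0 + 0) addr0.
have CD := Ck_comp_affine Wo i0c i0E (Ck_D ((0, 1) : E * R^o) (CP k.+1)).
have iW : i0 @^-1` W = U by apply/seteqP; split=> [e []|e Ue]; [|split].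
rewrite iW in CD; apply: Ck_ext CD => // e Ue /=.
have d1 := Ck_derive (CP 1%N) ((0, 1) : E * R^o) (conj Ue V0 : W (i0 e)).
have d2 := (is_derive_partial2 _ _ _ _ _).1 d1.
have d3 := sw _ (smooth3_fun3 (a e) (b e) sP).
by have [_ <-] := d3; have [_ <-] := d2.
Qed.

Lemma smooth2_tangent Phi : smooth2 Phi -> smooth_fun (fun x => w (Phi x)).
Proof.
move=> sP; have s3 : smooth3 (fun x _ z => Phi x z) by move=> E U a b c sa _ sc; exact: sP.
exact: (smooth2_fun1 1%g (smooth3_tangent s3)).
Qed.

(** Chain rule along the diagonal. Products, inverses, powers and conjugations are all
    differentiated by separating the occurrences of the variable with it. *)
Lemma tangent_diag Phi : smooth2 Phi ->
  w (fun x => Phi x x) = w (fun x => Phi x 1%g) + w (fun x => Phi 1%g x).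
Proof.
move=> sP; have [V [s [ss V0 s1 sw]]] := lie_curve lw; have [Vo _ _] := ss.
pose W := [set p : R^o * R^o | V p.1 /\ V p.2].
have Wo : open W by exact: open_prod.
pose F (p : R^o * R^o) : R^o := Phi (s p.1) (s p.2).
have CF j : Ck j W F.
  by apply: (sP _ W (fun p => s p.1) (fun p => s p.2)); [exact: (smooth_fst Vo ss)|exact: (smooth_snd Vo ss)].
have W0 : W (0, 0) by split.
have sd := Ck_strict_diff C2 Wo (CF 1%N) W0.
have d1 := Ck_derive (CF 1%N) ((1, 0) : R^o * R^o) W0.
have d2 := Ck_derive (CF 1%N) ((0, 1) : R^o * R^o) W0.
have [_ <-] := sw _ (smooth2_fun1 1%g sP).
have [_ <-] := sw _ (smooth2_fun2 1%g sP).
have sdiag : smooth_fun (fun x => Phi x x).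
  by move=> c ac k; apply: sP; exact: smooth_map_chart.
have [_ <-] := sw _ sdiag.
have := strict_diff_chain C2 (F := fun t : R^o => (t, t)) (dF := fun=> 1) (x := 0 : R^o) (v := 1 : R^o)
  _ sd.
have coordid i : is_derive (0 : R^o) (1 : R^o) (@prod_coord R R^o R^o 1 1 (fun _ (x : R^o) => x : R)
     (fun _ (x : R^o) => x : R) i \o (fun t : R^o => (t, t)) : R^o -> R^o) (1 : R^o).
  by rewrite /comp /prod_coord; case: fintype.split => _; exact: is_derive_id.
move=> /(_ coordid); rewrite big_split_ord !big_ord1 /prod_basis /=.
rewrite (unsplitK (inl _ : 'I_1 + 'I_1)%type) (unsplitK (inr _ : 'I_1 + 'I_1)%type) !mul1r => d.
have e1 : 'D_1 ((Phi^~ 1%g) \o s : R^o -> R^o) (0 : R^o) = 'D_(1, 0) F (0, 0).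
  have := (is_derive_partial1 _ _ _ _ _).1 d1; rewrite /F /= s1 => h.
  by have [_ ->] := h.
have e2 : 'D_1 ((Phi 1%g) \o s : R^o -> R^o) (0 : R^o) = 'D_(0, 1) F (0, 0).
  have := (is_derive_partial2 _ _ _ _ _).1 d2; rewrite /F /= s1 => h.
  by have [_ ->] := h.
by rewrite e1 e2; have [_ ->] := d.
Qed.

Lemma tangent_inv f : smooth_fun f -> w (fun x => f x^-1%g) = - w f.
Proof.
move=> fs; have s2 : smooth2 (fun x y => f (x * y^-1)%g).
  move=> E U a b sa sb; have [_ _] := smooth_map_mul sa (smooth_map_inv sb); exact.
have := tangent_diag s2.
under eq_fun do rewrite mulgV.
rewrite (tangent_cst lw) => /eqP; rewrite eq_sym addrC addr_eq0 => /eqP.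
under eq_fun do rewrite mul1g; move=> ->; congr (- w _); apply/funext => x.
by rewrite invg1 mulg1.
Qed.

End one_vector.

(** Along curves realizing the two vectors, both sides are mixed second derivatives of one function
    of two real variables. *)
Lemma tangent_schwarz v w Phi : lie_algebra v -> lie_algebra w -> smooth2 Phi ->
  v (fun y => w (fun x => Phi x y)) = w (fun x => v (fun y => Phi x y)).
Proof.
move=> lv lw sP; have [V [s [ss V0 s1 sv]]] := lie_curve lv; have [W [t [st W0 t1 tw]]] := lie_curve lw.
have [Vo _ _] := ss; have [Wo _ _] := st.
pose X := [set p : R^o * R^o | W p.1 /\ V p.2].
have Xo : open X.
  apply: (@openI _ (fst @^-1` W) (snd @^-1` V)).
    by apply: open_comp => // p _; exact: cvg_fst.
  by apply: open_comp => // p _; exact: cvg_snd.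
pose F (p : R^o * R^o) : R^o := Phi (t p.1) (s p.2).
have st1 : smooth_map X (fun p => t p.1).
  have := @smooth_map_affine R n G R^o (R^o * R^o)%type W t fst fst (@continuous_fst _ _) (fun _ _ _ => erefl) st.
  by move=> sH; apply: (smooth_map_sub _ _ sH) => // p [].
have ss1 : smooth_map X (fun p => s p.2).
  have := @smooth_map_affine R n G R^o (R^o * R^o)%type V s snd snd (@continuous_snd _ _) (fun _ _ _ => erefl) ss.
  by move=> sH; apply: (smooth_map_sub _ _ sH) => // p [].
have CF j : Ck j X F by apply: (sP _ X (fun p => t p.1) (fun p => s p.2)).
have X0 : X (0, 0) by split.
have := @schwarz R _ X F (0, 0) (1, 0) (0, 1) Xo (CF 2%N) X0.
have dw y : W 0 -> V y -> w (fun x => Phi x (s y)) = 'D_(1, 0) F (0, y).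
  move=> _ Vy; have d1 := Ck_derive (CF 1%N) ((1, 0) : R^o * R^o) (conj W0 Vy : X (0, y)).
  have [_ <-] := tw _ (smooth2_fun1 (s y) sP).
  by have [_ ->] := (is_derive_partial1 _ _ _ _ _).1 d1.
have dv x : W x -> v (fun y => Phi (t x) y) = 'D_(0, 1) F (x, 0).
  move=> Wx; have d2 := Ck_derive (CF 1%N) ((0, 1) : R^o * R^o) (conj Wx V0 : X (x, 0)).
  have [_ <-] := sv _ (smooth2_fun2 (t x) sP).
  by have [_ ->] := (is_derive_partial2 _ _ _ _ _).1 d2.
have sP' : smooth2 (fun y x => Phi x y) by move=> E U a b sa sb; exact: sP.
have E1 : v (fun y => w (fun x => Phi x y)) = 'D_(0, 1) ('D_(1, 0) F) (0, 0).
  have dd := Ck_derive (Ck_D ((1, 0) : R^o * R^o) (CF 2%N)) ((0, 1) : R^o * R^o) X0.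
  have dd2 := (is_derive_partial2 _ _ _ _ _).1 dd.
  have [_ <-] := sv _ (smooth2_tangent lw sP').
  have [_ <-] := dd2; apply: near_eq_derive; apply: (near_open Vo V0) => y Vy /=.
  exact: dw.
have E2 : w (fun x => v (fun y => Phi x y)) = 'D_(1, 0) ('D_(0, 1) F) (0, 0).
  have dd := Ck_derive (Ck_D ((0, 1) : R^o * R^o) (CF 2%N)) ((1, 0) : R^o * R^o) X0.
  have dd2 := (is_derive_partial1 _ _ _ _ _).1 dd.
  have [_ <-] := tw _ (smooth2_tangent lv sP).
  have [_ <-] := dd2; apply: near_eq_derive; apply: (near_open Wo W0) => x Wx /=.
  exact: dv.
by rewrite E1 E2.
Qed.

Lemma smooth_fun2 f (T : G -> G -> G) : smooth_fun f ->
  (forall (E : normedModType R) (U : set E) (a b : E -> G), smooth_map U a -> smooth_map U b ->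
     smooth_map U (fun e => T (a e) (b e))) ->
  smooth2 (fun x y => f (T x y)).
Proof. by move=> fs HT E U a b sa sb; have [_ _] := HT _ _ _ _ sa sb; exact. Qed.

Lemma smooth2_mul f : smooth_fun f -> smooth2 (fun x y => f (x * y)%g).
Proof. by move=> fs; apply: smooth_fun2 => // E U a b; exact: smooth_map_mul. Qed.

Lemma smooth_field v f : lie_algebra v -> smooth_fun f -> smooth_fun (left_invariant_field v f).
Proof. by move=> lv fs; exact: (smooth2_tangent lv (smooth2_mul fs)). Qed.

Lemma smooth2_conj f : smooth_fun f -> smooth2 (fun x y => f (x * y * x^-1)%g).
Proof.
move=> fs; apply: smooth_fun2 => // E U a b sa sb.
by do 2?[apply: smooth_map_mul => //]; exact: smooth_map_inv.
Qed.

(* The derivative of [Ad] along [w] is the bracket with [w]. *)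
Lemma tangent_conj v w f : lie_algebra v -> lie_algebra w -> smooth_fun f ->
  w (fun x => v (fun y => f (x * y * x^-1)%g)) = lie_bracket w v f.
Proof.
move=> lv lw fs.
have s3 : smooth3 (fun x x' y => f (x * y * x'^-1)%g).
  move=> E U a b c sa sb sc.
  have [_ _] := smooth_map_mul (smooth_map_mul sa sc) (smooth_map_inv sb); exact.
have s2 := smooth3_tangent lv s3.
rewrite (tangent_diag lw s2) /lie_bracket; congr (_ + _).
  congr w; apply/funext => x; congr v; apply/funext => y.
  by rewrite invg1 mulg1.
have s2' : smooth2 (fun x y => f (y * x^-1)%g).
  move=> E U a b sa sb; have [_ _] := smooth_map_mul sb (smooth_map_inv sa); exact.
rewrite (_ : (fun x => _) = (fun x => v (fun y => f (y * x^-1)%g))); last first.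
  by apply/funext => x; congr v; apply/funext => y; rewrite mul1g.
rewrite -(tangent_schwarz lv lw s2').
rewrite (_ : (fun y => w _) = (fun y => -1 * left_invariant_field w f y)); last first.
  apply/funext => y; rewrite mulN1r.
  exact: (tangent_inv lw (smooth_fun_lmul y fs)).
by rewrite (tangentZ lv) ?mulN1r //; exact: smooth_field.
Qed.

End lie_vectors.

(** * Absolutely continuous curves *)

(** A property that holds on all small intervals around each point and is stable under concatenation
    holds on the whole interval: the supremum of the good endpoints can be passed. *)
Lemma cousin (R : realType) (P : R -> R -> Prop) (a b : R) : a <= b ->
  (forall x, a <= x <= b -> exists2 d, 0 < d & forall u v, x - d < u -> u <= x -> x <= v ->
     v < x + d -> a <= u -> v <= b -> P u v) ->
  (forall u v w, u <= v -> v <= w -> P u v -> P v w -> P u w) -> P a b.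
Proof.
move=> ab loc add; pose S := [set t | a <= t <= b /\ P a t].
have aI : a <= a <= b by rewrite lexx.
have Sa : S a.
  split=> //; have [d d0 Hd] := loc a aI.
  by apply: Hd => //; rewrite ?ltrDl // gtrBl.
have Sub : ubound S b by move=> t [/andP[]].
have Shs : has_sup S by split; [exists a|exists b].
pose s := sup S.
have as_ : a <= s by exact: ub_le_sup Shs.2 _ Sa.
have sb : s <= b by apply: ge_sup => //; exists a.
have [d d0 Hd] := loc s (introT andP (conj as_ sb)).
have [t [/andP[at_ tb] Pt] st] := sup_adherent d0 Shs.
have ts : t <= s by apply: ub_le_sup Shs.2 _ _; split=> //; rewrite at_.
have Ps : P a s by apply: (add a t s) => //; apply: Hd => //; rewrite ltrDl.
have [<- //|sb'] := eqVneq s b.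
have {}sb' : s < b by rewrite lt_def eq_sym sb' sb.
pose v := Num.min b (s + d / 2).
have sv : s < v by rewrite lt_min sb' ltrDl divr_gt0.
have vb : v <= b by rewrite ge_min lexx.
have Sv : S v.
  split; first by rewrite vb (le_trans as_ (ltW sv)).
  apply: (add a s v) => //; first exact: ltW.
  apply: Hd => //; [by rewrite gtrBl|exact: ltW|].
  by rewrite /v gt_min ltrD2l ltr_pdivrMr // ltr_pMr // ltr1n orbT.
by have := @ub_le_sup R S Shs.2 v Sv; rewrite leNgt sv.
Qed.

Section ac_estimate.
Context {R : realType}.
Local Notation mu := (@lebesgue_measure R).

Fixpoint chain (u : R) (l : seq (R * R)) (v : R) : Prop :=
  if l is p :: l' then [/\ u <= p.1, p.1 <= p.2 & chain p.2 l' v] else u <= v.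

Lemma chain_le u u' l v : u <= u' -> chain u' l v -> chain u l v.
Proof. by case: l => [|p l] /= uu; [exact: le_trans|move=> [u'p]; split=> //; exact: le_trans uu _]. Qed.

Lemma chain_cat u l v l' w : chain u l v -> chain v l' w -> chain u (l ++ l') w.
Proof.
elim: l u => [|p l IH] u /=; first exact: chain_le.
by move=> [up pp pl] /IH H; split=> //; exact: H.
Qed.

Lemma chain_nth u l v i : chain u l v -> (i < size l)%N ->
  [/\ u <= (nth (0, 0) l i).1, (nth (0, 0) l i).1 <= (nth (0, 0) l i).2 &
      (nth (0, 0) l i).2 <= v].
Proof.
have end_ u' l' : chain u' l' v -> u' <= v.
  elim: l' u' => //= p l' IH u' [h1 h2 /IH h3].
  exact: le_trans (le_trans h1 h2) h3.
elim: l u i => // p l IH u [|i] /= [up pp pl] il; first by split=> //; exact: end_ pl.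
by have [h1 h2 h3] := IH _ _ pl il; split=> //; rewrite (le_trans _ h1) // (le_trans up).
Qed.

Lemma chain_sorted u l v i j : chain u l v -> (i < j < size l)%N ->
  (nth (0, 0) l i).2 <= (nth (0, 0) l j).1.
Proof.
elim: l u i j => [|p l IH] u i j; first by rewrite ltn0 andbF.
move=> /= [up pp pl]; case: j => [|j]; first by rewrite ltn0.
case: i => [|i] /andP[ij jl] /=; first by have [] := chain_nth pl jl.
by apply: (IH _ i j pl); rewrite -ltnS ij.
Qed.

Lemma chain_measure u l v (A : set R) : measurable (A : set (measurableTypeR R)) ->
  chain u l v -> (forall p, p \in l -> `]p.1, p.2[%classic `<=` A) ->
  ((\sum_(i < size l) ((nth (0, 0) l i).2 - (nth (0, 0) l i).1))%:E <= mu A)%E /\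
  trivIset [set: 'I_(size l)] (fun i => `](nth (0, 0) l i).1, (nth (0, 0) l i).2[%classic).
Proof.
move=> mA cl lA; pose F (i : 'I_(size l)) := `](nth (0, 0) l i).1, (nth (0, 0) l i).2[%classic : set R.
have tF : trivIset [set: 'I_(size l)] F.
  have H (i j : 'I_(size l)) z : (i < j)%N -> F i z -> F j z -> False.
    move=> ij; rewrite /F /= !in_itv /= => /andP[_ zi] /andP[zj _].
    have := chain_sorted cl (introT andP (conj ij (ltn_ord j))).
    by rewrite leNgt (lt_trans zj zi).
  move=> i j _ _ [z [Fi Fj]]; apply: ord_inj; case: (ltngtP i j) => // ij.
    by case: (H i j z ij Fi Fj).
  by case: (H j i z ij Fj Fi).
split=> //; rewrite -sumEFin.
have mF i : measurable (F i : set (measurableTypeR R)) by exact: measurable_itv.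
rewrite (eq_bigr (fun i => mu (F i))); last first.
  move=> i _; have [_ h _] := chain_nth cl (ltn_ord i).
  rewrite /F lebesgue_measure_itv /= lte_fin; case: ltP => // h'.
  by congr _%:E; apply/eqP; rewrite subr_eq0 eq_le h'.
rewrite -measure_semi_additive_ord //; last exact: bigsetU_measurable.
apply: le_measure; rewrite ?inE //; first exact: bigsetU_measurable.
apply: (big_ind (fun B => B `<=` A)) => [//|B B' BA B'A|i _]; first by rewrite subUset.
by apply: lA; exact: mem_nth.
Qed.

(* Cousin's lemma on [[a, b]]: near a point of the exceptional set, covered by an open set of
   small measure, the increment of [f] is charged to absolute continuity. *)
Lemma abs_continuous_increment (f H : R -> R) (a b : R) (Bad : set R) : a <= b ->
  abs_continuous a b f -> {homo H : x y / x <= y} -> mu.-negligible Bad ->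
  (forall t, a < t < b -> ~ Bad t -> forall e, 0 < e -> exists2 d, 0 < d &
    forall u v, t - d < u -> u <= t -> t <= v -> v < t + d -> a <= u -> v <= b ->
    `|f v - f u| <= H v - H u + e * (v - u)) ->
  `|f b - f a| <= H b - H a.
Proof.
move=> ab fac Hh nBad loc.
suff main e : 0 < e -> `|f b - f a| <= H b - H a + e * (b - a) + e.
  apply/ler_addgt0Pr => e e0; have ba : 0 < b - a + 1 by lra.
  apply: le_trans (main (e / (b - a + 1)) (divr_gt0 e0 ba)) _.
  by rewrite -addrA lerD2l -{2}[_ / _]mulr1 -mulrDr divfK // gt_eqF.
move=> e0; have [delta delta0 Hd] := fac e e0.
(* The endpoints are counted as exceptional, because the local estimate is given at interior points
   only. *)
have [N [mN N0 BN]] : mu.-negligible (Bad `|` [set a; b]).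
  apply: negligibleU => //; exists [set a; b]; split=> //.
    by apply: measurableU; exact: measurable_set1.
  exact/countable_lebesgue_measure0/finite_set_countable/finite_set2.
have [W [Oo NO mO]] : exists W : set R, [/\ open W, N `<=` W & (mu W < delta%:E)%E].
  have [|W [Oo NO mO]] := @lebesgue_regularity_outer R N delta mN _ delta0; first by rewrite [X in (X < _)%E]N0 ltry.
  exists W; split=> //; rewrite -(setDUK NO) (le_lt_trans _ mO) //.
  have mOm : measurable (W : set (measurableTypeR R)) by exact: measurable_realfun.open_measurable.
  rewrite measureU ?setDIK //; last exact: measurableD.
  by rewrite [X in (X + _)%E]N0 add0e.
have mOm : measurable (W : set (measurableTypeR R)) by exact: measurable_realfun.open_measurable.
pose P u v := exists l, [/\ chain u l v, forall p, p \in l -> `]p.1, p.2[%classic `<=` W &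
  `|f v - f u| <= H v - H u + e * (v - u) + \sum_(p <- l) `|f p.2 - f p.1|].
have [|u v w uv vw [l [l1 l2 l3]] [l' [l'1 l'2 l'3]]|l [l1 l2 l3]] := @cousin R P a b ab.
- move=> x /andP[ax xb]; have [Ox|Ox] := pselect (W x).
    have /nbhs_ballP[d /= d0 Hd'] := open_nbhs_nbhs (conj Oo Ox).
    exists d => // u v du ux xv vd au vb; exists [:: (u, v)]; split=> /=.
    + by split=> //; exact: le_trans xv.
    + move=> p; rewrite inE => /eqP -> z /=; rewrite in_itv /= => /andP[uz zv].
      by apply: Hd'; rewrite /ball /= ltr_distl; apply/andP; split; lra.
    + by rewrite big_seq1 lerDr addr_ge0 ?subr_ge0 ?Hh ?mulr_ge0 ?subr_ge0 ?(ltW e0) // (le_trans ux).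
  have nB : ~ (Bad `|` [set a; b]) x by move=> /BN/NO.
  have xI : a < x < b.
    by rewrite !lt_neqAle ax xb !andbT; apply/andP; split; apply/eqP => E; apply: nB; right; [left|right].
  have [d d0 Hd'] := loc x xI (fun B => nB (or_introl B)) e e0.
  exists d => // u v du ux xv vd au vb; exists [::]; split=> //=; first exact: le_trans xv.
  by rewrite big_nil addr0; exact: Hd'.
- exists (l ++ l'); split; first exact: chain_cat l1 l'1.
    by move=> p; rewrite mem_cat => /orP[/l2|/l'2].
  rewrite big_cat /=; have := ler_normD (f w - f v) (f v - f u).
  rewrite subrKA => /le_trans; apply; apply: le_trans (lerD l'3 l3) _.
  by lra.
apply: le_trans l3 _; rewrite lerD2l; have [s1 s2] := chain_measure mOm l1 l2.
have lt : \sum_(i < size l) ((nth (0, 0) l i).2 - (nth (0, 0) l i).1) < delta.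
  by rewrite -lte_fin (le_lt_trans s1).
have cn (i : 'I_(size l)) := chain_nth l1 (ltn_ord i).
apply/ltW; rewrite (big_nth (0, 0)) big_mkord.
by apply: (Hd (size l) (fun i => (nth (0, 0) l i).1) (fun i => (nth (0, 0) l i).2)) => // i; case: (cn i).
Qed.

End ac_estimate.

(* The integral of a nonnegative function is a supremum over simple functions, hence it is
   monotone even on nonmeasurable functions. *)
Lemma le_integral_simple d (T : measurableType d) (R : realType)
    (mu : {measure set T -> \bar R}) (D E : set T) (f g : T -> R) :
  (forall x, 0 <= f x) -> (forall x, 0 <= g x) ->
  (forall x, D x -> f x != 0 -> E x /\ f x <= g x) ->
  (\int[mu]_(x in D) (f x)%:E <= \int[mu]_(x in E) (g x)%:E)%E.
Proof.
move=> f0 g0 fg; rewrite !ge0_integralE; try by move=> x _; rewrite lee_fin.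
apply: ereal_sup_le => _ /= [h hf <-]; exists h => // x.
apply: le_trans (hf x) _; rewrite /patch; case: ifPn => xD; last first.
  by case: ifPn => // _; rewrite lee_fin.
have [-> |fx0] := eqVneq (f x) 0; first by case: ifPn => // _; rewrite lee_fin.
by have [Ex fgx] := fg x (set_mem xD) fx0; rewrite mem_set // lee_fin.
Qed.

Lemma straddle (R : realType) (f : R -> R) (t df e : R) : is_derive t (1 : R) (f : R -> R^o) df -> 0 < e ->
  exists2 d, 0 < d & forall u v, t - d < u -> u <= t -> t <= v -> v < t + d ->
    `|f v - f u - df * (v - u)| <= e * (v - u).
Proof.
move=> /is_deriveP/[apply] -[d d0 Hd].
have H w : `|w - t| < d -> `|f w - f t - df * (w - t)| <= e * `|w - t|.
  have [-> _|wt] := eqVneq w t; first by rewrite !subrr mulr0 subr0 normr0 mulr0.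
  move=> wd; have wt0 : w - t != 0 by rewrite subr_eq0.
  have := Hd _ wt0 wd; rewrite [_ *: 1]mulr1 subrK => H.
  have -> : f w - f t - df * (w - t) = (w - t) * ((w - t)^-1 *: (f w - f t : R^o) - df).
    have E (x y : R) : x != 0 -> y - df * x = x * (x^-1 * y - df) by move=> x0; field.
    exact: E.
  by rewrite normrM mulrC ler_wpM2r.
exists d => // u v du ut tv vd.
have Hu := H u; have Hv := H v; rewrite (ler0_norm (_ : u - t <= 0)) in Hu; last lra.
rewrite (ger0_norm (_ : 0 <= v - t)) in Hv; last lra.
have := ler_normB (f v - f t - df * (v - t)) (f u - f t - df * (u - t)).
rewrite (_ : f v - f t - _ - _ = f v - f u - df * (v - u)); last by ring.
move/le_trans; apply; have : u - t > - d by lra.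
by move=> hu; have := Hu ltac:(lra); have := Hv ltac:(lra); lra.
Qed.

Section curve_increment.
Context {R : realType}.
Local Notation mu := (@lebesgue_measure R).
Variables (psi h : R -> R) (ell : R).
Hypothesis psi_c : {within `[0, 1], continuous psi}.
Hypothesis psi_ac : forall x, 0 <= x <= 1 -> exists2 d, 0 < d & forall u v,
  x - d < u -> u <= x -> x <= v -> v < x + d -> 0 <= u -> v <= 1 -> abs_continuous u v psi.
Hypothesis h0 : forall t, 0 <= h t.
Hypothesis psi_d : {ae mu, forall t, `]0, 1[%classic t ->
  derivable (psi : R -> R^o) t 1 /\ `|derive1 (psi : R -> R^o) t| <= h t}.
Hypothesis h_int : (\int[mu]_(t in `]0%R, 1%R[) (h t)%:E <= ell%:E)%E.

(** The bound [h] may fail to be measurable. It is replaced by the absolute derivative of [psi], a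
    limit of difference quotients and so measurable; its integral is at most that of [h] by
    [le_integral_simple]. *)
Let dominating : exists kr : R -> R, [/\ measurable_fun setT kr, forall t, 0 <= kr t,
  forall D, measurable (D : set (measurableTypeR R)) -> (\int[mu]_(t in D) (kr t)%:E <= ell%:E)%E &
  {ae mu, forall t, `]0, 1[%classic t ->
    derivable (psi : R -> R^o) t 1 /\ `|derive1 (psi : R -> R^o) t| = kr t}].
Proof.
have [N [mN N0 HN]] := psi_d.
pose D := `]0, 1[%classic `\` N.
have mD : measurable (D : set (measurableTypeR R)) by apply: measurableD.
have HD t : D t -> derivable (psi : R -> R^o) t 1 /\ `|derive1 (psi : R -> R^o) t| <= h t.
  by move=> [t01 tN]; apply: contrapT => H; apply: tN; apply: HN => /= H'; apply: H; exact: H'.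
(* Continuity of [psi] is known within the unit interval only; clamping the argument gives a
   measurable function on the line. *)
pose clamp (t : R) := Num.max 0 (Num.min 1 t).
have clampE t : 0 <= t <= 1 -> clamp t = t by move=> /andP[t0 t1]; rewrite /clamp (min_r t1) (max_r t0).
have mpc : measurable_fun setT (psi \o clamp).
  apply: (measurable_comp (F := (`[0, 1]%classic : set (measurableTypeR R)))) => //.
  - by move=> _ [t _ <-]; rewrite /= in_itv /= /clamp le_max lexx /= ge_max ler01 ge_min lexx.
  - exact: subspace_continuous_measurable_fun.
  - by apply: measurable_maxr => //; exact: measurable_minr.
pose q (m : nat) (t : R) := m.+1%:R * ((psi \o clamp) (t + m.+1%:R^-1) - (psi \o clamp) t).
pose kr := (fun t => `|derive1 (psi : R -> R^o) t|) \_ D.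
exists kr; split.
- suff mf : measurable_fun (D : set (measurableTypeR R)) (fun t => `|derive1 (psi : R -> R^o) t| : R).
    exact: (measurable_restrictT _ mD).1 mf.
  apply: (measurable_fun_cvg (h := fun m t => `|q m t|)) => [m|t Dt].
    apply: (measurable_comp (F := setT) (f := fun x : R => `|x|)) => //.
    apply: measurable_funTS; apply: measurable_funM => //.
    apply: measurable_funB; last exact: mpc.
    by apply: (measurable_comp (F := setT) (f := psi \o clamp)) => //; exact: measurable_funD.
  have [/DeriveDef/(_ (esym (derive1E _ _))) dt _] := HD t Dt.
  apply: cvg_norm; apply/cvgrPdist_le => e e0; have [d d0 Hd] := (is_deriveP _ _ _ _).1 dt e e0.
  have /andP[t0 t1] : 0 < t < 1 by have [] := Dt; rewrite /= in_itv.
  have dd : 0 < Num.min d (1 - t) by rewrite lt_min d0 subr_gt0.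
  near=> m; have md : m.+1%:R^-1 < Num.min d (1 - t).
    near: m; exact: (near_infty_natSinv_lt (PosNum dd)).
  move: md; rewrite lt_min => /andP[md mt].
  have m0 : 0 < (m.+1%:R^-1 : R) by rewrite invr_gt0.
  have := Hd _ (lt0r_neq0 m0); rewrite ger0_norm ?(ltW m0) // => /(_ md).
  have c1 : clamp t = t by apply: clampE; rewrite !ltW.
  have c2 : clamp (t + m.+1%:R^-1) = t + m.+1%:R^-1.
    by apply: clampE; rewrite addr_ge0 ?(ltW t0) ?(ltW m0) //= -lerBrDl ltW.
  rewrite distrC /q -[(psi \o clamp) _]/(psi (clamp _)) c2 -[(psi \o clamp) t]/(psi (clamp t)) c1.
  by rewrite invrK [_ *: 1]mulr1 (addrC t).
- by move=> t; rewrite /kr /patch; case: ifP.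
- move=> E mE; apply: le_trans h_int; apply: le_integral_simple => //.
    by move=> t; rewrite /kr /patch; case: ifP.
  move=> t _; rewrite /kr /patch; case: ifPn => [/set_mem Dt _|]; last by rewrite eqxx.
  by have [_ ?] := HD t Dt; case: Dt.
exists N; split=> // t; apply: contra_notP => tN t01.
have Dt : D t by split.
by rewrite /kr /patch mem_set //; have [] := HD t Dt.
Unshelve. all: by end_near. Qed.

(** The primitive [H] of the measurable majorant is differentiable almost everywhere, so
    [abs_continuous_increment] compares [psi] with it on short intervals. Absolute continuity being
    only local, Cousin's lemma is used again to join them. *)
Lemma curve_increment s : 0 <= s <= 1 -> `|psi s - psi 0| <= ell.
Proof.
have [kr [mkr kr0 kri krd]] := dominating.
have krint (D : set R) : measurable (D : set (measurableTypeR R)) -> mu.-integrable D (EFin \o kr).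
  move=> mD; apply/integrableP; split; first by apply/measurable_EFinP; exact: measurable_funTS.
  apply: le_lt_trans (ltry ell); apply: le_trans (kri D mD).
  by rewrite le_eqVlt; apply/orP; left; apply/eqP/eq_integral => t _; rewrite /= ger0_norm.
pose H x := \int[mu]_(t in `[0, x]) kr t.
have HE x : (H x)%:E = (\int[mu]_(t in `[0%R, x]) (kr t)%:E)%E.
  by rewrite /H /Rintegral fineK //; apply: integrable_fin_num => //; exact: krint.
have Hmono : {homo H : x y / x <= y}.
  move=> x y xy; rewrite -lee_fin !HE; apply: ge0_subset_integral => //.
  - by apply/measurable_EFinP; exact: measurable_funTS.
  - by move=> z _; rewrite lee_fin.
  - by move=> z /=; rewrite !in_itv /= => /andP[-> /le_trans->].
have H0 : 0 <= H 0 by rewrite -lee_fin HE; apply: integral_ge0 => z _; rewrite lee_fin.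
have HF := @FTC1 R kr (BLeft 0) (fun y => krint _ (measurable_itv _))
  (open_integrable_locally openT (krint _ measurableT)).
move=> /andP[s0 s1]; apply: le_trans (_ : H s - H 0 <= _); last first.
  by rewrite lerBlDr (le_trans (_ : H s <= ell)) ?lerDl // -lee_fin HE; exact: kri.
pose P u v := `|psi v - psi u| <= H v - H u.
apply: (@cousin R P 0 s s0) => [x /andP[x0 xs]|u v w uv vw P1 P2]; last first.
  have := ler_normD (psi w - psi v) (psi v - psi u).
  rewrite subrKA => /le_trans; apply; apply: le_trans (lerD P2 P1) _.
  by lra.
have [|d d0 Hd] := psi_ac (x := x); first by rewrite x0 (le_trans xs).
exists d => // u v du ux xv vd u0 vs.
have acuv : abs_continuous u v psi by apply: Hd => //; exact: le_trans s1.
have [N1 [mN1 N10 HN1]] := krd; have [N2 [mN2 N20 HN2]] := HF.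
have nB : mu.-negligible (N1 `|` N2) by apply: negligibleU; [exists N1; split|exists N2; split].
apply: (abs_continuous_increment (le_trans ux xv) acuv Hmono nB) => t /andP[ut tv] tN e e0.
have t01 : `]0, 1[%classic t by rewrite /= in_itv /= (le_lt_trans u0 ut) (lt_le_trans tv (le_trans vs s1)).
have [d1 d2] : derivable (psi : R -> R^o) t 1 /\ `|derive1 (psi : R -> R^o) t| = kr t.
  by apply: contrapT => C; apply: tN; left; apply: HN1 => C'; apply: C; exact: C'.
have [d3 d4] : derivable (H : R -> R^o) t 1 /\ derive1 (H : R -> R^o) t = kr t.
  apply: contrapT => C; apply: tN; right; apply: HN2 => C'; apply: C; apply: C'.
  move: t01; rewrite /= in_itv /= => /andP[t0 _].
  by rewrite lte_fin.
have [e1 e10 He1] := straddle (DeriveDef d1 (esym (derive1E _ _))) (divr_gt0 e0 (ltr0n _ 2)).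
have [e2 e20 He2] := straddle (DeriveDef d3 (esym (derive1E _ _))) (divr_gt0 e0 (ltr0n _ 2)).
exists (Num.min e1 e2); first by rewrite lt_min e10.
move=> u' v' h1 h2 h3 h4 _ _; have m1 : Num.min e1 e2 <= e1 by rewrite ge_min lexx.
have m2 : Num.min e1 e2 <= e2 by rewrite ge_min lexx orbT.
have A1 := He1 u' v' ltac:(lra) h2 h3 ltac:(lra).
have A2 := He2 u' v' ltac:(lra) h2 h3 ltac:(lra).
have vu : 0 <= v' - u' by lra.
have := ler_normD (psi v' - psi u' - derive1 (psi : R -> R^o) t * (v' - u')) (derive1 (psi : R -> R^o) t * (v' - u')).
rewrite subrK normrM d2 (ger0_norm vu) => /le_trans; apply.
by move: A2; rewrite d4 ler_norml => /andP[A2 _]; lra.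
Qed.

End curve_increment.

Lemma uniform_delta (R : realType) N (P : 'I_N -> R -> Prop) :
  (forall i d d', 0 < d' -> d' <= d -> P i d -> P i d') ->
  (forall i, exists2 d, 0 < d & P i d) -> exists2 d, 0 < d & forall i, P i d.
Proof.
move=> mono H; have [|d Hd] := @choice _ _ (fun i d => 0 < d /\ P i d).
  by move=> i; have [d d0 Pd] := H i; exists d.
have s0 : 0 <= \sum_i (d i)^-1 by apply: sumr_ge0 => i _; rewrite invr_ge0 ltW // (Hd i).1.
have s1 : 0 < 1 + \sum_i (d i)^-1 by rewrite ltr_wpDr.
(* A positive lower bound for all the [d i], also when there are none. *)
exists (1 + \sum_i (d i)^-1)^-1; first by rewrite invr_gt0.
move=> i; apply: mono (Hd i).2; first by rewrite invr_gt0.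
rewrite -[leRHS]invrK lef_pV2 ?posrE ?invr_gt0 ?(Hd i).1 //.
rewrite (bigD1 i) //= addrCA lerDl addr_ge0 //; apply: sumr_ge0 => j _.
by rewrite invr_ge0 ltW // (Hd j).1.
Qed.

Section clamp.
Context {R : realType}.
Implicit Types a b t : R.

Definition clamp a b t := Num.max a (Num.min b t).

Lemma clamp_in a b t : a <= b -> a <= clamp a b t <= b.
Proof. by move=> ab; rewrite /clamp le_max lexx ge_max ab ge_min lexx. Qed.

Lemma clamp_id a b t : a <= t <= b -> clamp a b t = t.
Proof. by move=> /andP[at_ tb]; rewrite /clamp (min_r tb) (max_r at_). Qed.

Lemma clamp_le a b t : a <= b -> t <= a -> clamp a b t = a.
Proof. by move=> ab ta; rewrite /clamp (min_r (le_trans ta ab)) (max_l ta). Qed.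

Lemma clamp_ge a b t : a <= b -> b <= t -> clamp a b t = b.
Proof. by move=> ab bt; rewrite /clamp (min_l bt) (max_r ab). Qed.

Lemma clamp_mono a b s t : a <= b -> s <= t ->
  clamp a b s <= clamp a b t /\ clamp a b t - clamp a b s <= t - s.
Proof.
move=> ab st; rewrite /clamp !maxEle !minEle.
by do !case: ifPn; rewrite -?ltNge => *; split; lra.
Qed.

Lemma clamp_dist a b s t : a <= b -> `|clamp a b t - clamp a b s| <= `|t - s|.
Proof.
move=> ab; wlog st : s t / s <= t.
  by move=> H; case: (leP s t) => [/H //|/ltW/H]; rewrite distrC (distrC t).
have [h1 h2] := clamp_mono ab st.
by rewrite !ger0_norm ?subr_ge0.
Qed.

Lemma clamp_itv a b u v z : a <= b -> clamp a b u < z -> z < clamp a b v -> u < z < v.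
Proof.
move=> ab; rewrite /clamp !maxEle !minEle.
by do !case: ifPn; rewrite -?ltNge => *; apply/andP; split; lra.
Qed.

Lemma clamp_clamp a b p q t : a <= b -> p <= q -> a <= t <= b ->
  clamp (clamp p q a) (clamp p q b) t = clamp p q t.
Proof.
move=> ab pq /andP[at_ tb]; have [cab _] := clamp_mono pq ab.
have /andP[h1 h2] := clamp_in a pq; have /andP[h3 h4] := clamp_in b pq.
have [tp|/ltW pt] := leP t p.
  by rewrite (clamp_le pq tp) (clamp_le pq (le_trans at_ tp)) clamp_le.
have [qt|/ltW tq] := leP q t.
  by rewrite (clamp_ge pq qt) (clamp_ge pq (le_trans qt tb)) clamp_ge.
have ct : clamp p q t = t by rewrite clamp_id // pt.
rewrite ct clamp_id // -{1 2}ct.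
by have [-> _] := clamp_mono pq at_; have [-> _] := clamp_mono pq tb.
Qed.

Lemma clamp_surj a b p q t : a <= b -> p <= q -> clamp p q a <= t <= clamp p q b ->
  clamp p q (clamp a b t) = t.
Proof.
move=> ab pq /andP[cat tcb].
have /andP[h1 h2] := clamp_in a pq; have /andP[h3 h4] := clamp_in b pq.
have [ta|at_] := ltP t a.
  rewrite (clamp_le ab (ltW ta)); apply/eqP; rewrite eq_le cat /=.
  have [qa|/ltW aq] := leP q a; first by rewrite (clamp_ge pq qa) (le_trans tcb).
  have [ap|/ltW pa] := leP a p; first by rewrite (clamp_le pq ap) (le_trans (ltW ta)).
  by rewrite clamp_id ?pa // ltW.
have [tb|/ltW bt] := leP t b.
  by rewrite (clamp_id (introT andP (conj at_ tb))) clamp_id // (le_trans h1) // (le_trans tcb).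
rewrite (clamp_ge ab bt); apply/eqP; rewrite eq_le tcb andbT.
have [bp|/ltW pb] := leP b p; first by rewrite (clamp_le pq bp) (le_trans h1).
have [qb|/ltW bq] := leP q b; first by rewrite (clamp_ge pq qb) (le_trans qb).
by rewrite clamp_id ?pb.
Qed.

End clamp.

Section abs_continuous.
Context {R : realType}.
Implicit Types (f g : R -> R) (a b : R).

Lemma ac_lipschitz N a b (f : 'I_N -> R -> R) g (K : R) : 0 <= K ->
  (forall i, abs_continuous a b (f i)) ->
  (forall s t, a <= s <= b -> a <= t <= b -> `|g t - g s| <= K * \sum_i `|f i t - f i s|) ->
  abs_continuous a b g.
Proof.
move=> K0 fac gf e e0; pose e' := e / ((K + 1) * N.+1%:R).
have K1 : 0 < K + 1 by lra.
have e'0 : 0 < e' by rewrite divr_gt0 // mulr_gt0.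
have [|d d0 Hd] := @uniform_delta R N (fun i d => forall (m : nat) (u v : 'I_m -> R),
      (forall i, a <= u i /\ u i <= v i /\ v i <= b) ->
      trivIset [set: 'I_m] (fun i => `]u i, v i[%classic) ->
      \sum_i (v i - u i) < d -> \sum_k `|f i (v k) - f i (u k)| < e') _ (fun i => fac i e' e'0).
  by move=> i d d' _ dd' H m u v h1 h2 h3; apply: H => //; exact: lt_le_trans dd'.
exists d => // m u v uv tuv suv.
apply: le_lt_trans (_ : K * \sum_(i < N) e' < _).
  apply: le_trans (_ : \sum_k K * \sum_i `|f i (v k) - f i (u k)| <= _).
    apply: ler_sum => k _; have [h1 [h2 h3]] := uv k.
    by apply: gf; rewrite ?h1 ?h3 ?(le_trans h1) ?(le_trans h2).
  rewrite -mulr_sumr exchange_big /= ler_wpM2l //; apply: ler_sum => i _.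
  by apply/ltW; exact: Hd uv tuv suv.
rewrite sumr_const card_ord -mulr_natr.
have N1 : (N%:R : R) < N.+1%:R by rewrite ltr_nat.
have N0 : 0 <= (N%:R : R) by [].
rewrite (_ : K * _ = e * (K * N%:R / ((K + 1) * N.+1%:R))); last by rewrite /e'; ring.
rewrite gtr_pMr // ltr_pdivrMr ?mulr_gt0 // mul1r.
by apply: le_lt_trans (_ : (K + 1) * N%:R < _); rewrite ?ler_wpM2r ?lerDl // ltr_pM2l.
Qed.

Lemma ac_ext a b f g : (forall t, a <= t <= b -> f t = g t) -> abs_continuous a b f ->
  abs_continuous a b g.
Proof.
move=> fg fac; apply: (@ac_lipschitz 1 a b (fun=> f) g 1) => // s t si ti.
by rewrite big_ord1 mul1r !fg.
Qed.

Lemma ac_clamp a b a' b' f : a <= b -> abs_continuous a b f ->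
  abs_continuous a' b' (fun t => f (clamp a b t)).
Proof.
move=> ab fac e /fac[d d0 Hd]; exists d => // m u v uv tuv suv.
apply: (Hd m (fun i => clamp a b (u i)) (fun i => clamp a b (v i))).
- move=> i; have [_ [uvi _]] := uv i; have [h _] := clamp_mono ab uvi.
  by have /andP[h1 h2] := clamp_in (u i) ab; have /andP[h3 h4] := clamp_in (v i) ab.
- move=> i j _ _ [z [zi zj]]; apply: tuv => //; exists z.
  move: zi zj; rewrite /= !in_itv /= => /andP[h1 h2] /andP[h3 h4].
  by split; [exact: clamp_itv h1 h2|exact: clamp_itv h3 h4].
apply: le_lt_trans suv; apply: ler_sum => i _.
by have [_ [uvi _]] := uv i; have [] := clamp_mono ab uvi.
Qed.

Lemma ac_glue u v w f : u <= v -> v <= w -> abs_continuous u v f -> abs_continuous v w f ->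
  abs_continuous u w f.
Proof.
move=> uv vw fuv fvw.
pose F (i : 'I_2) := if i == ord0 then fun t => f (clamp u v t) else fun t => f (clamp v w t).
have FE t : u <= t <= w -> f t = F ord0 t + F ord_max t - f v.
  move=> /andP[ut tw]; rewrite /F /=; have [tv|/ltW vt] := leP t v.
    by rewrite (clamp_le vw tv) clamp_id ?ut // addrK.
  by rewrite (clamp_ge uv vt) clamp_id ?vt //; ring.
apply: (@ac_lipschitz 2 u w F f 1) => // [i|s t si ti].
  by rewrite /F; case: ifP => _; exact: ac_clamp.
rewrite mul1r (FE s si) (FE t ti) big_ord_recl big_ord1.
rewrite (_ : lift ord0 ord0 = ord_max); last exact/val_inj.
rewrite (_ : _ - _ = (F ord0 t - F ord0 s) + (F ord_max t - F ord_max s)); last by ring.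
exact: ler_normD.
Qed.

Lemma ac_local a b f : a <= b ->
  (forall x, a <= x <= b -> exists2 d, 0 < d & forall u v, x - d < u -> u <= x -> x <= v ->
     v < x + d -> a <= u -> v <= b -> abs_continuous u v f) -> abs_continuous a b f.
Proof.
move=> ab loc; apply: (@cousin R (fun u v => abs_continuous u v f)) => // u v w.
exact: ac_glue.
Qed.

End abs_continuous.

Section curves.
Context {R : realType} {n : nat} {M : smoothManifoldType R n}.
Local Notation rV := 'rV[R]_n.
Let Crv := rV_coordinates R n.

Lemma within_curveP (T : topologicalType) (g : R -> T) : {within `[0, 1], continuous g} <->
  forall x W, 0 <= x <= 1 -> open W -> W (g x) ->
  exists2 d, 0 < d & forall t, 0 <= t <= 1 -> `|t - x| < d -> W (g t).
Proof.
split=> [/subspace_continuousP gc x W x01 Wo Wx|H].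
  have xI : `[0, 1]%classic x by rewrite /= in_itv.
  have := gc x xI W (open_nbhs_nbhs (conj Wo Wx)); rewrite nbhs_simpl /= /within /=.
  move=> /nbhs_ballP[d /= d0 Hd]; exists d => // t t01 td; apply: Hd.
    by rewrite /ball /= distrC.
  by rewrite in_itv.
apply/subspace_continuousP => x; rewrite /= in_itv /= => x01 W; rewrite nbhsE => -[W' [W'o W'x] W'W].
have [d d0 Hd] := H x W' x01 W'o W'x; rewrite nbhs_simpl /= /within /=.
apply/nbhs_ballP; exists d => // t; rewrite /ball /= distrC in_itv /= => td t01.
by apply: W'W; exact: Hd.
Qed.

Lemma within_curve_comp (T T' : topologicalType) (g : R -> T) (F : T -> T') : continuous F ->
  {within `[0, 1], continuous g} -> {within `[0, 1], continuous (F \o g)}.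
Proof.
move=> Fc /within_curveP H; apply/within_curveP => x W x01 Wo Wx.
by apply: (H x (F @^-1` W)) => //; apply: open_comp => // y _; exact: Fc.
Qed.

(** A C^1 function of the coordinates is locally Lipschitz, so it preserves absolute continuity on a
    short time interval. *)
Lemma curve_local_ac (g : R -> M) x (c : chart R n M) (h : rV -> R^o) U (f : R -> R) :
  abs_continuous_curve g -> 0 <= x <= 1 -> atlas c -> chart_dom c (g x) -> open U -> Ck 1 U h ->
  U (c (g x)) ->
  (forall t, 0 <= t <= 1 -> chart_dom c (g t) -> U (c (g t)) -> f t = h (c (g t))) ->
  exists2 d, 0 < d & forall u v, x - d < u -> u <= x -> x <= v -> v < x + d -> 0 <= u -> v <= 1 ->
    abs_continuous u v f.
Proof.
move=> [/within_curveP gc gac] x01 ac cx Uo Ch Ux fh.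
have [K K0 [d0 d00 HK]] := strict_diff_lipschitz Crv (Ck_strict_diff Crv Uo Ch Ux).
pose B : set rV := [set q | U q /\ `|q - c (g x)| < d0].
have Bo : open B.
  rewrite (_ : B = U `&` ball (c (g x)) d0); first by apply: openI => //; exact: ball_open.
  by apply/seteqP; split=> q /=; rewrite -ball_normE /= distrC.
have Wo : open (chart_dom c `&` c @^-1` B).
  by apply: open_preimage_within => //; [exact: chart_dom_open|exact: chart_fun_for].
have [|d d0' Hd] := gc x _ x01 Wo; first by split=> //; split=> //; rewrite subrr normr0.
have Hd' u v : x - d < u -> u <= x -> x <= v -> v < x + d -> 0 <= u -> v <= 1 ->
    forall t, u <= t <= v -> (0 <= t <= 1 /\ chart_dom c (g t)) /\ B (c (g t)).
  move=> du ux xv vd u0 v1 t /andP[ut tv].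
  have t01 : 0 <= t <= 1 by rewrite (le_trans u0 ut) (le_trans tv v1).
  have [|h1 h2] := Hd t t01; last by split.
  by rewrite ltr_distl; apply/andP; split; lra.
exists d => // u v du ux xv vd u0 v1; have H := Hd' u v du ux xv vd u0 v1.
apply: (@ac_lipschitz R n u v (fun i t => c (g t) ord0 i) f K K0) => [i|s t si ti].
  apply: gac => //; first exact: le_trans xv.
  by move=> t; rewrite /= in_itv /= => /H[[]].
have [[s01 cs] [Us Bs]] := H s si; have [[t01 ct] [Ut Bt]] := H t ti.
rewrite (fh s) // (fh t) //; apply: le_trans (HK _ _ Bs Bt) _.
by rewrite ler_wpM2l // le_eqVlt; apply/orP; left; apply/eqP; apply: eq_bigr => i _; rewrite !mxE.
Qed.

Lemma curve_smooth_ac (g : R -> M) phi x : abs_continuous_curve g -> smooth_fun phi -> 0 <= x <= 1 ->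
  exists2 d, 0 < d & forall u v, x - d < u -> u <= x -> x <= v -> v < x + d -> 0 <= u -> v <= 1 ->
    abs_continuous u v (phi \o g).
Proof.
move=> gac ps x01; have [c ac cx] := atlas_cover (g x).
apply: (curve_local_ac gac x01 ac cx (chart_img_openW _ _ _ c) (ps c ac 1%N) (chart_imgP cx)).
by move=> t _ ct _ /=; rewrite chart_funK.
Qed.

Lemma clamp_curve (g : R -> M) p q : 0 <= p -> p <= q -> q <= 1 -> abs_continuous_curve g ->
  abs_continuous_curve (g \o clamp p q).
Proof.
move=> p0 pq q1 [/within_curveP gc gac].
have c01 t : 0 <= clamp p q t <= 1.
  by have /andP[h1 h2] := clamp_in t pq; rewrite (le_trans p0) // (le_trans h2).
split.
  apply/within_curveP => x W x01 Wo Wx; have [d d0 Hd] := gc (clamp p q x) W (c01 x) Wo Wx.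
  by exists d => // t t01 td; apply: Hd => //; apply: le_lt_trans td; exact: clamp_dist.
move=> c a b ac a0 ab b1 dom i; have [cab _] := clamp_mono pq ab.
apply: (@ac_ext _ _ _ (fun t => c (g (clamp (clamp p q a) (clamp p q b) t)) ord0 i)).
  by move=> t tab /=; rewrite clamp_clamp.
apply: (@ac_clamp R (clamp p q a) (clamp p q b) a b (fun t => c (g t) ord0 i)) => //.
apply: gac => //; [by have /andP[] := c01 a|by have /andP[] := c01 b|].
move=> t; rewrite /= in_itv /= => tab; rewrite -(clamp_surj ab pq tab).
by apply: dom; rewrite /= in_itv /=; exact: clamp_in.
Qed.

End curves.

Section translation.
Context {R : realType} {n : nat} {G : lieGroupType R n}.

(** Absolute continuity is tested in every chart: near each time the coordinates of the translated
    curve are smooth functions of the coordinates of [g] in some chart around it. *)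
Lemma lmul_curve (a : G) (g : R -> G) : abs_continuous_curve g ->
  abs_continuous_curve (fun t => a * g t)%g.
Proof.
move=> gac; have [gc _] := gac; split.
  apply: (@within_curve_comp R G G g (fun x => a * x)%g) => // x.
  apply: (@continuous_comp _ _ _ (fun x => (a, x)) (fun p : G * G => p.1 * p.2)%g).
    by apply: cvg_pair; [exact: cvg_cst|exact: cvg_id].
  exact: lie_mul_continuous.
move=> c p q ac p0 pq q1 dom i; apply: ac_local => // x /andP[px xq].
have x01 : 0 <= x <= 1 by rewrite (le_trans p0 px) (le_trans xq q1).
have [c' ac' cx] := atlas_cover (g x).
have sm : smooth_map (chart_img c') (fun y => a * chart_inv c' y)%g.
  apply: smooth_map_mul; last exact: smooth_map_chart.
  by apply: smooth_map_cst; exact: chart_img_openW.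
have Uo := smooth_map_dom_open sm (chart_dom_open c).
have [||d d0 Hd] := @curve_local_ac R n G g x c' _ _ (fun t => c (a * g t)%g ord0 i) gac x01 ac' cx Uo
  (smooth_map_coord i 1%N ac sm).
- by split; [exact: chart_imgP|rewrite /= chart_funK //; apply: dom; rewrite /= in_itv /= px].
- by move=> t _ ct _; rewrite chart_funK.
by exists d => // u v h1 h2 h3 h4 h5 h6; apply: Hd => //; lra.
Qed.

End translation.

(** * Lower integrals of functions that may be nonmeasurable *)

Section lower_integral.
Context d (T : measurableType d) (R : realType) (mu : {measure set T -> \bar R}).
Implicit Types (D E N : set T) (f g : T -> R).

Lemma integral_le_simple D f (M : \bar R) : (forall x, 0 <= f x) ->
  (forall s : {nnsfun T >-> R}, (forall x, s x <= f x) -> (forall x, ~ D x -> s x = 0) ->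
    (\int[mu]_x (s x)%:E <= M)%E) -> (\int[mu]_(x in D) (f x)%:E <= M)%E.
Proof.
move=> f0 H; rewrite ge0_integralE; last by move=> x _; rewrite lee_fin.
apply: ge_ereal_sup => _ /= [s hs <-]; rewrite -integralT_nnsfun; apply: H => x.
  by have := hs x; rewrite /patch; case: ifP => _; rewrite lee_fin // => /le_trans->.
move=> Dx; have := hs x; rewrite /patch memNset // lee_fin => h.
by apply/eqP; rewrite eq_le h fun_ge0.
Qed.

Lemma measurable_simple (s : {nnsfun T >-> R}) : measurable_fun setT (fun x => (s x)%:E).
Proof. by apply/measurable_EFinP; exact: measurable_funPT. Qed.

Lemma le_integral_ae D E N f g : (forall x, 0 <= f x) -> (forall x, 0 <= g x) ->
  measurable N -> mu N = 0 ->
  (forall x, D x -> ~ N x -> f x != 0 -> E x /\ f x <= g x) ->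
  (\int[mu]_(x in D) (f x)%:E <= \int[mu]_(x in E) (g x)%:E)%E.
Proof.
move=> f0 g0 mN N0 fg; apply: integral_le_simple => // s sf sD.
pose s' := (s : T -> R) \_ (~` N).
have s'0 x : 0 <= s' x by rewrite /s' /patch; case: ifP.
have ms' : measurable_fun setT (fun x => (s' x)%:E).
  apply/measurable_EFinP/(measurable_restrictT _ (measurableC mN)).1.
  by apply: measurable_funTS; exact: measurable_funPT.
have -> : (\int[mu]_x (s x)%:E = \int[mu]_x (s' x)%:E)%E.
  apply: ge0_ae_eq_integral => //.
  - exact: measurable_simple.
  - by move=> x _; rewrite lee_fin.
  - by move=> x _; rewrite lee_fin.
  exists N; split=> // x /= H; apply: contrapT => Nx; apply: H => _.
  by rewrite /s' /patch mem_set.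
apply: le_integral_simple => // x _; rewrite /s' /patch; case: ifPn => [/set_mem Nx sx|]; last by rewrite eqxx.
have Dx : D x by apply: contrapT => /sD sx0; move: sx; rewrite sx0 eqxx.
have fx : f x != 0.
  by apply: contraNneq sx => fx0; have := sf x; rewrite fx0 => h; rewrite eq_le h fun_ge0.
by have [Ex fgx] := fg x Dx Nx fx; split=> //; exact: le_trans fgx.
Qed.

(* A function with a finite lower integral has a measurable minorant with the same lower
   integral on every measurable set. *)
Lemma measurable_minorant D f : (forall x, 0 <= f x) -> (\int[mu]_(x in D) (f x)%:E < +oo)%E ->
  exists k : T -> R, [/\ measurable_fun setT k, forall x, 0 <= k x,
    (\int[mu]_x (k x)%:E < +oo)%E &
    forall E, measurable E -> E `<=` D -> (\int[mu]_(x in E) (f x)%:E <= \int[mu]_(x in E) (k x)%:E)%E].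
Proof.
move=> f0 fi; set I := (\int[mu]_(x in D) (f x)%:E)%E in fi.
have I0 : (0 <= I)%E by apply: integral_ge0 => x _; rewrite lee_fin.
have Ifin : I \is a fin_num by rewrite ge0_fin_numE.
have ex (m : nat) : exists s : {nnsfun T >-> R}, (forall x, s x <= (f \_ D) x) /\
    (I <= \int[mu]_x (s x)%:E + (m.+1%:R^-1)%:E)%E.
  have m0 : 0 < (m.+1%:R^-1 : R) by rewrite invr_gt0.
  pose S := [set sintegral mu h |
      h in [set h : {nnsfun T >-> R} | forall x, ((h x)%:E <= ((fun x => (f x)%:E) \_ D) x)%E]].
  have IE : I = ereal_sup S by rewrite /I ge0_integralE // => x _; rewrite lee_fin.
  have := @ub_ereal_sup_adherent R S _ m0; rewrite -IE => /(_ Ifin)[_ [s /= hs <-] Is].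
  exists s; split.
    by move=> x; have := hs x; rewrite /patch; case: ifP => _; rewrite lee_fin.
  by rewrite integralT_nnsfun -leeBlDr // ltW.
have [h Hh] := choice ex.
have fD0 x : 0 <= (f \_ D) x by rewrite /patch; case: ifP.
pose k x := sups (fun m => h m x) 0.
have hub x : has_ubound (range (h ^~ x)) by exists ((f \_ D) x) => _ [m _ <-]; exact: (Hh m).1.
have kE x : k x = sup (range (h ^~ x)).
  by rewrite /k /sups /sdrop; congr sup; apply/seteqP; split=> [_ [m _ <-]|_ [m _ <-]]; exists m.
have hk m x : h m x <= k x by rewrite kE; apply: ub_le_sup => //; exists m.
have kf x : k x <= (f \_ D) x.
  by rewrite kE; apply: ge_sup; [exists (h 0%N x); exists 0%N|move=> _ [m _ <-]; exact: (Hh m).1].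
have k0 x : 0 <= k x by apply: le_trans (hk 0%N x); exact: fun_ge0.
have mk : measurable_fun setT k.
  by apply: measurable_fun_sups => [x _|m]; [exact: hub|exact: measurable_funPT].
have mkE : measurable_fun setT (fun x => (k x)%:E) by exact/measurable_EFinP.
have kI : (\int[mu]_x (k x)%:E <= I)%E.
  apply: le_integral_simple => // x _; have := kf x; rewrite /patch; case: ifPn => [/set_mem Dx h1 h2|_ h1 h2].
    by split.
  by move: h2; rewrite eq_le h1 k0.
have Ik : (I <= \int[mu]_x (k x)%:E)%E.
  apply/lee_addgt0Pr => e e0; have [m me] : exists m : nat, m.+1%:R^-1 < e.
    by have [m _ Hm] := near_infty_natSinv_lt (PosNum e0); exists m; exact: (Hm m (leqnn m)).
  apply: le_trans (Hh m).2 _; apply: leeD; last by rewrite lee_fin ltW.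
  apply: ge0_le_integral => //.
  - by move=> x _; rewrite lee_fin.
  - exact: measurable_simple.
  - by move=> x _; rewrite lee_fin.
exists k; split=> //; first exact: le_lt_trans kI fi.
move=> E mE ED; apply: integral_le_simple => // s sf sE.
(* The simple function [s], supported in [E], plus the part of [k] outside [E] is still below [f] on
   [D]. Its integral is thus at most that of [k], and the finite part outside [E] cancels. *)
pose kc := k \_ (~` E).
have kc0 x : 0 <= kc x by rewrite /kc /patch; case: ifP.
have mkc : measurable_fun setT (fun x => (kc x)%:E).
  apply/measurable_EFinP/(measurable_restrictT _ (measurableC mE)).1.
  exact: measurable_funTS.
have kcE : (\int[mu]_x (kc x)%:E = \int[mu]_(x in ~` E) (k x)%:E)%E.
  rewrite [RHS]integral_mkcond; congr (integral _ _ _); apply/funext => x.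
  by rewrite /kc /patch; case: ifP.
have kcfin : (\int[mu]_x (kc x)%:E)%E \is a fin_num.
  rewrite ge0_fin_numE; last by apply: integral_ge0 => x _; rewrite lee_fin.
  apply: le_lt_trans fi; apply: le_trans kI; apply: le_integral_simple => // x _ _; split=> //.
  by rewrite /kc /patch; case: ifP.
rewrite -(leeD2rE _ _ kcfin) -ge0_integralD //; last 3 first.
- by move=> x _; rewrite lee_fin.
- exact: measurable_simple.
- by move=> x _; rewrite lee_fin.
rewrite kcE -ge0_integral_setU //; last 4 first.
- exact: measurableC.
- exact: measurable_funTS.
- by move=> x _; rewrite lee_fin.
- by rewrite disj_set2E setICr.
rewrite setUCr; apply: le_trans Ik.
rewrite (_ : (\int[mu]_x _ = \int[mu]_x (s x + kc x)%:E)%E) //.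
apply: le_integral_simple => // x; first by rewrite addr_ge0.
move=> _; rewrite /kc /patch; case: ifPn => [/set_mem Ex|/negP Ex].
  rewrite sE // add0r => kx; have := kf x; rewrite /patch; case: ifPn => [/set_mem //|_ h'].
  by move: kx; rewrite eq_le h' k0.
by move=> _; rewrite addr0; split=> //; apply: ED; apply: contrapT => nE; apply: Ex; rewrite mem_set.
Qed.

End lower_integral.

Section density.
Context {R : realType}.
Local Notation mu := (@lebesgue_measure R).

(** Lebesgue differentiation for the measurable minorant, which controls the lower integral of [h]
    on every short interval; the constant is the derivative plus 1. *)
Lemma lower_integral_density (h : R -> R) : (forall t, 0 <= h t) ->
  (\int[mu]_(t in `]0%R, 1%R[) (h t)%:E < +oo)%E ->
  {ae mu, forall t, `]0, 1[%classic t ->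
    exists C d, [/\ 0 <= C, 0 < d & forall e, 0 < e -> e < d ->
      (\int[mu]_(s in `]t, (t + e)%R[) (h s)%:E <= (C * e)%:E)%E]}.
Proof.
move=> h0 hi.
have [k [mk k0 kfin kh]] := @measurable_minorant _ (measurableTypeR R) R mu `]0, 1[%classic h h0 hi.
have krint (D : set R) : measurable (D : set (measurableTypeR R)) -> mu.-integrable D (EFin \o k).
  move=> mD; apply: (integrableS measurableT) => //; apply/integrableP; split; first exact/measurable_EFinP.
  apply: le_lt_trans kfin.
  by rewrite le_eqVlt; apply/orP; left; apply/eqP/eq_integral => t _; rewrite /= ger0_norm.
pose H x := \int[mu]_(t in `[0, x]) k t.
have HE x : (H x)%:E = (\int[mu]_(t in `[0%R, x]) (k t)%:E)%E.
  by rewrite /H /Rintegral fineK //; apply: integrable_fin_num => //; exact: krint.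
have HF := @FTC1 R k (BLeft 0) (fun y => krint _ (measurable_itv _))
  (open_integrable_locally openT (krint _ measurableT)).
have [N [mN N0 HN]] := HF; exists N; split=> // t tN; apply: HN => /= Ht; apply: tN => /=.
rewrite in_itv /= => /andP[t0 t1].
have [|d1 d2] := Ht; first by rewrite lte_fin.
have [d d0 Hd] := straddle (DeriveDef d1 (esym (derive1E _ _))) (@ltr01 R).
rewrite {}d2 in Hd.
have kt : 0 <= k t + 1 by rewrite addr_ge0.
exists (k t + 1), (Num.min d (1 - t)); split=> //; first by rewrite lt_min d0 subr_gt0.
move=> e e0; rewrite lt_min => /andP[ed e1].
have sub : `]t, (t + e)%R[%classic `<=` `]0, 1[%classic.
  by move=> s; rewrite /= !in_itv /= => /andP[h1 h2]; apply/andP; split; lra.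
apply: le_trans (kh _ (measurable_itv _) sub) _.
rewrite -(leeD2lE (x := (H t)%:E)) // -EFinD.
have := Hd t (t + e) ltac:(lra) ltac:(lra) ltac:(lra) ltac:(lra); rewrite ler_norml => /andP[_ Hte].
apply: le_trans (_ : (H (t + e))%:E <= _)%E; last first.
  by rewrite lee_fin; move: Hte; rewrite -/(H t) -/(H (t + e)); lra.
rewrite !HE -ge0_integral_setU //=; last 3 first.
- by apply: measurable_funTS; exact/measurable_EFinP.
- by move=> x _; rewrite lee_fin.
- apply/disj_set2P/seteqP; split=> // x; rewrite /= !in_itv /= => -[/andP[_ h1] /andP[h2 _]].
  by move: h2; rewrite ltNge h1.
apply: ge0_subset_integral => //.
- by apply: measurableU.
- by apply: measurable_funTS; exact/measurable_EFinP.
- by move=> x _; rewrite lee_fin.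
by move=> x [|]; rewrite /= !in_itv /= => /andP[h1 h2]; apply/andP; split; lra.
Qed.

End density.

(** * Horizontal curves *)

Section carnot.
Context {R : realType} {G : carnotGroup R}.
Local Notation mu := (@lebesgue_measure R).
Local Notation lif := left_invariant_field.
Implicit Types (v w : (G -> R) -> R^o) (f phi : G -> R).

Lemma layer_lie i v : (1 <= i <= carnot_step G)%N -> layer G i v -> lie_algebra v.
Proof. by have [_ + _ _] := carnot_stratification G => /[apply] -[_]; apply. Qed.

Lemma layer_lin i (a : R) v w : (1 <= i <= carnot_step G)%N -> layer G i v -> layer G i w ->
  layer G i (a *: v + w).
Proof.
have [_ + _ _] := carnot_stratification G => /[apply] -[[_ H] _] lv lw.
by have := H a v w (mem_set lv) (mem_set lw) => /set_mem.
Qed.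

Lemma layer_0 i : (1 <= i <= carnot_step G)%N -> layer G i 0.
Proof. by have [_ + _ _] := carnot_stratification G => /[apply] -[[/set_mem]]. Qed.

Lemma layer1_index : (1 <= 1 <= carnot_step G)%N.
Proof. by have [? _ _ _] := carnot_stratification G. Qed.

Definition layer1_lie v := @layer_lie 1 v layer1_index.
Definition layer1_0 := layer_0 layer1_index.
Definition layer1_lin a v w := @layer_lin 1 a v w layer1_index.

Lemma hscal00 : hscal G 0 0 = 0.
Proof.
have [_ H _] := carnot_hscal G; have := H 1 0 0 0 layer1_0 layer1_0 layer1_0.
by rewrite scale1r add0r mul1r => E; apply: (@addrI _ (hscal G 0 0)); rewrite -E addr0.
Qed.

Lemma dLK (x : G) v : dL (x^-1)%g (dL x v) = v.
Proof. by apply/funext => f; rewrite /dL; congr v; apply/funext => y; rewrite mulKg. Qed.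

Lemma horizontal_normE (x : G) v : horizontal_norm x (dL x v) = Num.sqrt (hscal G v v).
Proof. by rewrite /horizontal_norm dLK. Qed.

Definition speed (g : R -> G) (t : R) : R := horizontal_norm (g t) (velocity g t).

Lemma speed_ge0 g t : 0 <= speed g t.
Proof. exact: sqrtr_ge0. Qed.

Lemma velocity_derive (g : R -> G) (t : R) v phi : differentiable_curve_at g t ->
  velocity g t = dL (g t) v -> smooth_fun phi ->
  is_derive t (1 : R) (phi \o g : R -> R^o) (lif v phi (g t)).
Proof.
move=> gd gv ps; apply: DeriveDef; first exact: gd.
by rewrite -derive1E /left_invariant_field -gv /velocity asboolT.
Qed.

Lemma curve_estimate_ae (g : R -> G) phi ell : horizontal_curve g -> smooth_fun phi ->
  {ae mu, forall t, `]0, 1[%classic t -> `|derive1 (phi \o g : R -> R^o) t| <= speed g t} ->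
  (curve_length g <= ell%:E)%E -> forall s, 0 <= s <= 1 -> `|phi (g s) - phi (g 0)| <= ell.
Proof.
move=> [gac gh] ps Hd gl s s01.
apply: (@curve_increment R (phi \o g) (speed g) ell) => //.
- by apply: within_curve_comp gac.1; exact: smooth_fun_continuous.
- by move=> x x01; exact: curve_smooth_ac.
- exact: speed_ge0.
have aeF := ae_filter_ringOfSetsType mu.
apply: filterS2 gh Hd => t H1 H2 t01; split; last exact: H2.
by have [gd _] := H1 t01; exact: gd.
Qed.

Lemma curve_estimate (g : R -> G) phi (K ell : R) : horizontal_curve g -> smooth_fun phi -> 0 < K ->
  (forall t v, 0 < t < 1 -> layer G 1 v -> `|lif v phi (g t)| <= K * Num.sqrt (hscal G v v)) ->
  (curve_length g <= ell%:E)%E -> forall s, 0 <= s <= 1 -> `|phi (g s) - phi (g 0)| <= K * ell.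
Proof.
move=> gh ps K0 H gl s s01; pose phi' x := K^-1 * phi x.
have ps' : smooth_fun phi' by apply: smooth_funM => //; exact: smooth_fun_cst.
suff : `|phi' (g s) - phi' (g 0)| <= ell.
  by rewrite /phi' -mulrBr normrM gtr0_norm ?invr_gt0 // mulrC ler_pdivrMr // mulrC.
have aeF := ae_filter_ringOfSetsType mu.
apply: (curve_estimate_ae gh ps' _ gl) => //; have [_ gh'] := gh; apply: filterS gh' => t Ht t01.
have [gd [v lv gv]] := Ht t01.
have [_ E] := velocity_derive gd (esym gv) ps'.
rewrite derive1E E /speed -gv horizontal_normE /left_invariant_field /dL /phi'.
rewrite (tangentZ (layer1_lie lv)); last exact: smooth_fun_lmul.
rewrite normrM gtr0_norm ?invr_gt0 // mulrC ler_pdivrMr // mulrC.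
by apply: H => //; move: t01; rewrite /= in_itv.
Qed.

(* Left translate of the arc of [g] over [[p, q]], made constant before [p] and after [q]. *)
Lemma subarc (g : R -> G) (a : G) (p q : R) (eta := fun t => (a * g (clamp p q t))%g) :
  horizontal_curve g -> 0 <= p -> p <= q -> q <= 1 ->
  horizontal_curve eta /\ (curve_length eta <= \int[mu]_(t in `]p, q[) (speed g t)%:E)%E.
Proof.
move=> [gac gh] p0 pq q1.
have smooth_a f : smooth_fun (fun x => f (a * x)%g) <-> smooth_fun f.
  split; last exact: smooth_fun_lmul.
  move=> /(@smooth_fun_lmul _ _ _ _ a^-1%g); congr smooth_fun.
  by apply/funext => x; rewrite mulVKg.
have inner (t : R) : p < t -> t < q -> differentiable_curve_at g t ->
    differentiable_curve_at eta t /\ velocity eta t = fun f => velocity g t (fun x => f (a * x)%g).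
  move=> pt tq gd.
  have loc f : smooth_fun f -> is_derive t (1 : R) (f \o eta : R -> R^o)
      ('D_1 ((fun x => f (a * x)%g) \o g : R -> R^o) t).
    move=> fs; apply: (@is_derive_local _ _ _ ((fun x => f (a * x)%g) \o g : R -> R^o)).
      have : \forall x \near t, x \in `]p, q[ by apply: near_in_itvoo; rewrite in_itv /= pt.
      apply: filterS => x; rewrite in_itv /= => /andP[px xq].
      by rewrite /= /eta clamp_id // !ltW.
    by apply: DeriveDef => //; apply: gd; exact/smooth_a.
  split; first by move=> f /loc[].
  apply/funext => f; rewrite /velocity; case: asboolP => fs; case: asboolP => // fs'.
  - by have [_ E] := loc f fs; rewrite !derive1E E.
  - by case: fs'; exact/smooth_a.
  - by case: fs; exact/smooth_a.
have outer (t : R) : t < p \/ q < t -> differentiable_curve_at eta t /\ velocity eta t = 0.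
  move=> tpq.
  have loc f : is_derive t (1 : R) (f \o eta : R -> R^o) 0.
    apply: (@is_derive_local _ _ _ (fun=> f (eta t) : R^o)).
    case: tpq => [tp|qt].
      have : \forall x \near t, x \in `]t - 1, p[ by apply: near_in_itvoo; rewrite in_itv /= tp gtrBl ltr01.
      apply: filterS => x; rewrite in_itv /= => /andP[_ xp]; rewrite /= /eta !clamp_le //; exact: ltW.
    have : \forall x \near t, x \in `]q, t + 1[ by apply: near_in_itvoo; rewrite in_itv /= qt ltrDl ltr01.
    apply: filterS => x; rewrite in_itv /= => /andP[qx _]; rewrite /= /eta !clamp_ge //; exact: ltW.
  split; first by move=> f _; have [] := loc f.
  apply/funext => f; rewrite /velocity; case: asboolP => // fs.
  by have [_ E] := loc f; rewrite derive1E E.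
have [N [mN N0 HN]] := gh.
have good t : `]0, 1[%classic t -> ~ (N `|` [set p; q]) t -> [/\ differentiable_curve_at eta t,
    horizontal_distribution (eta t) (velocity eta t) &
    speed eta t != 0 -> `]p, q[%classic t /\ speed eta t <= speed g t].
  move=> t01 tN; have [gd [v lv gv]] : differentiable_curve_at g t /\
      horizontal_distribution (g t) (velocity g t).
    by apply: contrapT => C; apply: tN; left; apply: HN => C'; apply: C; exact: C'.
  have out : t < p \/ q < t -> [/\ differentiable_curve_at eta t,
      horizontal_distribution (eta t) (velocity eta t) &
      speed eta t != 0 -> `]p, q[%classic t /\ speed eta t <= speed g t].
    move=> /outer[d E]; have E0 : velocity eta t = dL (eta t) 0 by rewrite E.
    split=> //; first by exists 0; [exact: layer1_0|].
    by rewrite /speed E0 horizontal_normE hscal00 sqrtr0 eqxx.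
  have tp : t != p by apply/eqP => E; apply: tN; right; left.
  have tq : t != q by apply/eqP => E; apply: tN; right; right.
  case: (ltP t p) => tp'; first by apply: out; left.
  case: (ltP q t) => tq'; first by apply: out; right.
  have {}pt : p < t by rewrite lt_neqAle eq_sym tp.
  have {}tq : t < q by rewrite lt_neqAle tq.
  have etaE : eta t = (a * g t)%g by rewrite /eta clamp_id // tp'.
  have [d E] := inner t pt tq gd; split=> //.
    exists v => //; rewrite E etaE -gv; apply/funext => f; rewrite /dL; congr v.
    by apply/funext => x; rewrite mulgA.
  move=> _; split; first by rewrite /= in_itv /= pt.
  rewrite le_eqVlt; apply/orP; left; apply/eqP; rewrite /speed /horizontal_norm.
  suff -> : dL (eta t)^-1%g (velocity eta t) = dL (g t)^-1%g (velocity g t) by [].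
  apply/funext => f; rewrite /dL E etaE; congr (velocity g t _); apply/funext => x.
  by rewrite invgM -mulgA mulKg.
have mNpq : measurable (N `|` [set p; q] : set (measurableTypeR R)).
  by apply: measurableU => //; apply: measurableU; exact: measurable_set1.
have pq0 : mu [set p; q] = 0%E.
  exact/countable_lebesgue_measure0/finite_set_countable/finite_set2.
have Npq0 : mu (N `|` [set p; q]) = 0%E.
  apply/eqP; rewrite eq_le measure_ge0 andbT; apply: le_trans (measureU2 _ _ _) _ => //.
    by apply: measurableU; exact: measurable_set1.
  by rewrite [X in (X + _)%E]N0 add0e [X in (X <= _)%E]pq0.
split.
  split; first exact: (@lmul_curve R _ G a (g \o clamp p q)) (clamp_curve p0 pq q1 gac).
  exists (N `|` [set p; q]); split=> // t; apply: contra_notP => tN t01.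
  by have [] := good t t01 tN.
apply: (@le_integral_ae _ (measurableTypeR R) R mu `]0, 1[%classic `]p, q[%classic _ (speed eta) (speed g)
  (speed_ge0 _) (speed_ge0 _) mNpq Npq0) => t t01 tN s0.
by have [_ _] := good t t01 tN; apply.
Qed.

(** By [lower_integral_density], almost every time of a horizontal curve of finite length gives such
    a vector. The last clause makes short arcs starting at [t0] have length of order [e]. *)
Definition attained v : Prop := layer G 1 v /\ exists (g : R -> G) (t0 : R),
  [/\ horizontal_curve g, 0 < t0 < 1, differentiable_curve_at g t0,
      velocity g t0 = dL (g t0) v &
      exists C d, [/\ 0 <= C, 0 < d & forall e, 0 < e -> e < d ->
        (\int[mu]_(s in `]t0, (t0 + e)%R[) (speed g s)%:E <= (C * e)%:E)%E]].

Lemma attained_lie v : attained v -> lie_algebra v.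
Proof. by move=> [/layer1_lie]. Qed.

(** Along a curve of finite length almost all velocities come from attained vectors, so every
    multiple of [phi] has derivative 0 almost everywhere. Hence all multiples of [|phi y - phi x|]
    are bounded by one length, and the difference is 0. *)
Lemma attained_constant phi : (forall x y : G, carnot_dist x y < +oo)%E -> smooth_fun phi ->
  (forall v, attained v -> forall x, lif v phi x = 0) -> forall x y, phi x = phi y.
Proof.
move=> dfin ps Hv x y.
have [_ [g [gh g0 g1] <-] gl] := ereal_inf_lt (dfin x y).
have gl0 : (0 <= curve_length g)%E by apply: integral_ge0 => t _; rewrite lee_fin speed_ge0.
have lE : curve_length g = (fine (curve_length g))%:E by rewrite fineK // ge0_fin_numE.
set ell := fine _ in lE.
have bound (a : R) : 0 < a -> a * `|phi y - phi x| <= ell.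
  move=> a0; pose phi' x := a * phi x.
  have ps' : smooth_fun phi' by apply: smooth_funM => //; exact: smooth_fun_cst.
  have := @curve_estimate_ae g phi' ell gh ps' _ _ 1.
  rewrite g0 g1 /phi' -mulrBr normrM (gtr0_norm a0); apply; last 2 first.
  - by rewrite lE.
  - by rewrite ler01 lexx.
  have dens := lower_integral_density (speed_ge0 g) gl.
  have aeF := ae_filter_ringOfSetsType mu.
  have [_ gh'] := gh; apply: filterS2 gh' dens => t H1 H2 t01.
  have [gd [v lv gv]] := H1 t01; have [_ E] := velocity_derive gd (esym gv) ps'.
  rewrite derive1E E /speed -gv horizontal_normE /left_invariant_field /dL (tangentZ (layer1_lie lv)); last exact: smooth_fun_lmul.
  have av : attained v.
    split=> //; exists g, t; split=> //; exact: H2.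
  by have := Hv v av (g t); rewrite /left_invariant_field /dL => ->; rewrite mulr0 normr0 sqrtr_ge0.
apply/eqP; rewrite eq_sym -subr_eq0 -normr_le0 leNgt; apply/negP => d0.
have ell0 : 0 <= ell by rewrite -lee_fin -lE.
have e1 : 0 < ell + 1 by lra.
have := bound ((ell + 1) / `|phi y - phi x|) (divr_gt0 e1 d0).
by rewrite divfK ?gt_eqF //; lra.
Qed.

(** The arc after [t0], translated so as to start at the identity. It need not be horizontal at each
    time, but it has velocity [v] at 0 and its points are within [C e] of the identity. *)
Lemma attained_curve v : attained v -> exists (x : R -> G) (C d : R),
  [/\ 0 <= C, 0 < d, x 0 = 1%g,
    forall f, smooth_fun f -> is_derive (0 : R) (1 : R) (f \o x : R -> R^o) (v f) &
    forall (a : G) e, 0 < e -> e < d -> (carnot_dist a (a * x e)%g <= (C * e)%:E)%E].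
Proof.
move=> [lv [g [t0 [gh /andP[t00 t01] gd gv [C [d [C0 d0 Hd]]]]]]].
exists (fun e => ((g t0)^-1 * g (e + t0))%g), C, (Num.min d (1 - t0)); split=> //.
- by rewrite lt_min d0 subr_gt0.
- by rewrite add0r mulVg.
- move=> f fs; have := velocity_derive gd gv (smooth_fun_lmul (g t0)^-1%g fs).
  rewrite /left_invariant_field /dL (_ : (fun x => f _) = f); last first.
    by apply/funext => x; rewrite mulKg.
  move=> H2; have [|H1 _] := @is_derive_affine R R^o R^o R^o (fun s => s + t0) id
    ((fun x => f ((g t0)^-1 * x)%g) \o g) 0 1 (v f); first by move=> h; rewrite addrA.
  by apply: H1; rewrite add0r.
move=> a e e0; rewrite lt_min => /andP[ed e1].
have [|||eh el] := @subarc g (a * (g t0)^-1)%g t0 (t0 + e) gh; [lra|lra|lra|].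
apply: le_trans (le_trans el (Hd e e0 ed)); apply: ereal_inf_lbound.
exists (fun t => (a * (g t0)^-1 * g (clamp t0 (t0 + e) t))%g) => //; split=> //.
  by rewrite clamp_le ?mulgVK //; lra.
by rewrite clamp_ge ?mulgA ?(addrC e) //; lra.
Qed.

End carnot.

(** * Nilpotency *)

Section lie_functionals.
Context {R : realType} {n : nat} {G : lieGroupType R n}.
Local Notation lif := left_invariant_field.
Implicit Types (v w u z : (G -> R) -> R^o) (f : G -> R) (S : set ((G -> R) -> R^o)).

Lemma subspace_lin S (a : R) v w : subspace_set S -> S v -> S w -> S (a *: v + w).
Proof. by move=> [_ H] Sv Sw; have := H a v w (mem_set Sv) (mem_set Sw) => /set_mem. Qed.

Lemma subspace_0 S : subspace_set S -> S 0.
Proof. by move=> [/set_mem]. Qed.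

Lemma subspace_mk S : S 0 -> (forall (a : R) v w, S v -> S w -> S (a *: v + w)) -> subspace_set S.
Proof.
move=> S0 Sl; split=> [|a v w Sv Sw]; first exact: (mem_set S0).
by apply: (@mem_set _ S); apply: Sl; exact: set_mem.
Qed.

Lemma subspace_sum S N (a : 'I_N -> R) (v : 'I_N -> (G -> R) -> R^o) : subspace_set S ->
  (forall i, S (v i)) -> S (\sum_i a i *: v i).
Proof.
move=> sS Sv; elim: N a v Sv => [|N IH] a v Sv; first by rewrite big_ord0; exact: subspace_0.
by rewrite big_ord_recl; apply: subspace_lin => //; exact: IH.
Qed.

Lemma lie_subspace : subspace_set (@lie_algebra R n G).
Proof.
apply: subspace_mk => [|a v w [v1 v2 v3] [w1 w2 w3]].
  split=> [a f g _ _|f g _ _|f _] //; first by rewrite -[RHS]/(a * 0 + 0) mulr0 addr0.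
  by rewrite -[RHS]/(0 * g 1%g + f 1%g * 0) mul0r mulr0 addr0.
split=> [b f g fs gs|f g fs gs|f fs]; rewrite -![(a *: v + w) _]/(a * v _ + w _).
- by rewrite v1 // w1 //; ring.
- by rewrite v2 // w2 //; ring.
- by rewrite v3 // w3 // mulr0 addr0.
Qed.

Lemma lie_eq v w : lie_algebra v -> lie_algebra w -> (forall f, smooth_fun f -> v f = w f) -> v = w.
Proof.
move=> [_ _ v3] [_ _ w3] H; apply/funext => f; have [/H //|nf] := pselect (smooth_fun f).
by rewrite v3 // w3.
Qed.

(* A functional on the Lie algebra separating a vector from a subspace is given by a
   combination of coordinate functions. *)
Lemma separation S z : subspace_set S -> S `<=` @lie_algebra R n G -> lie_algebra z -> ~ S z ->
  exists f, [/\ smooth_fun f, forall v, S v -> v f = 0 & z f != 0].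
Proof.
move=> sS Sl lz Sz; have [c ac c1] := atlas_cover (1%g : G).
have [xi Hxi] := local_coordinates ac c1.
pose vec v : 'rV[R]_n := \row_j v (xi j).
have vec_inj v w : lie_algebra v -> lie_algebra w -> vec v = vec w -> v = w.
  move=> lv lw E; apply: lie_eq => // f fs.
  rewrite (hadamard lv ac c1 (fun i => (Hxi i).1) (fun i => (Hxi i).2) fs).
  rewrite (hadamard lw ac c1 (fun i => (Hxi i).1) (fun i => (Hxi i).2) fs).
  by apply: eq_bigr => j _; have := congr1 (fun r : 'rV_n => r ord0 j) E; rewrite !mxE => ->.
have vec_sum N (a : 'I_N -> R) (v : 'I_N -> (G -> R) -> R^o) :
    vec (\sum_i a i *: v i) = \sum_i a i *: vec (v i).
  apply/rowP => j; rewrite !mxE summxE fct_sumE; apply: eq_bigr => i _.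
  by rewrite !mxE.
(* A matrix of maximal rank with rows in the coordinate image of [S] spans that image; a column of
   its cokernel not killed by [z] gives the function. *)
pose P N := `[< exists m (A : 'M[R]_(m, n)) (v : 'I_m -> (G -> R) -> R^o),
  [/\ \rank A = N, forall i, S (v i) & forall i, row i A = vec (v i)] >].
have P0 : P 0%N.
  by apply/asboolP; exists 0%N, 0, (fun=> 0); split; [rewrite mxrank0|case|case].
have Pn N : P N -> (N <= n)%N by move=> /asboolP[m [A [v [<- _ _]]]]; exact: rank_leq_col.
have [N /asboolP[m [A [v [rA Sv Av]]]] Nmax] := ex_maxnP (ex_intro _ 0%N P0) Pn.
have span w : S w -> (vec w <= A)%MS.
  move=> Sw; pose B := col_mx A (vec w).
  have AB : (A <= B)%MS by have := submx_refl B; rewrite col_mx_sub => /andP[].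
  suff : (B <= A)%MS by rewrite col_mx_sub => /andP[].
  rewrite -(mxrank_leqif_sup AB) eqn_leq mxrankS // rA; apply: Nmax; apply/asboolP.
  exists (m + 1)%N, B, (fun i => match fintype.split i with inl i => v i | inr _ => w end); split=> //.
    by move=> i; case: fintype.split.
  move=> i; rewrite -(splitK i); case: fintype.split => j /=.
    by rewrite (unsplitK (inl j)) rowKu.
  by rewrite (unsplitK (inr j)) rowKd; apply/rowP => k; rewrite !mxE.
have nz : ~~ (vec z <= A)%MS.
  apply/negP => /submxP[D zD]; apply: Sz.
  have -> : z = \sum_i D ord0 i *: v i.
    apply: vec_inj => //; first by apply: Sl; exact: subspace_sum.
    rewrite vec_sum zD mulmx_sum_row; apply: eq_bigr => i _; by rewrite Av.
  exact: subspace_sum.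
have /rV0Pn[j zj] : vec z *m cokermx A != 0 by rewrite -submxE.
exists (fun x => \sum_k cokermx A k j * xi k x).
have sx k : smooth_fun (fun x => cokermx A k j * xi k x).
  by apply: smooth_funM; [exact: smooth_fun_cst|exact: (Hxi k).1].
have eval v' : lie_algebra v' ->
    v' (fun x => \sum_k cokermx A k j * xi k x) = (vec v' *m cokermx A) ord0 j.
  move=> lv'; rewrite (tangent_sum lv' sx) mxE; apply: eq_bigr => k _.
  by rewrite (tangentZ lv' _ (Hxi k).1) [vec _ _ _]mxE mulrC.
split; first exact: smooth_fun_sum.
  by move=> w Sw; rewrite eval; [|exact: Sl]; have := span w Sw; rewrite submxE => /eqP ->; rewrite mxE.
by rewrite eval.
Qed.

Definition Ad (h : G) v : (G -> R) -> R^o := fun f => v (fun x => f (h * x * h^-1)%g).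

Lemma Ad_mul g h v : Ad (g * h)%g v = Ad g (Ad h v).
Proof.
apply/funext => f; congr v; apply/funext => x.
by rewrite invgM !mulgA.
Qed.

Lemma Ad1 v : Ad 1%g v = v.
Proof. by apply/funext => f; congr v; apply/funext => x; rewrite invg1 mulg1 mul1g. Qed.

Lemma AdB h v w : Ad h (v - w) = Ad h v - Ad h w.
Proof. by []. Qed.

Lemma smooth_conjE h f : smooth_fun (fun x => f (h * x * h^-1)%g) <-> smooth_fun f.
Proof.
split; last exact: smooth_fun_conj.
move=> /(@smooth_fun_conj _ _ _ _ h^-1%g); congr smooth_fun.
by apply/funext => x; rewrite invgK !mulgA mulgV mul1g mulgK.
Qed.

Lemma Ad_lie h v : lie_algebra v -> lie_algebra (Ad h v).
Proof.
move=> [v1 v2 v3]; split=> [a f g fs gs|f g fs gs|f fs]; rewrite /Ad.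
- by apply: v1; exact: smooth_fun_conj.
- rewrite v2; [|exact: smooth_fun_conj|exact: smooth_fun_conj].
  by rewrite mulg1 mulgV.
- by apply: v3 => /smooth_conjE.
Qed.

(** Separating the two occurrences of [y] gives an [Ad h v] term and a [- v] term for the same test
    function. *)
Lemma tangent_comm h v f x : lie_algebra v -> smooth_fun f -> (forall f', smooth_fun f' -> Ad h v f' = v f') ->
  lif v (fun y => f (h * y * h^-1 * y^-1)%g) x = 0.
Proof.
move=> lv fs Hv; rewrite /left_invariant_field /dL.
pose T (y y' : G) := (h * (x * y) * h^-1 * y'^-1 * x^-1)%g.
have sT : smooth2 (fun y y' => f (T y y')).
  apply: smooth_fun2 => // E U a b sa sb; have [Uo _ _] := sa.
  have cst (g : G) : smooth_map U (fun=> g) by exact: smooth_map_cst.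
  by do !apply: smooth_map_mul => //; exact: smooth_map_inv.
have := tangent_diag lv sT.
rewrite (_ : (fun y => f (T y y)) = (fun y => f (h * (x * y) * h^-1 * (x * y)^-1)%g)); last first.
  by apply/funext => y; rewrite /T invgM !mulgA.
move=> ->; pose f' y := f (h * x * h^-1 * y * x^-1)%g.
have fs' : smooth_fun f' by exact: (smooth_fun_lmul (h * x * h^-1)%g (smooth_fun_rmul x^-1%g fs)).
have -> : (fun y => f (T y 1%g)) = (fun y => f' (h * y * h^-1)%g).
  by apply/funext => y; rewrite /T /f' invg1 mulg1 !mulgA mulgVK.
have -> : (fun y => f (T 1%g y)) = (fun y => f' y^-1%g).
  by apply/funext => y; rewrite /T /f' mulg1.
by rewrite (tangent_inv lv fs') -[v (fun y => f' _)]/(Ad h v f') Hv // subrr.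
Qed.

Lemma smooth_separates (x y : G) : (forall f, smooth_fun f -> f x = f y) -> x = y.
Proof.
move=> H; apply: contrapT => /eqP xy.
have [W [Wo Wx Wy]] : exists W : set G, [/\ open W, W x & ~ W y].
  have := @manifold_hausdorff R n G; rewrite open_hausdorff.
  move=> /(_ _ _ xy)[[A B] /= [/set_mem Ax /set_mem By] [Ao Bo /eqP AB]].
  exists A; split=> // Ay; have : (A `&` B) y by split.
  by rewrite AB.
have [rho [rs r1 rW]] := bump_near Wo Wx.
have rx := nbhs_singleton r1; apply: Wy; apply: rW.
by rewrite -(H rho rs) rx oner_eq0.
Qed.

End lie_functionals.

Section nilpotent.
Context {R : realType} {G : carnotGroup R}.
Local Notation lif := left_invariant_field.
Local Notation s := (carnot_step G).
Implicit Types (v w u z : (G -> R) -> R^o) (f : G -> R) (S : set ((G -> R) -> R^o)).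
Hypothesis dfin : forall x y : G, (carnot_dist x y < +oo)%E.

(** By [tangent_conj] the derivative of [h |-> Ad h v f] at [g] along [w] is the bracket of [w] and
    [v] on [f] conjugated by [g]; then [attained_constant] applies. *)
Lemma conj_constant v f : lie_algebra v -> smooth_fun f ->
  (forall w g, attained w -> lie_bracket w v (fun y => f (g * y * g^-1)%g) = 0) ->
  forall h, Ad h v f = v f.
Proof.
move=> lv fs H h; pose phi h := v (fun y => f (h * y * h^-1)%g).
have ps : smooth_fun phi by exact: (smooth2_tangent lv (smooth2_conj fs)).
rewrite -[RHS](congr1 (fun w => w f) (Ad1 v)); apply: (attained_constant dfin ps) => w aw g.
rewrite -(H w g aw) -(tangent_conj lv (attained_lie aw)); last exact: smooth_fun_conj.
rewrite /left_invariant_field /dL /phi; congr w; apply/funext => x; congr v; apply/funext => y.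
by rewrite invgM !mulgA.
Qed.

(** The map y |-> h y h^-1 y^-1 has zero derivative along attained vectors, so smooth functions of
    it are constant; smooth functions separate points. *)
Lemma commute_of_Ad (h x : G) : (forall v f, attained v -> smooth_fun f -> Ad h v f = v f) ->
  (h * x = x * h)%g.
Proof.
move=> H; suff E : (h * x * h^-1 * x^-1 = 1)%g.
  by have := congr1 (fun y => y * x * h)%g E; rewrite mul1g mulgVK mulgVK.
apply: smooth_separates => f fs; pose K y := f (h * y * h^-1 * y^-1)%g.
have Ks : smooth_fun K.
  apply: (smooth2_fun1 1%g (Phi := fun y _ => f (h * y * h^-1 * y^-1)%g)).
  apply: smooth_fun2 => // E' U a b sa sb; have [Uo _ _] := sa.
  have cst (g : G) : smooth_map U (fun=> g) by exact: smooth_map_cst.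
  by do !apply: smooth_map_mul => //; exact: smooth_map_inv.
have := attained_constant dfin Ks _ x 1%g; rewrite /K invg1 !mulg1 mulgV; apply=> v av y.
apply: tangent_comm => //; [exact: attained_lie|by move=> f' fs'; exact: H].
Qed.

(** The sum of the layers of index at least [i], encoded as an intersection of subspaces to get an
    induction principle. *)
Definition flag (i : nat) v : Prop := forall S, subspace_set S ->
  (forall k, (1 <= k <= s)%N -> (i <= k)%N -> layer G k `<=` S) -> S v.

Lemma flag_subspace i : subspace_set (flag i).
Proof.
apply: subspace_mk => [S sS _|a v w Fv Fw S sS HS]; first exact: subspace_0.
by apply: subspace_lin => //; [exact: Fv|exact: Fw].
Qed.

Lemma flag_layer i k v : (1 <= k <= s)%N -> (i <= k)%N -> layer G k v -> flag i v.
Proof. by move=> ks ik lv S _ HS; exact: (HS k). Qed.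

Lemma flagS i j v : (i <= j)%N -> flag j v -> flag i v.
Proof. by move=> ij Fv S sS HS; apply: Fv => // k ks jk; apply: HS => //; exact: leq_trans jk. Qed.

Lemma flag_lie i v : flag i v -> lie_algebra v.
Proof. by apply; [exact: lie_subspace|move=> k ks _ w; exact: layer_lie]. Qed.

Lemma flag_top i v : (s < i)%N -> flag i v -> v = 0.
Proof.
move=> si Fv; apply: (Fv [set 0]) => [|k /andP[_ ks] ik].
  by apply: subspace_mk => // a v' w -> ->; rewrite scaler0 addr0.
by have := leq_trans si ik; rewrite ltnNge ks.
Qed.

Lemma bracket_lin v w u (a : R) : lie_algebra v -> lie_algebra w -> lie_algebra u ->
  lie_bracket v (a *: w + u) = a *: lie_bracket v w + lie_bracket v u.
Proof.
move=> lv lw lu; apply/funext => f; rewrite /lie_bracket.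
rewrite -[RHS]/(a * (v (lif w f) - w (lif v f)) + (v (lif u f) - u (lif v f))).
rewrite -[(a *: w + u) (lif v f)]/(a * w (lif v f) + u (lif v f)).
suff -> : v (lif (a *: w + u) f) = a * v (lif w f) + v (lif u f) by ring.
have E : lif (a *: w + u) f = fun x => a * lif w f x + lif u f x by [].
have [fs|nf] := pselect (smooth_fun f).
  by rewrite E; have [-> //] := lv; exact: smooth_field.
have lif0 v' : lie_algebra v' -> lif v' f = fun=> 0.
  move=> [_ _ v0]; apply/funext => x; apply: v0 => /(smooth_fun_lmul x^-1%g).
  by move=> fs; apply: nf; move: fs; congr smooth_fun; apply/funext => y; rewrite mulVKg.
rewrite E !lif0 //; under eq_fun do rewrite mulr0 addr0.
by rewrite (tangent_cst lv) mulr0 addr0.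
Qed.

Lemma flag_bracket i v w : layer G 1 w -> flag i v -> flag i.+1 (lie_bracket w v).
Proof.
move=> lw Fv; have llw := layer1_lie lw.
pose S := [set u | lie_algebra u /\ flag i.+1 (lie_bracket w u)].
suff [] : S v by [].
apply: Fv => [|k ks ik u lu].
  apply: subspace_mk => [|a u u' [lu Fu] [lu' Fu']].
    split; first exact: (subspace_0 lie_subspace).
    have := bracket_lin 1 llw (subspace_0 lie_subspace) (subspace_0 lie_subspace).
    rewrite scale1r add0r scale1r => E; have -> : lie_bracket w 0 = 0.
      by apply: (@addrI _ (lie_bracket w 0)); rewrite -E addr0.
    exact: subspace_0 (flag_subspace _).
  split; first exact: (subspace_lin _ lie_subspace).
  by rewrite bracket_lin //; exact: (subspace_lin _ (flag_subspace _)).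
split; first exact: (layer_lie ks).
have [_ _ _ [gen last _]] := carnot_stratification G.
have inb : lie_bracket_set (layer G 1) (layer G k) (lie_bracket w u).
  by move=> S' [sS' HS']; apply: HS'; exists w => //; exists u.
move: ks inb => /andP[k1 ks]; case: (ltngtP k s) ks => // [ks _|ks _].
  rewrite gen; last by rewrite k1.
  by move=> lb; apply: (@flag_layer _ k.+1) lb => //; rewrite ks andbT.
by rewrite ks last => ->; exact: subspace_0 (flag_subspace _).
Qed.

(** Descending induction on [i]. If the difference were outside [flag i.+1], some [f] vanishing on
    [flag i.+1] would separate it. But the derivatives of [Ad h v f] in [h] are values of [f] on
    conjugates of brackets, which lie in [flag i.+1] by induction; so [Ad h v f] does not depend on
    [h]. *)
Lemma Ad_flag i v h : flag i v -> flag i.+1 (Ad h v - v).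
Proof.
have [k ik] := ubnP (s.+1 - i); elim: k i ik v h => // k IH i ik v h Fv.
have [si|is_] := ltnP s i.
  rewrite (flag_top si Fv) -[Ad h 0]/(0 : (G -> R) -> R^o) subrr; exact: subspace_0 (flag_subspace _).
have AdF u g : flag i.+1 u -> flag i.+1 (Ad g u).
  move=> Fu; rewrite -[Ad g u](subrK u) -[Ad g u - u]scale1r.
  apply: (subspace_lin _ (flag_subspace _)) => //.
  by apply: (@flagS _ i.+2) => //; apply: IH => //; lia.
have lv := flag_lie Fv.
have ld : lie_algebra (Ad h v - v).
  by rewrite addrC -scaleN1r; apply: (subspace_lin _ lie_subspace) => //; exact: Ad_lie.
apply: contrapT => nF.
have [f [fs f0]] := separation (flag_subspace i.+1) (@flag_lie _) ld nF.
move=> /eqP; apply; rewrite -[(Ad h v - v) f]/(Ad h v f - v f).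
rewrite (conj_constant lv fs) ?subrr // => w g [lw _].
exact: (f0 _ (AdF _ g (flag_bracket lw Fv))).
Qed.

Lemma Ad_flag_stable i v h : flag i v -> flag i (Ad h v).
Proof.
move=> Fv; rewrite -[Ad h v](subrK v) -[_ - v]scale1r.
apply: (subspace_lin _ (flag_subspace _)) => //.
by apply: (@flagS _ i.+1) => //; exact: Ad_flag.
Qed.

(** Level [j] consists of the elements whose adjoint action is the identity up to a shift by [j.+1]
    in the flag. The cut at [s] is legitimate since elements of level s-1 fix every attained vector,
    hence are central by [Ad_central], and their commutators are 1. *)
Definition Ad_filtration (j : nat) : set G := if (j < s)%N
  then [set h | forall i v, flag i v -> flag (i + j.+1) (Ad h v - v)] else [set 1%g].

Lemma flag_sub i v w : flag i v -> flag i w -> flag i (v - w).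
Proof. by move=> Fv Fw; rewrite addrC -scaleN1r; exact: (subspace_lin _ (flag_subspace _)). Qed.

Lemma flag_add i v w : flag i v -> flag i w -> flag i (v + w).
Proof. by move=> Fv Fw; rewrite -[v]scale1r; exact: (subspace_lin _ (flag_subspace _)). Qed.

Lemma Ad_central h : (forall i v, flag i v -> flag (i + s) (Ad h v - v)) ->
  forall x, (h * x = x * h)%g.
Proof.
move=> H x; apply: commute_of_Ad => v f [lv _] fs.
have F1 : flag 1 v by exact: (flag_layer layer1_index).
by have /eqP := flag_top (ltnSn s) (H 1%N v F1); rewrite subr_eq0 => /eqP ->.
Qed.

Lemma Ad_filtration_central : central_filtration setT Ad_filtration.
Proof.
have [s0 _ _ _] := carnot_stratification G.
have comm0 (h u : G) : (forall x, u * x = x * u)%g -> [~ h, u]%g = 1%g.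
  by move=> H; rewrite commgEl /conjg -(H h) mulKg mulVg.
split.
- apply/seteqP; split=> // h _; rewrite /Ad_filtration s0 => i v Fv.
  by rewrite addn1; exact: Ad_flag.
- move=> j; rewrite /Ad_filtration; case: ifP => _; last first.
    by split=> // [g h -> ->|g ->]; rewrite ?mulg1 ?invg1.
  split=> [i v Fv|g h Hg Hh i v Fv|g Hg i v Fv].
  + by rewrite Ad1 subrr; exact: subspace_0 (flag_subspace _).
  + rewrite Ad_mul -(subrK (Ad h v) (Ad g (Ad h v))) -addrA; apply: flag_add; last exact: Hh.
    by apply: Hg; exact: Ad_flag_stable.
  + have Fg : flag i (Ad g^-1%g v) by exact: Ad_flag_stable.
    have := Hg i _ Fg; rewrite -Ad_mul mulgV Ad1 -opprB => H.
    move: H; set X := Ad _ v - v => H; rewrite -[X]opprK -scaleN1r -[_ *: _]addr0.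
    by apply: (subspace_lin _ (flag_subspace _)) => //; exact: subspace_0 (flag_subspace _).
- move=> j h; rewrite /Ad_filtration; case: (ltnP j.+1 s) => js.
    rewrite (ltnW js) => H i v Fv; apply: flagS (H i v Fv); lia.
  move=> /= ->; case: ifP => // _ i v Fv.
  by rewrite Ad1 subrr; exact: subspace_0 (flag_subspace _).
move=> j g h _; rewrite /Ad_filtration; case: (ltnP j s) => js; last first.
  by move=> /= ->; rewrite commg1; case: ifP => // _ i v Fv; rewrite Ad1 subrr; exact: subspace_0 (flag_subspace _).
move=> Hh; case: ltnP => js1; last first.
  have E : j.+1 = s by apply/eqP; rewrite eqn_leq js js1.
  by apply: comm0; apply: Ad_central; rewrite -E.
move=> i v Fv.
have cE : [~ g, h]%g = ((h * g)^-1 * (g * h))%g by rewrite commgEl /conjg invgM !mulgA.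
(* Up to [Ad (h * g)^-1], the operator Ad [g,h] - 1 is the commutator of Ad g - 1 and Ad h - 1, so
   the two shifts in the flag add up. *)
have -> : Ad [~ g, h]%g v - v = Ad (h * g)^-1%g (Ad (g * h)%g v - Ad (h * g)%g v).
  by rewrite AdB -!Ad_mul mulVg Ad1 cE.
apply: Ad_flag_stable.
have -> : Ad (g * h)%g v - Ad (h * g)%g v =
    (Ad g (Ad h v - v) - (Ad h v - v)) - (Ad h (Ad g v - v) - (Ad g v - v)).
  rewrite !AdB !Ad_mul; move: (Ad g (Ad h v)) (Ad h (Ad g v)) (Ad g v) (Ad h v) => a b c d.
  by apply/funext => f; rewrite /GRing.add /GRing.opp /=; ring.
apply: flag_sub; first by rewrite addnS; apply: Ad_flag; exact: Hh.
have := Hh _ _ (Ad_flag g Fv); by rewrite addSnnS.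
Qed.

Lemma Ad_filtration_top : Ad_filtration s `<=` [set 1%g].
Proof. by rewrite /Ad_filtration ltnn. Qed.

Lemma abelian_of_attained :
  (forall v w, attained v -> attained w -> forall f, smooth_fun f -> lie_bracket v w f = 0) ->
  forall x y : G, (x * y = y * x)%g.
Proof.
move=> H x y; apply: commute_of_Ad => v f av fs.
apply: (conj_constant (attained_lie av) fs) => w g aw.
by apply: H => //; exact: smooth_fun_conj.
Qed.

End nilpotent.

(** * Bounds for the Carnot metric *)

Section orthonormal.
Context {R : realType} {G : carnotGroup R}.
Local Notation lif := left_invariant_field.
Implicit Types (v w u z : (G -> R) -> R^o) (f : G -> R).
Local Notation V := (layer G 1).
Local Notation ip := (hscal G).

Lemma layer1_subspace : subspace_set V.
Proof. by apply: subspace_mk; [exact: layer1_0|exact: layer1_lin]. Qed.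

Lemma ip_lin (a : R) u v w : V u -> V v -> V w -> ip (a *: u + v) w = a * ip u w + ip v w.
Proof. by have [_ + _] := carnot_hscal G; exact. Qed.

Lemma ip_sym v w : V v -> V w -> ip v w = ip w v.
Proof. by have [+ _ _] := carnot_hscal G; exact. Qed.

Lemma ip_pos v : V v -> v <> 0 -> 0 < ip v v.
Proof. by have [_ _ +] := carnot_hscal G; exact. Qed.

Lemma ip0 w : V w -> ip 0 w = 0.
Proof.
move=> Vw; have := ip_lin 1 layer1_0 layer1_0 Vw.
by rewrite scale1r add0r mul1r => E; apply: (@addrI _ (ip 0 w)); rewrite -E addr0.
Qed.

Lemma ip_ge0 v : V v -> 0 <= ip v v.
Proof.
move=> Vv; have [->|/eqP v0] := eqVneq v 0; first by rewrite ip0 //; exact: layer1_0.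
exact/ltW/ip_pos.
Qed.

Lemma ip_sum N (a : 'I_N -> R) (e : 'I_N -> (G -> R) -> R^o) w : (forall i, V (e i)) -> V w ->
  ip (\sum_i a i *: e i) w = \sum_i a i * ip (e i) w.
Proof.
elim: N a e => [|N IH] a e Ve Vw; first by rewrite !big_ord0 ip0.
rewrite !big_ord_recl ip_lin // ?IH //; exact: (subspace_sum _ layer1_subspace).
Qed.

Definition orthonormal N (e : 'I_N -> (G -> R) -> R^o) : Prop :=
  (forall i, V (e i)) /\ forall i j, ip (e i) (e j) = (i == j)%:R.

Lemma orthonormal_coord N e (a : 'I_N -> R) j : orthonormal e -> ip (\sum_i a i *: e i) (e j) = a j.
Proof.
move=> [Ve eo]; rewrite ip_sum // (bigD1 j) //= eo eqxx mulr1 big1 ?addr0 // => i ij.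
by rewrite eo (negbTE ij) mulr0.
Qed.

Lemma orthonormal_size N (e : 'I_N -> (G -> R) -> R^o) : orthonormal e -> (N <= carnot_dim G)%N.
Proof.
move=> eo; have [Ve _] := eo; have [c ac c1] := atlas_cover (1%g : G).
have [xi Hxi] := local_coordinates ac c1.
pose A : 'M[R]_(N, carnot_dim G) := \matrix_(i, j) e i (xi j).
suff /eqP <- : row_free A by exact: rank_leq_col.
apply: inj_row_free => x xA; apply/rowP => k; rewrite mxE.
pose w := \sum_i x ord0 i *: e i.
have Vw : V w by exact: (subspace_sum _ layer1_subspace).
have w0 : w = 0.
  apply: lie_eq; [exact: layer1_lie|exact: (subspace_0 lie_subspace)|] => f fs.
  rewrite (hadamard (layer1_lie Vw) ac c1 (fun i => (Hxi i).1) (fun i => (Hxi i).2) fs).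
  apply: big1 => j _; rewrite /w fct_sumE.
  have := congr1 (fun r : 'rV_(carnot_dim G) => r ord0 j) xA; rewrite !mxE => E.
  suff -> : \sum_i (x ord0 i *: e i) (xi j) = 0 by rewrite mul0r.
  by rewrite -[RHS]E; apply: eq_bigr => i _; rewrite mxE.
by rewrite -(orthonormal_coord (x ord0) k eo) -/w w0 ip0.
Qed.

(** A maximal orthonormal family, which exists because its size is bounded by the dimension of [G];
    it gives uniform control of all unit horizontal vectors by finitely many. *)
Lemma horizontal_frame : exists N (e : 'I_N -> (G -> R) -> R^o), (forall i, V (e i)) /\
  forall v f, V v -> `|v f| <= Num.sqrt (ip v v) * \sum_i `|e i f|.
Proof.
pose P N := `[< exists e : 'I_N -> (G -> R) -> R^o, orthonormal e >].
have P0 : P 0%N by apply/asboolP; exists (fun=> 0); split; case.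
have Pn N : P N -> (N <= carnot_dim G)%N by move=> /asboolP[e]; exact: orthonormal_size.
have [N /asboolP[e eo] Nmax] := ex_maxnP (ex_intro _ 0%N P0) Pn.
have [Ve ee] := eo; exists N, e; split=> // v f Vv.
pose a i := ip v (e i); pose w := \sum_i a i *: e i.
have Vw : V w by exact: (subspace_sum _ layer1_subspace).
pose r := v - w.
have rE : r = -1 *: w + v by rewrite scaleN1r addrC.
have Vr : V r by rewrite rE; exact: layer1_lin.
have re i : ip r (e i) = 0.
  by rewrite rE ip_lin // /w (orthonormal_coord a i eo) /a mulN1r addNr.
have r0 : r = 0.
  apply: contrapT => r0; have rp := ip_pos Vr r0.
  have sp : 0 < Num.sqrt (ip r r) by rewrite sqrtr_gt0.
  pose r' := (Num.sqrt (ip r r))^-1 *: r.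
  have r'E : r' = (Num.sqrt (ip r r))^-1 *: r + 0 by rewrite addr0.
  have Vr' : V r' by rewrite r'E; apply: layer1_lin => //; exact: layer1_0.
  have r'l z : V z -> ip r' z = (Num.sqrt (ip r r))^-1 * ip r z.
    by move=> Vz; rewrite r'E ip_lin ?ip0 ?addr0 //; exact: layer1_0.
  have r'r' : ip r' r' = 1.
    rewrite r'l // ip_sym // r'l // mulrA -invfM -expr2 sqr_sqrtr ?mulVf ?gt_eqF //; exact: ltW.
  suff /Nmax : P (N + 1)%N by rewrite addn1 ltnn.
  apply/asboolP; exists (fun i => match fintype.split i with inl i => e i | inr _ => r' end).
  split=> [i|i j]; first by case: fintype.split.
  rewrite -(splitK i) -(splitK j) (can_eq (@unsplitK N 1)) !unsplitK.
  case: (fintype.split i) => i'; case: (fintype.split j) => j'.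
  - by rewrite ee.
  - by rewrite ip_sym // r'l // re mulr0.
  - by rewrite r'l // re mulr0.
  - by rewrite r'r' !ord1 eqxx.
have vw : v = w by apply/eqP; rewrite -subr_eq0 -/r r0.
have ale i : `|a i| <= Num.sqrt (ip v v).
  rewrite -[`|a i|]sqrtr_sqr ?normr_id; have Vei := Ve i.
  rewrite ler_wsqrtr //.
  (* Bessel's inequality for one vector: the square of [a i] is at most [ip v v], because [ip q q]
     is nonnegative. *)
  pose q := - a i *: e i + v.
  have Vq : V q by exact: layer1_lin.
  have := ip_ge0 Vq; rewrite {1}/q ip_lin // ip_sym // (ip_sym Vv Vq) /q !ip_lin //.
  by rewrite ee eqxx -[true%:R]/(1 : R) (ip_sym Vei Vv) -/(a i) expr2; lra.
rewrite {1}vw /w fct_sumE mulr_sumr; apply: le_trans (ler_norm_sum _ _ _) _.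
by apply: ler_sum => i _; rewrite -[(a i *: e i) f]/(a i * e i f) normrM ler_wpM2r.
Qed.

Lemma compact_bump : exists (K : set G) (rho : G -> R), [/\ compact K, smooth_fun rho,
  \forall x \near (1%g : G), rho x = 1 & forall x, rho x != 0 -> K x].
Proof.
have [c ac c1] := atlas_cover (1%g : G).
have Uo := chart_img_openW _ _ _ c; have [r r0 Hr] := ball_in_open Uo (chart_imgP c1).
have [|rho [rs r1 rK]] := @bump_extension R _ G c (fun=> 1) _ _ r ac Uo (@subset_refl _ _) _ r0 Hr.
  by move=> k; exact: (Ck_cst _ (1 : R^o)).
pose Q : set 'rV[R]_(carnot_dim G) := [set q | forall i,
  `[c 1%g ord0 i - 3 / 2 * r, c 1%g ord0 i + 3 / 2 * r]%classic (q ord0 i)].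
have Qc : compact Q.
  apply: (@rV_compact R _ (fun i => `[c 1%g ord0 i - 3 / 2 * r, c 1%g ord0 i + 3 / 2 * r]%classic)) => i.
  exact: segment_compact.
have QU q : Q q -> chart_img c q.
  move=> Qq; apply: Hr; apply: mx_norm_le => [|i]; first by rewrite mulr_ge0 // ltW.
  by have := Qq i; rewrite /= in_itv /= !mxE => /andP[h1 h2]; rewrite ler_norml; apply/andP; split; lra.
exists (chart_inv c @` Q), rho; split=> //.
- apply: continuous_compact => //; apply: (continuous_subspaceW QU); exact: chart_inv_continuous.
- by apply: filterS (near_chart c1 r0) => x [cx /(r1 _ cx)].
move=> x /rK[cx xr]; exists (c x); last by rewrite chart_funK.
move=> i; rewrite /= in_itv /=; have := le_trans (mx_coord_le (c x - c 1%g) i) xr.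
by rewrite !mxE ler_norml => /andP[h1 h2]; apply/andP; split; lra.
Qed.

Lemma bounded_of_support (K : set G) f : compact K -> smooth_fun f -> (forall x, f x != 0 -> K x) ->
  exists2 B : R, 0 < B & forall x, `|f x| <= B.
Proof.
move=> Kc fs fK; have cK : compact (f @` K).
  by apply: continuous_compact => //; apply: continuous_subspaceT; exact: smooth_fun_continuous.
have [B [_ HB]] := compact_bounded cK.
exists (Num.max 1 (B + 1)); first by rewrite lt_max ltr01.
move=> x; have [-> |/fK Kx] := eqVneq (f x) 0; first by rewrite normr0 le_max ler01.
by rewrite le_max (HB (B + 1)) ?orbT ?ltrDl //; exists x.
Qed.

Lemma lif_support (K : set G) v f : lie_algebra v -> compact K -> smooth_fun f ->
  (forall x, f x != 0 -> K x) -> forall x, lif v f x != 0 -> K x.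
Proof.
move=> lv Kc fs fK x; apply: contra_neqP => Kx.
have Ko : open (~` K) by apply: closed_openC; apply: compact_closed Kc; exact: manifold_hausdorff.
rewrite /left_invariant_field /dL -(tangent_cst lv 0).
apply: (tangent_near lv); [exact: smooth_fun_lmul|exact: smooth_fun_cst|].
have cx : continuous (fun y : G => (x * y)%g).
  move=> y; apply: (@continuous_comp _ _ _ (fun y => (x, y)) (fun p : G * G => p.1 * p.2)%g).
    by apply: cvg_pair; [exact: cvg_cst|exact: cvg_id].
  exact: lie_mul_continuous.
have : \forall y \near (1%g : G), (~` K) (x * y)%g.
  by apply: cx; apply: open_nbhs_nbhs; split=> //; rewrite mulg1.
by apply: filterS => y nK; apply/eqP; apply: contrapT => /negP/fK.
Qed.

(** The horizontal derivatives of [f] vanish at the identity and have bounded horizontal derivatives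
    by compact support. Along a curve of length [ell] they are thus O([ell]), and a second
    application of [curve_estimate] gives the square. *)
Lemma second_order (K : set G) f : compact K -> smooth_fun f -> (forall x, f x != 0 -> K x) ->
  (forall v, V v -> v f = 0) ->
  exists2 C : R, 0 < C & forall (g c : G) (ell : R), (carnot_dist g (g * c)%g < ell%:E)%E ->
    `|f c - f 1%g| <= C * ell ^+ 2.
Proof.
move=> Kc fs fK Vf; have [N [e [Ve He]]] := horizontal_frame.
have le i := layer1_lie (Ve i).
have [B B0 HB] : exists2 B : R, 0 < B & forall i j x, `|lif (e j) (lif (e i) f) x| <= B.
  have [||d d0 Hd] := @uniform_delta R N (fun i d => forall j x, `|lif (e j) (lif (e i) f) x| <= d^-1).
  - move=> i d d' d'0 dd' H j x; apply: le_trans (H j x) _.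
    by rewrite lef_pV2 // posrE // (lt_le_trans d'0).
  - move=> i; have [||d d0 Hd] := @uniform_delta R N (fun j d => forall x, `|lif (e j) (lif (e i) f) x| <= d^-1).
    + move=> j d d' d'0 dd' H x; apply: le_trans (H x) _.
      by rewrite lef_pV2 // posrE // (lt_le_trans d'0).
    + move=> j; have s1 := smooth_field (le i) fs; have s2 := smooth_field (le j) s1.
      have [B B0 HB] := bounded_of_support Kc s2 (lif_support (le j) Kc s1 (lif_support (le i) Kc fs fK)).
      by exists B^-1; [rewrite invr_gt0|move=> x; rewrite invrK].
    by exists d.
  by exists d^-1; [rewrite invr_gt0|].
(* The added units keep the constants positive when the frame is empty. *)
pose C1 := N%:R * B + 1.
have NR : 0 <= (N%:R : R) by [].
have C10 : 0 < C1 by rewrite ltr_wpDl // mulr_ge0 // ltW.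
exists ((N%:R + 1) * C1); first by rewrite mulr_gt0 // ltr_wpDl.
move=> g c ell dist; have [_ [gam [gh g0 g1] <-] gl] := ereal_inf_lt dist.
have gl' := ltW gl.
have ell0 : 0 < ell.
  by rewrite -lte_fin; apply: le_lt_trans gl; apply: integral_ge0 => t _; rewrite lee_fin sqrtr_ge0.
pose phi x := f (g^-1 * x)%g.
have ps : smooth_fun phi by exact: smooth_fun_lmul.
have lphi v x : lif v phi x = lif v f (g^-1 * x)%g.
  by rewrite /left_invariant_field /dL /phi; congr v; apply/funext => y; rewrite mulgA.
have first i t : 0 <= t <= 1 -> `|lif (e i) f (g^-1 * gam t)%g| <= C1 * ell.
  move=> t01; pose phi1 x := lif (e i) f (g^-1 * x)%g.
  have ps1 : smooth_fun phi1 by apply: smooth_fun_lmul; exact: smooth_field.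
  have := @curve_estimate R G gam phi1 C1 ell gh ps1 C10 _ gl' t t01.
  rewrite /phi1 g0 mulVg [lif (e i) f 1%g](_ : _ = 0); last first.
    rewrite /left_invariant_field /dL -[RHS](Vf _ (Ve i)); congr (e i).
    by apply/funext => y; rewrite mul1g.
  rewrite subr0; apply=> t' v _ Vv.
  have -> : lif v (fun x => lif (e i) f (g^-1 * x)%g) (gam t') = lif v (lif (e i) f) (g^-1 * gam t')%g.
    by rewrite {1 3}/left_invariant_field /dL; congr v; apply/funext => y; rewrite mulgA.
  rewrite {1}/left_invariant_field /dL; apply: le_trans (He v _ Vv) _.
  rewrite mulrC ler_wpM2r ?sqrtr_ge0 // /C1.
  apply: le_trans (_ : \sum_(i < N) B <= _); first by apply: ler_sum => j _; exact: HB.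
  by rewrite sumr_const card_ord -[B *+ _]mulr_natl lerDl.
have := @curve_estimate R G gam phi ((N%:R + 1) * (C1 * ell)) ell gh ps _ _ gl' 1.
rewrite g0 g1 /phi mulKg mulVg expr2 !mulrA; apply.
- by rewrite !mulr_gt0 // ltr_wpDl.
- move=> t v /andP[t0 t1] Vv; rewrite -[lif v _ _]/(lif v phi _) lphi {1}/left_invariant_field /dL.
  apply: le_trans (He v _ Vv) _; rewrite mulrC ler_wpM2r ?sqrtr_ge0 //.
  apply: le_trans (_ : \sum_(i < N) C1 * ell <= _).
    by apply: ler_sum => j _; apply: first; rewrite !ltW.
  by rewrite sumr_const card_ord -[(C1 * ell) *+ _]mulr_natl -mulrA ler_wpM2r ?lerDl // mulr_ge0 // ltW.
by rewrite ler01 lexx.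
Qed.

End orthonormal.

(** * Second differences and commutators at small scale *)

Section mixed_difference.
Context {R : realType} {E : normedModType R} {N : nat} {b : 'I_N -> E} {p : 'I_N -> E -> R}.
Hypothesis C : coordinates b p.
Implicit Types (U : set E) (f : E -> R^o) (x v w : E).

Lemma derive_coordinates U f x v : open U -> Ck 1 U f -> U x ->
  'D_v f x = \sum_i p i v * 'D_(b i) f x.
Proof.
move=> Uo Cf Ux.
have := strict_diff_chain C (F := fun y : E => y) (dF := fun i => p i v) (x := x) (v := v)
  (h := f) (D := fun i => 'D_(b i) f x).
move=> /(_ _ (Ck_strict_diff C Uo Cf Ux)) H; apply: (@derive_val _ _ _ _ _ _ _ (H _)) => i.
apply/is_deriveP => e e0; exists 1 => // h h0 _ /=.
have [L _ _] := C; rewrite L addrK -[_ *: _]/(_ * _) mulKf // subrr normr0; exact: ltW.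
Qed.

Lemma derive2_coordinates U f x v w : open U -> Ck 2 U f -> U x ->
  'D_w ('D_v f) x = \sum_j \sum_i p j w * (p i v * 'D_(b i) ('D_(b j) f) x).
Proof.
move=> Uo Cf Ux; rewrite (derive_coordinates w Uo (Ck_D v Cf) Ux); apply: eq_bigr => j _.
rewrite (schwarz v (b j) Uo Cf Ux) (derive_coordinates v Uo (Ck_D (b j) Cf) Ux).
by rewrite mulr_sumr.
Qed.

Lemma coordinates_cvg (v : nat -> E) (l : E) : (forall i, p i (v n) @[n --> \oo] --> p i l) ->
  v n @[n --> \oo] --> l.
Proof.
move=> H; have [_ S _] := C; rewrite [X in _ --> X]S.
rewrite (_ : v = fun n => \sum_i p i (v n) *: b i); last by apply/funext => n; exact: S.
apply: cvg_big => [|i _]; first exact: add_continuous.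
by apply: cvgZl; exact: H.
Qed.

(** The mean value form evaluates the second mixed derivative at points tending to [x], on
    increments of order [delta]; expanding in coordinates reduces the limit to continuity of the
    second partial derivatives. *)
Lemma mixed_difference_cvg U f x (v w : nat -> E) (delta : nat -> R) (v0 w0 : E) :
  open U -> Ck 2 U f -> U x -> (forall n, 0 < delta n) -> delta n @[n --> \oo] --> (0 : R) ->
  (forall i, p i (v n) / delta n @[n --> \oo] --> p i v0) ->
  (forall i, p i (w n) / delta n @[n --> \oo] --> p i w0) ->
  (f (v n + (w n + x)) - f (v n + x) - (f (w n + x) - f x)) / delta n ^+ 2 @[n --> \oo] -->
    'D_w0 ('D_v0 f) x.
Proof.
move=> Uo Cf Ux d0 dc vc wc.
have c0 (v' : nat -> E) v0' : (forall i, p i (v' n) / delta n @[n --> \oo] --> p i v0') ->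
    v' n @[n --> \oo] --> 0.
  move=> H; apply: coordinates_cvg => i.
  have -> : p i 0 = p i v0' * 0 by have := coordB C i 0 0; rewrite !subrr mulr0.
  rewrite (_ : (fun n => p i (v' n)) = fun n => p i (v' n) / delta n * delta n); last first.
    by apply/funext => n; rewrite divfK // gt_eqF.
  exact: cvgM (H i) dc.
have v0c := c0 v v0 vc; have w0c := c0 w w0 wc.
have /nbhs_ballP[r /= r0 Hr] := open_nbhs_nbhs (conj Uo Ux).
have inU n : `|v n| < r / 2 -> `|w n| < r / 2 -> forall s t : R, `|s| <= 1 -> `|t| <= 1 ->
    U (s *: v n + (t *: w n + x)).
  move=> hv hw s t hs ht; apply: Hr; rewrite -ball_normE /= distrC addrA addrK.
  apply: le_lt_trans (ler_normD _ _) _; rewrite !normrZ.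
  have h1 : `|s| * `|v n| <= `|v n| by rewrite ler_piMl.
  have h2 : `|t| * `|w n| <= `|w n| by rewrite ler_piMl.
  by lra.
have r2 : 0 < r / 2 by rewrite divr_gt0.
have small : \forall n \near \oo, `|v n| < r / 2 /\ `|w n| < r / 2.
  move: v0c w0c => /cvgrPdist_lt/(_ _ r2) h1 /cvgrPdist_lt/(_ _ r2) h2.
  by apply: filterS2 h1 h2 => n; rewrite !sub0r !normrN.
have ex n : exists q : E, `|v n| < r / 2 /\ `|w n| < r / 2 ->
    U q /\ `|q - x| <= `|v n| + `|w n| /\
    f (v n + (w n + x)) - f (v n + x) - (f (w n + x) - f x) = 'D_(w n) ('D_(v n) f) q.
  have [[hv hw]|] := pselect (`|v n| < r / 2 /\ `|w n| < r / 2); last by exists x.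
  have [|s [t [hs ht Ed]]] := @double_mvt R E U f x (v n) (w n) 1 1 Uo Cf.
    by move=> s t; rewrite !normr1; exact: inU.
  rewrite !normr1 in hs ht; rewrite !scale1r !mul1r in Ed.
  exists (s *: v n + (t *: w n + x)) => _; split; first exact: inU.
  split=> //; rewrite addrA addrK; apply: le_trans (ler_normD _ _) _; rewrite !normrZ.
  by apply: lerD; rewrite ler_piMl.
have [q Hq] := choice ex.
have qc : q n @[n --> \oo] --> x.
  apply/cvgrPdist_lt => e e0; have e2 : 0 < e / 2 by rewrite divr_gt0.
  move: (v0c) (w0c) => /cvgrPdist_lt/(_ _ e2) h1 /cvgrPdist_lt/(_ _ e2) h2.
  apply: filterS3 small h1 h2 => n /Hq[_ [h _]]; rewrite !sub0r !normrN => h1 h2.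
  by rewrite distrC (le_lt_trans h) //; lra.
rewrite (derive2_coordinates v0 w0 Uo Cf Ux).
apply: (@cvg_trans _ ((fun n => \sum_j \sum_i (p j (w n) / delta n) *
    ((p i (v n) / delta n) * 'D_(b i) ('D_(b j) f) (q n))) @ \oo)).
  apply: near_eq_cvg; apply: filterS small => n hn.
  have [Uq [_ ->]] := Hq n hn; rewrite (derive2_coordinates (v n) (w n) Uo Cf Uq) mulr_suml.
  apply: eq_bigr => j _; rewrite mulr_suml; apply: eq_bigr => i _.
  have dn : delta n != 0 by rewrite gt_eqF.
  by field.
apply: cvg_big => [|j _]; first exact: add_continuous.
apply: cvg_big => [|i _]; first exact: add_continuous.
apply: cvgM; first exact: wc.
apply: cvgM; first exact: vc.
have cD : {for x, continuous ('D_(b i) ('D_(b j) f))}.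
  by apply: (Ck_for Uo (Ck_D (b i) (Ck_D (b j) Cf))).
exact: (@cvg_comp _ _ _ q ('D_(b i) ('D_(b j) f)) _ _ _ qc cD).
Qed.

End mixed_difference.

Section commutator.
Context {R : realType} {n : nat} {G : lieGroupType R n}.
Local Notation rV := 'rV[R]_n.
Local Notation lif := left_invariant_field.
Implicit Types (X Y : (G -> R) -> R^o) (f u : G -> R).
Let Crv := rV_coordinates R n.
Let C2 := prod_coordinates Crv Crv.

Lemma smooth_expg (f : G -> R) m : smooth_fun f -> smooth_fun (fun x => f (x ^+ m)%g).
Proof.
apply: smooth_fun_map => E U a sa; have [Uo _ _] := sa.
elim: m => [|m IH]; first exact: smooth_map_cst.
rewrite (_ : _ \o a = fun x => a x * (a x ^+ m))%g; first exact: smooth_map_mul.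
by apply/funext => x; rewrite /= expgS.
Qed.

Lemma tangent_expg X f m : lie_algebra X -> smooth_fun f -> X (fun x => f (x ^+ m)%g) = m%:R * X f.
Proof.
move=> lX fs; elim: m => [|m IH]; first by rewrite mul0r; exact: (tangent_cst lX (f 1%g)).
have s2 : smooth2 (fun x y => f (x * y ^+ m)%g).
  move=> E U a b sa sb k; have [Uo _ _] := sa.
  have sbm : smooth_map U (fun x => b x ^+ m)%g.
    elim: m {IH} => [|m IH]; first exact: smooth_map_cst.
    rewrite (_ : (fun x => _) = fun x => b x * (b x ^+ m))%g; first exact: smooth_map_mul.
    by apply/funext => x; rewrite /= expgS.
  by have [_ _] := smooth_map_mul sa sbm; exact.
have -> : (fun x => f (x ^+ m.+1)%g) = (fun x => f (x * x ^+ m)%g).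
  by apply/funext => x; rewrite expgS.
rewrite (tangent_diag lX s2) /=.
under eq_fun do rewrite expg1n mulg1.
under [X in _ + _ X]eq_fun do rewrite mul1g.
by rewrite IH -natr1; ring.
Qed.

(** Differentiating in [b] gives [Y u] minus the conjugate of [Y] by [a^-1] on [u]; the derivative
    in [a] is then that of [Ad], with two changes of sign. *)
Lemma commutator_derivative X Y u : lie_algebra X -> lie_algebra Y -> smooth_fun u ->
  X (fun a => Y (fun b => u [~ a, b]%g)) = lie_bracket X Y u.
Proof.
move=> lX lY us; pose g a := Y (fun b => u (a * b * a^-1)%g).
have gs : smooth_fun g by exact: (smooth2_tangent lY (smooth2_conj us)).
have E a : Y (fun b => u [~ a, b]%g) = -1 * g a^-1%g + Y u.
  have s2 : smooth2 (fun b b' => u (a^-1 * b^-1 * a * b')%g).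
    apply: smooth_fun2 => // E U b b' sb sb'; have [Uo _ _] := sb.
    have cst (g0 : G) : smooth_map U (fun=> g0) by exact: smooth_map_cst.
    by do !apply: smooth_map_mul => //; exact: smooth_map_inv.
  rewrite (_ : (fun b => u [~ a, b]%g) = (fun b => u (a^-1 * b^-1 * a * b)%g)); last first.
    by apply/funext => b; rewrite commgEl /conjg !mulgA.
  rewrite (tangent_diag lY s2); congr (_ + _); last first.
    by congr Y; apply/funext => b; rewrite invg1 mulg1 mulVg mul1g.
  rewrite mulN1r /g -(tangent_inv lY); last exact: smooth_fun_conj.
  by congr Y; apply/funext => b; rewrite mulg1 invgK.
under eq_fun do rewrite E.
have gis : smooth_fun (fun a => g a^-1%g).
  by apply: (@smooth_fun_map R n G g (fun a => a^-1)%g) gs => E' U a; exact: smooth_map_inv.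
have [-> //] := lX; last exact: smooth_fun_cst.
by rewrite (tangent_cst lX) addr0 (tangent_inv lX gs) mulN1r opprK /g (tangent_conj lY lX us).
Qed.

(* Powers of first-order approximations of one-parameter subgroups: the rescaled increment of
   [u] on their commutator converges to the derivative along the bracket. *)
Lemma commutator_cvg X Y u (x y : R -> G) (delta : nat -> R) m :
  lie_algebra X -> lie_algebra Y -> smooth_fun u -> x 0 = 1%g -> y 0 = 1%g ->
  (forall f, smooth_fun f -> is_derive (0 : R) (1 : R) (f \o x : R -> R^o) (X f)) ->
  (forall f, smooth_fun f -> is_derive (0 : R) (1 : R) (f \o y : R -> R^o) (Y f)) ->
  (forall k, 0 < delta k) -> delta k @[k --> \oo] --> (0 : R) ->
  (u [~ x (delta k) ^+ m, y (delta k) ^+ m]%g - u 1%g) / delta k ^+ 2 @[k --> \oo] -->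
    m%:R ^+ 2 * lie_bracket X Y u.
Proof.
move=> lX lY us x1 y1 xd yd d0 dc; have [c ac c1] := atlas_cover (1%g : G).
have [xi Hxi] := local_coordinates ac c1.
have quot (z : R -> G) Z f : z 0 = 1%g -> smooth_fun f ->
    (forall f, smooth_fun f -> is_derive (0 : R) (1 : R) (f \o z : R -> R^o) (Z f)) ->
    (f (z (delta k)) - f 1%g) / delta k @[k --> \oo] --> Z f.
  move=> z1 fs zd; have /is_deriveP H := zd f fs; apply/cvgrPdist_le => e e0.
  have [d d0' Hd] := H e e0; move: dc => /cvgrPdist_lt/(_ _ d0').
  apply: filterS => k; rewrite sub0r normrN => dk.
  have := Hd _ (lt0r_neq0 (d0 k)) dk; rewrite [_ *: 1]mulr1 addr0 /= z1 => h.
  by rewrite distrC mulrC.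
have cts (z : R -> G) Z f : z 0 = 1%g -> smooth_fun f ->
    (forall f, smooth_fun f -> is_derive (0 : R) (1 : R) (f \o z : R -> R^o) (Z f)) ->
    f (z (delta k)) @[k --> \oo] --> f 1%g.
  move=> z1 fs zd; have h : (f (z (delta k)) - f 1%g) / delta k * delta k + f 1%g @[k --> \oo] -->
      Z f * 0 + f 1%g.
    by apply: cvgD; [apply: cvgM; [exact: quot|exact: dc]|exact: cvg_cst].
  rewrite mulr0 add0r in h; apply: cvg_trans h; apply: near_eq_cvg; apply: nearW => k.
  by rewrite /= divfK ?subrK // gt_eqF.
have near1 (z : R -> G) Z (W : set G) : z 0 = 1%g -> open W -> W 1%g ->
    (forall f, smooth_fun f -> is_derive (0 : R) (1 : R) (f \o z : R -> R^o) (Z f)) ->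
    \forall k \near \oo, W (z (delta k) ^+ m)%g.
  move=> z1 Wo W1 zd; have [rho [rs r1 rW]] := bump_near Wo W1.
  have rE : rho 1%g = 1 by exact: nbhs_singleton r1.
  have := cts z Z _ z1 (smooth_expg m rs) zd; rewrite expg1n rE.
  move=> /cvgrPdist_lt/(_ _ ltr01); apply: filterS => k hk; apply: rW.
  by apply/eqP => E; move: hk; rewrite E subr0 normr1 ltxx.
have coord (z : R -> G) Z i : lie_algebra Z -> z 0 = 1%g ->
    (forall f, smooth_fun f -> is_derive (0 : R) (1 : R) (f \o z : R -> R^o) (Z f)) ->
    (c (z (delta k) ^+ m)%g - c 1%g) ord0 i / delta k @[k --> \oo] --> m%:R * Z (xi i).
  move=> lZ z1 zd; rewrite -(tangent_expg m lZ (Hxi i).1).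
  have := quot z Z _ z1 (smooth_expg m (Hxi i).1) zd; apply: cvg_trans; apply: near_eq_cvg.
  have [W [Wo W1 HW]] : exists W : set G, [/\ open W, W 1%g & forall y, W y -> xi i y = c y ord0 i].
    have : nbhs (1%g : G) [set y | xi i y = c y ord0 i] by exact: (Hxi i).2.
    by rewrite nbhsE => -[W [Wo W1] HW]; exists W.
  apply: filterS (near1 z Z W z1 Wo W1 zd) => k Wk.
  by rewrite (HW _ Wk) expg1n (HW _ W1) !mxE.
pose U : set (rV * rV) := [set p | chart_img c p.1 /\ chart_img c p.2].
have co := chart_img_openW _ _ _ c.
have Uo : open U.
  apply: (@openI _ (fst @^-1` chart_img c) (snd @^-1` chart_img c)).
    by apply: open_comp => // q _; exact: cvg_fst.
  by apply: open_comp => // q _; exact: cvg_snd.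
pose F (q : rV * rV) : R^o := u [~ chart_inv c q.1, chart_inv c q.2]%g.
have CF k : Ck k U F.
  have sc := smooth_map_chart ac.
  have s1 : smooth_map U (fun q : rV * rV => chart_inv c q.1).
    have := @smooth_map_affine R n G rV (rV * rV)%type _ _ fst fst (@continuous_fst _ _) (fun _ _ _ => erefl) sc.
    by move=> sH; apply: (smooth_map_sub _ _ sH) => // q [].
  have s2 : smooth_map U (fun q : rV * rV => chart_inv c q.2).
    have := @smooth_map_affine R n G rV (rV * rV)%type _ _ snd snd (@continuous_snd _ _) (fun _ _ _ => erefl) sc.
    by move=> sH; apply: (smooth_map_sub _ _ sH) => // q [].
  have s3 : smooth_map U (fun q : rV * rV => [~ chart_inv c q.1, chart_inv c q.2]%g).
    rewrite (_ : (fun q => _) = fun q : rV * rV => ((chart_inv c q.1)^-1 * ((chart_inv c q.2)^-1 *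
      (chart_inv c q.1 * chart_inv c q.2)))%g); last by apply/funext => q; rewrite commgEl /conjg.
    by do !apply: smooth_map_mul => //; exact: smooth_map_inv.
  by have [_ _] := s3; exact.
have p0 := chart_imgP c1; set o := c 1%g in p0.
have U0 : U (o, o) by split.
pose vec Z : rV := \row_i Z (xi i).
have lin Z f : lie_algebra Z -> smooth_fun f -> Z f = 'D_(vec Z) (f \o chart_inv c : rV -> R^o) o.
  move=> lZ fs; rewrite (hadamard lZ ac c1 (fun i => (Hxi i).1) (fun i => (Hxi i).2) fs).
  rewrite (derive_coordinates Crv (vec Z) co (fs c ac 1%N) p0).
  by apply: eq_bigr => i _; rewrite mxE.
pose v0 : rV * rV := (m%:R *: vec X, 0); pose w0 : rV * rV := (0, m%:R *: vec Y).
have bracketE : 'D_w0 ('D_v0 F) (o, o) = m%:R ^+ 2 * lie_bracket X Y u.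
  rewrite -(commutator_derivative lX lY us).
  have sc2 : smooth2 (fun a b => u [~ a, b]%g).
    apply: smooth_fun2 => // E U' a b sa sb.
    rewrite (_ : (fun e => _) = fun e => ((a e)^-1 * ((b e)^-1 * (a e * b e)))%g); last first.
      by apply/funext => e; rewrite commgEl /conjg.
    by do !apply: smooth_map_mul => //; exact: smooth_map_inv.
  have sY : smooth_fun (fun a => Y (fun b => u [~ a, b]%g)) by exact: (smooth2_tangent lY sc2).
  rewrite (schwarz v0 w0 Uo (CF 2%N) U0) (lin X _ lX sY).
  have E1 q : chart_img c q -> 'D_w0 F (q, o) = m%:R * (Y (fun b => u [~ chart_inv c q, b]%g)).
    move=> cq; rewrite (lin Y _ lY (smooth2_fun2 _ sc2)).
    have Uq : U (q, o) by split.
    have d1 := Ck_derive (CF 1%N) w0 Uq.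
    have [_ <-] := (is_derive_partial2 _ _ _ _ _).1 d1.
    have CY := smooth2_fun2 (chart_inv c q) sc2 ac 1%N.
    rewrite (derive_coordinates Crv _ co CY p0) [RHS]mulrC.
    rewrite (derive_coordinates Crv (vec Y) co CY p0) mulr_suml; apply: eq_bigr => i _.
    by rewrite !mxE; ring.
  have d2 := Ck_derive (Ck_D w0 (CF 2%N)) v0 U0.
  have d3 := (is_derive_partial1 _ _ _ _ _).1 d2.
  have CX : Ck 1 (chart_img c) ((fun a => Y (fun b => u [~ a, b]%g)) \o chart_inv c : rV -> R^o).
    exact: sY.
  have [|_ <-] := is_derive_local (g := fun q : rV => m%:R * (Y (fun b => u [~ chart_inv c q, b]%g)) : R^o) _ d3.
    have : \forall q \near o, chart_img c q by exact: open_nbhs_nbhs.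
    by apply: filterS => q; exact: E1.
  have CmX : Ck 1 (chart_img c) (fun q : rV => m%:R * (Y (fun b => u [~ chart_inv c q, b]%g)) : R^o).
    exact: (Ck_mul co (Ck_cst 1 (m%:R : R^o) co) CX).
  rewrite (derive_coordinates Crv _ co CmX p0) (derive_coordinates Crv (vec X) co CX p0) mulr_sumr.
  apply: eq_bigr => i _; rewrite !mxE.
  have dX := Ck_derive CX (delta_mx ord0 i) p0.
  have [_ ->] := is_deriveZ (m%:R : R) dX.
  by rewrite -[_ *: _]/(_ * _); ring.
rewrite -bracketE.
pose v k : rV * rV := (c (x (delta k) ^+ m)%g - o, 0).
pose w k : rV * rV := (0, c (y (delta k) ^+ m)%g - o).
(* The commutator is trivial when one argument is the identity, so the second mixed difference
   reduces to the increment of [u]. *)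
have Fo q : F (o, q) = u 1%g by rewrite /F /= /o chart_funK // comm1g.
have Fo' q : F (q, o) = u 1%g by rewrite /F /= /o chart_funK // commg1.
have := @mixed_difference_cvg R _ _ _ _ C2 U F (o, o) v w delta v0 w0 Uo (CF 2%N) U0 d0 dc.
have zero (j : 'I_n) : (0 : rV) ord0 j / delta k @[k --> \oo] --> (0 : rV) ord0 j.
  have z0 : (0 : rV) ord0 j = 0 by rewrite mxE.
  rewrite z0; apply: (@cvg_trans _ ((fun=> 0 : R) @ \oo)); last exact: cvg_cst.
  by apply: near_eq_cvg; apply: nearW => k; rewrite /= mul0r.
move=> H; apply: cvg_trans (H _ _).
- apply: near_eq_cvg.
  have cdo := chart_dom_open c.
  apply: filterS2 (near1 x X _ x1 cdo c1 xd) (near1 y Y _ y1 cdo c1 yd) => k xk yk.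
  congr (_ / _); rewrite /v /w.
  have -> : (0, c (y (delta k) ^+ m)%g - o) + (o, o) = (o, c (y (delta k) ^+ m)%g).
    by congr pair; rewrite /= ?add0r ?subrK.
  have -> : (c (x (delta k) ^+ m)%g - o, 0) + (o, o) = (c (x (delta k) ^+ m)%g, o).
    by congr pair; rewrite /= ?add0r ?subrK.
  have -> : (c (x (delta k) ^+ m)%g - o, 0) + (o, c (y (delta k) ^+ m)%g) =
      (c (x (delta k) ^+ m)%g, c (y (delta k) ^+ m)%g).
    by congr pair; rewrite /= ?add0r ?subrK.
  by rewrite !Fo !Fo' subrr subr0 /F /= !chart_funK.
- move=> i; rewrite /prod_coord; case: fintype.split => j; rewrite /v /v0 /=.
    by have := coord x X j lX x1 xd; rewrite (_ : (m%:R *: vec X) ord0 j = m%:R * X (xi j)) // !mxE.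
  exact: zero.
- move=> i; rewrite /prod_coord; case: fintype.split => j; rewrite /w /w0 /=; last first.
    by have := coord y Y j lY y1 yd; rewrite (_ : (m%:R *: vec Y) ord0 j = m%:R * Y (xi j)) // !mxE.
  exact: zero.
Qed.

End commutator.

(** * Distances in [L1] and in the group; conclusion *)

Section L1.
Context {R : realType}.
Local Notation mu := (lebesgue01 R).

Lemma L1_integrable (f : L1 R) : mu.-integrable setT (EFin \o (f : R -> R)).
Proof.
apply/integrableP; split.
  apply/measurable_EFinP; have H := @measurable_funPT _ _ _ _ (repr (LebesgueSpace.sort f)).
  exact: H.
by have := Lebesgue_finite (s := f); rewrite /finite_norm Lnorm1.
Qed.

Lemma L1distE (f g : L1 R) :
  L1dist f g = (\int[mu]_w `|(f : R -> R) w - (g : R -> R) w|)%:E.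
Proof.
have ifg : mu.-integrable setT (EFin \o ((f : R -> R) \- (g : R -> R))).
  have -> : EFin \o ((f : R -> R) \- (g : R -> R)) = ((EFin \o (f : R -> R)) \- (EFin \o (g : R -> R)))%E by [].
  by apply: integrableB => //; exact: L1_integrable.
rewrite /L1dist Lnorm1 /Rintegral fineK; first exact: eq_integral.
exact: (integrable_fin_num _ (integrable_norm ifg)).
Qed.

End L1.

Section carnot_distance.
Context {R : realType} {G : carnotGroup R}.
Local Notation lif := left_invariant_field.
Implicit Types (v w u z X Y : (G -> R) -> R^o) (f : G -> R).

Lemma carnot_dist_ge0 (x y : G) : (0 <= carnot_dist x y)%E.
Proof.
apply: le_ereal_inf_tmp => _ [g _ <-]; apply: integral_ge0 => t _.
by rewrite lee_fin sqrtr_ge0.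
Qed.

Lemma carnot_dist_lmul_le (a x y : G) : (carnot_dist (a * x)%g (a * y)%g <= carnot_dist x y)%E.
Proof.
apply: le_ereal_inf_tmp => _ [g [gh g0 g1] <-].
have [||| eh el] := @subarc R G g a 0 1 gh; [by []|exact: ler01|by []|].
apply: le_trans el; apply: ereal_inf_lbound.
exists (fun t => (a * g (clamp 0 1 t))%g) => //; split=> //.
  by rewrite clamp_le ?ler01 // g0.
by rewrite clamp_ge ?ler01 // g1.
Qed.

Lemma carnot_dist_lmul (g c : G) : carnot_dist g (g * c)%g = carnot_dist 1%g c.
Proof.
apply/eqP; rewrite eq_le; apply/andP; split.
  by have := carnot_dist_lmul_le g 1%g c; rewrite mulg1.
by have := carnot_dist_lmul_le g^-1%g g (g * c)%g; rewrite mulVg mulKg.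
Qed.

(** In step 1 the bracket would vanish, so it lies in the second layer; uniqueness of the
    decomposition keeps a nonzero vector from lying in two layers. *)
Lemma bracket_layer2 X Y : layer G 1 X -> layer G 1 Y -> lie_bracket X Y <> 0 ->
  lie_algebra (lie_bracket X Y) /\ ~ layer G 1 (lie_bracket X Y).
Proof.
move=> lX lY Z0; set Z := lie_bracket X Y in Z0 *.
have [s0 _ dec [gen last _]] := carnot_stratification G.
have inb : lie_bracket_set (layer G 1) (layer G 1) Z.
  by move=> S' [sS' HS']; apply: HS'; exists X => //; exists Y.
have s1 : (1 < carnot_step G)%N.
  rewrite ltn_neqAle s0 andbT; apply/eqP => E.
  by apply: Z0; move: inb; rewrite {2}E last.
have Z2 : layer G 2 Z by rewrite -gen // s1.
have lZ : lie_algebra Z by apply: (layer_lie _ Z2); rewrite s1.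
split=> // Z1; have [v [_ uniq]] := dec Z lZ.
pose i0 := Ordinal s0; pose i1 := Ordinal s1.
pose single (i : 'I_(carnot_step G)) : 'I_(carnot_step G) -> (G -> R) -> R^o :=
  fun j => if j == i then Z else 0.
have single_dec (i : 'I_(carnot_step G)) : layer G i.+1 Z ->
    (forall j : 'I_(carnot_step G), layer G j.+1 (single i j)) /\ Z = \sum_j single i j.
  move=> li; split=> [j|].
    rewrite /single; case: eqP => [-> //|_]; apply: layer_0; exact: ltn_ord.
  by rewrite (bigD1 i) //= /single eqxx big1 ?addr0 // => j /negbTE ->.
have e0 := uniq _ (single_dec i0 Z1); have e1 := uniq _ (single_dec i1 Z2).
apply: Z0; have := congr1 (fun h => h i0) e0; rewrite e1 /single eqxx.
by rewrite (_ : (i0 == i1) = false) // => ->.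
Qed.

Lemma carnot_commutator_lower X Y (x y : R -> G) (delta : nat -> R) :
  layer G 1 X -> layer G 1 Y -> lie_bracket X Y <> 0 -> x 0 = 1%g -> y 0 = 1%g ->
  (forall f, smooth_fun f -> is_derive (0 : R) (1 : R) (f \o x : R -> R^o) (X f)) ->
  (forall f, smooth_fun f -> is_derive (0 : R) (1 : R) (f \o y : R -> R^o) (Y f)) ->
  (forall n, 0 < delta n) -> delta n @[n --> \oo] --> (0 : R) ->
  exists2 k : R, 0 < k & forall m : nat, \forall n \near \oo,
    ((k * m%:R * delta n)%:E <= carnot_dist 1%g [~ x (delta n) ^+ m, y (delta n) ^+ m]%g)%E.
Proof.
move=> lX lY Z0 x1 y1 xd yd d0 dc; set Z := lie_bracket X Y in Z0.
have [lZ nZ] := bracket_layer2 lX lY Z0; rewrite -/Z in lZ nZ.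
have [f [fs Vf Zf]] := separation layer1_subspace (@layer1_lie R G) lZ nZ.
have [K [rho [Kc rs r1 rK]]] := @compact_bump R G.
pose u g := rho g * f g.
have us : smooth_fun u by exact: smooth_funM.
have uE v : lie_algebra v -> v u = v f.
  move=> lv; apply: (tangent_near lv) => //; apply: filterS r1 => g rg.
  by rewrite /u rg mul1r.
have uK g : u g != 0 -> K g by rewrite mulf_eq0 negb_or => /andP[/rK].
have Vu v : layer G 1 v -> v u = 0 by move=> lv; rewrite uE ?Vf //; exact: layer1_lie.
have [C C0 HC] := second_order Kc us uK Vu.
have Zu : Z u != 0 by rewrite uE.
pose a := `|Z u|; have a0 : 0 < a by rewrite normr_gt0.
(* With this choice a distance below [k m delta] bounds the increment of [u] by m^2 delta^2 a/2,
   whereas for small [delta] it exceeds this value, its quotient by delta^2 having a limit of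
   absolute value m^2 a. *)
pose k := Num.sqrt (a / (2 * C)).
have aC : 0 < a / (2 * C) by rewrite divr_gt0 // mulr_gt0.
have k0 : 0 < k by rewrite sqrtr_gt0.
have k2 : C * k ^+ 2 = a / 2 by rewrite sqr_sqrtr ?(ltW aC) //; field; rewrite gt_eqF.
exists k => // m; case: m => [|m].
  by apply: nearW => n; rewrite mulr0 mul0r; exact: carnot_dist_ge0.
have cv := @commutator_cvg R _ G X Y u x y delta m.+1 (layer1_lie lX) (layer1_lie lY) us x1 y1 xd yd d0 dc.
have M0 : 0 < (m.+1%:R : R) by [].
have h : 0 < m.+1%:R ^+ 2 * a / 2 by rewrite divr_gt0 // mulr_gt0 // exprn_gt0.
move: cv => /cvgrPdist_lt/(_ _ h); apply: filterS => n.
rewrite -/Z; set c := [~ _, _]%g; set q := _ / _ => Hn; rewrite leNgt; apply/negP => dlt.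
have := HC 1%g c (k * m.+1%:R * delta n); rewrite mul1g => /(_ dlt).
rewrite (_ : C * _ = C * k ^+ 2 * m.+1%:R ^+ 2 * delta n ^+ 2); last by ring.
rewrite k2 => up.
have d2 : 0 < delta n ^+ 2 by rewrite exprn_gt0.
have qle : `|q| <= a / 2 * m.+1%:R ^+ 2.
  by rewrite /q normrM [`|(delta n ^+ 2)^-1|]ger0_norm ?invr_ge0 ?(ltW d2) // ler_pdivrMr.
have := ler_normD (m.+1%:R ^+ 2 * Z u - q) q; rewrite subrK normrM -/a ger0_norm ?exprn_ge0 //.
have E (M : R) : M * a / 2 + a / 2 * M = M * a by field.
by move=> /le_lt_trans/(_ (ltr_leD Hn qle)); rewrite E ltxx.
Qed.

End carnot_distance.

Theorem theorem1p2 (R : realType) (G : carnotGroup R) :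
  biLipschitz_embeds_L1 (@carnot_dist R G) ->
  forall x y : G, (x * y)%g = (y * x)%g.
Proof.
move=> [F [L [L1 FL]]]; have L0 : 0 < L by exact: lt_le_trans L1.
(* An infinite distance would force an infinite distance in [L1]. *)
have dfin (x y : G) : (carnot_dist x y < +oo)%E.
  rewrite ltey; apply/eqP => E; have [+ _] := FL x y.
  by rewrite E L1distE gt0_muley ?lte_fin ?invr_gt0 // leye_eq.
apply: (abelian_of_attained dfin) => X Y aX aY f fs; apply: contrapT => Zf.
have Z0 : lie_bracket X Y <> 0 by move=> E; apply: Zf; rewrite E.
have [lX _] := aX; have [lY _] := aY.
have [x [Cx [dx [Cx0 dx0 x1 xd xC]]]] := attained_curve aX.
have [y [Cy [dy [Cy0 dy0 y1 yd yC]]]] := attained_curve aY.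
pose d := Num.min dx dy; have d0 : 0 < d by rewrite lt_min dx0.
(* Scales tending to 0 within the range where the arcs [x] and [y] satisfy their linear bounds. *)
pose delta (n : nat) : R := d / 2 * n.+1%:R^-1.
have delta0 n : 0 < delta n by rewrite mulr_gt0 ?invr_gt0 // divr_gt0.
have deltad n : delta n < d.
  apply: le_lt_trans (_ : d / 2 < _); last by lra.
  by rewrite ler_piMr ?invf_le1 // ?ler1n // ltW // divr_gt0.
have deltac : delta n @[n --> \oo] --> (0 : R).
  by rewrite -[X in _ --> X](mulr0 (d / 2)); apply: cvgM; [exact: cvg_cst|exact: cvg_harmonic].
have [k k0 low] := carnot_commutator_lower lX lY Z0 x1 y1 xd yd delta0 deltac.
have dE (c : G) : carnot_dist 1%g c = (fine (carnot_dist 1%g c))%:E.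
  by rewrite fineK // ge0_fin_numE //; exact: carnot_dist_ge0.
(* By left invariance the bounds of the embedding do not depend on the base point; the upper one is
   [D c] and the lower one is [D c] divided by the square of [L]. *)
pose D c := L * fine (carnot_dist (1%g : G) c).
have iF g : (lebesgue01 R).-integrable setT (EFin \o (F g : R -> R)) by exact: L1_integrable.
have lam0 : 0 < L^-1 * L^-1 by rewrite mulr_gt0 // invr_gt0.
have FD g c : L^-1 * L^-1 * D c <= \int[lebesgue01 R]_w `|(F (g * c)%g : R -> R) w - (F g : R -> R) w| <= D c.
  have [h1 h2] := FL g (g * c)%g.
  move: h1 h2; rewrite carnot_dist_lmul dE L1distE -!EFinM !lee_fin /D => h1 h2.
  have -> : \int[lebesgue01 R]_w `|(F (g * c)%g : R -> R) w - (F g : R -> R) w| =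
      \int[lebesgue01 R]_w `|(F g : R -> R) w - (F (g * c)%g : R -> R) w|.
    by apply: eq_Rintegral => w _; rewrite distrC.
  by rewrite h2 andbT -mulrA mulKf // gt_eqF.
apply: (@no_integrable_orbit R _ _ (lebesgue01 R) G _ _ (fun g => (F g : R -> R)) D (L^-1 * L^-1)
  (Ad_filtration_central dfin) (@Ad_filtration_top R G) iF lam0 FD
  (fun n => x (delta n)) (fun n => y (delta n)) delta (L * (Cx + Cy)) (L * k)) => //.
- move=> n; rewrite /D -mulrA ler_wpM2l ?(ltW L0) //.
  have := xC 1%g (delta n) (delta0 n); rewrite mul1g dE lee_fin => /(_ _) h.
  apply: le_trans (h _) _; first by apply: lt_le_trans (deltad n) _; rewrite ge_min lexx.
  by rewrite ler_wpM2r ?lerDl // ltW.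
- move=> n; rewrite /D -mulrA ler_wpM2l ?(ltW L0) //.
  have := yC 1%g (delta n) (delta0 n); rewrite mul1g dE lee_fin => /(_ _) h.
  apply: le_trans (h _) _; first by apply: lt_le_trans (deltad n) _; rewrite ge_min lexx orbT.
  by rewrite ler_wpM2r ?lerDr // ltW.
- by rewrite mulr_gt0.
move=> m; apply: filterS (low m) => n; rewrite dE lee_fin => h.
by rewrite /D -!mulrA ler_wpM2l ?(ltW L0) // mulrA.
Qed.
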